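(* Let $p\ge2$, $\frac1p+\frac1q=1$, $\epsilon>0$. Let the mirror descent linearized augmented Lagrangian algorithm described in the context be equipped with the distance-generating function $v=v_\delta$, $$v_\delta(x)=\frac1{2(q-1)}\Big(\sum_{i=1}^d(x_i^2+\delta^2)^{q/2}\Big)^{2/q},$$ where $\delta>0$ is fixed independently of $d$, $q$ and $\epsilon$. Suppose that $u$ follows the Rademacher distribution (independent coordinates, uniform on $\{-1,1\}$), that assumptions (A1), (A2), (A3), (A6) of the context hold, and that the constants $D_X$ in (A1) and $\beta$ in (A6) are independent of $d$ and $p$. Let the parameters be chosen as in the context (''Parameter setting''). If $\|c(x^0)\|_2^2\le1/\mu$, then the algorithm returns an $\epsilon$-KKT point, with oracle complexity (total number of evaluations of stochastic function values $F(\cdot;\xi)$) of order $$\begin{cases}\mathcal O\big(p\,d^{2/p}\epsilon^{-3}+p^2d\,\epsilon^{-2}+p^3d^{2-2/p}\big),& p\in[2,2\ln d],\\[1mm] \mathcal O\big(\ln d\cdot\epsilon^{-3}+p\,d^{1-2/p}\ln d\cdot\epsilon^{-2}+p^2d^{2-4/p}\ln d\big),& p>2\ln d.\end{cases}$$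
   Context: Problem. Let $d\ge3$ and $m\ge1$. Consider $\min_{x\in X}\Phi(x):=f(x)+h(x)$ subject to $c(x)=0$, where $f(x)=\mathbb E_\xi[F(x;\xi)]$, $X\subset\mathbb R^d$ is convex, $f:\mathbb R^d\to\mathbb R$ and $c=(c_1,\ldots,c_m):\mathbb R^d\to\mathbb R^m$ are continuously differentiable, $\xi\sim\mathbb P$ is a random variable independent of $x$, $F(\cdot;\xi)$ is continuously differentiable for almost every $\xi$, and $h:\mathbb R^d\to\mathbb R\cup\{\infty\}$ is convex. Write $\nabla c(x)^\top\lambda=\sum_i\lambda_i\nabla c_i(x)$. $\mathcal N_X(x)$ is the normal cone of $X$ at $x$ and $\mathrm{dist}_p(a,B)=\inf_{b\in B}\|a-b\|_p$. Let $\mathbb P_u$ be the sampling distribution of $u\in\mathbb R^d$; for $\nu>0$ let $X_\nu=\{x+t\nu u: x\in X,\ t\in[0,1],\ u\text{ in the range of }\mathbb P_u\}$ and let $\mathcal O_\nu$ be an open set containing $X_\nu$. Assumptions. (A1) $X$ is nonempty, closed, convex and $\|x\|_q\le D_X$ for all $x\in X$ ($D_X>0$). $\|\nabla f(x)-\nabla f(y)\|_2\le L_f\|x-y\|_2$ and $|f(x)-f(y)|\le M_f\|x-y\|_2$ for all $x,y\in\mathcal O_\nu$ ($L_f,M_f>0$). $h$ is proper, lower semicontinuous and convex over $X$, and for all $x\in X$, $\partial h(x)\neq\emptyset$ and $\sup_{g\in\partial h(x)}\|g\|_2\le M_h$ ($M_h>0$). For $i=1,\ldots,m$ and $x,y\in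 X$: $|c_i(x)|\le\bar M_c$, $\|\nabla c_i(x)\|_2\le M_c$, $\|\nabla c_i(x)-\nabla c_i(y)\|_2\le L_c\|x-y\|_2$ ($\bar M_c,M_c,L_c>0$). $\Phi$ has a finite lower bound $\Phi_{\inf}$ over $X$. (A2) For all $x\in\mathcal O_\nu$: $\mathbb E_\xi[\nabla F(x;\xi)]=\nabla f(x)$ and $\mathbb E_\xi[\|\nabla F(x;\xi)-\nabla f(x)\|_2^2]\le\sigma^2$ ($\sigma>0$). (A3) $(\mathbb E_\xi[\|\nabla F(x;\xi)-\nabla F(y;\xi)\|_2^2])^{1/2}\le L_f\|x-y\|_2$ for all $x,y\in\mathcal O_\nu$. (A6) There is a constant $\beta>0$ such that the iterates $x^0,\ldots,x^K$ of the algorithm satisfy $\beta\|c(x^k)\|_p\le\mathrm{dist}_p(\nabla c(x^k)^\top c(x^k),-\mathcal N_X(x^k))$ for $k=0,\ldots,K$. Algorithm. Let $G_\nu(x;u,\xi)=\frac{F(x+\nu u;\xi)-F(x;\xi)}{\nu}u$ and $V(x,y)=v(y)-v(x)-\langle\nabla v(x),y-x\rangle$. Inputs: $x^0\in X$, $\lambda^0=0\in\mathbb R^m$, $\mu,\eta,\nu>0$, $\alpha\in(0,1]$, $\rho_k\in(0,\mu)$, positive integers $K,n_0,n$. All random directions $u_j^k\sim\mathbb P_u$ and samples $\xi_j^k\sim\mathbb P$ are mutually independent. For $k=0,\ldots,K-1$: $s^0=\frac1{n_0}\sum_{j=1}^{n_0}G_\nu(x^0;u_j^0,\xi_j^0)$,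 and for $k\ge1$, $s^k=\frac1n\sum_{j=1}^n[G_\nu(x^k;u_j^k,\xi_j^k)+(1-\alpha)(s^{k-1}-G_\nu(x^{k-1};u_j^k,\xi_j^k))]$; $x^{k+1}=\arg\min_{x\in X}\langle s^k+\nabla c(x^k)^\top(\lambda^k+\mu c(x^k)),x\rangle+h(x)+\frac1\eta V(x^k,x)$; $\lambda^{k+1}=\lambda^k+\rho_kc(x^k)$. Output $x^R$, with $R$ uniform on $\{0,\ldots,K-1\}$. Constants. $\mathcal L(x,\lambda;\mu)=f(x)+h(x)+\lambda^\top c(x)+\frac\mu2\|c(x)\|_2^2$; $L_\mu=L_f+m(\mu M_c^2+\mu\bar M_cL_c+\rho\bar M_cL_c)$; $\Delta_0=\mathcal L(x^0,\lambda^0;\mu)-\Phi_{\inf}+2m\rho\bar M_c^2$; $L_v=\frac{2-q}{q-1}+\frac1{q-1}(D_X^q+d\delta^q)^{(2-q)/q}\delta^{q-2}$. Parameter setting. Let $\hat p=p$ if $p\in[2,2\ln d]$ and $\hat p=2\ln d$ if $p>2\ln d$; let $S=d^{2/\hat p}$ (so $S=d^{2/p}$ in the first case and $S=e$ in the second). With a fixed constant $\rho>0$ and $\rho_k=\rho/K$: $\bar\sigma^2=\frac{\epsilon^2}{16}+4S(\sigma^2+M_f^2)+2M_f^2$; $\mu^2=\max\{\frac{10(8L_v^2+3)}{27\beta^2},\frac{8(2L_v^2+1)}{3\beta^2},\frac{40(M_f^2+M_h^2+m^2\rho^2\bar M_c^2M_c^2)}{\beta^2\epsilon^2}\}$; $\eta^2=\min\{\frac1{4L_\mu^2},\frac1{96L_f^2},\frac{S\epsilon^2}{23040L_f^2\bar\sigma^2}\}$;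 $\alpha=96L_f^2\eta^2$; $n_0=\lceil\frac{5(\hat p-1)\bar\sigma^2}{4\epsilon^2}\rceil$; $n=\lceil(\hat p-1)S\rceil$; $\nu^2=\min\{\frac{\epsilon^2}{4(4L_f^2+3\eta^{-2})\mathbb E_u[\|u\|_2^6]},\frac{\beta^2\mu^2\eta^2\epsilon^2}{20(2L_v^2+1)\mathbb E_u[\|u\|_2^6]}\}$; $K=\lceil\max\{\frac{108\Delta_0}{\eta\epsilon^2},\frac{5\|c(x^0)\|_2^2}{\epsilon^2},\frac1{L_f^2\eta^2}\}\rceil$. $\epsilon$-KKT point. With $\mathcal G_X(x,g,\eta)=\frac1\eta(x-x^+)$, $x^+=\arg\min_{y\in X}\langle g,y\rangle+h(y)+\frac1\eta V(x,y)$, a (random) point $x\in X$ is an $\epsilon$-KKT point if there is a (random) $\lambda\in\mathbb R^m$ with $\mathbb E[\|\mathcal G_X(x,\nabla f(x)+\nabla c(x)^\top\lambda,\eta)\|_q^2]\le\epsilon^2$ and $\mathbb E[\|c(x)\|_p^2]\le\epsilon^2$, where $\eta$ is the algorithm's step parameter and the expectation is over all randomness of the algorithm. Convention. $\mathcal O(\cdot)$ is for $\epsilon\in(0,1]$ and hides a constant independent of $\epsilon,d,p$, depending only on $L_f,M_f,M_h,M_c,\bar M_c,L_c,m,\sigma,\beta,\rho,D_X,\delta$ and $f(x^0)+h(x^0)-\Phi_{\inf}$. *)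

(* Defs.v *)
From HB Require Import structures.
From mathcomp Require Import all_boot all_order all_algebra.
From mathcomp Require Import all_classical all_reals all_analysis.
Import Order.TTheory GRing.Theory Num.Theory.
Import numFieldNormedType.Exports.

Set Implicit Arguments.
Unset Strict Implicit.
Unset Printing Implicit Defensive.

Local Open Scope classical_set_scope.
Local Open Scope ring_scope.

(* R^n with its Borel sigma-algebra; convertible to 'rV[R]_n. *)
Notation borelRV R n := (g_sigma_algebraType (@open 'rV[R]_n)).

Section Vectors.
Variable R : realType.

Definition dotv n (x y : 'rV[R]_n) : R := \sum_(i < n) x ord0 i * y ord0 i.

Definition pnorm n (p : R) (x : 'rV[R]_n) : R :=
  (\sum_(i < n) `|x ord0 i| `^ p) `^ p^-1.

Definition grad n (f : 'rV[R]_n -> R) (x : 'rV[R]_n) : 'rV[R]_n :=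
  \row_i 'D_(delta_mx ord0 i) f x.

Definition C1 n (f : 'rV[R]_n -> R) : Prop :=
  (forall x, differentiable f x) /\ continuous (grad f).

Definition comp n m (c : 'rV[R]_n -> 'rV[R]_m) (i : 'I_m) : 'rV[R]_n -> R :=
  fun x => c x ord0 i.

(* \nabla c(x)^T lambda *)
Definition gradT n m (c : 'rV[R]_n -> 'rV[R]_m) (x : 'rV[R]_n)
    (lam : 'rV[R]_m) : 'rV[R]_n :=
  \sum_(i < m) lam ord0 i *: grad (comp c i) x.

Definition normal_cone n (X : set 'rV[R]_n) (x : 'rV[R]_n) : set 'rV[R]_n :=
  [set g | forall y, X y -> dotv g (y - x) <= 0].

Definition distp n (p : R) (a : 'rV[R]_n) (B : set 'rV[R]_n) : R :=
  inf [set pnorm p (a - b) | b in B].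

Definition convex_ereal n (h : 'rV[R]_n -> \bar R) : Prop :=
  forall x y (t : R), 0 <= t <= 1 ->
    (h (t *: x + (1 - t) *: y)%R <= t%:E * h x + (1 - t)%:E * h y)%E.

Definition subdifferential n (h : 'rV[R]_n -> \bar R) (x : 'rV[R]_n) :
    set 'rV[R]_n :=
  [set g | forall y, (h x + (dotv g (y - x))%:E <= h y)%E].

(* Lower semicontinuity of the restriction of h to X; compare the library's
   lower_semicontinuous, which is the case X = setT. *)
Definition lsc_on n (X : set 'rV[R]_n) (h : 'rV[R]_n -> \bar R) : Prop :=
  forall x (a : R), X x -> (a%:E < h x)%E ->
    \forall y \near within X (nbhs x), (a%:E < h y)%E.

(* On the problems considered here the minimizer exists and is unique; the value
   is 0 if no minimizer exists. *)
Definition argmin n (X : set 'rV[R]_n) (g : 'rV[R]_n -> \bar R) : 'rV[R]_n :=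
  xget 0 [set x | X x /\ forall y, X y -> (g x <= g y)%E].

Definition bregman n (v : 'rV[R]_n -> R) (x y : 'rV[R]_n) : R :=
  v y - v x - dotv (grad v x) (y - x).

Definition mirror_step n (X : set 'rV[R]_n) (h : 'rV[R]_n -> \bar R)
    (v : 'rV[R]_n -> R) (eta : R) (x g : 'rV[R]_n) : 'rV[R]_n :=
  argmin X (fun y => (dotv g y)%:E + h y + (eta^-1 * bregman v x y)%:E)%E.

Definition grad_mapping n (X : set 'rV[R]_n) (h : 'rV[R]_n -> \bar R)
    (v : 'rV[R]_n -> R) (eta : R) (x g : 'rV[R]_n) : 'rV[R]_n :=
  eta^-1 *: (x - mirror_step X h v eta x g).

Definition vdelta n (q delta : R) (x : 'rV[R]_n) : R :=
  (2 * (q - 1))^-1 *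
  (\sum_(i < n) (x ord0 i ^+ 2 + delta ^+ 2) `^ (q / 2)) `^ (2 / q).

End Vectors.

Section Probability.
Variable R : realType.

Definition mutually_independent d (T : measurableType d) (P : probability T R)
    (I : eqType) (D : set I) (G : I -> set (set T)) : Prop :=
  forall (s : seq I) (A : I -> set T), uniq s ->
    (forall i, i \in s -> D i /\ G i (A i)) ->
    P (\bigcap_(i in [set` s]) A i) = (\prod_(i <- s) P (A i))%E.

(* The sigma-algebra generated by Y. *)
Definition sigma_of d d' (T : measurableType d) (T' : measurableType d')
    (Y : T -> T') : set (set T) :=
  preimage_set_system setT Y measurable.

Definition has_law d d' (T : measurableType d) (T' : measurableType d')
    (P : probability T R) (Y : {RV P >-> T'}) (Q : probability T' R) : Prop :=
  forall A, measurable A -> distribution P Y A = Q A.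

Definition rademacher n (Pu : probability (borelRV R n) R) : Prop :=
  [/\ forall i : 'I_n, Pu [set u | (u : 'rV[R]_n) ord0 i = 1] = (2^-1)%:E,
      forall i : 'I_n, Pu [set u | (u : 'rV[R]_n) ord0 i = -1] = (2^-1)%:E &
      mutually_independent Pu [set: 'I_n]
        (fun i => sigma_of (fun u : borelRV R n => (u : 'rV[R]_n) ord0 i : R))].

(* The range of a sampling distribution is read as its topological support. *)
Definition range_of n (Pu : probability (borelRV R n) R) : set 'rV[R]_n :=
  [set u | forall V : set 'rV[R]_n, open V -> V u -> (0 < Pu V)%E].

Definition Enorm6 n (Pu : probability (borelRV R n) R) : R :=
  fine 'E_Pu[fun u : borelRV R n => pnorm 2 (u : 'rV[R]_n) ^+ 6].

End Probability.

Record problem (R : realType) (d m : nat) (dxi : measure_display)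
    (Xi : measurableType dxi) := Problem {
  feas : set 'rV[R]_d ;                 (* X *)
  obj  : 'rV[R]_d -> R ;                (* f *)
  reg  : 'rV[R]_d -> \bar R ;           (* h *)
  con  : 'rV[R]_d -> 'rV[R]_m ;         (* c *)
  sobj : 'rV[R]_d -> Xi -> R ;          (* F(x; xi) *)
  law  : probability Xi R               (* distribution of xi *)
}.

(* The scalars on which, together with m and f(x^0) + h(x^0) - Phi_inf, the
   constant hidden in O(.) may depend. *)
Record constants (R : realType) := Constants {
  cLf : R ; cMf : R ; cMh : R ;
  cMc : R ; cMcbar : R ; (* bounds on |grad c_i|_2 and on |c_i| respectively *)
  cLc : R ; csigma : R ; cbeta : R ; crho : R ; cDX : R ; cdelta : R
}.

Definition constants_pos (R : realType) (k : constants R) : Prop :=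
  [/\ 0 < cLf k, 0 < cMf k, 0 < cMh k & 0 < cMc k] /\
  [/\ 0 < cMcbar k, 0 < cLc k, 0 < csigma k & 0 < cbeta k] /\
  [/\ 0 < crho k, 0 < cDX k & 0 < cdelta k].

Section Assumptions.
Variables (R : realType) (d m : nat) (dxi : measure_display)
  (Xi : measurableType dxi) (pb : problem R d m Xi) (k : constants R).

Let X := feas pb.
Let f := obj pb.
Let h := reg pb.
Let c := con pb.
Let F := sobj pb.
Let Pxi := law pb.

(* Joint measurability of F makes the iterates random variables. *)
Definition problem_setting : Prop :=
  [/\ convex_set (X : set (convex_lmodType 'rV[R]_d)),
      C1 f,
      forall i : 'I_m, C1 (comp c i),
      (forall x, h x != -oo%E) &
      convex_ereal h] /\
  [/\ measurable_fun [set: borelRV R d * Xi]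
        (fun z : borelRV R d * Xi => F z.1 z.2),
      forall x, Pxi.-integrable setT (EFin \o F x),
      forall x, 'E_Pxi[F x]%E = (f x)%:E &
      {ae Pxi, forall xi, C1 (F ^~ xi)}].

(* X_nu *)
Definition smoothing_region (nu : R) (Pu : probability (borelRV R d) R) :
    set 'rV[R]_d :=
  [set z | exists x t u, [/\ X x, 0 <= t <= 1, range_of Pu u &
                             z = x + (t * nu) *: u]].

Definition assumption_A1 (q : R) (O : set 'rV[R]_d) (Phi_inf : R) : Prop :=
  [/\ X !=set0, closed X,
      convex_set (X : set (convex_lmodType 'rV[R]_d)) &
      forall x, X x -> pnorm q x <= cDX k] /\
  (forall x y, O x -> O y ->
     pnorm 2 (grad f x - grad f y) <= cLf k * pnorm 2 (x - y) /\
     `|f x - f y| <= cMf k * pnorm 2 (x - y)) /\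
  [/\ exists2 x, X x & (h x < +oo)%E,
      lsc_on X h,
      forall x, X x -> subdifferential h x !=set0 &
      forall x g, X x -> subdifferential h x g -> pnorm 2 g <= cMh k] /\
  (forall (i : 'I_m) x y, X x -> X y ->
     [/\ `|comp c i x| <= cMcbar k,
         pnorm 2 (grad (comp c i) x) <= cMc k &
         pnorm 2 (grad (comp c i) x - grad (comp c i) y)
           <= cLc k * pnorm 2 (x - y)]) /\
  (forall x, X x -> (Phi_inf%:E <= (f x)%:E + h x)%E).

Definition assumption_A2 (O : set 'rV[R]_d) : Prop :=
  forall x, O x ->
    (forall i : 'I_d,
       Pxi.-integrable setT (EFin \o (fun xi => grad (F ^~ xi) x ord0 i)) /\
       'E_Pxi[fun xi => grad (F ^~ xi) x ord0 i]%E = (grad f x ord0 i)%:E) /\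
    ('E_Pxi[fun xi => (pnorm 2 (grad (F ^~ xi) x - grad f x) ^+ 2)%R]
       <= (csigma k ^+ 2)%:E)%E.

Definition assumption_A3 (O : set 'rV[R]_d) : Prop :=
  forall x y, O x -> O y ->
    ('E_Pxi[fun xi => (pnorm 2 (grad (F ^~ xi) x - grad (F ^~ xi) y) ^+ 2)%R]
       `^ (2^-1)%R <= (cLf k * pnorm 2 (x - y))%:E)%E.

Definition regular_at (p : R) (x : 'rV[R]_d) : Prop :=
  cbeta k * pnorm p (c x) <=
    distp p (gradT c x (c x)) [set - g | g in normal_cone X x].

Definition aug_lagrangian (x : 'rV[R]_d) (lam : 'rV[R]_m) (mu : R) : R :=
  f x + fine (h x) + dotv lam (c x) + mu / 2 * pnorm 2 (c x) ^+ 2.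

End Assumptions.

Section Algorithm.
Variables (R : realType) (d m : nat) (dxi : measure_display)
  (Xi : measurableType dxi) (pb : problem R d m Xi) (v : 'rV[R]_d -> R).
Variables (x0 : 'rV[R]_d) (mu eta nu alpha : R) (rho : nat -> R) (n0 n : nat).

Definition zo_grad (x u : 'rV[R]_d) (xi : Xi) : 'rV[R]_d :=
  ((sobj pb (x + nu *: u) xi - sobj pb x xi) / nu) *: u.

Record state := State {
  st_x : 'rV[R]_d ; st_s : 'rV[R]_d ; st_lam : 'rV[R]_m }.

(* One realization of the algorithm, driven by the draws u k j and xi k j for
   j < n0 (k = 0) or j < n (k >= 1); mdlal_state u xi k = (x^k, s^k, lambda^k). *)
Fixpoint mdlal_state (u : nat -> nat -> 'rV[R]_d) (xi : nat -> nat -> Xi)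
    (k : nat) : state :=
  if k is k'.+1 then
    let: State x s lam := mdlal_state u xi k' in
    let x' := mirror_step (feas pb) (reg pb) v eta x
                (s + gradT (con pb) x (lam + mu *: con pb x)) in
    let s' := n%:R^-1 *: \sum_(j < n)
                (zo_grad x' (u k j) (xi k j) +
                 (1 - alpha) *: (s - zo_grad x (u k j) (xi k j))) in
    State x' s' (lam + rho k' *: con pb x)
  else State x0 (n0%:R^-1 *: \sum_(j < n0) zo_grad x0 (u 0%N j) (xi 0%N j)) 0.

Definition iterate u xi k : 'rV[R]_d := st_x (mdlal_state u xi k).

(* Evaluations of F in K iterations: two per zo_grad. *)
Definition oracle_calls (K : nat) : nat :=
  (\sum_(k < K) if k == 0 :> nat then 2 * n0 else n * (2 + 2))%N.

End Algorithm.

Section Randomness.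
Variables (R : realType) (d : nat) (dxi dom : measure_display)
  (Xi : measurableType dxi) (Om : measurableType dom) (Pr : probability Om R).
Variables (u : nat -> nat -> {RV Pr >-> borelRV R d})
  (xi : nat -> nat -> {RV Pr >-> Xi}) (ind : {RV Pr >-> nat}).

(* inl (inl (k, j)) is u_j^k, inl (inr (k, j)) is xi_j^k and inr tt is R. *)
Definition draw_sigma (i : (nat * nat + nat * nat) + unit) : set (set Om) :=
  match i with
  | inl (inl (k, j)) => sigma_of (u k j)
  | inl (inr (k, j)) => sigma_of (xi k j)
  | inr _ => sigma_of ind
  end.

Definition draw_used (n0 n K k j : nat) : bool :=
  (k < K)%N && (j < if k == 0%N then n0 else n)%N.

Definition draw_index (n0 n K : nat) : set ((nat * nat + nat * nat) + unit) :=
  [set i | match i with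
           | inl (inl (k, j)) => draw_used n0 n K k j
           | inl (inr (k, j)) => draw_used n0 n K k j
           | inr _ => true
           end].

Definition sampling (Pu : probability (borelRV R d) R) (Pxi : probability Xi R)
    (n0 n K : nat) : Prop :=
  [/\ forall k j, draw_used n0 n K k j ->
        has_law (u k j) Pu /\ has_law (xi k j) Pxi,
      forall r, (r < K)%N -> Pr (ind @^-1` [set r]) = (K%:R^-1)%:E &
      mutually_independent Pr (draw_index n0 n K) draw_sigma].

Definition eps_kkt m (pb : problem R d m Xi) (v : 'rV[R]_d -> R)
    (p q eta eps : R) (x : Om -> 'rV[R]_d) : Prop :=
  [/\ measurable_fun setT (x : Om -> borelRV R d),
      forall w, feas pb (x w) &
      exists lam : {RV Pr >-> borelRV R m},
        ('E_Pr[fun w => (pnorm q (grad_mapping (feas pb) (reg pb) v eta (x w)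
             (grad (obj pb) (x w) + gradT (con pb) (x w) (lam w))) ^+ 2)%R]
           <= (eps ^+ 2)%:E)%E /\
        ('E_Pr[fun w => (pnorm p (con pb (x w)) ^+ 2)%R] <= (eps ^+ 2)%:E)%E].

End Randomness.

Section ParameterSetting.
Variables (R : realType) (k : constants R) (m d : nat) (p q eps : R).

Definition natceil (x : R) : nat := `|Num.ceil x|%N.

Definition phat : R := if p <= 2 * ln d%:R then p else 2 * ln d%:R.

Definition Sdim : R := d%:R `^ (2 / phat).

Definition par_Lv : R :=
  (2 - q) / (q - 1) +
  (q - 1)^-1 * (cDX k `^ q + d%:R * cdelta k `^ q) `^ ((2 - q) / q)
    * cdelta k `^ (q - 2).

Definition par_sigmabar2 : R :=
  eps ^+ 2 / 16 + 4 * Sdim * (csigma k ^+ 2 + cMf k ^+ 2) + 2 * cMf k ^+ 2.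

Definition par_mu : R := Num.sqrt
  (Num.max (Num.max
    (10 * (8 * par_Lv ^+ 2 + 3) / (27 * cbeta k ^+ 2))
    (8 * (2 * par_Lv ^+ 2 + 1) / (3 * cbeta k ^+ 2)))
    (40 * (cMf k ^+ 2 + cMh k ^+ 2
           + m%:R ^+ 2 * crho k ^+ 2 * cMcbar k ^+ 2 * cMc k ^+ 2)
      / (cbeta k ^+ 2 * eps ^+ 2))).

Definition par_Lmu : R :=
  cLf k + m%:R * (par_mu * cMc k ^+ 2 + par_mu * cMcbar k * cLc k
                  + crho k * cMcbar k * cLc k).

Definition par_eta : R := Num.sqrt
  (Num.min (Num.min
    (4 * par_Lmu ^+ 2)^-1
    (96 * cLf k ^+ 2)^-1)
    (Sdim * eps ^+ 2 / (23040 * cLf k ^+ 2 * par_sigmabar2))).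

Definition par_alpha : R := 96 * cLf k ^+ 2 * par_eta ^+ 2.

Definition par_n0 : nat :=
  natceil (5 * (phat - 1) * par_sigmabar2 / (4 * eps ^+ 2)).

Definition par_n : nat := natceil ((phat - 1) * Sdim).

(* E6 stands for E_u[|u|_2^6]. *)
Definition par_nu (E6 : R) : R := Num.sqrt
  (Num.min
    (eps ^+ 2 / (4 * (4 * cLf k ^+ 2 + 3 * par_eta ^- 2) * E6))
    (cbeta k ^+ 2 * par_mu ^+ 2 * par_eta ^+ 2 * eps ^+ 2
      / (20 * (2 * par_Lv ^+ 2 + 1) * E6))).

Definition par_Delta0 dxi (Xi : measurableType dxi) (pb : problem R d m Xi)
    (x0 : 'rV[R]_d) (Phi_inf : R) : R :=
  aug_lagrangian pb x0 0 par_mu - Phi_inf + 2 * m%:R * crho k * cMcbar k ^+ 2.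

Definition par_K dxi (Xi : measurableType dxi) (pb : problem R d m Xi)
    (x0 : 'rV[R]_d) (Phi_inf : R) : nat :=
  natceil (Num.max (Num.max
    (108 * par_Delta0 pb x0 Phi_inf / (par_eta * eps ^+ 2))
    (5 * pnorm 2 (con pb x0) ^+ 2 / eps ^+ 2))
    (cLf k ^+ 2 * par_eta ^+ 2)^-1).

Definition complexity_rate : R :=
  if p <= 2 * ln d%:R then
    p * d%:R `^ (2 / p) * eps ^- 3 + p ^+ 2 * d%:R * eps ^- 2
    + p ^+ 3 * d%:R `^ (2 - 2 / p)
  else
    ln d%:R * eps ^- 3 + p * d%:R `^ (1 - 2 / p) * ln d%:R * eps ^- 2
    + p ^+ 2 * d%:R `^ (2 - 4 / p) * ln d%:R.

End ParameterSetting.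

(* Main.v *)
(* The generating function v_delta is 1-strongly convex and has an L_v-Lipschitz
   gradient from the q-norm to the p-norm on X, both read off its Hessian along
   lines. The same Hessian with an exponent r >= 2, for delta -> 0, gives
   |a + b|_r^2 <= |a|_r^2 + (linear in b) + (r - 1) |b|_r^2, so averaging n
   independent centred vectors divides their second r-norm moment by n / (r - 1).
   For a sign vector u, |z u|_r^2 = d^(2/r) z^2: a two-point estimate costs the
   factor S = d^(2/r), whereas Euclidean estimates cost d. With r = min(p, 2 ln d)
   the error of s^k as an estimate of the gradient of the Rademacher smoothing of f
   satisfies E e_(k+1) <= (1 - alpha)^2 E e_k + O(E |x^(k+1) - x^k|_q^2) + small,
   and the remaining bias |grad f_nu - grad f|_2 is at most nu L_f d^(3/2).
   On X the augmented Lagrangian in x is L_mu-smooth for every multiplier that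
   occurs (their entries are at most rho times the bound on c), so a step with
   2 eta L_mu <= 1 decreases it by |x^(k+1) - x^k|_q^2 / (2 eta), up to eta times the
   squared p-norm error of s^k. Summing over k bounds the averages of the squared
   steps and of the errors; these control the gradient mapping at x^k and, through
   the optimality condition of the mirror step and the regularity condition (A6),
   the constraint violation at x^(k+1). The index R is independent of the iterates,
   which turns averages over k into expectations. *)

Require Import Defs.
From HB Require Import structures.
From mathcomp Require Import all_boot all_order all_algebra.
From mathcomp Require Import all_classical all_reals all_analysis.
From mathcomp Require Import measurable_realfun.
From mathcomp Require Import ring lra.
Import Order.TTheory GRing.Theory Num.Theory.
Import numFieldNormedType.Exports.

Set Implicit Arguments.
Unset Strict Implicit.
Unset Printing Implicit Defensive.

Local Open Scope classical_set_scope.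
Local Open Scope ring_scope.

(** * Norms *)

Section PNorm.
Variable R : realType.
Implicit Types (a b p q r th : R).

(** Expectations given the past are computed by Fubini. The state (x^k, s^k, lambda^k) is a
    measurable function of the draws made so far, hence independent of all later ones; the direction
    and the sample of a draw are split off from the product law one at a time, and the integral over
    a Rademacher direction is a finite average. Measurability of the iterates rests on the Lipschitz
    continuity of the proximal map. Constraint violation is controlled one step late: the step taken
    from x^k bounds c(x^(k+1)). The value c(x^0) is left over and is paid for by the term 5
    |c(x^0)|_2^2 / eps^2 of K. Errors and squared steps bound each other. The choice alpha = 96
    L_f^2 eta^2 closes the loop: in the error sum the steps have coefficient 1 / (8 eta^2), while
    the descent inequality offers them 1 / (2 eta^2), of which the errors, with weight 5/4, use up
    only 5 / (32 eta^2). For the rate every parameter is measured by A = p d^(1 - 2/p), the order of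
    L_v: mu, L_mu and 1/eta are O(A + 1/eps), hence K = O(eps^-3 + A eps^-2 + A^2). *)

Lemma weighted_amgm a b th : 0 <= a -> 0 <= b -> 0 <= th <= 1 ->
  a `^ th * b `^ (1 - th) <= th * a + (1 - th) * b.
Proof.
move=> a0 b0 /andP[]; rewrite le_eqVlt => /predU1P[<- _|th0].
  by rewrite powRr0 subr0 powRr1// mul0r add0r.
rewrite le_eqVlt => /predU1P[->|th1].
  by rewrite subrr powRr0 powRr1// mul0r addr0 mulr1 mul1r.
have th1' : 0 < 1 - th by rewrite subr_gt0.
have := @conjugate_powR R (a `^ th) (b `^ (1 - th)) th^-1 (1 - th)^-1
  (powR_ge0 _ _) (powR_ge0 _ _).
rewrite !invr_gt0 !invrK -!powRrM !mulfV ?gt_eqF// !powRr1//.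
by move=> /(_ th0 th1'); rewrite mulrC [X in _ <= _ + X]mulrC [X in _ <= X + _]mulrC mulrC; apply; ring.
Qed.

(* Stated with exponents [th] and [1 - th] so that the endpoint cases are
   covered; this uses [x `^ 0 = 1] also for [x = 0]. *)
Lemma hoelder_sum (I : finType) (a b : I -> R) th : 0 <= th <= 1 ->
  (forall i, 0 <= a i) -> (forall i, 0 <= b i) ->
  \sum_i a i `^ th * b i `^ (1 - th)
    <= (\sum_i a i) `^ th * (\sum_i b i) `^ (1 - th).
Proof.
move=> th01 a0 b0; have /andP[] := th01.
rewrite le_eqVlt => /predU1P[<- _|th0].
  by under eq_bigr do rewrite powRr0 subr0 mul1r powRr1//;
    rewrite powRr0 subr0 mul1r powRr1 ?sumr_ge0.
rewrite le_eqVlt => /predU1P[->|th1].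
  by under eq_bigr do rewrite subrr powRr0 mulr1 powRr1//;
    rewrite subrr powRr0 mulr1 powRr1 ?sumr_ge0.
have : 0 <= \sum_i a i by exact: sumr_ge0.
rewrite le_eqVlt => /predU1P[A0|A0].
  rewrite -A0 powR0 ?gt_eqF// mul0r big1// => i _.
  have -> := psumr_eq0P (fun i _ => a0 i) (esym A0) (erefl _ : predT i).
  by rewrite powR0 ?gt_eqF// mul0r.
have : 0 <= \sum_i b i by exact: sumr_ge0.
rewrite le_eqVlt => /predU1P[B0|B0].
  rewrite -B0 powR0 ?mulr0 ?subr_eq0 ?gt_eqF// big1// => i _.
  have -> := psumr_eq0P (fun i _ => b0 i) (esym B0) (erefl _ : predT i).
  by rewrite powR0 ?mulr0 ?subr_eq0 ?gt_eqF.
set A := \sum_i a i in A0 *; set B := \sum_i b i in B0 *.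
(* With both sums normalized to 1 the claim is the weighted AM-GM inequality, summed over the
   index. *)
rewrite [leLHS](_ : _ = A `^ th * B `^ (1 - th) *
    \sum_i (a i / A) `^ th * (b i / B) `^ (1 - th)); last first.
  rewrite mulr_sumr; apply: eq_bigr => i _.
  have scale (c C r : R) : 0 <= c -> 0 < C -> C `^ r * (c / C) `^ r = c `^ r.
    move=> c0 C0; rewrite -powRM ?divr_ge0 ?(ltW C0)//.
    by rewrite mulrC divfK// gt_eqF.
  by rewrite mulrACA !scale.
rewrite ger_pMr ?mulr_gt0 ?powR_gt0//.
apply: (@le_trans _ _ (\sum_i (th * (a i / A) + (1 - th) * (b i / B)))).
  by apply: ler_sum => i _; apply: weighted_amgm => //; rewrite divr_ge0// ltW.
rewrite big_split/= -!mulr_sumr -!mulr_suml.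
by rewrite -/A -/B !mulfV ?gt_eqF// !mulr1 addrC subrK.
Qed.

Section Fixed.
Variable n : nat.
Implicit Types x y z : 'rV[R]_n.

Lemma dotvC x y : dotv x y = dotv y x.
Proof. by apply: eq_bigr => i _; rewrite mulrC. Qed.
Lemma dotvDl x y z : dotv (x + y) z = dotv x z + dotv y z.
Proof. by rewrite -big_split; apply: eq_bigr => i _; rewrite mxE mulrDl. Qed.
Lemma dotvDr x y z : dotv z (x + y) = dotv z x + dotv z y.
Proof. by rewrite dotvC dotvDl !(dotvC z). Qed.
Lemma dotvZl a x y : dotv (a *: x) y = a * dotv x y.
Proof. by rewrite mulr_sumr; apply: eq_bigr => i _; rewrite mxE mulrA. Qed.
Lemma dotvZr a x y : dotv x (a *: y) = a * dotv x y.
Proof. by rewrite dotvC dotvZl dotvC. Qed.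
Lemma dotvNl x y : dotv (- x) y = - dotv x y.
Proof. by rewrite -scaleN1r dotvZl mulN1r. Qed.
Lemma dotvNr x y : dotv x (- y) = - dotv x y.
Proof. by rewrite -scaleN1r dotvZr mulN1r. Qed.
Lemma dotvBl x y z : dotv (x - y) z = dotv x z - dotv y z.
Proof. by rewrite dotvDl dotvNl. Qed.
Lemma dotvBr x y z : dotv z (x - y) = dotv z x - dotv z y.
Proof. by rewrite dotvDr dotvNr. Qed.
Lemma dotv0l x : dotv 0 x = 0.
Proof. by rewrite -(scale0r x) dotvZl mul0r. Qed.
Lemma dotv0r x : dotv x 0 = 0.
Proof. by rewrite dotvC dotv0l. Qed.
Lemma dotv_suml (I : Type) (s : seq I) (P : pred I) (F : I -> 'rV[R]_n) y :
  dotv (\sum_(i <- s | P i) F i) y = \sum_(i <- s | P i) dotv (F i) y.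
Proof. by apply: (big_morph (fun x => dotv x y) (fun _ _ => dotvDl _ _ _) (dotv0l y)). Qed.
Lemma dotv_sumr (I : Type) (s : seq I) (P : pred I) (F : I -> 'rV[R]_n) y :
  dotv y (\sum_(i <- s | P i) F i) = \sum_(i <- s | P i) dotv y (F i).
Proof. by rewrite dotvC dotv_suml; apply: eq_bigr => i _; rewrite dotvC. Qed.
Lemma dotv_ge0 x : 0 <= dotv x x.
Proof. by apply: sumr_ge0 => i _; rewrite -expr2 sqr_ge0. Qed.
Lemma dotv_delta x i : dotv x (delta_mx ord0 i) = x ord0 i.
Proof.
rewrite /dotv (bigD1 i)//= mxE !eqxx mulr1 big1 ?addr0// => j /negPf ji.
by rewrite mxE eqxx/= ji mulr0.
Qed.

Lemma pnorm_ge0 p x : 0 <= pnorm p x.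
Proof. exact: powR_ge0. Qed.

Lemma pnorm_powR p x : p != 0 -> pnorm p x `^ p = \sum_i `|x ord0 i| `^ p.
Proof.
move=> p0; rewrite /pnorm -powRrM mulVf// powRr1//.
by apply: sumr_ge0 => i _; exact: powR_ge0.
Qed.

Lemma pnorm2E x : pnorm 2 x ^+ 2 = dotv x x.
Proof.
rewrite -powR_mulrn ?pnorm_ge0// pnorm_powR//.
by apply: eq_bigr => i _; rewrite powR_mulrn// real_normK ?num_real// expr2.
Qed.

Lemma pnorm0 p : 0 < p -> pnorm p (0 : 'rV[R]_n) = 0.
Proof.
move=> p0; rewrite /pnorm big1 ?powR0 ?invr_eq0 ?gt_eqF// => i _.
by rewrite mxE normr0 powR0 ?gt_eqF.
Qed.

Lemma pnormZ p a x : 0 < p -> pnorm p (a *: x) = `|a| * pnorm p x.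
Proof.
move=> p0; rewrite /pnorm.
under eq_bigr do rewrite mxE normrM powRM//.
rewrite -mulr_sumr powRM ?powR_ge0//; last first.
  by apply: sumr_ge0 => i _; exact: powR_ge0.
by rewrite -powRrM mulfV ?gt_eqF// powRr1.
Qed.

Lemma pnormN p x : pnorm p (- x) = pnorm p x.
Proof. by rewrite /pnorm; under eq_bigr do rewrite mxE normrN. Qed.

Lemma pnormC p x y : pnorm p (x - y) = pnorm p (y - x).
Proof. by rewrite -opprB pnormN. Qed.

Lemma coord_le_pnorm p x i : 0 < p -> `|x ord0 i| <= pnorm p x.
Proof.
move=> p0; rewrite -[leLHS]powRr1// -(mulfV (lt0r_neq0 p0)) powRrM.
apply: ge0_ler_powR; rewrite ?invr_ge0 ?(ltW p0)// ?nnegrE ?powR_ge0//.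
  by apply: sumr_ge0 => j _; exact: powR_ge0.
by rewrite [leRHS](bigD1 i)//= lerDl sumr_ge0// => j _; exact: powR_ge0.
Qed.

Lemma pnorm_eq0 p x : 0 < p -> pnorm p x = 0 -> x = 0.
Proof.
move=> p0 x0; apply/rowP => i; rewrite mxE.
by apply/eqP; rewrite -normr_le0 -x0 coord_le_pnorm.
Qed.

Lemma ler_dotv_pnorm p q x y : 0 < p -> 0 < q -> p^-1 + q^-1 = 1 ->
  dotv x y <= pnorm p x * pnorm q y.
Proof.
move=> p0 q0 pq.
apply: (@le_trans _ _ (\sum_i (`|x ord0 i| `^ p) `^ p^-1 * (`|y ord0 i| `^ q) `^ (1 - p^-1))).
  apply: ler_sum => i _; rewrite -!powRrM -pq addrAC subrr add0r.
  rewrite !mulfV ?gt_eqF// !powRr1//.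
  by rewrite -normrM ler_norm.
apply: le_trans (hoelder_sum _ _ _) _ => //.
  by rewrite invr_ge0 ltW//= -pq lerDl invr_ge0 ltW.
by rewrite -[X in _ `^ (X - _)]pq addrAC subrr add0r.
Qed.

Lemma ler_norm_dotv p q x y : 0 < p -> 0 < q -> p^-1 + q^-1 = 1 ->
  `|dotv x y| <= pnorm p x * pnorm q y.
Proof.
move=> p0 q0 pq; rewrite ler_norml ler_dotv_pnorm// andbT.
by rewrite lerNl -dotvNl -(pnormN p) ler_dotv_pnorm.
Qed.

(* Attained at [z_i = sgn(x_i) |x_i|^(p-1)]. *)
Lemma pnorm_dual p q x C : 1 < p -> 1 < q -> p^-1 + q^-1 = 1 -> 0 <= C ->
  (forall z, dotv x z <= C * pnorm q z) -> pnorm p x <= C.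
Proof.
move=> p1 q1 pq C0 H.
have p0 : 0 < p by exact: lt_trans p1.
have q0 : 0 < q by exact: lt_trans q1.
have := pnorm_ge0 p x; rewrite le_eqVlt => /predU1P[<-//|x0].
have qp : (p - 1) * q = p.
  have : q = p / (p - 1).
    have -> : q = (1 - p^-1)^-1 by rewrite -pq addrAC subrr add0r invrK.
    by field; rewrite subr_eq0 !gt_eqF.
  by move=> ->; rewrite mulrC divfK// subr_eq0 gt_eqF.
pose z : 'rV[R]_n := \row_i (Num.sg (x ord0 i) * `|x ord0 i| `^ (p - 1)).
have xz : dotv x z = pnorm p x `^ p.
  rewrite pnorm_powR ?gt_eqF//; apply: eq_bigr => i _.
  by rewrite mxE mulrA [_ * Num.sg _]mulrC -normrEsg mulr_powRB1.
have nz : pnorm q z = pnorm p x `^ (p - 1).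
  rewrite /pnorm -powRrM; congr (_ `^ _); last first.
    by rewrite mulrBr mulVf ?gt_eqF// mulr1 -pq addrC addKr.
  apply: eq_bigr => i _; rewrite mxE normrM (ger0_norm (powR_ge0 _ _)) normr_sg.
  have [->|xi0] := eqVneq (x ord0 i) 0; first by rewrite normr0 mul0r !powR0 ?gt_eqF.
  by rewrite mul1r -powRrM qp.
have := H z; rewrite xz nz -(mulr_powRB1 (pnorm_ge0 _ _) p0).
by rewrite ler_pM2r// powR_gt0.
Qed.

(** By duality: tested against [z], each summand obeys Hoelder's inequality with the same factor,
    the conjugate norm of [z]. *)
Lemma ler_pnormD p x y : 1 < p -> pnorm p (x + y) <= pnorm p x + pnorm p y.
Proof.
move=> p1; have p0 : 0 < p by exact: lt_trans p1.
have pq : p^-1 + ((1 - p^-1)^-1)^-1 = 1 by rewrite invrK addrC subrK.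
have q1 : 1 < (1 - p^-1)^-1.
  by rewrite invf_gt1 ?ltrBlDr ?ltrDl ?invr_gt0// subr_gt0 invf_lt1.
have q0 := lt_trans ltr01 q1.
apply: (pnorm_dual p1 q1 pq); first by rewrite addr_ge0 ?pnorm_ge0.
by move=> z; rewrite dotvDl mulrDl lerD// ler_dotv_pnorm.
Qed.

Lemma ler_pnormB p x y : 1 < p -> pnorm p (x - y) <= pnorm p x + pnorm p y.
Proof. by move=> p1; rewrite -(pnormN p y) ler_pnormD. Qed.

Lemma ler_pnorm_sum (I : Type) (s : seq I) p (F : I -> 'rV[R]_n) : 1 < p ->
  pnorm p (\sum_(i <- s) F i) <= \sum_(i <- s) pnorm p (F i).
Proof.
move=> p1; elim/big_ind2: _ => // [|x a y b xa yb].
  by rewrite pnorm0// (lt_trans _ p1).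
by apply: le_trans (ler_pnormD _ _ p1) _; rewrite lerD.
Qed.

(** No coordinate exceeds |x|_r, so |x_i|^p <= |x|_r^(p-r) |x_i|^r; sum over i. *)
Lemma ler_pnorm p r x : 0 < r -> r <= p -> pnorm p x <= pnorm r x.
Proof.
move=> r0 rp; have p0 : 0 < p by exact: lt_le_trans rp.
have := pnorm_ge0 r x; rewrite le_eqVlt => /predU1P[x0|x0].
  by rewrite (pnorm_eq0 r0 (esym x0)) !pnorm0.
rewrite -[leRHS]powRr1 ?pnorm_ge0// -(mulfV (lt0r_neq0 p0)) powRrM.
apply: ge0_ler_powR; rewrite ?invr_ge0 ?(ltW p0)// ?nnegrE ?powR_ge0//.
  by apply: sumr_ge0 => j _; exact: powR_ge0.
have -> : pnorm r x `^ p = pnorm r x `^ (p - r) * \sum_i `|x ord0 i| `^ r.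
  rewrite -pnorm_powR ?gt_eqF// -powRD ?subrK//.
  by rewrite (gt_eqF x0) implybT.
rewrite mulr_sumr; apply: ler_sum => i _.
have [->|xi0] := eqVneq (x ord0 i) 0.
  by rewrite normr0 !powR0 ?gt_eqF// mulr0.
have -> : `|x ord0 i| `^ p = `|x ord0 i| `^ (p - r) * `|x ord0 i| `^ r.
  by rewrite -powRD ?subrK// normr_eq0 xi0 implybT.
rewrite ler_wpM2r ?powR_ge0// ge0_ler_powR ?subr_ge0// ?nnegrE ?pnorm_ge0//.
exact: coord_le_pnorm.
Qed.

End Fixed.
End PNorm.

(** * The smoothed squared norm along lines *)

Section LineCalculus.
Variable R : realType.

Lemma is_derive_powR (f : R -> R) (t df a : R) : 0 < f t ->
  is_derive t 1 f df ->
  is_derive t 1 (fun s => f s `^ a) (a * f t `^ (a - 1) * df).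
Proof.
move=> ft0 fdf.
by have h := is_derive1_comp (is_derive1_powR a ft0) fdf; refine h.
Qed.

Lemma is_derive_mul (f g : R -> R) (t df dg : R) :
  is_derive t 1 f df -> is_derive t 1 g dg ->
  is_derive t 1 (fun s => f s * g s) (df * g t + f t * dg).
Proof.
move=> fdf gdg; have := is_deriveM fdf gdg.
by move/is_derive_eq; apply; rewrite addrC [g t *: _]mulrC.
Qed.

Lemma is_derive_add (f g : R -> R) (t df dg : R) :
  is_derive t 1 f df -> is_derive t 1 g dg ->
  is_derive t 1 (fun s => f s + g s) (df + dg).
Proof. exact: is_deriveD. Qed.

Lemma is_derive_bigsum n (f : 'I_n -> R -> R) (df : 'I_n -> R) (t : R) :
  (forall i, is_derive t 1 (f i) (df i)) ->
  is_derive t 1 (fun s => \sum_(i < n) f i s) (\sum_(i < n) df i).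
Proof.
move=> fdf; rewrite (_ : (fun _ => _) = \sum_(i < n) f i); last first.
  by apply/funext => s; rewrite fct_sumE.
exact: is_derive_sum.
Qed.

Lemma is_derive_affine (a b t : R) : is_derive t 1 (fun s => a + s * b) b.
Proof.
have h1 : is_derive t 1 (cst a : R -> R) (0 : R) by exact: is_derive_cst.
have h2 : is_derive t 1 (fun s : R => s * b) (1 * b + t * 0).
  have hi : is_derive t 1 (id : R -> R) (1 : R) by exact: is_derive_id.
  have hc : is_derive t 1 (cst b : R -> R) (0 : R) by exact: is_derive_cst.
  exact: (is_derive_mul hi hc).
by have := is_derive_add h1 h2; move/is_derive_eq; apply; rewrite mul1r mulr0 addr0 add0r.
Qed.

Lemma MVT01 (f df : R -> R) : (forall t : R, 0 <= t <= 1 -> is_derive t 1 f (df t)) ->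
  exists2 c : R, 0 < c < 1 & f 1 - f 0 = df c.
Proof.
move=> fdf; have [|||c c01 ->] := @MVT R f df 0 1 => //.
- by move=> x; rewrite in_itv/= => /andP[x0 x1]; apply: fdf; rewrite !ltW.
- by apply: derivable_within_continuous => x; rewrite in_itv/= => /fdf[].
by exists c; [rewrite in_itv/= in c01 | rewrite subr0 mulr1].
Qed.

(** Mean value theorem for f(s) - s df(0) - C s^2 / 2, whose derivative is nonpositive on the
    segment. The hypothesis bounds the growth of [df] from 0 only, which a Hessian bound and a
    Lipschitz gradient both provide. *)
Lemma taylor2_le (f df : R -> R) (C : R) :
  (forall t : R, 0 <= t <= 1 -> is_derive t 1 f (df t)) ->
  (forall t : R, 0 <= t <= 1 -> df t - df 0 <= C * t) ->
  f 1 <= f 0 + df 0 + C / 2.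
Proof.
move=> fdf dfC.
have h (t : R) : 0 <= t <= 1 ->
    is_derive t 1 (fun s => f s + (- s * (df 0) + (- (C / 2)) * (s * s)))
      (df t - df 0 - C * t).
  move=> t01; have hid : is_derive t 1 (id : R -> R) 1 by exact: is_derive_id.
  have h1 := is_derive_affine 0 (- df 0) t.
  have h2 := is_derive_mul (@is_derive_cst _ _ _ (- (C / 2)) t 1) (is_derive_mul hid hid).
  have := is_derive_add (fdf t t01) (is_derive_add h1 h2).
  rewrite (_ : (fun s => _) = (fun s => f s + (- s * df 0 + - (C / 2) * (s * s)))).
    by move/is_derive_eq; apply; rewrite /cst/=; field.
  by apply/funext => s /=; rewrite /cst/=; ring.
have [c /andP[c0 c1] /=] := MVT01 h.
have := dfC c; rewrite (ltW c0) (ltW c1) => /(_ isT); lra.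
Qed.

Lemma is_derive_line n (f : 'rV[R]_n -> R) (x w : 'rV[R]_n) (t : R) :
  differentiable f (x + t *: w) ->
  is_derive t 1 (fun s => f (x + s *: w)) (dotv (grad f (x + t *: w)) w).
Proof.
move=> df.
have hw : is_diff t (fun s : R => x + s *: w) (fun s => s *: w).
  have h1 : is_diff t (fun s : R => s *: w) (fun s => s *: w) by exact: is_diff_scalel.
  by have := is_diffD (is_diff_cst x t) h1; rewrite add0r => h; refine h.
have hf : is_diff t (fun s => f (x + s *: w))
    ('d f (x + t *: w) \o (fun s => s *: w)).
  by apply: is_diff_comp; exact: differentiableP.
apply: DeriveDef; first by apply/derivable1_diffP; case: hf.
rewrite deriveE; last by case: hf.
rewrite (@diff_val _ _ _ _ _ _ _ hf) /= scale1r.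
transitivity ('d f (x + t *: w) (\sum_j w ord0 j *: delta_mx ord0 j)).
  by rewrite -row_sum_delta.
rewrite linear_sum.
rewrite /dotv; apply: eq_bigr => i _.
by rewrite linearZ/= -deriveE// mxE mulrC.
Qed.

(** Reads a directional derivative off the curve through the point; this is how the gradient of
    [vdelta] is identified from its derivatives along lines. *)
Lemma derive_line n (f : 'rV[R]_n -> R) (x w : 'rV[R]_n) (l : R) :
  is_derive (0 : R) (1 : R) (fun s : R => f (x + s *: w)) l -> 'D_w f x = l.
Proof.
case=> _ <-; rewrite /derive.
set g := (X in _ = lim (X @ _)).
rewrite (_ : (fun h => _) = g)//; apply/funext => h; rewrite /g/=.
have h1 : h%:A = h :> R by exact: mulr1.
by rewrite h1 scale0r !addr0 (addrC x).
Qed.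

End LineCalculus.

Lemma ler_powR_base (R : realType) (a b c : R) :
  0 <= c -> 0 <= a -> a <= b -> a `^ c <= b `^ c.
Proof.
by move=> c0 a0 ab; apply: ge0_ler_powR; rewrite ?nnegrE//; exact: le_trans ab.
Qed.

Section Smoothing.
Variables (R : realType) (n : nat) (r dl : R).
Hypothesis dl0 : 0 < dl.
Implicit Types (x w z a b : 'rV[R]_n) (t : R).

Definition sqd x (i : 'I_n) : R := x ord0 i ^+ 2 + dl ^+ 2.
Definition Phid x : R := \sum_(i < n) sqd x i `^ (r / 2).
(** The squared [r]-norm of the vector with entries sqrt(x_i^2 + dl^2). For [r = q] it is 2 (q - 1)
    times [vdelta]; for [r >= 2] it is a smooth majorant of |x|_r^2. *)
Definition Nd x : R := Phid x `^ (2 / r).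
(** Half the gradient of [Nd]; likewise [hessNd] is half its second derivative as a bilinear form, a
    rank-one part plus a diagonal part. With the factor 2 taken out, the constant [r - 1] appears
    bare below. *)
Definition gradNd x : 'rV[R]_n :=
  \row_i (Phid x `^ (2 / r - 1) * (sqd x i `^ (r / 2 - 1) * x ord0 i)).
Definition hessNd x w z : R :=
  (2 - r) * Phid x `^ (2 / r - 2)
    * (\sum_i sqd x i `^ (r / 2 - 1) * x ord0 i * w ord0 i)
    * (\sum_i sqd x i `^ (r / 2 - 1) * x ord0 i * z ord0 i)
  + Phid x `^ (2 / r - 1)
    * \sum_i (sqd x i `^ (r / 2 - 1)
        + (r - 2) * sqd x i `^ (r / 2 - 2) * x ord0 i ^+ 2)
        * w ord0 i * z ord0 i.

Lemma sqd_gt0 x i : 0 < sqd x i.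
Proof. by rewrite ltr_wpDl ?sqr_ge0// exprn_gt0. Qed.

Lemma Phid_ge0 x : 0 <= Phid x.
Proof. by apply: sumr_ge0 => i _; exact: powR_ge0. Qed.

Lemma Phid_gt0 x : (0 < n)%N -> 0 < Phid x.
Proof.
move=> n0; rewrite /Phid (bigD1 (Ordinal n0))//= ltr_pwDl ?powR_gt0 ?sqd_gt0//.
by apply: sumr_ge0 => i _; exact: powR_ge0.
Qed.

Lemma is_derive_sqd_line x w i t :
  is_derive t 1 (fun s : R => sqd (x + s *: w) i)
    (2 * (x + t *: w) ord0 i * w ord0 i).
Proof.
have h := is_derive_affine (x ord0 i) (w ord0 i) t.
have := is_derive_add (is_derive_mul h h) (@is_derive_cst _ _ _ (dl ^+ 2) t 1).
rewrite (_ : (fun s => _) = (fun s : R => sqd (x + s *: w) i)); last first.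
  by apply/funext => s; rewrite /sqd !mxE expr2.
by move/is_derive_eq; apply; rewrite !mxE; ring.
Qed.

Lemma is_derive_Phid_line x w t : 0 < r ->
  is_derive t 1 (fun s : R => Phid (x + s *: w))
    (r * \sum_i sqd (x + t *: w) i `^ (r / 2 - 1) * (x + t *: w) ord0 i * w ord0 i).
Proof.
move=> r0; have h i := @is_derive_powR R (fun s => sqd (x + s *: w) i) t _ (r / 2) (sqd_gt0 _ i) (is_derive_sqd_line x w i t).
have := is_derive_bigsum h; move/is_derive_eq; apply.
by rewrite mulr_sumr; apply: eq_bigr => i _; field.
Qed.

Lemma is_derive_Nd_line x w t : (0 < n)%N -> 0 < r ->
  is_derive t 1 (fun s : R => Nd (x + s *: w)) (2 * dotv (gradNd (x + t *: w)) w).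
Proof.
move=> n0 r0; have h := is_derive_powR (2 / r) (Phid_gt0 (x + t *: w) n0) (is_derive_Phid_line x w t r0).
move: h; move/is_derive_eq; apply; rewrite /dotv mulrA mulr_sumr mulr_sumr.
by apply: eq_bigr => i _; rewrite [gradNd _ _ _]mxE; field; rewrite gt_eqF.
Qed.

Lemma is_derive_gradNd_line x w z t : (0 < n)%N -> 0 < r ->
  is_derive t 1 (fun s : R => dotv (gradNd (x + s *: w)) z)
    (hessNd (x + t *: w) w z).
Proof.
move=> n0 r0; set y := x + t *: w.
have h1 := is_derive_powR (2 / r - 1) (Phid_gt0 y n0) (is_derive_Phid_line x w t r0).
have h2 i := @is_derive_powR R (fun s => sqd (x + s *: w) i) t _ (r / 2 - 1) (sqd_gt0 _ i) (is_derive_sqd_line x w i t).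
have h3 i : is_derive t 1 (fun s : R => (x + s *: w) ord0 i) (w ord0 i).
  rewrite (_ : (fun s => _) = (fun s : R => x ord0 i + s * w ord0 i)).
    exact: is_derive_affine.
  by apply/funext => s; rewrite !mxE.
have h4 i := is_derive_mul h1 (is_derive_mul (is_derive_mul (h2 i) (h3 i)) (@is_derive_cst _ _ _ (z ord0 i) t 1)).
have := is_derive_bigsum h4.
rewrite (_ : (fun s => _) = (fun s : R => dotv (gradNd (x + s *: w)) z)); last first.
  by apply/funext => s; apply: eq_bigr => i _; rewrite [gradNd _ _ _]mxE /cst/=; ring.
move/is_derive_eq; apply; rewrite /hessNd -/y.
rewrite big_split/= -!mulr_sumr; congr (_ + _).
  rewrite (_ : 2 / r - 1 - 1 = 2 / r - 2); last by ring.
  set S1 := \sum_(i < n) _; set S2 := \sum_(i < n) _.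
  by field; rewrite gt_eqF.
congr (_ * _); apply: eq_bigr => i _.
rewrite (_ : r / 2 - 1 - 1 = r / 2 - 2); last by ring.
by rewrite /cst/=; field.
Qed.

Lemma pnorm_powR2 p x : 0 < p -> (\sum_i `|x ord0 i| `^ p) `^ (2 / p) = pnorm p x ^+ 2.
Proof.
by move=> p0; rewrite mulrC powRrM -/(pnorm p x) powR_mulrn// pnorm_ge0.
Qed.

Lemma sqr_le_sqd x i : x ord0 i ^+ 2 <= sqd x i.
Proof. by rewrite lerDl sqr_ge0. Qed.

(** After factoring out s^(r/2 - 2), with s = x_i^2 + dl^2, the diagonal coefficient is s + (r - 2)
    x_i^2, and 0 <= x_i^2 <= s decides both bounds. *)
Lemma hess_coef_itv x i : 1 <= r <= 2 ->
  (r - 1) * sqd x i `^ (r / 2 - 1)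
    <= sqd x i `^ (r / 2 - 1) + (r - 2) * sqd x i `^ (r / 2 - 2) * x ord0 i ^+ 2
    <= sqd x i `^ (r / 2 - 1).
Proof.
move=> /andP[r1 r2].
have e : sqd x i `^ (r / 2 - 1) = sqd x i `^ (r / 2 - 2) * sqd x i.
  rewrite -[X in _ = _ * X]powRr1 ?(ltW (sqd_gt0 _ _))// -powRD; last first.
    by rewrite (gt_eqF (sqd_gt0 _ _)) implybT.
  by congr (_ `^ _); ring.
rewrite e; have := sqr_le_sqd x i; have := powR_gt0 (r / 2 - 2) (sqd_gt0 x i).
move: (sqd x i) (sqd x i `^ _) (sqr_ge0 (x ord0 i)) => s S x0 S0 sx.
apply/andP; split; last first.
  by rewrite -[leRHS]addr0 lerD2l mulr_le0_ge0// mulr_le0_ge0 ?(ltW S0)// subr_le0.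
rewrite -subr_ge0 (_ : _ - _ = (2 - r) * (S * (s - x ord0 i ^+ 2))); last by ring.
by rewrite mulr_ge0 ?subr_ge0// mulr_ge0 ?subr_ge0 ?(ltW S0).
Qed.

Lemma hess_coef_le x i : 2 <= r ->
  sqd x i `^ (r / 2 - 1) + (r - 2) * sqd x i `^ (r / 2 - 2) * x ord0 i ^+ 2
    <= (r - 1) * sqd x i `^ (r / 2 - 1).
Proof.
move=> r2.
have e : sqd x i `^ (r / 2 - 1) = sqd x i `^ (r / 2 - 2) * sqd x i.
  rewrite -[X in _ = _ * X]powRr1 ?(ltW (sqd_gt0 _ _))// -powRD; last first.
    by rewrite (gt_eqF (sqd_gt0 _ _)) implybT.
  by congr (_ `^ _); ring.
rewrite e; have := sqr_le_sqd x i; have := powR_gt0 (r / 2 - 2) (sqd_gt0 x i).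
move: (sqd x i) (sqd x i `^ _) => s S S0 sx.
rewrite -subr_ge0 (_ : _ - _ = (r - 2) * (S * (s - x ord0 i ^+ 2))); last by ring.
by rewrite mulr_ge0 ?subr_ge0// mulr_ge0 ?subr_ge0 ?(ltW S0).
Qed.

(** Hoelder with exponents 1 - r/2 and r/2: |w_i|^r is the product of (s_i^(r/2))^(1 - r/2) and
    (s_i^(r/2 - 1) w_i^2)^(r/2), the powers of s_i cancelling. *)
Lemma pnorm_le_hess x w : 1 < r <= 2 ->
  pnorm r w ^+ 2 <= Phid x `^ (2 / r - 1) * \sum_i sqd x i `^ (r / 2 - 1) * w ord0 i ^+ 2.
Proof.
move=> /andP[r1 r2]; have r0 : 0 < r by exact: lt_trans r1.
set W := \sum_i _; have W0 : 0 <= W.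
  by apply: sumr_ge0 => i _; rewrite mulr_ge0 ?powR_ge0 ?sqr_ge0.
rewrite -pnorm_powR2//.
have H : \sum_i `|w ord0 i| `^ r <= Phid x `^ (1 - r / 2) * W `^ (1 - (1 - r / 2)).
  apply: le_trans (hoelder_sum _ _ _); last first.
  - by move=> i; rewrite mulr_ge0 ?powR_ge0 ?sqr_ge0.
  - by move=> i; exact: powR_ge0.
  - by apply/andP; split; lra.
  apply: ler_sum => i _; rewrite powRM ?powR_ge0 ?sqr_ge0// mulrA -!powRrM -powRD; last first.
    by rewrite (gt_eqF (sqd_gt0 _ _)) implybT.
  rewrite (_ : _ + _ = 0); last by field.
  rewrite powRr0 mul1r -real_normK ?num_real// -powR_mulrn// -powRrM.
  by rewrite (_ : 2 * _ = r)//; field.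
apply: (@le_trans _ _ ((Phid x `^ (1 - r / 2) * W `^ (1 - (1 - r / 2))) `^ (2 / r))).
  apply: ler_powR_base => //; first by rewrite divr_ge0// ltW.
  by apply: sumr_ge0 => i _; exact: powR_ge0.
rewrite powRM ?powR_ge0// -!powRrM.
rewrite (_ : (1 - r / 2) * (2 / r) = 2 / r - 1); last by field; rewrite gt_eqF.
rewrite (_ : (1 - (1 - r / 2)) * (2 / r) = 1); last by field; rewrite gt_eqF.
by rewrite powRr1.
Qed.

(** For [r <= 2] the rank-one part is nonnegative and is dropped; the diagonal part gives strong
    convexity. *)
Lemma hessNd_ge x w : 1 < r <= 2 -> (r - 1) * pnorm r w ^+ 2 <= hessNd x w w.
Proof.
move=> r12; have /andP[r1 r2] := r12; rewrite /hessNd.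
apply: (@le_trans _ _ (Phid x `^ (2 / r - 1) * ((r - 1) * \sum_i sqd x i `^ (r / 2 - 1) * w ord0 i ^+ 2))).
  by rewrite [leRHS]mulrCA ler_wpM2l ?subr_ge0 ?(ltW r1)// pnorm_le_hess.
rewrite -[leLHS]add0r lerD//.
  by rewrite -mulrA mulr_ge0 -?expr2 ?sqr_ge0// mulr_ge0 ?powR_ge0// subr_ge0.
rewrite ler_wpM2l ?powR_ge0// mulr_sumr ler_sum// => i _.
have := @hess_coef_itv x i; rewrite r2 (ltW r1) => /(_ isT)/andP[H _].
by rewrite mulrA -[leRHS]mulrA -expr2 ler_wpM2r ?sqr_ge0.
Qed.

(** For [r >= 2] the rank-one part is nonpositive and is dropped. Hoelder with exponents 1 - 2/r and
    2/r bounds the diagonal part, and the two powers of [Phid] cancel. *)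
Lemma hessNd_le x w : (0 < n)%N -> 2 <= r -> hessNd x w w <= (r - 1) * pnorm r w ^+ 2.
Proof.
move=> n0 r2; have r0 : 0 < r by exact: lt_le_trans r2.
rewrite /hessNd -[leRHS]add0r lerD//.
  rewrite -mulrA mulr_le0_ge0 -?expr2 ?sqr_ge0//.
  by rewrite mulr_le0_ge0 ?powR_ge0// subr_le0.
set T := \sum_i _.
have hT : T <= (r - 1) * \sum_i sqd x i `^ (r / 2 - 1) * w ord0 i ^+ 2.
  rewrite mulr_sumr ler_sum// => i _.
  by rewrite mulrA -[leLHS]mulrA -expr2 ler_wpM2r ?sqr_ge0// hess_coef_le.
apply: le_trans (ler_wpM2l (powR_ge0 _ _) hT) _.
rewrite [leLHS]mulrCA ler_wpM2l//; first by rewrite subr_ge0 (le_trans _ r2)// ler1n.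
apply: (@le_trans _ _ (Phid x `^ (2 / r - 1) * (Phid x `^ (1 - 2 / r) * (\sum_i `|w ord0 i| `^ r) `^ (1 - (1 - 2 / r))))).
  rewrite ler_wpM2l ?powR_ge0//; apply: le_trans (hoelder_sum _ _ _); last first.
  - by move=> i; exact: powR_ge0.
  - by move=> i; exact: powR_ge0.
  - rewrite subr_ge0 ler_pdivrMr// mul1r r2/= gerBl divr_ge0// ltW//.
  apply: ler_sum => i _; rewrite -!powRrM.
  rewrite (_ : r / 2 * _ = r / 2 - 1); last by field; rewrite gt_eqF.
  rewrite (_ : r * (1 - _) = 2); last by field; rewrite gt_eqF.
  by rewrite powR_mulrn// real_normK// num_real.
rewrite mulrA -powRD; last by rewrite (gt_eqF (Phid_gt0 _ n0)) implybT.
rewrite (_ : 2 / r - 1 + _ = 0) ?powRr0 ?mul1r; last by ring.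
by rewrite (_ : 1 - _ = 2 / r) ?pnorm_powR2//; ring.
Qed.

Lemma pnorm_le_Nd x : 0 < r -> pnorm r x ^+ 2 <= Nd x.
Proof.
move=> r0; rewrite -(pnorm_powR2 _ r0) /Nd; apply: ler_powR_base.
- by rewrite divr_ge0// ltW.
- by apply: sumr_ge0 => i _; exact: powR_ge0.
apply: ler_sum => i _; rewrite (_ : `|x ord0 i| `^ r = (`|x ord0 i| `^ 2) `^ (r / 2)); last first.
  by rewrite -powRrM; congr (_ `^ _); field.
apply: ler_powR_base; rewrite ?powR_ge0// ?divr_ge0// ?(ltW r0)//.
by rewrite powR_mulrn// real_normK ?num_real// sqr_le_sqd.
Qed.

(** Since sqrt(x_i^2 + dl^2) <= |x_i| + dl, Minkowski against the constant vector [dl] applies. This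
    is what lets [dl] tend to 0 in [pnorm_smooth_avg]. *)
Lemma Nd_ub x : 1 < r -> Nd x <= (pnorm r x + dl * n%:R `^ r^-1) ^+ 2.
Proof.
move=> r1; have r0 : 0 < r by exact: lt_trans r1.
pose y : 'rV[R]_n := \row_i `|x ord0 i|.
have -> : pnorm r x = pnorm r y by rewrite /pnorm; under [in RHS]eq_bigr do rewrite mxE normr_id.
have -> : dl * n%:R `^ r^-1 = pnorm r (const_mx dl : 'rV[R]_n).
  rewrite /pnorm; under eq_bigr do rewrite mxE gtr0_norm//.
  rewrite sumr_const card_ord -[dl `^ r *+ n]mulr_natr powRM ?powR_ge0//.
  by rewrite -powRrM mulfV ?gt_eqF// powRr1// ltW.
have yd : 0 <= pnorm r (y + const_mx dl) <= pnorm r y + pnorm r (const_mx dl : 'rV[R]_n).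
  by rewrite pnorm_ge0 ler_pnormD.
apply: (@le_trans _ _ (pnorm r (y + const_mx dl) ^+ 2)); last first.
  by have /andP[a0 ab] := yd; rewrite lerXn2r// nnegrE (le_trans a0).
rewrite -(pnorm_powR2 _ r0) /Nd; apply: ler_powR_base; first by rewrite divr_ge0// ltW.
  exact: Phid_ge0.
apply: ler_sum => i _; set c := `|_|; rewrite (_ : c `^ r = (c `^ 2) `^ (r / 2)); last first.
  by rewrite -powRrM; congr (_ `^ _); field.
apply: ler_powR_base; rewrite ?(ltW (sqd_gt0 _ _))// ?divr_ge0// ?(ltW r0)//.
rewrite /c powR_mulrn// !mxE real_normK ?num_real// /sqd -(@real_normK _ (x ord0 i)) ?num_real//.
have := normr_ge0 (x ord0 i); move: `|x ord0 i| => a a0.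
rewrite sqrrD lerD2r lerDl mulrn_wge0// mulr_ge0// ltW//.
Qed.

Lemma gradNd_mono x y : (0 < n)%N -> 1 < r <= 2 ->
  (r - 1) * pnorm r (y - x) ^+ 2 <= dotv (gradNd y - gradNd x) (y - x).
Proof.
move=> n0 r12; have r0 : 0 < r by case/andP: r12 => r1 _; exact: lt_trans r1.
have [c _] := MVT01 (fun t _ => is_derive_gradNd_line x (y - x) (y - x) t n0 r0).
rewrite scale1r scale0r addr0 (addrC x) subrK -dotvBl => ->.
exact: hessNd_ge.
Qed.

Lemma Nd_smooth a b : (0 < n)%N -> 2 <= r ->
  pnorm r (a + b) ^+ 2 <= Nd a + 2 * dotv (gradNd a) b + (r - 1) * pnorm r b ^+ 2.
Proof.
move=> n0 r2; have r0 : 0 < r by exact: lt_le_trans r2.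
apply: (le_trans (pnorm_le_Nd _ r0)).
have := @taylor2_le R _ _ (2 * ((r - 1) * pnorm r b ^+ 2))
  (fun t _ => is_derive_Nd_line a b t n0 r0).
rewrite scale1r scale0r addr0 [2 * ((r - 1) * _)]mulrC mulfK//; apply => t /andP[t0 _].
rewrite -mulrBr [_ * 2]mulrC -mulrA ler_wpM2l//.
have [c _] := @MVT_segment R (fun s => dotv (gradNd (a + s *: b)) b)
    (fun s => hessNd (a + s *: b) b b) 0 t t0
    (fun s _ => is_derive_gradNd_line a b b s n0 r0)
    (derivable_within_continuous (fun s _ => @ex_derive _ _ _ _ _ _ _
      (is_derive_gradNd_line a b b s n0 r0))).
by rewrite scale0r addr0 subr0 => ->; rewrite ler_wpM2r// hessNd_le.
Qed.

(** Source of L_v. In the rank-one part the vector s_i^(r/2 - 1) x_i has [p]-norm at most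
    Phid^(1/p), because |x_i| <= s_i^(1/2); used twice, this cancels Phid^(2/r - 2). In the diagonal
    part the coefficients are at most dl^(r - 2), the exponent being nonpositive, and Hoelder
    applies together with |z|_p <= |z|_r. *)
Lemma hessNd_abs p x w z : (0 < n)%N -> 1 < r <= 2 -> p^-1 + r^-1 = 1 -> 0 < p ->
  `|hessNd x w z| <= ((2 - r) + Phid x `^ (2 / r - 1) * dl `^ (r - 2))
                       * pnorm r w * pnorm r z.
Proof.
move=> n0 /andP[r1 r2] pr p0; have r0 : 0 < r by exact: lt_trans r1.
have Hs (y : 'rV[R]_n) : `|\sum_i sqd x i `^ (r / 2 - 1) * x ord0 i * y ord0 i|
    <= Phid x `^ p^-1 * pnorm r y.
  pose a : 'rV[R]_n := \row_i (sqd x i `^ (r / 2 - 1) * x ord0 i).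
  rewrite (_ : \sum_i _ = dotv a y); last by apply: eq_bigr => i _; rewrite mxE.
  apply: le_trans (ler_norm_dotv _ _ p0 r0 pr) _.
  suff : pnorm p a <= Phid x `^ p^-1 by move=> H; rewrite ler_wpM2r ?pnorm_ge0.
  rewrite /pnorm; apply: ler_powR_base; first by rewrite invr_ge0 ltW.
    by apply: sumr_ge0 => i _; exact: powR_ge0.
  apply: ler_sum => i _; rewrite mxE normrM ger0_norm ?powR_ge0//.
  have xs : `|x ord0 i| <= sqd x i `^ 2^-1.
    rewrite powR12_sqrt ?(ltW (sqd_gt0 _ _))// -sqrtr_sqr ler_wsqrtr//.
    exact: sqr_le_sqd.
  apply: (@le_trans _ _ ((sqd x i `^ (r / 2 - 1) * sqd x i `^ 2^-1) `^ p)).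
    apply: ler_powR_base; rewrite ?(ltW p0)// ?mulr_ge0 ?powR_ge0//.
    by rewrite ler_wpM2l ?powR_ge0.
  rewrite -powRD; last by rewrite (gt_eqF (sqd_gt0 _ _)) implybT.
  rewrite -powRrM (_ : (r / 2 - 1 + 2^-1) * p = r / 2)//.
  have -> : p = (1 - r^-1)^-1 by rewrite -pr addrK invrK.
  by field; rewrite !gt_eqF// subr_gt0.
rewrite /hessNd; apply: le_trans (ler_normD _ _) _.
rewrite -[leRHS]mulrA [leRHS]mulrDl; apply: lerD.
  rewrite !normrM (ger0_norm (powR_ge0 _ _)) ger0_norm ?subr_ge0//.
  have e : Phid x `^ (2 / r - 2) * Phid x `^ p^-1 * Phid x `^ p^-1 = 1.
    rewrite -!powRD ?(gt_eqF (Phid_gt0 _ n0)) ?implybT//.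
    have -> : p^-1 = 1 - r^-1 by rewrite -pr addrK.
    by rewrite (_ : _ + _ = 0) ?powRr0//; ring.
  apply: (@le_trans _ _ ((2 - r) * Phid x `^ (2 / r - 2)
      * (Phid x `^ p^-1 * pnorm r w) * (Phid x `^ p^-1 * pnorm r z))); last first.
    rewrite le_eqVlt; apply/orP; left; apply/eqP; move: e.
    move: (_ `^ _) (_ `^ _) (pnorm r w) (pnorm r z) (2 - r) => A B w' z' c e.
    by transitivity (c * (w' * z') * (B * A * A)); [ring | rewrite e mulr1].
  rewrite ler_pM ?mulr_ge0 ?normr_ge0 ?powR_ge0 ?subr_ge0//.
  by rewrite ler_wpM2l ?mulr_ge0 ?powR_ge0 ?subr_ge0.
rewrite -[leRHS]mulrA normrM (ger0_norm (powR_ge0 _ _)) ler_wpM2l ?powR_ge0//.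
apply: le_trans (ler_norm_sum _ _ _) _.
have rz : pnorm p z <= pnorm r z.
  apply: ler_pnorm => //.
  have r2' : 2^-1 <= r^-1 by rewrite lef_pV2 ?posrE.
  have : r^-1 >= p^-1 by move: pr r2'; move: p^-1 r^-1 => p' r' pr r2'; lra.
  by rewrite lef_pV2 ?posrE.
apply: (@le_trans _ _ (dl `^ (r - 2) * \sum_i `|z ord0 i| * `|w ord0 i|)).
  rewrite mulr_sumr ler_sum// => i _; rewrite !normrM [`|z _ _| * _]mulrC -mulrA ler_wpM2r ?mulr_ge0//.
  have := @hess_coef_itv x i; rewrite r2 (ltW r1) => /(_ isT)/andP[h1 h2].
  rewrite ger0_norm; last by apply: le_trans h1; rewrite mulr_ge0 ?powR_ge0// subr_ge0 ltW.
  apply: (le_trans h2).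
  have -> : dl `^ (r - 2) = (dl ^+ 2) `^ (r / 2 - 1).
    by rewrite -powR_mulrn ?(ltW dl0)// -powRrM; congr (_ `^ _); field.
  rewrite -[r / 2 - 1]opprB !powRN lef_pV2 ?posrE ?powR_gt0 ?sqd_gt0 ?exprn_gt0//.
  apply: ler_powR_base; rewrite ?sqr_ge0//.
    by rewrite subr_ge0 ler_pdivrMr// mul1r.
  by rewrite /sqd lerDr sqr_ge0.
rewrite ler_wpM2l ?powR_ge0//.
pose az : 'rV[R]_n := \row_i `|z ord0 i|; pose aw : 'rV[R]_n := \row_i `|w ord0 i|.
rewrite (_ : \sum_i _ = dotv az aw); last by apply: eq_bigr => i _; rewrite !mxE.
apply: le_trans (ler_dotv_pnorm _ _ p0 r0 pr) _; rewrite [pnorm p _ * _]mulrC.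
have e s (y : 'rV[R]_n) : pnorm s (\row_i `|y ord0 i|) = pnorm s y.
  by rewrite /pnorm; under eq_bigr do rewrite mxE normr_id.
by rewrite !e ler_wpM2l ?pnorm_ge0.
Qed.

(** Subadditivity of t^(r/2), whose exponent is at most 1: a ratio c / (a + b) <= 1 is at most its
    own power r/2. *)
Lemma Phid_ub x D : 1 < r <= 2 -> pnorm r x <= D -> Phid x <= D `^ r + n%:R * dl `^ r.
Proof.
move=> /andP[r1 r2] xD; have r0 : 0 < r by exact: lt_trans r1.
have r21 : 0 <= r / 2 <= 1 by rewrite divr_ge0 ?(ltW r0)// ler_pdivrMr// mul1r.
apply: (@le_trans _ _ (\sum_(i < n) (`|x ord0 i| `^ r + dl `^ r))).
  apply: ler_sum => i _.
  have e (a : R) : 0 <= a -> a `^ r = (a ^+ 2) `^ (r / 2).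
    by move=> a0; rewrite -powR_mulrn// -powRrM; congr (_ `^ _); field.
  rewrite !e// ?(ltW dl0)// real_normK ?num_real// /sqd.
  have := sqr_ge0 (x ord0 i); have : 0 < dl ^+ 2 by rewrite exprn_gt0.
  move: (dl ^+ 2) (x ord0 i ^+ 2) => a b a0 b0; have ab : 0 < b + a by rewrite ltr_wpDl.
  have H (c : R) : 0 <= c <= b + a -> (b + a) `^ (r / 2) * (c / (b + a)) <= c `^ (r / 2).
    move=> /andP[]; rewrite le_eqVlt => /predU1P[<- _|c0 cab].
      by rewrite mul0r mulr0 powR_ge0.
    have -> : c `^ (r / 2) = (b + a) `^ (r / 2) * (c / (b + a)) `^ (r / 2).
      by rewrite -powRM ?divr_ge0 ?(ltW c0) ?(ltW ab)// [_ * (_ / _)]mulrC divfK ?gt_eqF.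
    rewrite ler_wpM2l ?powR_ge0// ger1_powR ?divr_gt0 ?ler_pdivrMr ?mul1r//.
  apply: (@le_trans _ _ ((b + a) `^ (r / 2) * (b / (b + a)) + (b + a) `^ (r / 2) * (a / (b + a)))).
    by rewrite -mulrDr -mulrDl mulfV ?mulr1// gt_eqF.
  by rewrite lerD// H// ?b0 ?(ltW a0) ?lerDl ?lerDr// ltW.
rewrite big_split/= sumr_const card_ord -[dl `^ r *+ n]mulr_natl lerD2r.
rewrite -pnorm_powR ?gt_eqF//; exact: ler_powR_base (ltW r0) (pnorm_ge0 _ _) xD.
Qed.

End Smoothing.

(** * The mirror step *)

Lemma pnorm1E (R : realType) n (x : 'rV[R]_n) : pnorm 1 x = \sum_i `|x ord0 i|.
Proof.
rewrite /pnorm invr1 powRr1; last by apply: sumr_ge0 => i _; exact: powR_ge0.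
by apply: eq_bigr => i _; rewrite powRr1.
Qed.

Opaque pnorm powR.

(** * Topology of row vectors in terms of the norms *)

Section Topology.
Variable R : realType.

Lemma coord_le_norm n (x : 'rV[R]_n) i : `|x ord0 i| <= `|x|.
Proof.
rewrite [leRHS]/Num.Def.normr/= mx_normrE; apply/bigmax_geP; right => /=.
by exists (ord0, i).
Qed.

Lemma pnorm_le_norm n p (x : 'rV[R]_n) : 1 <= p -> pnorm p x <= n%:R * `|x|.
Proof.
move=> p1; apply: le_trans (ler_pnorm _ ltr01 p1) _.
rewrite pnorm1E.
rewrite -[X in X%:R]card_ord -sum1_card natr_sum mulr_suml ler_sum// => i _.
by rewrite mul1r coord_le_norm.
Qed.

Lemma norm_le_pnorm n p (x : 'rV[R]_n) : 0 < p -> `|x| <= pnorm p x.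
Proof.
move=> p0; rewrite [leLHS]/Num.Def.normr/= mx_normrE; apply/bigmax_leP; split.
  exact: pnorm_ge0.
by move=> [i j] _ /=; rewrite ord1 coord_le_pnorm.
Qed.

Lemma cvg_rV (T : Type) (F : set_system T) {FF : Filter F} n (f : T -> 'rV[R]_n) (l : 'rV[R]_n) :
  (forall i, f x ord0 i @[x --> F] --> l ord0 i) -> f @ F --> l.
Proof.
move=> fc A [B Bx BA].
have : \forall x \near F, forall i, B ord0 i (f x ord0 i).
  apply: filter_forall => i; exact: fc.
by apply: filterS => y yB; apply: BA => i j; rewrite ord1.
Qed.

Lemma cvg_sum_seq (T I : Type) (F : set_system T) {FF : Filter F} (s : seq I)
    (f : I -> T -> R) (l : I -> R) :
  (forall i, f i @ F --> l i) -> \sum_(i <- s) f i x @[x --> F] --> \sum_(i <- s) l i.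
Proof.
move=> fc; elim: s => [|i s IHs].
  under eq_fun do rewrite big_nil; rewrite big_nil; exact: cvg_cst.
by under eq_fun do rewrite big_cons; rewrite big_cons; apply: cvgD.
Qed.

Lemma cvg_dotv (T : Type) (F : set_system T) {FF : Filter F} n (f g : T -> 'rV[R]_n) (a b : 'rV[R]_n) :
  f @ F --> a -> g @ F --> b -> dotv (f x) (g x) @[x --> F] --> dotv a b.
Proof.
move=> fa gb; apply: cvg_sum_seq => i; apply: cvgM.
  exact: (cvg_comp _ _ fa (@coord_continuous _ _ _ ord0 i a)).
exact: (cvg_comp _ _ gb (@coord_continuous _ _ _ ord0 i b)).
Qed.

Lemma cvg_powR (T : Type) (F : set_system T) {FF : Filter F} (f : T -> R) (a r : R) :
  0 < a -> f @ F --> a -> f x `^ r @[x --> F] --> a `^ r.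
Proof.
move=> a0 fa; have [d _] := is_derive1_powR r a0.
have h : {for a, continuous (fun x : R => x `^ r)}.
  by move/derivable1_diffP : d => /differentiable_continuous.
exact: (continuous_cvg _ h fa).
Qed.

Lemma cvg_pnorm (T : Type) (F : set_system T) {FF : Filter F} n p
    (f : T -> 'rV[R]_n) (l : 'rV[R]_n) : 1 < p ->
  f @ F --> l -> pnorm p (f x) @[x --> F] --> pnorm p l.
Proof.
move=> p1 fl; apply/cvgrPdist_le => e e0; near=> y.
have p0 : 0 < p by exact: lt_trans p1.
have H (u w : 'rV[R]_n) : pnorm p u - pnorm p w <= pnorm p (u - w).
  by have := ler_pnormD (u - w) w p1; rewrite subrK lerBlDr.
have xy : pnorm p (l - f y) <= e.
  apply: le_trans (pnorm_le_norm _ (ltW p1)) _.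
  (* [n.+1] in place of [n] keeps the factor positive in dimension 0. *)
  apply: (@le_trans _ _ (n.+1%:R * `|l - f y|)); first by rewrite ler_wpM2r// ler_nat.
  rewrite -ler_pdivlMl//; near: y.
  by apply: (cvgr_dist_le _ _ fl); rewrite mulr_gt0// invr_gt0.
rewrite ler_norml; apply/andP; split; last exact: le_trans (H _ _) xy.
rewrite lerNl opprB; apply: le_trans (H _ _) _; rewrite pnormC; exact: xy.
Unshelve. all: by end_near. Qed.

(** Continuity relative to [X] is the right notion for the regularizer, which may be infinite
    outside [X]. *)
Lemma lipschitz_continuous_within n p (X : set 'rV[R]_n) (f : 'rV[R]_n -> R) (M : R) : 1 < p ->
  (forall x y, X x -> X y -> f x - f y <= M * pnorm p (x - y)) ->
  {within X, continuous f}.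
Proof.
move=> p1 fl; apply/subspace_continuousP => x Xx.
apply/cvgrPdist_le => e e0.
have H (u w : 'rV[R]_n) : X u -> X w -> f u - f w <= `|M| * pnorm p (u - w).
  by move=> Xu Xw; apply: le_trans (fl _ _ Xu Xw) _; rewrite ler_wpM2r ?pnorm_ge0// ler_norm.
have M0 : 0 < (`|M| + 1) * n.+1%:R by rewrite mulr_gt0// ltr_wpDl.
have : \forall y \near x, `|x - y| <= e / ((`|M| + 1) * n.+1%:R).
  by apply: (cvgr_dist_le _ _ (cvg_id : x' @[x' --> x] --> x)); rewrite divr_gt0.
apply: filterS => y xy Xy.
have yx : `|M| * pnorm p (x - y) <= e.
  rewrite -(divfK (lt0r_neq0 M0) e) [leRHS]mulrC -mulrA ler_pM ?pnorm_ge0 ?lerDl//.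
  apply: le_trans (pnorm_le_norm _ (ltW p1)) _.
  by rewrite ler_pM// ler_nat.
rewrite ler_norml /from_subspace; apply/andP; split; last exact: le_trans (H _ _ Xx Xy) yx.
rewrite lerNl opprB; apply: le_trans (H _ _ Xy Xx) _; rewrite pnormC; exact: yx.
Qed.

Lemma pnorm_bounded_compact n p (X : set 'rV[R]_n) (D : R) : 0 < p -> closed X ->
  (forall x, X x -> pnorm p x <= D) -> compact X.
Proof.
move=> p0 Xc XD; apply: bounded_closed_compact => //.
exists D; split; first exact: num_real.
move=> M DM x Xx /=; apply: le_trans (norm_le_pnorm _ p0) _.
by apply: le_trans (XD _ Xx) (ltW _).
Qed.

End Topology.

(** * The distance-generating function *)

Section DistanceGenerating.
Variables (R : realType) (n : nat) (p q dl : R).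
Hypotheses (n0 : (0 < n)%N) (dl0 : 0 < dl) (p2 : 2 <= p) (pq : p^-1 + q^-1 = 1).
Implicit Types x y z w : 'rV[R]_n.

Lemma conj_gt0 : 0 < p.
Proof. exact: lt_le_trans p2. Qed.

Lemma conj_itv : 1 < q <= 2.
Proof.
have p0 := conj_gt0.
have qE : q = (1 - p^-1)^-1 by rewrite -pq addrAC subrr add0r invrK.
have p1 : 0 < p^-1 <= 2^-1 by rewrite invr_gt0 p0 lef_pV2 ?posrE.
rewrite qE invf_gt1 ?subr_gt0; last by lra.
rewrite -[X in _ <= X]invrK lef_pV2 ?posrE ?invr_gt0; last by lra.
  by apply/andP; split; lra.
by lra.
Qed.

Lemma conj_q0 : 0 < q. Proof. by case/andP: conj_itv => /(lt_trans ltr01). Qed.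
Lemma conj_q1 : 0 < q - 1. Proof. by case/andP: conj_itv; rewrite subr_gt0. Qed.

Lemma vdelta_line x w (t : R) :
  is_derive t 1 (fun s : R => vdelta q dl (x + s *: w))
    ((q - 1)^-1 * dotv (gradNd q dl (x + t *: w)) w).
Proof.
have := is_derive_mul (@is_derive_cst _ _ _ ((2 * (q - 1))^-1) t 1)
  (is_derive_Nd_line dl0 x w t n0 conj_q0).
move/is_derive_eq; apply; rewrite /cst/= mul0r add0r invfM.
by rewrite mulrA [2^-1 * _]mulrC -(mulrA _ 2^-1) mulVf// mulr1.
Qed.

Lemma grad_vdelta x : grad (vdelta q dl) x = (q - 1)^-1 *: gradNd q dl x.
Proof.
apply/rowP => i; rewrite !mxE; apply: derive_line.
apply: is_derive_eq (vdelta_line _ _ _) _.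
by rewrite scale0r addr0 dotv_delta mxE.
Qed.

Lemma is_derive_vdelta x w (t : R) :
  is_derive t 1 (fun s : R => vdelta q dl (x + s *: w))
    (dotv (grad (vdelta q dl) (x + t *: w)) w).
Proof. by rewrite grad_vdelta dotvZl; exact: vdelta_line. Qed.

(** The normalization 1 / (q - 1) of [vdelta] cancels the convexity constant of [Nd], so the modulus
    is 1 for every [q]. *)
Lemma vdelta_mono x y :
  pnorm q (y - x) ^+ 2 <= dotv (grad (vdelta q dl) y - grad (vdelta q dl) x) (y - x).
Proof.
rewrite !grad_vdelta -scalerBr dotvZl ler_pdivlMl ?conj_q1//.
exact: gradNd_mono dl0 _ _ n0 conj_itv.
Qed.

(** Duality reduces the [p]-norm to pairings with a vector [z]; the mean value theorem turns each
    pairing into the Hessian at a point of the segment, which stays in the [q]-ball of radius [D],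
    so that [Phid_ub] applies there. With D = D_X the constant is [par_Lv]. *)
Lemma vdelta_lipschitz D x y : pnorm q x <= D -> pnorm q y <= D ->
  pnorm p (grad (vdelta q dl) y - grad (vdelta q dl) x)
    <= ((2 - q) / (q - 1)
        + (q - 1)^-1 * (D `^ q + n%:R * dl `^ q) `^ ((2 - q) / q) * dl `^ (q - 2))
       * pnorm q (y - x).
Proof.
move=> xD yD; have /andP[q1 q2] := conj_itv.
have p0 := conj_gt0; have q0 := conj_q0.
have p1 : 1 < p by apply: lt_le_trans p2; rewrite ltr1n.
have qi0 : 0 <= (q - 1)^-1 by rewrite invr_ge0 ltW// conj_q1.
set A := (D `^ q + _) `^ _.
apply: (pnorm_dual p1 q1 pq).
  rewrite mulr_ge0 ?pnorm_ge0// addr_ge0//.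
    by rewrite mulr_ge0 ?subr_ge0.
  by rewrite !mulr_ge0 ?powR_ge0.
move=> z; rewrite !grad_vdelta -scalerBr dotvZl.
have [c /andP[c0 c1]] := MVT01 (fun t _ => is_derive_gradNd_line dl0 x (y - x) z t n0 q0).
rewrite scale1r scale0r addr0 (addrC x) subrK -dotvBl => ->.
have cD : pnorm q (x + c *: (y - x)) <= D.
  rewrite scalerBr addrCA -{1}(scale1r x) -scalerBl.
  apply: le_trans (ler_pnormD _ _ q1) _; rewrite !pnormZ//.
  rewrite gtr0_norm// ger0_norm ?subr_ge0 ?(ltW c1)//.
  apply: (@le_trans _ _ (c * D + (1 - c) * D)); last by rewrite -mulrDl addrC subrK mul1r.
  have c1' : 0 <= 1 - c by rewrite subr_ge0 ltW.
  exact: (lerD (ler_wpM2l (ltW c0) yD) (ler_wpM2l c1' xD)).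
set u := x + _ in cD *.
have := hessNd_abs dl0 u (y - x) z n0 conj_itv pq p0.
move=> /(le_trans (ler_norm _)) H.
apply: (@le_trans _ _ ((q - 1)^-1 * ((2 - q + A * dl `^ (q - 2)) * pnorm q (y - x) * pnorm q z))); last first.
  rewrite le_eqVlt; apply/orP; left; apply/eqP.
  by move: A (_ `^ _) (pnorm _ _) (pnorm _ _) ((q - 1)^-1) => A B C E F; ring.
apply: (ler_wpM2l qi0); apply: (le_trans H).
apply: ler_wpM2r (pnorm_ge0 _ _) _ _ _; apply: ler_wpM2r (pnorm_ge0 _ _) _ _ _.
apply: lerD (lexx _) _; apply: ler_wpM2r (powR_ge0 _ _) _ _ _.
rewrite /A (_ : (2 - q) / q = 2 / q - 1); last by rewrite mulrBl mulfV// gt_eqF.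
apply: ler_powR_base (Phid_ge0 _ _ _) (Phid_ub dl0 conj_itv cD).
by rewrite subr_ge0 ler_pdivlMr ?mul1r.
Qed.

Lemma cvg_sqd (T : Type) (F : set_system T) {FF : Filter F} (f : T -> 'rV[R]_n) x i :
  f @ F --> x -> sqd dl (f y) i @[y --> F] --> sqd dl x i.
Proof.
move=> fx; apply: cvgD; last exact: cvg_cst.
have h : f y ord0 i @[y --> F] --> x ord0 i.
  exact: (cvg_comp _ _ fx (@coord_continuous _ _ _ ord0 i x)).
by under eq_fun do rewrite expr2; rewrite expr2; exact: cvgM.
Qed.

Lemma cvg_Phid (T : Type) (F : set_system T) {FF : Filter F} (f : T -> 'rV[R]_n) x :
  f @ F --> x -> Phid q dl (f y) @[y --> F] --> Phid q dl x.
Proof.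
move=> fx; apply: cvg_sum_seq => i; apply: cvg_powR; last exact: cvg_sqd.
exact: sqd_gt0.
Qed.

Lemma cvg_vdelta (T : Type) (F : set_system T) {FF : Filter F} (f : T -> 'rV[R]_n) x :
  f @ F --> x -> vdelta q dl (f y) @[y --> F] --> vdelta q dl x.
Proof.
move=> fx; rewrite /vdelta; apply: cvgM; first exact: cvg_cst.
by apply: cvg_powR; [exact: Phid_gt0 | exact: cvg_Phid].
Qed.

Lemma cvg_grad_vdelta (T : Type) (F : set_system T) {FF : Filter F} (f : T -> 'rV[R]_n) x :
  f @ F --> x -> grad (vdelta q dl) (f y) @[y --> F] --> grad (vdelta q dl) x.
Proof.
move=> fx; rewrite (_ : grad _ = fun x => (q - 1)^-1 *: gradNd q dl x); last first.
  by apply/funext => y; exact: grad_vdelta.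
apply: cvg_rV => i; under eq_fun do rewrite !mxE; rewrite !mxE.
apply: cvgM; first exact: cvg_cst.
apply: cvgM; first by apply: cvg_powR; [exact: Phid_gt0 | exact: cvg_Phid].
apply: cvgM; first by apply: cvg_powR; [exact: sqd_gt0 | exact: cvg_sqd].
exact: (cvg_comp _ _ fx (@coord_continuous _ _ _ ord0 i x)).
Qed.

End DistanceGenerating.

(** * Projections and normal cones of compact convex sets *)

Section ConvexSets.
Variable R : realType.

(** Only increments to the right are known in a constrained minimization, as the other direction may
    leave the feasible set. *)
Lemma derive_right_ge (f : R -> R) (df K : R) : is_derive (0 : R) (1 : R) f df ->
  (forall t : R, 0 < t <= 1 -> K * t <= f t - f 0) -> K <= df.
Proof.
move=> [d <-] fK; rewrite ['D_1 f 0]cvg_at_rightE; last exact: d.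
apply: limr_ge.
  rewrite -(cvg_at_rightE (fun h : R => h^-1 *: ((f \o shift 0) _ - f 0))) //.
  apply: cvg_trans d; apply: cvg_app => A [e egt0 Ae]; exists e => // x xe xgt0.
  by apply: Ae => //; exact/lt0r_neq0.
near=> t; have t0 : 0 < t by near: t; exact: nbhs_right_gt.
have t1 : t <= 1 by near: t; exact: nbhs_right_le.
rewrite /= addr0 [t%:A]mulr1 [_ *: _]mulrC ler_pdivlMr//.
by apply: fK; rewrite t0 t1.
Unshelve. all: by end_near. Qed.

Lemma cvg_subr_rV (T : Type) (F : set_system T) {FF : Filter F} n
    (f : T -> 'rV[R]_n) (l a : 'rV[R]_n) :
  f @ F --> l -> (f x - a) @[x --> F] --> l - a.
Proof. by move=> fl; apply: cvgB => //; exact: cvg_cst. Qed.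

Variables (n : nat) (X : set 'rV[R]_n).
Hypothesis Xcomp : compact X.
Hypothesis Xconv : forall x y (t : R), X x -> X y -> 0 <= t <= 1 ->
  X (x + t *: (y - x)).
Implicit Types (x y z w a b : 'rV[R]_n).

Lemma projection_exists w : X !=set0 ->
  exists2 p, X p & forall y, X y -> dotv (w - p) (y - p) <= 0.
Proof.
move=> X0; have [p Xp pmin] : exists2 p, p \in X & forall y, y \in X ->
    dotv (p - w) (p - w) <= dotv (y - w) (y - w).
  apply: compact_EVT_min => //; apply: continuous_subspaceT => x.
  have h := @cvg_subr_rV _ _ (nbhs_filter x) _ id x w cvg_id.
  exact: (@cvg_dotv _ _ _ (nbhs_filter x) _ _ _ _ _ h h).
rewrite inE in Xp; exists p => // y Xy; rewrite leNgt; apply/negP.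
set D := dotv (w - p) (y - p) => D0; set N := dotv (y - p) (y - p).
have N0 : 0 <= N by exact: dotv_ge0.
have DN : 0 < D + N by rewrite ltr_pwDl.
(* Moving from [p] towards [y] by t changes the squared distance to [w] by t (t N - 2 D). The value
   t = D / (D + N) is feasible, also for N = 0, and satisfies t N <= D, so the change would be
   negative. *)
have t01 : 0 <= D / (D + N) <= 1.
  by rewrite divr_ge0 ?(ltW D0) ?(ltW DN)//= ler_pdivrMr// mul1r lerDl.
have := pmin (p + (D / (D + N)) *: (y - p)); rewrite inE => /(_ (Xconv Xp Xy t01)).
set t := D / (D + N) in t01 *.
rewrite [p + _ - w](_ : _ = (t *: (y - p)) - (w - p)); last by apply/rowP => i; rewrite !mxE; ring.
have -> : dotv (p - w) (p - w) = dotv (w - p) (w - p) by rewrite -opprB dotvNl dotvNr opprK.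
rewrite [leRHS](_ : _ = t * (t * N) - 2 * (t * D) + dotv (w - p) (w - p)); last first.
  rewrite /N /D; move: (y - p) (w - p) => a b.
  rewrite dotvBl !dotvBr !dotvZl !dotvZr (dotvC a b).
  by move: (dotv a a) (dotv b a) (dotv b b) => A1 A2 A3; ring.
rewrite lerDr => H0.
have t0 : 0 < t by rewrite divr_gt0.
have : t * N <= D by rewrite /t mulrAC ler_pdivrMr// ler_pM2l// lerDr ltW.
by move: H0; clearbody t; nra.
Qed.

(* A first-order condition with slack [M * |y - z|] puts [- a] within Euclidean
   distance [M] of the normal cone: [b] is a cluster point of [(P_X (z - t a) - z) / t]
   as [t -> 0+], where [P_X] is the projection. *)
Lemma normal_cone_decomposition z a (M : R) : X z -> 0 <= M ->
  (forall y, X y -> - (M * pnorm 2 (y - z)) <= dotv a (y - z)) ->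
  exists2 b, pnorm 2 b <= M & normal_cone X z (- (a + b)).
Proof.
move=> Xz M0 aM; pose C := (pnorm 2 a + M) * M.
have h2 : (2 : R)^-1 + 2^-1 = 1 by field.
have bk (k : nat) : {b | pnorm 2 b <= M /\ forall y, X y ->
    dotv (- (a + b)) (y - z) <= C / k.+1%:R}.
  apply: cid; pose t : R := k.+1%:R^-1.
  have t0 : 0 < t by rewrite invr_gt0.
  have [u Xu uP] := projection_exists (z - t *: a) (ex_intro _ z Xz).
  (* Testing the projection at [z] gives |u - z|^2 <= - t <a, u - z>, and the slack condition bounds
     the right-hand side by t M |u - z|. *)
  have uzM : pnorm 2 (u - z) <= t * M.
    have := uP z Xz; have := aM u Xu; have := pnorm_ge0 2 (u - z).
    have := pnorm2E (u - z).
    rewrite (_ : z - t *: a - u = - ((u - z) + t *: a)); last first.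
      by apply/rowP => i; rewrite !mxE; ring.
    have -> : dotv (- ((u - z) + t *: a)) (z - u) = dotv (u - z) (u - z) + t * dotv a (u - z).
      by rewrite dotvNl -dotvNr opprB dotvDl dotvZl.
    move: (dotv _ _) (dotv a _) (pnorm 2 (u - z)) => A B P <- + MB H.
    rewrite le_eqVlt => /predU1P[<-|P0]; first by rewrite mulr_ge0// ltW.
    by rewrite -(ler_pM2r P0); nra.
  exists (t^-1 *: (u - z)); split.
    by rewrite pnormZ// gtr0_norm ?invr_gt0// ler_pdivrMl.
  move=> y Xy; set b := t^-1 *: (u - z).
  have bM : pnorm 2 b <= M by rewrite pnormZ// gtr0_norm ?invr_gt0// ler_pdivrMl.
  (* Here t (- (a + b)) = z - t a - u is normal to [X] at [u]. Passing from [u] to [z] costs at most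
     |a + b| |u - z| <= (|a| + M) t M = C t, which vanishes in the limit. *)
  have e1 : dotv (- (a + b)) (y - u) <= 0.
    have := uP y Xy; rewrite (_ : z - t *: a - u = t *: (- (a + b))); last first.
      by apply/rowP => i; rewrite !mxE; field; rewrite gt_eqF// ltr0n.
    by rewrite dotvZl pmulr_rle0.
  have e2 : dotv (- (a + b)) (u - z) <= C / k.+1%:R.
    apply: le_trans (ler_dotv_pnorm _ _ (ltr0n R 2) (ltr0n R 2) h2) _.
    rewrite /C -mulrA (mulrC M); apply: ler_pM (pnorm_ge0 _ _) (pnorm_ge0 _ _) _ uzM.
    rewrite pnormN; apply: le_trans (ler_pnormD _ _ (ltr1n R 2)) _.
    exact: lerD (lexx _) bM.
  rewrite (_ : y - z = (y - u) + (u - z)); last by rewrite addrA subrK.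
  by rewrite dotvDr -[leRHS]add0r lerD.
have Bc : compact [set b : 'rV[R]_n | pnorm 2 b <= M].
  apply: (@pnorm_bounded_compact _ _ 2 _ M) => //.
  rewrite (_ : [set b | _] = (fun b : 'rV[R]_n => pnorm 2 b) @^-1` [set r | r <= M])//.
  apply: preimage_closed; last exact: closed_le.
  by move=> b _; exact: (@cvg_pnorm _ _ _ (nbhs_filter b) _ 2 id b (ltr1n R 2) cvg_id).
pose s k := sval (bk k).
have sP k : pnorm 2 (s k) <= M /\ forall y, X y -> dotv (- (a + s k)) (y - z) <= C / k.+1%:R.
  exact: (svalP (bk k)).
have [|b [bM bcl]] := Bc (s @ \oo) _ _.
  by exists 0%N => // k _ /=; case: (sP k).
exists b => // y Xy; rewrite leNgt; apply/negP => b0.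
have c : {for b, continuous (fun b' => dotv (- (a + b')) (y - z))}.
  rewrite (_ : (fun b' => _) = fun b' => dotv (b' - - a) (- (y - z))); last first.
    by apply/funext => b'; rewrite dotvNr dotvNl opprK addrC.
  have hb := @cvg_subr_rV _ _ (nbhs_filter b) _ id b (- a) cvg_id.
  exact: (@cvg_dotv _ _ _ (nbhs_filter b) _ _ _ _ _ hb (cvg_cst _)).
have d0 : 0 < dotv (- (a + b)) (y - z) / 2 by rewrite divr_gt0.
have B : nbhs b [set b' | dotv (- (a + b)) (y - z) / 2 < dotv (- (a + b')) (y - z)].
  by apply: (cvgr_gt _ c); rewrite ltr_pdivrMr// mulr_natr mulr2n ltrDl.
have A : (s @ \oo) [set b' | dotv (- (a + b')) (y - z) <= dotv (- (a + b)) (y - z) / 2].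
  have : C / k.+1%:R @[k --> \oo] --> C * 0.
    by apply: cvgM; [exact: cvg_cst | exact: cvg_harmonic].
  rewrite mulr0 => /cvgr_le /(_ _ d0); apply: filterS => k Ck.
  by apply: le_trans Ck; have [_] := sP k; apply.
by have [b' [/= b1 /lt_le_trans /(_ b1)]] := bcl _ _ A B; rewrite ltxx.
Qed.
End ConvexSets.

(** * The proximal map behind the mirror step *)

Section Mirror.
Variables (R : realType) (n : nat) (p q eta : R) (v : 'rV[R]_n -> R)
  (X : set 'rV[R]_n) (h : 'rV[R]_n -> \bar R) (hr : 'rV[R]_n -> R) (Mh : R).
Hypotheses (p1 : 1 < p) (q1 : 1 < q) (pq : p^-1 + q^-1 = 1) (eta0 : 0 < eta).
Hypothesis v_line : forall x w (t : R),
  is_derive t 1 (fun s : R => v (x + s *: w)) (dotv (grad v (x + t *: w)) w).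
Hypothesis v_mono : forall x y,
  pnorm q (y - x) ^+ 2 <= dotv (grad v y - grad v x) (y - x).
Hypothesis v_cont : continuous v.
Hypotheses (X0 : X !=set0) (Xcomp : compact X).
Hypothesis Xconv : forall x y (t : R), X x -> X y -> 0 <= t <= 1 ->
  X (x + t *: (y - x)).
Hypothesis h_fin : forall x, X x -> h x = (hr x)%:E.
Hypothesis h_conv : forall x y (t : R), X x -> X y -> 0 <= t <= 1 ->
  hr (x + t *: (y - x)) <= hr x + t * (hr y - hr x).
Hypothesis h_lip : forall x y, X x -> X y -> hr x - hr y <= Mh * pnorm 2 (x - y).
Implicit Types (x y z w zeta g : 'rV[R]_n).

Definition prox_obj zeta y : \bar R :=
  ((dotv zeta y)%:E + h y + (eta^-1 * v y)%:E)%E.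
Definition prox zeta : 'rV[R]_n := argmin X (prox_obj zeta).

(** Up to a constant, the Bregman term adds to v(y) / eta only the linear term - <grad v(x), y> /
    eta. The iterates and the points defining the gradient mapping are therefore values of one and
    the same map of one argument. *)
Lemma mirror_stepE x g :
  mirror_step X h v eta x g = prox (g - eta^-1 *: grad v x).
Proof.
rewrite /mirror_step /prox /argmin; congr xget; apply/seteqP; split => z [Xz zmin].
  split=> // y Xy; have := zmin y Xy; rewrite /prox_obj !h_fin// -!EFinD !lee_fin.
  rewrite /bregman !dotvBl !dotvBr !dotvZl.
  move: (dotv g _) (dotv g _) (dotv (grad v x) _) (dotv (grad v x) _) (dotv (grad v x) _).
  by move: (v _) (v _) (v _) (hr _) (hr _) (eta^-1) => *; lra.
split=> // y Xy; have := zmin y Xy; rewrite /prox_obj !h_fin// -!EFinD !lee_fin.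
rewrite /bregman !dotvBl !dotvBr !dotvZl.
move: (dotv g _) (dotv g _) (dotv (grad v x) _) (dotv (grad v x) _) (dotv (grad v x) _).
by move: (v _) (v _) (v _) (hr _) (hr _) (eta^-1) => *; lra.
Qed.

Lemma prox_min zeta : X (prox zeta) /\
  forall y, X y -> dotv zeta (prox zeta) + hr (prox zeta) + eta^-1 * v (prox zeta)
    <= dotv zeta y + hr y + eta^-1 * v y.
Proof.
have [x Xx xmin] : exists2 x, x \in X & forall y, y \in X ->
    dotv zeta x + hr x + eta^-1 * v x <= dotv zeta y + hr y + eta^-1 * v y.
  apply: compact_EVT_min => //; apply/subspace_continuousP => x Xx.
  apply: cvgD.
    apply: cvgD.
      apply: cvg_dotv; first exact: cvg_cst.
      exact: cvg_within_filter cvg_id.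
    have /subspace_continuousP := lipschitz_continuous_within (ltr1n R 2) h_lip.
    exact.
  apply: cvgM; first exact: cvg_cst.
  by apply: cvg_within_filter; exact: v_cont.
(* [argmin] falls back on 0 only if there is no minimizer, which the compactness argument above
   excludes. *)
have H : [set x | X x /\ forall y, X y -> (prox_obj zeta x <= prox_obj zeta y)%E] (prox zeta).
  apply: xgetPex; exists x; rewrite inE in Xx; split=> // y Xy.
  by rewrite /prox_obj !h_fin// -!EFinD lee_fin xmin// inE.
case: H => Xp pmin; split=> // y Xy.
by have := pmin y Xy; rewrite /prox_obj !h_fin// -!EFinD lee_fin.
Qed.

Lemma prox_in zeta : X (prox zeta). Proof. by case: (prox_min zeta). Qed.

(** Minimality is used along the segment from the minimizer to [y]: convexity makes the increment of
    [hr] linear in t, and the increment of [v] is controlled by its one-sided derivative. *)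
Lemma prox_variational zeta y : X y ->
  0 <= dotv (zeta + eta^-1 *: grad v (prox zeta)) (y - prox zeta)
       + hr y - hr (prox zeta).
Proof.
have [Xz zmin] := prox_min zeta; set z := prox zeta in Xz zmin *.
move=> Xy; set w := y - z.
have H := @derive_right_ge R (fun s => v (z + s *: w)) _ (- (eta * (dotv zeta w + hr y - hr z))) (v_line z w 0).
have : - (eta * (dotv zeta w + hr y - hr z)) <= dotv (grad v (z + 0 *: w)) w.
  apply: H => t /andP[t0 t1]; have t01 : 0 <= t <= 1 by rewrite t1 ltW.
  have := zmin _ (Xconv Xz Xy t01); have := h_conv Xz Xy t01.
  rewrite scale0r addr0 dotvDr dotvZr -/w.
  move: (v _) (v _) (hr _) (hr _) (hr _) (dotv _ _) (dotv _ _) => v1 v2 h1 h2 h3 d1 d2 e1 e2.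
  have {}e2 : eta^-1 * (v2 - v1) <= t * d1 + t * (h1 - h2) by lra.
  have : v2 - v1 <= eta * (t * d1 + t * (h1 - h2)) by rewrite -ler_pdivrMl.
  lra.
rewrite scale0r addr0 dotvDl dotvZl.
move: (dotv _ _) (dotv _ _) (hr _) (hr _) => d1 d2 h1 h2.
rewrite -subr_ge0 opprK => /(mulr_ge0 (ltW (_ : 0 < eta^-1))); rewrite invr_gt0 => /(_ eta0).
by rewrite mulrDr mulrA mulVf ?gt_eqF// mul1r; lra.
Qed.

(* Also the reason why the iterates are continuous, hence measurable, functions of
   the draws. *)
Lemma prox_lipschitz zeta1 zeta2 :
  pnorm q (prox zeta1 - prox zeta2) <= eta * pnorm p (zeta1 - zeta2).
Proof.
(* Each variational inequality is tested at the other minimizer; in the sum [hr] cancels, and strong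
   monotonicity of [grad v] is set against Hoelder's inequality. *)
have H1 := prox_variational zeta1 (prox_in zeta2).
have H2 := prox_variational zeta2 (prox_in zeta1).
move: (prox zeta1) (prox zeta2) H1 H2 => z1 z2 H1 H2.
have p0 : 0 < p by exact: lt_trans p1.
have q0 : 0 < q by exact: lt_trans q1.
have H3 := v_mono z2 z1.
have H4 := ler_dotv_pnorm (zeta1 - zeta2) (z2 - z1) p0 q0 pq.
have := pnorm_ge0 q (z1 - z2); rewrite le_eqVlt => /predU1P[<-|N0].
  by rewrite mulr_ge0 ?pnorm_ge0// ltW.
rewrite -(ler_pM2r N0) -expr2 -mulrA (pnormC q z1) -ler_pdivrMl//.
apply: le_trans H4; rewrite (pnormC q z2).
apply: (@le_trans _ _ (eta^-1 * dotv (grad v z1 - grad v z2) (z1 - z2))).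
  by rewrite ler_pM2l ?invr_gt0.
have e : z1 - z2 = - (z2 - z1) by rewrite opprB.
move: H1 H2; rewrite e 2!dotvNr 2!dotvBl 2!dotvDl 2!dotvZl.
move: (dotv _ _) (dotv _ _) (dotv _ _) (dotv _ _) (hr _) (hr _) (eta^-1) => *; lra.
Qed.

(** The Lipschitz constant of [hr] is the slack in the first-order condition, and [b] takes the
    place of a subgradient of [h] at the minimizer. *)
Lemma prox_normal zeta : 0 <= Mh ->
  exists2 b, pnorm 2 b <= Mh &
    normal_cone X (prox zeta) (- (zeta + eta^-1 *: grad v (prox zeta) + b)).
Proof.
move=> Mh0; apply: normal_cone_decomposition => //; first exact: prox_in.
move=> y Xy; have := prox_variational zeta Xy; have := h_lip Xy (prox_in zeta).
by move: (dotv _ _) (hr _) (hr _) (_ * _) => *; lra.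
Qed.

End Mirror.

(** * Measurability in coordinates *)

Section Measurability.
Variable R : realType.

Lemma rV_open_measurable n (A : set 'rV[R]_n) : open A -> measurable (A : set (borelRV R n)).
Proof. exact: sub_sigma_algebra. Qed.

Lemma continuous_measurable_real n (f : 'rV[R]_n -> R) : continuous f ->
  measurable_fun [set: borelRV R n] (f : borelRV R n -> R).
Proof.
move=> fc; apply: (measurability _ (RGenOpens.measurableE R)).
move=> _ [_ [a [b ->] <-]]; rewrite setTI; apply: rV_open_measurable.
by move/continuousP : fc; apply; exact: interval_open.
Qed.

Lemma measurable_coord n (i : 'I_n) :
  measurable_fun [set: borelRV R n] (fun x : borelRV R n => (x : 'rV[R]_n) ord0 i).
Proof. by apply: continuous_measurable_real; exact: coord_continuous. Qed.

(** Cubes with rational centre and radius form a countable base. Thanks to this, measurability into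
    row vectors can be checked coordinate by coordinate. *)
Lemma rV_open_boxes n (U : set 'rV[R]_n) : open U ->
  U = \bigcup_(ce in [set ce : 'rV[rat]_n * rat |
        [set y : 'rV[R]_n | forall i, `|y ord0 i - ratr (ce.1 ord0 i)| < ratr ce.2] `<=` U])
      [set y : 'rV[R]_n | forall i, `|y ord0 i - ratr (ce.1 ord0 i)| < ratr ce.2].
Proof.
move=> Uo; apply/seteqP; split=> [x Ux|x [ce /= ceU]]; last exact: ceU.
have [e /= e0 xeU] : exists2 e : R, 0 < e & forall y : (matrix R 1 n), (forall i, `|x ord0 i - y ord0 i| < e) -> U y.
  have /nbhs_ballP[e /= e0 xe] : nbhs x U by exact: open_nbhs_nbhs.
  exists e => // y xy; apply: xe; rewrite mx_norm_ball /ball_/=.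
  rewrite [ltLHS]/Num.Def.normr/= mx_normrE; apply/bigmax_ltP; split => //.
  by move=> [i j] _ /=; rewrite ord1 !mxE.
have [r /andP[r0 re]] : exists r : rat, 0 < (ratr r : R) < e / 2.
  have /rat_in_itvoo[r] : 0 < e / 2 by rewrite divr_gt0.
  by rewrite in_itv/= => ?; exists r.
have /choice[c cx] : forall i, exists c : rat, `|x ord0 i - ratr c| < (ratr r : R).
  move=> i; have /rat_in_itvoo[c] : x ord0 i < x ord0 i + ratr r by rewrite ltrDl.
  by rewrite in_itv/= => /andP[c1 c2]; exists c; rewrite ltr_norml; apply/andP; split; lra.
exists (\row_i c i, r) => /=; last by move=> i; rewrite mxE.
move=> y yr; apply: xeU => i; have := yr i; have := cx i; rewrite mxE.
move=> h1 h2; rewrite (_ : _ - _ = (x ord0 i - ratr (c i)) - (y ord0 i - ratr (c i))); last by ring.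
by apply: le_lt_trans (ler_normB _ _) _; lra.
Qed.

Lemma measurable_rV d (T : measurableType d) n (f : T -> 'rV[R]_n) :
  (forall i, measurable_fun [set: T] (fun x => f x ord0 i)) ->
  measurable_fun [set: T] (f : T -> borelRV R n).
Proof.
move=> fm; apply: (@measurability _ _ T (borelRV R n) setT f (@open (matrix R 1 n))) => //.
move=> _ [U Uo <-]; rewrite setTI (rV_open_boxes Uo) preimage_bigcup.
rewrite bigcup_mkcond; apply: countable_bigcupT_measurable.
  exact: countableP.
move=> [c r]; case: ifPn => // _.
rewrite (_ : _ @^-1` _ = \bigcap_(i in [set: 'I_n])
   ((fun x => f x ord0 i) @^-1` [set y | `|y - ratr (c ord0 i)| < ratr r])); last first.
  by apply/seteqP; split => x /= h; [move=> i _; exact: h | move=> i; exact: h].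
apply: fin_bigcap_measurable => // i _.
rewrite -[_ @^-1` _]setTI; apply: fm => //.
rewrite (_ : [set y | _] = `](ratr (c ord0 i) - ratr r), (ratr (c ord0 i) + ratr r)[%classic).
  exact: measurable_itv.
by apply/seteqP; split => y /=; rewrite in_itv/= ltr_distl.
Qed.

Lemma continuous_measurable_rV n k (f : 'rV[R]_n -> 'rV[R]_k) : continuous f ->
  measurable_fun [set: borelRV R n] (f : borelRV R n -> borelRV R k).
Proof.
move=> fc; apply: measurable_rV => i; apply: continuous_measurable_real => x.
exact: (@cvg_comp _ _ _ f (fun y : 'rV_k => y ord0 i) _ _ _ (fc x) (@coord_continuous _ _ _ ord0 i (f x))).
Qed.

Section Operations.
Context d (T : measurableType d).
Implicit Types (n : nat) (f g : T -> R).

Lemma measurable_coord_comp n (f : T -> 'rV[R]_n) i :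
  measurable_fun [set: T] (f : T -> borelRV R n) ->
  measurable_fun [set: T] (fun x => f x ord0 i).
Proof. by move=> fm; exact: (measurableT_comp (measurable_coord i) fm). Qed.

Lemma measurable_add_rV n (f g : T -> 'rV[R]_n) :
  measurable_fun [set: T] (f : T -> borelRV R n) ->
  measurable_fun [set: T] (g : T -> borelRV R n) ->
  measurable_fun [set: T] ((fun x => f x + g x) : T -> borelRV R n).
Proof.
move=> fm gm; apply: measurable_rV => i; under eq_fun do rewrite mxE.
by apply: measurable_funD; exact: measurable_coord_comp.
Qed.

Lemma measurable_scale_rV n (a : T -> R) (f : T -> 'rV[R]_n) :
  measurable_fun [set: T] a ->
  measurable_fun [set: T] (f : T -> borelRV R n) ->
  measurable_fun [set: T] ((fun x => a x *: f x) : T -> borelRV R n).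
Proof.
move=> am fm; apply: measurable_rV => i; under eq_fun do rewrite mxE.
by apply: measurable_funM => //; exact: measurable_coord_comp.
Qed.

Lemma measurable_opp_rV n (f : T -> 'rV[R]_n) :
  measurable_fun [set: T] (f : T -> borelRV R n) ->
  measurable_fun [set: T] ((fun x => - f x) : T -> borelRV R n).
Proof.
move=> fm; under eq_fun do rewrite -scaleN1r.
exact: measurable_scale_rV.
Qed.

Lemma measurable_sub_rV n (f g : T -> 'rV[R]_n) :
  measurable_fun [set: T] (f : T -> borelRV R n) ->
  measurable_fun [set: T] (g : T -> borelRV R n) ->
  measurable_fun [set: T] ((fun x => f x - g x) : T -> borelRV R n).
Proof. by move=> fm gm; apply: measurable_add_rV => //; exact: measurable_opp_rV. Qed.

Lemma measurable_sum_rV n (I : Type) (s : seq I) (f : I -> T -> 'rV[R]_n) :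
  (forall i, measurable_fun [set: T] (f i : T -> borelRV R n)) ->
  measurable_fun [set: T] ((fun x => \sum_(i <- s) f i x) : T -> borelRV R n).
Proof.
move=> fm; elim: s => [|i s IHs].
  by under eq_fun do rewrite big_nil; exact: measurable_cst.
by under eq_fun do rewrite big_cons; exact: measurable_add_rV.
Qed.

Lemma measurable_sum_real (I : Type) (s : seq I) (f : I -> T -> R) :
  (forall i, measurable_fun [set: T] (f i)) ->
  measurable_fun [set: T] (fun x => \sum_(i <- s) f i x).
Proof.
move=> fm; elim: s => [|i s IHs].
  by under eq_fun do rewrite big_nil; exact: measurable_cst.
by under eq_fun do rewrite big_cons; exact: measurable_funD.
Qed.

Lemma measurable_dotv n (f g : T -> 'rV[R]_n) :
  measurable_fun [set: T] (f : T -> borelRV R n) ->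
  measurable_fun [set: T] (g : T -> borelRV R n) ->
  measurable_fun [set: T] (fun x => dotv (f x) (g x)).
Proof.
move=> fm gm; apply: measurable_sum_real => i.
by apply: measurable_funM; exact: measurable_coord_comp.
Qed.

Lemma measurable_pnorm n p (f : T -> 'rV[R]_n) : 1 < p ->
  measurable_fun [set: T] (f : T -> borelRV R n) ->
  measurable_fun [set: T] (fun x => pnorm p (f x)).
Proof.
move=> p1 fm.
have pm : measurable_fun [set: borelRV R n] (pnorm p : borelRV R n -> R).
  by apply: continuous_measurable_real => x; exact: (@cvg_pnorm _ _ _ (nbhs_filter x) _ _ id x p1 cvg_id).
exact: (measurableT_comp pm fm).
Qed.

End Operations.

End Measurability.

(** * Rademacher directions and two-point estimates *)

Section SignVectors.
Variables (R : realType) (n : nat).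

Definition signv (b : {ffun 'I_n -> bool}) : 'rV[R]_n := \row_i (-1) ^+ b i.

(** Stated for values in any module, so that it averages scalars and vectors alike; it is the
    expectation over a Rademacher direction. *)
Definition savg (V : lmodType R) (f : 'rV[R]_n -> V) : V :=
  (2 ^+ n)^-1 *: \sum_b f (signv b).

Lemma signv_sqr b i : signv b ord0 i ^+ 2 = 1.
Proof. by rewrite mxE sqrr_sign. Qed.

Lemma norm_signv b i : `|signv b ord0 i| = 1.
Proof. by rewrite mxE normr_sign. Qed.

Lemma card_signs : #|{ffun 'I_n -> bool}|%:R = 2 ^+ n :> R.
Proof. by rewrite card_ffun card_bool card_ord natrX. Qed.

Lemma savg_cst (V : lmodType R) (a : V) : savg (fun _ => a) = a.
Proof.
rewrite /savg sumr_const -[a *+ _]scaler_nat scalerA -card_signs mulVf ?scale1r//.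
by rewrite card_signs expf_neq0.
Qed.

Lemma savgD (V : lmodType R) (f g : 'rV[R]_n -> V) :
  savg (fun s => f s + g s) = savg f + savg g.
Proof. by rewrite /savg big_split scalerDr. Qed.

Lemma savgZ (V : lmodType R) (a : R) (f : 'rV[R]_n -> V) :
  savg (fun s => a *: f s) = a *: savg f.
Proof. by rewrite /savg -scaler_sumr !scalerA mulrC. Qed.

Lemma savg_le (f g : 'rV[R]_n -> R^o) : (forall b, f (signv b) <= g (signv b)) ->
  savg f <= savg g.
Proof.
move=> fg; rewrite /savg /GRing.scale/= ler_pM2l ?invr_gt0 ?exprn_gt0//.
by apply: ler_sum => b _; exact: fg.
Qed.

(** For i <> j, flipping the sign of coordinate i permutes the sign vectors and reverses the
    product. *)
Lemma savg_coord (i j : 'I_n) :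
  savg (fun s => s ord0 i * s ord0 j : R^o) = (i == j)%:R.
Proof.
have [->|ij] := eqVneq i j.
  rewrite (_ : (fun s => _) = fun s : 'rV[R]_n => s ord0 j ^+ 2); last by apply/funext => s; rewrite expr2.
  rewrite -[RHS](savg_cst (1 : R^o)) /savg; congr (_ *: _).
  by apply: eq_bigr => b _; exact: signv_sqr.
pose flip (b : {ffun 'I_n -> bool}) : {ffun 'I_n -> bool} := [ffun k => (k == i) (+) b k].
have flipK : involutive flip.
  by move=> b; apply/ffunP => k; rewrite !ffunE addbA addbb.
set S : R := savg _; suff : S = - S by move=> /eqP; rewrite -addr_eq0 -mulr2n mulrn_eq0 => /eqP.
rewrite /S /savg -scalerN; congr (_ *: _).
rewrite [LHS](reindex_inj (inv_inj flipK))/= -sumrN; apply: eq_bigr => b _.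
by rewrite !mxE !ffunE eqxx eq_sym (negPf ij)/= signrN mulNr.
Qed.

(** The second-moment matrix of a sign vector is the identity. This is what makes directional
    derivatives along random signs recover the gradient on average. *)
Lemma savg_dotv (g : 'rV[R]_n) : savg (fun s => dotv g s *: s) = g.
Proof.
apply/rowP => j; rewrite /savg mxE summxE.
transitivity (\sum_i g ord0 i * savg (fun s => s ord0 i * s ord0 j : R^o)).
  rewrite /savg /GRing.scale/=.
  under [RHS]eq_bigr do rewrite mulrCA mulr_sumr.
  rewrite -mulr_sumr exchange_big/=; congr (_ * _); apply: eq_bigr => b _.
  by rewrite [in LHS]mxE /dotv mulr_suml; apply: eq_bigr => i _; rewrite mulrA.
under eq_bigr do rewrite savg_coord.
rewrite (bigD1 j)//= eqxx mulr1 big1 ?addr0// => i /negPf ->; exact: mulr0.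
Qed.

Lemma savg_dotv_sqr (g : 'rV[R]_n) : savg (fun s => dotv g s ^+ 2 : R^o) = dotv g g.
Proof.
transitivity (dotv g (savg (fun s => dotv g s *: s))); last by rewrite savg_dotv.
rewrite /savg dotvZr dotv_sumr; congr (_ * _); apply: eq_bigr => b _.
by rewrite dotvZr expr2.
Qed.

Lemma pnorm_signv p b : 0 < p -> pnorm p (signv b) = n%:R `^ p^-1.
Proof.
Transparent pnorm.
move=> p0; rewrite /pnorm; under eq_bigr do rewrite norm_signv powR1.
by rewrite sumr_const card_ord.
Opaque pnorm.
Qed.

Lemma dotv_signv b : dotv (signv b) (signv b) = n%:R.
Proof.
rewrite /dotv; under eq_bigr do rewrite -expr2 signv_sqr.
by rewrite sumr_const card_ord.
Qed.

Section Law.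
Variable Pu : probability (borelRV R n) R.
Hypothesis rad : rademacher Pu.

Lemma signv_set1 b : [set signv b : borelRV R n] =
  \bigcap_(i in [set` enum 'I_n]) [set u : borelRV R n | (u : 'rV[R]_n) ord0 i = (-1) ^+ b i].
Proof.
apply/seteqP; split=> [u -> i _ /=|u uP]; first by rewrite mxE.
by apply/rowP => i; rewrite mxE; apply: uP; rewrite /= mem_enum.
Qed.

Lemma measurable_signv b : measurable [set signv b : borelRV R n].
Proof.
rewrite signv_set1; apply: fin_bigcap_measurable => // i _.
rewrite -[X in measurable X]setTI.
exact: (measurable_coord i measurableT (measurable_set1 ((-1) ^+ b i))).
Qed.

(** The singleton is the intersection of the coordinate events, so mutual independence gives a
    product of [n] factors 1/2. *)
Lemma rademacher_signv b : Pu [set signv b : borelRV R n] = ((2 ^+ n)^-1)%:E.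
Proof.
have [h1 hN1 ind] := rad; rewrite signv_set1 ind ?enum_uniq//; last first.
  move=> i _; split=> //; exists [set (-1) ^+ b i]; first exact: measurable_set1.
  by rewrite setTI.
rewrite big_enum/= (eq_bigr (fun _ => (2^-1)%:E)); last first.
  by move=> i _; case: (b i) => /=; [exact: hN1 | exact: h1].
by rewrite -[in RHS]exprVn prodEFin prodr_const card_ord.
Qed.

Lemma signv_inj : injective signv.
Proof.
move=> b b' /rowP bb; apply/ffunP => i; have := bb i; rewrite !mxE.
exact: signr_inj.
Qed.

(** The masses of the 2^n atoms add up to 1, so the complement of the set of sign vectors is null
    and [Pu] is a sum of point masses. *)
Lemma rademacherE (A : set (borelRV R n)) : measurable A ->
  Pu A = (\sum_b ((2 ^+ n)^-1)%:E * \d_(signv b : borelRV R n) A)%E.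
Proof.
move=> mA; pose S := \bigcup_(b in [set: {ffun 'I_n -> bool}]) [set signv b : borelRV R n].
have mS : measurable S.
  by apply: fin_bigcup_measurable => // b _; exact: measurable_signv.
have PS (B : set (borelRV R n)) : measurable B -> Pu (B `&` S) = (\sum_b Pu (B `&` [set signv b]))%E.
  move=> mB; rewrite /S setI_bigcupr measure_fin_bigcup//; first last.
  - by move=> b _; apply: measurableI => //; exact: measurable_signv.
  - by move=> b b' _ _ [u [[_ ->] [_ /signv_inj]]].
  - exact: finite_finset.
  rewrite (_ : [set: {ffun _}] = [set` enum {ffun 'I_n -> bool}]); last first.
    by apply/seteqP; split => // x _ /=; rewrite mem_enum.
  by rewrite -fsbig_seq ?enum_uniq// big_enum.
have S1 : Pu S = 1%E.
  rewrite -(setTI S) PS//.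
  under eq_bigr do rewrite setTI rademacher_signv.
  rewrite sumEFin; congr (_%:E).
  rewrite -[RHS](savg_cst (1 : R^o)) /savg scaler_sumr.
  by apply: eq_bigr => b _; rewrite /GRing.scale/= mulr1.
transitivity (Pu (A `&` S)).
  have SC : Pu (~` S) = 0%E by rewrite probability_setC// S1 subee.
  rewrite -{1}(setIT A) -(setUv S) setIUr measureU; first last.
  - by rewrite setIACA setICr setI0.
  - by apply: measurableI => //; exact: measurableC.
  - exact: measurableI.
  rewrite [X in (_ + X)%E](_ : _ = 0%E) ?adde0//.
  by apply: (subset_measure0 (B := ~` S)) => //; [apply: measurableI => //; exact: measurableC | exact: measurableC].
rewrite PS//; apply: eq_bigr => b _; rewrite diracE.
have [bA|bA] := boolP (signv b \in A).
  rewrite mule1 (_ : _ `&` _ = [set signv b]) ?rademacher_signv//.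
  by apply/seteqP; split => [u []//|u ->]; split=> //; rewrite inE in bA.
rewrite mule0 (_ : _ `&` _ = set0) ?measure0//.
by apply/seteqP; split => // u [/= uA ub]; move: bA; rewrite -ub mem_set.
Qed.

Lemma integral_rademacher (g : borelRV R n -> \bar R) : measurable_fun setT g ->
  (forall u, 0 <= g u)%E ->
  (\int[Pu]_u g u = \sum_b ((2 ^+ n)^-1)%:E * g (signv b))%E.
Proof.
move=> mg g0.
have w0 : 0 <= (2 ^+ n : R)^-1 by rewrite invr_ge0 exprn_ge0.
pose e := enum {ffun 'I_n -> bool}; pose b0 : {ffun 'I_n -> bool} := [ffun=> true].
pose m (k : nat) : {measure set (borelRV R n) -> \bar R} :=
  mscale (NngNum w0) (\d_(signv (nth b0 e k) : borelRV R n)).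
have sumE (F : {ffun 'I_n -> bool} -> \bar R) :
    (\sum_(k < size e) F (nth b0 e k) = \sum_b F b)%E.
  by rewrite -[RHS]big_enum/= (big_nth b0) big_mkord.
transitivity (\int[msum m (size e)]_u g u)%E.
  apply: eq_measure_integral => A mA _; apply: etrans (rademacherE mA) _.
  by rewrite -sumE.
rewrite ge0_integral_measure_sum// -sumE; apply: eq_bigr => k _.
rewrite ge0_integral_mscale// integral_dirac// diracT mul1e//.
Qed.

(** Each sign vector is an atom, hence a point of the support; so the smoothing region contains
    every point at which the two-point estimates evaluate [F]. *)
Lemma range_of_signv b : range_of Pu (signv b).
Proof.
move=> V Vo Vb; apply: (@lt_le_trans _ _ (Pu [set signv b : borelRV R n])).
  by rewrite rademacher_signv lte_fin invr_gt0 exprn_gt0.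
apply: le_measure; rewrite ?inE; [exact: measurable_signv|exact: rV_open_measurable|].
by move=> u ->.
Qed.

Lemma Enorm6_rademacher : Enorm6 Pu = n%:R ^+ 3.
Proof.
rewrite /Enorm6 unlock.
rewrite integral_rademacher; first last.
- by move=> u; rewrite lee_fin exprn_ge0// pnorm_ge0.
- apply/measurable_EFinP; apply: measurable_funX; apply: measurable_pnorm; first by rewrite ltr1n.
  exact: measurable_id.
rewrite (eq_bigr (fun _ => ((2 ^+ n)^-1 * n%:R ^+ 3)%:E)); last first.
  move=> b _; rewrite -EFinM; congr (_ * _)%:E.
  by rewrite -[6%N]/(2 * 3)%N exprM pnorm2E dotv_signv.
rewrite sumEFin/= -[RHS](savg_cst (n%:R ^+ 3 : R^o)) /savg scaler_sumr.
by apply: eq_bigr.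
Qed.

End Law.
End SignVectors.

(** * Riemann sums *)

Section RiemannSums.
Variable R : realType.

(** By compactness: a sequence of counterexamples has a cluster point in the segment, where [f]
    would fail to be continuous. The bound 1 / (k + 1) is the mesh of the Riemann sums below. *)
Lemma segment_uniform_continuity (f : R -> R) (e : R) : continuous f -> 0 < e ->
  exists k0 : nat, forall (k : nat) (s t : R), (k0 <= k)%N -> 0 <= s <= 1 ->
    `|s - t| <= k.+1%:R^-1 -> `|f s - f t| <= e.
Proof.
move=> fc e0; apply/not_existsP => H.
have /choice[st stP] : forall k0, exists kst : nat * (R * R), [/\ (k0 <= kst.1)%N,
    0 <= kst.2.1 <= 1, `|kst.2.1 - kst.2.2| <= kst.1.+1%:R^-1 & e < `|f kst.2.1 - f kst.2.2| ].
  move=> k0; have := H k0; apply: contra_notP => H' k s t k0k s01 st.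
  rewrite leNgt; apply/negP => fst; apply: H'; by exists (k, (s, t)).
pose s k := (st k).2.1.
have [|a [a01 acl]] := @segment_compact R 0 1 (s @ \oo) _.
  by exists 0%N => // k _ /=; rewrite in_itv/=; have [] := stP k.
have /cvgrPdist_lt/(_ (e / 2)) := fc a; rewrite divr_gt0// => /(_ isT).
move=> /nbhs_ballP[r /= r0 ra].
have r2 : 0 < r / 2 by rewrite divr_gt0.
have A : (s @ \oo) [set y | exists2 k, s k = y & (st k).1.+1%:R^-1 < r / 2].
  have /cvgrPdist_lt/(_ _ r2)[k0 _ hk0] := @cvg_harmonic R.
  exists k0 => // k k0k /=; exists k => //.
  have [kk _ _ _] := stP k.
  have := hk0 k k0k; rewrite sub0r normrN ger0_norm ?invr_ge0// => h.
  apply: le_lt_trans h; rewrite lef_pV2 ?posrE// ler_nat ltnS//.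
have [y [[k <- kr]]] := acl _ _ A (nbhsx_ballx a (r / 2) r2).
rewrite /ball/= => ask; have [_ _ stk] := stP k; rewrite ltNge => /negP; apply.
have h1 : `|f a - f (s k)| < e / 2.
  by apply: ra; rewrite /ball/=; apply: lt_trans ask _; rewrite ltr_pdivrMr// mulr_natr mulr2n ltrDl.
have h2 : `|f a - f (st k).2.2| < e / 2.
  apply: ra; rewrite /ball/= (_ : a - _ = (a - s k) + ((st k).2.1 - (st k).2.2)); last by rewrite /s; ring.
  apply: le_lt_trans (ler_normD _ _) _; move: (le_lt_trans stk kr) ask.
  by move: `|_| `|_| => *; lra.
rewrite -/(s k) (_ : f (s k) - _ = (f a - f (st k).2.2) - (f a - f (s k))); last by ring.
by apply: le_trans (ler_normB _ _) _; move: h1 h2; move: `|_| `|_| => *; lra.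
Qed.

(** f 1 - f 0 is telescoped over the cells; on each cell the mean value theorem gives a value of
    [df] at distance at most one mesh from the left endpoint. *)
Lemma riemann_sum_cvg (f df : R -> R) :
  (forall t : R, is_derive t 1 f (df t)) -> continuous df ->
  k.+1%:R^-1 * \sum_(i < k.+1) df (i%:R / k.+1%:R) @[k --> \oo] --> f 1 - f 0.
Proof.
move=> fdf dfc; apply/cvgrPdist_le => e e0.
have [k0 hk0] := segment_uniform_continuity dfc e0.
exists k0 => // k k0k /=; have k1 : (0 : R) < k.+1%:R by [].
have mvt (i : 'I_k.+1) : exists2 c : R, `|i%:R / k.+1%:R - c| <= k.+1%:R^-1 &
    f (i.+1%:R / k.+1%:R) - f (i%:R / k.+1%:R) = df c / k.+1%:R.
  have le : i%:R / k.+1%:R <= i.+1%:R / k.+1%:R :> R by rewrite ler_pM2r ?invr_gt0// ler_nat.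
  have [|c] := @MVT_segment R f df _ _ le (fun x _ => fdf x).
    by apply: derivable_within_continuous => x _; exact: (@ex_derive _ _ _ _ _ _ _ (fdf x)).
  rewrite in_itv/= => /andP[c1 c2] ->; exists c.
    rewrite distrC ger0_norm ?subr_ge0// lerBlDr (le_trans c2)//.
    by rewrite -[i.+1]add1n natrD mulrDl mul1r.
  by rewrite -mulrBl -natrB// subSnn mul1r.
have -> : f 1 - f 0 = \sum_(i < k.+1) (f (i.+1%:R / k.+1%:R) - f (i%:R / k.+1%:R)).
  rewrite -(big_mkord xpredT (fun i => f (i.+1%:R / k.+1%:R) - f (i%:R / k.+1%:R))).
  by rewrite telescope_sumr// mul0r mulfV ?gt_eqF.
rewrite mulr_sumr -sumrB; apply: le_trans (ler_norm_sum _ _ _) _.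
rewrite [leRHS](_ : _ = \sum_(i < k.+1) e / k.+1%:R); last first.
  by rewrite sumr_const card_ord -[_ *+ _]mulr_natr divfK ?gt_eqF.
apply: ler_sum => i _; have [c ci ->] := mvt i.
rewrite [_^-1 * _]mulrC -mulrBl normrM (@ger0_norm _ k.+1%:R^-1) ?invr_ge0//.
rewrite ler_pM2r ?invr_gt0// distrC; apply: (hk0 k) => //.
by rewrite divr_ge0//= ler_pdivrMr// mul1r ler_nat ltnW.
Qed.

End RiemannSums.

Opaque dotv grad.

(** * A mean-squared first-order Taylor bound *)

Section StochasticTaylor.
Variables (R : realType) (n : nat) (dxi : measure_display) (Xi : measurableType dxi)
  (Pxi : probability Xi R) (F : 'rV[R]_n -> Xi -> R) (O : set 'rV[R]_n) (Lf : R).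
Let gF (x : 'rV[R]_n) (xi : Xi) : 'rV[R]_n := grad (F ^~ xi) x.
Hypothesis Lf0 : 0 <= Lf.
Hypothesis Fm : forall x, measurable_fun [set: Xi] (F x).
Hypothesis FC1 : {ae Pxi, forall xi, C1 (F ^~ xi)}.
Hypothesis gFm : forall x, O x -> measurable_fun [set: Xi] (gF x : Xi -> borelRV R n).
Hypothesis gFlip : forall x y, O x -> O y ->
  (\int[Pxi]_xi (pnorm 2 (gF x xi - gF y xi) ^+ 2)%:E
     <= (Lf ^+ 2 * pnorm 2 (x - y) ^+ 2)%:E)%E.

Lemma half_conj : (2 : R)^-1 + 2^-1 = 1.
Proof. by field. Qed.

Lemma sqr_dotv_le k (a b : 'rV[R]_k) : dotv a b ^+ 2 <= dotv b b * pnorm 2 a ^+ 2.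
Proof.
rewrite mulrC -(pnorm2E b).
rewrite -exprMn -real_normK ?num_real// lerXn2r// ?nnegrE ?mulr_ge0 ?pnorm_ge0//.
exact: ler_norm_dotv half_conj.
Qed.

(** Jensen's inequality for the square, as nonnegativity of the empirical variance. *)
Lemma sqr_sum_le (N : nat) (a : 'I_N.+1 -> R) :
  (N.+1%:R^-1 * \sum_i a i) ^+ 2 <= N.+1%:R^-1 * \sum_i a i ^+ 2.
Proof.
set m := N.+1%:R^-1 * \sum_i a i; have N0 : (0 : R) < N.+1%:R^-1 by rewrite invr_gt0.
have : 0 <= N.+1%:R^-1 * \sum_i (a i - m) ^+ 2.
  by rewrite mulr_ge0 ?(ltW N0)// sumr_ge0// => i _; exact: sqr_ge0.
have -> : \sum_i (a i - m) ^+ 2 = \sum_i a i ^+ 2 - (2 * m) * \sum_i a i + N.+1%:R * m ^+ 2.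
  rewrite mulr_sumr -sumrB (_ : N.+1%:R * m ^+ 2 = \sum_(i < N.+1) m ^+ 2).
    by rewrite -big_split/=; apply: eq_bigr => i _; ring.
  by rewrite sumr_const card_ord mulr_natl.
have -> : \sum_i a i = N.+1%:R * m by rewrite /m mulrA mulfV ?mul1r.
rewrite mulrDr mulrBr (_ : _^-1 * (2 * m * (_ * m)) = 2 * m ^+ 2); last by field; rewrite addrC natr1.
rewrite (_ : _^-1 * (_ * m ^+ 2) = m ^+ 2); last by field; rewrite addrC natr1.
by move: (_ * \sum_i _) (m ^+ 2) => A B; lra.
Qed.

Lemma ge0_le_integral_real (f g : Xi -> R) :
  measurable_fun setT f -> measurable_fun setT g -> (forall x, 0 <= f x <= g x) ->
  (\int[Pxi]_x (f x)%:E <= \int[Pxi]_x (g x)%:E)%E.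
Proof.
move=> mf mg fg; apply: ge0_le_integral => //.
- by move=> x _; rewrite lee_fin; case/andP: (fg x).
- exact/measurable_EFinP.
- exact/measurable_EFinP.
- by move=> x _; rewrite lee_fin; case/andP: (fg x).
Qed.

(* The remainder is an almost sure limit of Riemann sums of increments of the
   gradient, to which Fatou's lemma and the mean-squared Lipschitz condition apply. *)
Lemma stochastic_taylor x w : (forall t : R, 0 <= t <= 1 -> O (x + t *: w)) ->
  (\int[Pxi]_xi ((F (x + w) xi - F x xi - dotv (gF x xi) w) ^+ 2)%:E
     <= (Lf ^+ 2 * dotv w w ^+ 2)%:E)%E.
Proof.
move=> segO.
have Ox : O x by have := segO 0; rewrite scale0r addr0; apply; rewrite lexx ler01.
pose xk (k i : nat) : 'rV[R]_n := x + (i%:R / k.+1%:R) *: w.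
have xkO k (i : 'I_k.+1) : O (xk k i).
  by apply: segO; rewrite divr_ge0//= ler_pdivrMr// mul1r ler_nat ltnW.
pose T k xi := k.+1%:R^-1 * \sum_(i < k.+1) dotv (gF (xk k i) xi - gF x xi) w.
have mT k : measurable_fun setT (T k).
  apply: measurable_funM => //; apply: measurable_sum_real => i.
  apply: measurable_dotv => //; apply: measurable_sub_rV; exact: gFm.
have mr : measurable_fun setT (fun xi => F (x + w) xi - F x xi - dotv (gF x xi) w).
  apply: measurable_funB; last by apply: measurable_dotv => //; exact: gFm.
  by apply: measurable_funB.
have Tb k : (\int[Pxi]_xi (T k xi ^+ 2)%:E <= (Lf ^+ 2 * dotv w w ^+ 2)%:E)%E.
  have mi (i : 'I_k.+1) : measurable_fun setT (fun xi => pnorm 2 (gF (xk k i) xi - gF x xi) ^+ 2).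
    apply: measurable_funX; apply: measurable_pnorm; first by rewrite ltr1n.
    by apply: measurable_sub_rV; exact: gFm.
  apply: (@le_trans _ _ (\int[Pxi]_xi (\sum_(i < k.+1)
      (k.+1%:R^-1 * dotv w w)%:E * (pnorm 2 (gF (xk k i) xi - gF x xi) ^+ 2)%:E))%E).
    under [leRHS]eq_integral do (under eq_bigr do rewrite -EFinM; rewrite sumEFin).
    apply: ge0_le_integral_real.
    - exact: measurable_funX.
    - by apply: measurable_sum_real => i; apply: measurable_funM.
    - move=> xi; rewrite sqr_ge0/=; apply: le_trans (sqr_sum_le _) _.
      rewrite mulr_sumr; apply: ler_sum => i _; rewrite -mulrA ler_pM2l ?invr_gt0//.
      exact: sqr_dotv_le.
  have c0 : 0 <= k.+1%:R^-1 * dotv w w by rewrite mulr_ge0// dotv_ge0.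
  rewrite ge0_integral_sum//; first last.
  - by move=> i xi _; rewrite -EFinM lee_fin mulr_ge0// sqr_ge0.
  - by move=> i; apply: measurable_funeM; exact/measurable_EFinP.
  apply: (@le_trans _ _ (\sum_(i < k.+1) (k.+1%:R^-1 * (Lf ^+ 2 * dotv w w ^+ 2))%:E)%E); last first.
    by rewrite sumEFin sumr_const card_ord -[X in X%:E]mulr_natl mulrA mulfV// mul1r.
  apply: lee_sum => i _; rewrite ge0_integralZl//; first last.
  - by move=> xi _; rewrite lee_fin sqr_ge0.
  - exact/measurable_EFinP.
  have := gFlip (xkO k i) Ox.
  move=> /(lee_wpmul2l (_ : 0 <= (k.+1%:R^-1 * dotv w w)%:E)%E); rewrite lee_fin c0 => /(_ isT).
  move=> /le_trans; apply; rewrite -EFinM lee_fin.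
  rewrite /xk addrAC subrr add0r pnormZ// exprMn pnorm2E.
  have i1 : `|i%:R / k.+1%:R| ^+ 2 <= 1 :> R.
    rewrite ger0_norm ?divr_ge0// expr_le1 ?divr_ge0// ler_pdivrMr// mul1r ler_nat ltnW//.
  have := dotv_ge0 w; move: (dotv w w) => D D0.
  rewrite -mulrA ler_pM2l ?invr_gt0// mulrCA ler_wpM2l ?sqr_ge0// expr2.
  by rewrite mulrCA ler_piMl// mulr_ge0.
(* Fatou's lemma bounds the integral of the lower limit, which is defined for every sample. It
   equals the squared remainder whenever [F] is continuously differentiable in its first argument,
   that is, almost surely. *)
apply: (@le_trans _ _ (\int[Pxi]_xi limn_einf (fun k => (T k xi ^+ 2)%:E))%E); last first.
  apply: le_trans (fatou _ _ _ _) _ => //.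
  - by move=> k; apply/measurable_EFinP; exact: measurable_funX.
  - by move=> k xi _; rewrite lee_fin sqr_ge0.
  rewrite limn_einf_lim; apply: lime_le; first exact: is_cvg_einfs.
  apply: nearW => k; apply: le_trans (Tb k); apply: ereal_inf_lbound.
  by exists k => //=.
apply: ae_ge0_le_integral => //.
- by move=> xi _; rewrite lee_fin sqr_ge0.
- by apply/measurable_EFinP; exact: measurable_funX.
- move=> xi _; rewrite limn_einf_lim; apply: lime_ge; first exact: is_cvg_einfs.
  apply: nearW => k; apply: le_ereal_inf_tmp => _ [j _ <-].
  by rewrite lee_fin sqr_ge0.
- rewrite /limn_einf; apply: measurableT_comp => //; apply: measurable_fun_limn_esup => k.
  by apply: measurableT_comp => //; apply/measurable_EFinP; exact: measurable_funX.
move: FC1; apply: filterS => xi [Fd Fc] _.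
have h : T k xi @[k --> \oo] --> F (x + w) xi - F x xi - dotv (gF x xi) w.
  have := @riemann_sum_cvg R (fun t => F (x + t *: w) xi) (fun t => dotv (gF (x + t *: w) xi) w).
  rewrite scale1r scale0r addr0 => rs.
  have TE k : T k xi = k.+1%:R^-1 * \sum_(i < k.+1) dotv (gF (xk k i) xi) w - dotv (gF x xi) w.
    rewrite /T; under eq_bigr do rewrite dotvBl.
    rewrite sumrB [X in _ * (_ - X)](_ : _ = k.+1%:R * dotv (gF x xi) w).
      by rewrite mulrBr [_^-1 * (_ * dotv _ _)]mulrA mulVf ?mul1r.
    by rewrite sumr_const card_ord mulr_natl.
  rewrite (_ : T ^~ xi = fun k => k.+1%:R^-1 * \sum_(i < k.+1) dotv (gF (xk k i) xi) w - dotv (gF x xi) w); last first.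
    by apply/funext => k; exact: TE.
  apply: cvgB; last exact: cvg_cst.
  apply: rs => [t|t]; first exact: is_derive_line.
  apply: (@cvg_dotv _ _ _ (nbhs_filter t)); last exact: cvg_cst.
  apply: (@cvg_comp _ _ _ (fun t => x + t *: w) (gF ^~ xi)); last exact: Fc.
  have d : differentiable (fun t : R => x + t *: w) t.
    by apply: differentiableD => //; exact: differentiable_scalel.
  exact: (differentiable_continuous d).
have h2 : (T k xi ^+ 2)%:E @[k --> \oo] --> ((F (x + w) xi - F x xi - dotv (gF x xi) w) ^+ 2)%:E.
  by apply: cvg_EFin; [exact: nearW | under eq_fun do rewrite /= expr2; rewrite expr2; exact: cvgM].
by have [-> _] := cvg_limn_einf_sup h2.
Qed.

End StochasticTaylor.

Section RealIntegrals.
Context (R : realType) d (T : measurableType d) (P : {measure set T -> \bar R}).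

Lemma ge0_integralZ_real (a : R) (f : T -> R) : 0 <= a -> measurable_fun setT f ->
  (forall x, 0 <= f x) -> (\int[P]_x (a * f x)%:E = a%:E * \int[P]_x (f x)%:E)%E.
Proof.
move=> a0 mf f0; under eq_integral do rewrite EFinM.
by apply: ge0_integralZl => //; [exact/measurable_EFinP | move=> x _; rewrite lee_fin].
Qed.

Lemma ge0_integralD_real (f g : T -> R) : measurable_fun setT f -> measurable_fun setT g ->
  (forall x, 0 <= f x) -> (forall x, 0 <= g x) ->
  (\int[P]_x (f x + g x)%:E = \int[P]_x (f x)%:E + \int[P]_x (g x)%:E)%E.
Proof.
move=> mf mg f0 g0; under eq_integral do rewrite EFinD.
apply: ge0_integralD => //; try exact/measurable_EFinP; by move=> x _; rewrite lee_fin.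
Qed.

Lemma ge0_integral_real (f : T -> R) : (forall x, 0 <= f x) -> (0 <= \int[P]_x (f x)%:E)%E.
Proof. by move=> f0; apply: integral_ge0 => x _; rewrite lee_fin. Qed.

End RealIntegrals.

(** * Joint averages over a sign vector and a sample *)

Section SignAverages.
Variables (R : realType) (n : nat) (dxi : measure_display) (Xi : measurableType dxi)
  (Pxi : probability Xi R).
Implicit Types phi psi : 'rV[R]_n -> Xi -> R.

(** Expectation over an independent pair of a sign vector and a sample. The finite sum stays outside
    the integral, so that measurability in the sample is asked for one sign vector at a time
    ([smeas]). *)
Definition eavg phi : \bar R :=
  (\sum_(b : {ffun 'I_n -> bool}) ((2 ^+ n)^-1)%:E * \int[Pxi]_xi (phi (signv R b) xi)%:E)%E.

Definition smeas phi := forall b, measurable_fun [set: Xi] (phi (signv R b)).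

Lemma sw_ge0 : (0 <= ((2 ^+ n)^-1 : R)%:E)%E.
Proof. by rewrite lee_fin invr_ge0 exprn_ge0. Qed.

Lemma eavg_le phi psi : smeas phi -> smeas psi ->
  (forall b xi, 0 <= phi (signv R b) xi <= psi (signv R b) xi) -> (eavg phi <= eavg psi)%E.
Proof.
move=> mphi mpsi le; apply: lee_sum => b _; apply: lee_wpmul2l sw_ge0 _ _ _.
exact: ge0_le_integral_real.
Qed.

Lemma eavg_ge0 phi : (forall b xi, 0 <= phi (signv R b) xi) -> (0 <= eavg phi)%E.
Proof.
move=> phi0; apply: sume_ge0 => b _; apply: mule_ge0 sw_ge0 _.
by apply: integral_ge0 => xi _; rewrite lee_fin.
Qed.

Lemma eavgE phi : smeas phi -> (forall b xi, 0 <= phi (signv R b) xi) ->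
  eavg phi = (\int[Pxi]_xi (savg (fun s => phi s xi : R^o))%:E)%E.
Proof.
move=> mphi phi0.
under eq_integral do rewrite /savg scaler_sumr -sumEFin.
rewrite ge0_integral_sum//; first last.
- by move=> b xi _; rewrite lee_fin mulr_ge0// invr_ge0 exprn_ge0.
- move=> b; apply/measurable_EFinP; apply: measurable_funM => //; exact: mphi.
by apply: eq_bigr => b _; rewrite ge0_integralZ_real.
Qed.

Lemma eavg_add phi psi : smeas phi -> smeas psi ->
  (forall b xi, 0 <= phi (signv R b) xi) -> (forall b xi, 0 <= psi (signv R b) xi) ->
  eavg (fun s xi => phi s xi + psi s xi) = (eavg phi + eavg psi)%E.
Proof.
move=> mphi mpsi phi0 psi0; rewrite /eavg -big_split/=; apply: eq_bigr => b _.
rewrite ge0_integralD_real//.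
by rewrite ge0_muleDr// ge0_integral_real.
Qed.

Lemma eavg_scale (a : R) phi : 0 <= a -> smeas phi ->
  (forall b xi, 0 <= phi (signv R b) xi) ->
  eavg (fun s xi => a * phi s xi) = (a%:E * eavg phi)%E.
Proof.
move=> a0 mphi phi0; rewrite /eavg ge0_sume_distrr; last first.
  by move=> b _; apply: mule_ge0 sw_ge0 _; apply: integral_ge0 => xi _; rewrite lee_fin.
apply: eq_bigr => b _; rewrite ge0_integralZ_real//.
by rewrite muleCA.
Qed.

Lemma eavg_le_cst phi (c : R) :
  (forall b, \int[Pxi]_xi (phi (signv R b) xi)%:E <= c%:E)%E -> (eavg phi <= c%:E)%E.
Proof.
move=> le; apply: (@le_trans _ _ (\sum_(b : {ffun 'I_n -> bool}) ((2 ^+ n)^-1)%:E * c%:E)%E).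
  by apply: lee_sum => b _; apply: lee_wpmul2l sw_ge0 _ _ _; exact: le.
rewrite le_eqVlt; apply/orP; left; apply/eqP.
rewrite -[in RHS](savg_cst n (c : R^o)) /savg scaler_sumr -sumEFin.
by apply: eq_bigr.
Qed.

Lemma smeasD phi psi : smeas phi -> smeas psi -> smeas (fun s xi => phi s xi + psi s xi).
Proof. by move=> mphi mpsi b; exact: measurable_funD. Qed.

Lemma smeasZ (a : R) phi : smeas phi -> smeas (fun s xi => a * phi s xi).
Proof. by move=> mphi b; exact: measurable_funM. Qed.

Lemma smeasX k phi : smeas phi -> smeas (fun s xi => phi s xi ^+ k).
Proof. by move=> mphi b; exact: measurable_funX. Qed.

End SignAverages.
Arguments eavg {R n dxi Xi} Pxi phi%_R.

Section SmoothAverage.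
Variables (R : realType) (n : nat) (dxi : measure_display) (Xi : measurableType dxi)
  (Pxi : probability Xi R) (r : R).
Hypotheses (n0 : (0 < n)%N) (r2 : 2 <= r).
Variables (Z : 'rV[R]_n -> Xi -> 'rV[R]_n) (W : R).
Hypothesis Zm : forall b, measurable_fun [set: Xi] (Z (signv R b) : Xi -> borelRV R n).
Hypothesis Zint : forall g b,
  Pxi.-integrable setT (EFin \o (fun xi => dotv g (Z (signv R b) xi))).
Hypothesis Zmean : forall g,
  (\sum_(b : {ffun 'I_n -> bool}) ((2 ^+ n)^-1)%:E
     * \int[Pxi]_xi (dotv g (Z (signv R b) xi))%:E = 0)%E.
Hypothesis ZW : (eavg Pxi (fun s xi => pnorm r (Z s xi) ^+ 2)%R <= W%:E)%E.

Let r1 : 1 < r.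
Proof. by apply: lt_le_trans r2; rewrite ltr1n. Qed.

(** [Nd_smooth] is integrated with base point [a]: the linear term vanishes because [Z] is centred,
    which leaves Nd(a) + (r - 1) W. Letting the smoothing tend to 0 then replaces Nd(a) by
    |a|_r^2. *)
Lemma pnorm_smooth_avg a :
  (eavg Pxi (fun s xi => pnorm r (a + Z s xi) ^+ 2)%R <= (pnorm r a ^+ 2 + (r - 1) * W)%:E)%E.
Proof.
have r0 : 0 < r by exact: lt_trans r1.
have w0 : 0 < (2 ^+ n : R)^-1 by rewrite invr_gt0 exprn_gt0.
have mZ b : measurable_fun [set: Xi] (fun xi => pnorm r (Z (signv R b) xi) ^+ 2).
  by apply: measurable_funX; exact: measurable_pnorm r1 (Zm b).
(* Every sign vector has positive weight, so the finite joint moment [ZW] makes each individual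
   moment finite. *)
have Z2 b : Pxi.-integrable setT (EFin \o (fun xi => pnorm r (Z (signv R b) xi) ^+ 2)).
  apply/integrableP; split; first exact/measurable_EFinP.
  rewrite (eq_integral (fun xi => (pnorm r (Z (signv R b) xi) ^+ 2)%:E)); last first.
    by move=> xi _ /=; rewrite ger0_norm ?sqr_ge0.
  have : (((2 ^+ n)^-1)%:E * \int[Pxi]_xi (pnorm r (Z (signv R b) xi) ^+ 2)%:E <= W%:E)%E.
    apply: le_trans ZW; rewrite /eavg (bigD1 b)//= leeDl// sume_ge0// => b' _.
    by apply: mule_ge0 (sw_ge0 _ _) _; apply: ge0_integral_real => xi; exact: sqr_ge0.
  have : (0 <= \int[Pxi]_xi (pnorm r (Z (signv R b) xi) ^+ 2)%:E)%E.
    by apply: ge0_integral_real => xi; exact: sqr_ge0.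
  case: (\int[Pxi]_xi _)%E => [x _ _|_|//]; first exact: ltry.
  by rewrite gt0_muley ?lte_fin.
have key (dl : R) : 0 < dl ->
    (eavg Pxi (fun s xi => pnorm r (a + Z s xi) ^+ 2)%R <= (Nd r dl a + (r - 1) * W)%:E)%E.
  move=> dl0; set g := 2 *: gradNd r dl a.
  have pw b xi : pnorm r (a + Z (signv R b) xi) ^+ 2
      <= Nd r dl a + dotv g (Z (signv R b) xi) + (r - 1) * pnorm r (Z (signv R b) xi) ^+ 2.
    by rewrite /g dotvZl; exact: Nd_smooth dl0 a _ n0 r2.
  have Ib b : (\int[Pxi]_xi (pnorm r (a + Z (signv R b) xi) ^+ 2)%:E
      <= (Nd r dl a)%:E + \int[Pxi]_xi (dotv g (Z (signv R b) xi))%:E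
         + (r - 1)%:E * \int[Pxi]_xi (pnorm r (Z (signv R b) xi) ^+ 2)%:E)%E.
    apply: (@le_trans _ _ (\int[Pxi]_xi (Nd r dl a + dotv g (Z (signv R b) xi)
         + (r - 1) * pnorm r (Z (signv R b) xi) ^+ 2)%:E)%E).
      apply: ge0_le_integral_real.
      - apply: measurable_funX; apply: (measurable_pnorm r1).
        by apply: measurable_add_rV; [exact: measurable_cst | exact: Zm].
      - apply: measurable_funD; last by apply: measurable_funM.
        apply: measurable_funD => //; apply: measurable_dotv; [exact: measurable_cst | exact: Zm].
      - by move=> xi; rewrite sqr_ge0 pw.
    have i1 : Pxi.-integrable setT (EFin \o (fun=> Nd r dl a) : Xi -> \bar R).
      exact: finite_measure_integrable_cst.
    have i3 : Pxi.-integrable setT (fun xi => (r - 1)%:E * (pnorm r (Z (signv R b) xi) ^+ 2)%:E)%E.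
      apply: integrableZl => //; exact: Z2.
    under eq_integral do rewrite EFinD EFinM EFinD.
    have i2 : Pxi.-integrable setT (fun xi => (dotv g (Z (signv R b) xi))%:E) by exact: Zint.
    have i4 : Pxi.-integrable setT (fun xi => (Nd r dl a)%:E + (dotv g (Z (signv R b) xi))%:E)%E.
      exact: (integrableD measurableT i1 i2).
    rewrite (integralD measurableT i4 i3) (integralD measurableT i1 i2).
    rewrite (integralZl measurableT (Z2 b)).
    by have := expectation_cst Pxi (Nd r dl a); rewrite unlock => ->.
  apply: (@le_trans _ _ (\sum_(b : {ffun 'I_n -> bool}) (((2 ^+ n)^-1)%:E * (Nd r dl a)%:E
    + ((2 ^+ n)^-1)%:E * \int[Pxi]_xi (dotv g (Z (signv R b) xi))%:E
    + ((2 ^+ n)^-1)%:E * ((r - 1)%:E * \int[Pxi]_xi (pnorm r (Z (signv R b) xi) ^+ 2)%:E)))%E).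
    apply: lee_sum => b _.
    apply: le_trans (lee_wpmul2l (sw_ge0 _ _) (Ib b)) _.
    have f1 : (\int[Pxi]_xi (dotv g (Z (signv R b) xi))%:E)%E \is a fin_num.
      exact: (integrable_fin_num measurableT (Zint g b)).
    have f2 : (\int[Pxi]_xi (pnorm r (Z (signv R b) xi) ^+ 2)%:E)%E \is a fin_num.
      exact: (integrable_fin_num measurableT (Z2 b)).
    move: f1 f2; case: (\int[Pxi]_xi _)%E => [y| |]// _; case: (\int[Pxi]_xi _)%E => [z| |]// _.
    by rewrite le_eqVlt -?(EFinM, EFinD) eqe; apply/orP; left; apply/eqP; ring.
  rewrite !big_split/= Zmean adde0 [leRHS]EFinD; apply: leeD.
    rewrite -[X in (_ <= X%:E)%E](savg_cst n (_ : R^o)) /savg scaler_sumr -sumEFin.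
    by [].
  apply: (@le_trans _ _ ((r - 1)%:E * eavg Pxi (fun s xi => pnorm r (Z s xi) ^+ 2)%R)%E).
    rewrite /eavg ge0_sume_distrr; last first.
      move=> b _; apply: mule_ge0 (sw_ge0 _ _) _; apply: ge0_integral_real => xi; exact: sqr_ge0.
    by apply: lee_sum => b _; rewrite muleCA.
  rewrite EFinM; apply: lee_wpmul2l ZW; rewrite lee_fin subr_ge0; exact: ltW.
apply/lee_addgt0Pr => e e0; set k := n%:R `^ r^-1.
(* For dl <= 1 one has (|a|_r + dl k)^2 <= |a|_r^2 + dl T, and dl = e / (e + T) ensures both dl <= 1
   and dl T <= e. The summand 1 makes T positive. *)
pose T := 2 * pnorm r a * k + k ^+ 2 + 1.
have k0 : 0 <= k by exact: powR_ge0.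
have T0 : 0 < T by rewrite ltr_pwDr// addr_ge0 ?sqr_ge0// !mulr_ge0// pnorm_ge0.
have eT : 0 < e + T by exact: addr_gt0.
have d0 : 0 < e / (e + T) by exact: divr_gt0.
apply: le_trans (key _ d0) _; rewrite -EFinD lee_fin.
have := Nd_ub d0 a r1; rewrite -/k; set dl := e / (e + T) => ub.
have dl1 : dl <= 1 by rewrite ler_pdivrMr// mul1r lerDl ltW.
have dlT : dl * T <= e by rewrite /dl mulrAC ler_pdivrMr// ler_pM2l// lerDr ltW.
have : (pnorm r a + dl * k) ^+ 2 <= pnorm r a ^+ 2 + dl * T.
  rewrite -subr_ge0 (_ : _ - _ = dl * (1 - dl) * k ^+ 2 + dl); last by rewrite /T; ring.
  by rewrite addr_ge0 ?(ltW d0)// mulr_ge0 ?sqr_ge0// mulr_ge0 ?(ltW d0)// subr_ge0.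
by move: ub dlT; move: (Nd _ _ _) ((_ + _) ^+ 2) (pnorm r a ^+ 2) (_ * W) (dl * T) => *; lra.
Qed.

End SmoothAverage.

(** * Moments of the two-point estimate *)

Section ZerothOrderMoments.
Variables (R : realType) (n : nat) (dxi : measure_display) (Xi : measurableType dxi)
  (Pxi : probability Xi R) (F : 'rV[R]_n -> Xi -> R) (f : 'rV[R]_n -> R)
  (O : set 'rV[R]_n) (Lf Mf sigma nu : R).
Let gF (x : 'rV[R]_n) (xi : Xi) : 'rV[R]_n := grad (F ^~ xi) x.
Hypotheses (Lf0 : 0 <= Lf) (Mf0 : 0 <= Mf) (sigma0 : 0 <= sigma) (nu0 : 0 < nu).
Hypothesis Fint : forall x, Pxi.-integrable setT (EFin \o F x).
Hypothesis Fmean : forall x, (\int[Pxi]_xi (F x xi)%:E = (f x)%:E)%E.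
Hypothesis fdiff : forall x, differentiable f x.
Hypothesis flip : forall x y, O x -> O y ->
  pnorm 2 (grad f x - grad f y) <= Lf * pnorm 2 (x - y).
Hypothesis fM : forall x, O x -> pnorm 2 (grad f x) <= Mf.
Hypothesis FC1 : {ae Pxi, forall xi, C1 (F ^~ xi)}.
Hypothesis gFm : forall x, O x -> measurable_fun [set: Xi] (gF x : Xi -> borelRV R n).
Hypothesis gFvar : forall x, O x ->
  (\int[Pxi]_xi (pnorm 2 (gF x xi - grad f x) ^+ 2)%:E <= (sigma ^+ 2)%:E)%E.
Hypothesis gFlip : forall x y, O x -> O y ->
  (\int[Pxi]_xi (pnorm 2 (gF x xi - gF y xi) ^+ 2)%:E
     <= (Lf ^+ 2 * pnorm 2 (x - y) ^+ 2)%:E)%E.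

(* The points from which all smoothing directions stay in [O]. *)
Definition smooth_pt (x : 'rV[R]_n) :=
  forall b (t : R), 0 <= t <= 1 -> O (x + (t * nu) *: signv R b).

Definition zcoef (x s : 'rV[R]_n) (xi : Xi) : R := (F (x + nu *: s) xi - F x xi) / nu.

Lemma Fm x : measurable_fun [set: Xi] (F x).
Proof. by have /integrableP[/measurable_EFinP] := Fint x. Qed.

Lemma smooth_pt_in x : smooth_pt x -> O x.
Proof. by move=> /(_ [ffun=> true] 0); rewrite mul0r scale0r addr0; apply; rewrite lexx ler01. Qed.

Definition zrem (x s : 'rV[R]_n) (xi : Xi) : R :=
  F (x + nu *: s) xi - F x xi - dotv (gF x xi) (nu *: s).

Lemma zcoefE x s xi : zcoef x s xi = dotv (gF x xi) s + nu^-1 * zrem x s xi.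
Proof.
rewrite /zcoef /zrem dotvZr mulrBr [nu^-1 * (nu * _)]mulrA mulVf ?gt_eqF// mul1r.
by rewrite [RHS]addrC subrK mulrC.
Qed.

Lemma smeas_zcoef x : smeas (zcoef x).
Proof. by move=> b; apply: measurable_funM => //; apply: measurable_funB; exact: Fm. Qed.

Lemma smeas_zrem x : O x -> smeas (zrem x).
Proof.
move=> Ox b; apply: measurable_funB; first by apply: measurable_funB; exact: Fm.
by apply: measurable_dotv => //; exact: gFm.
Qed.

Lemma zrem_moment x : smooth_pt x ->
  (eavg Pxi (fun s xi => zrem x s xi ^+ 2)%R <= (Lf ^+ 2 * nu ^+ 4 * n%:R ^+ 2)%:E)%E.
Proof.
move=> xO; apply: eavg_le_cst => b.
have := @stochastic_taylor _ _ _ _ Pxi F O Lf Fm FC1 gFm gFlip x (nu *: signv R b).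
move=> /(_ _)/le_trans; apply; first by move=> t t01; rewrite scalerA; exact: xO.
by rewrite dotvZl dotvZr dotv_signv lee_fin le_eqVlt; apply/orP; left; apply/eqP; ring.
Qed.

Lemma gF_moment x : O x ->
  (\int[Pxi]_xi (dotv (gF x xi) (gF x xi))%:E <= (2 * sigma ^+ 2 + 2 * Mf ^+ 2)%:E)%E.
Proof.
move=> Ox.
have md : measurable_fun setT (fun xi => pnorm 2 (gF x xi - grad f x) ^+ 2).
  apply: measurable_funX; apply: measurable_pnorm; first by rewrite ltr1n.
  by apply: measurable_sub_rV => //; exact: gFm.
apply: (@le_trans _ _ (\int[Pxi]_xi (2 * pnorm 2 (gF x xi - grad f x) ^+ 2 + 2 * Mf ^+ 2)%:E)%E).
  apply: ge0_le_integral_real.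
  - by apply: measurable_dotv; exact: gFm.
  - by apply: measurable_funD => //; apply: measurable_funM.
  - move=> xi; rewrite dotv_ge0/= pnorm2E.
    have := fM Ox; have := pnorm_ge0 2 (grad f x); have := pnorm2E (grad f x).
    have := dotv_ge0 (gF x xi - 2 *: grad f x).
    move: (gF x xi) (grad f x) (pnorm 2 (grad f x)) => a g N.
    rewrite !(dotvBl, dotvBr, dotvZl, dotvZr) (dotvC g a).
    move: (dotv _ _) (dotv _ _) (dotv _ _) => u v w h1 e h2 h3.
    have : N ^+ 2 <= Mf ^+ 2 by rewrite lerXn2r// nnegrE.
    lra.
rewrite ge0_integralD_real//; first last.
- by move=> xi; rewrite mulr_ge0// sqr_ge0.
- by move=> xi; rewrite mulr_ge0// sqr_ge0.
- exact: measurable_funM.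
rewrite ge0_integralZ_real//; last by move=> xi; exact: sqr_ge0.
have -> : (\int[Pxi]__ (2 * Mf ^+ 2)%:E = (2 * Mf ^+ 2)%:E)%E.
  by have := expectation_cst Pxi (2 * Mf ^+ 2); rewrite unlock.
rewrite [leRHS]EFinD [X in (_ <= X + _)%E]EFinM.
by apply: leeD => //; apply: lee_wpmul2l => //; exact: gFvar.
Qed.

Lemma smeas_gF_dot x : O x -> smeas (fun s xi => dotv (gF x xi) s).
Proof. by move=> Ox b; apply: measurable_dotv => //; exact: gFm. Qed.

(** The quotient is the directional derivative plus the Taylor remainder over nu. The square of the
    former averages over the signs to |grad F|_2^2, free of the dimension; [n] enters through the
    remainder only, with a factor nu^2. *)
Lemma zcoef_moment x : smooth_pt x ->
  (eavg Pxi (fun s xi => zcoef x s xi ^+ 2)%R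
     <= (4 * (sigma ^+ 2 + Mf ^+ 2) + 2 * (Lf ^+ 2 * nu ^+ 2 * n%:R ^+ 2))%:E)%E.
Proof.
move=> xO; have Ox := smooth_pt_in xO.
have m1 := smeasX 2 (smeas_gF_dot Ox); have m2 := smeasX 2 (smeas_zrem Ox).
apply: (@le_trans _ _ (eavg Pxi (fun s xi => 2 * dotv (gF x xi) s ^+ 2
    + 2 * nu ^- 2 * zrem x s xi ^+ 2)%R)).
  apply: eavg_le; first exact: smeasX (smeas_zcoef x).
    by apply: smeasD; apply: smeasZ.
  move=> b xi; rewrite sqr_ge0/= zcoefE -exprVn.
  move: (dotv _ _) (zrem _ _ _) nu^-1 => A B C.
  by rewrite -subr_ge0 (_ : _ - _ = (A - C * B) ^+ 2) ?sqr_ge0//; ring.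
have n2 : 0 <= 2 * nu ^- 2 by rewrite mulr_ge0// invr_ge0 sqr_ge0.
rewrite eavg_add//; first last.
- by move=> b xi; rewrite mulr_ge0// sqr_ge0.
- by move=> b xi; rewrite mulr_ge0// sqr_ge0.
- exact: smeasZ.
- exact: smeasZ.
rewrite !eavg_scale//; [|by move=> b xi; exact: sqr_ge0|by move=> b xi; exact: sqr_ge0].
rewrite [leRHS]EFinD; apply: leeD.
  rewrite eavgE//; last by move=> b xi; exact: sqr_ge0.
  under eq_integral do rewrite savg_dotv_sqr.
  rewrite (_ : 4 * _ = 2 * (2 * sigma ^+ 2 + 2 * Mf ^+ 2)); last by ring.
  by rewrite EFinM; apply: lee_wpmul2l => //; exact: gF_moment.
rewrite [X in (_ <= X%:E)%E](_ : _ = (2 * nu ^- 2) * (Lf ^+ 2 * nu ^+ 4 * n%:R ^+ 2)); last first.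
  by move: n%:R => N; field; rewrite gt_eqF.
by rewrite [leRHS]EFinM; apply: lee_wpmul2l; [rewrite lee_fin | exact: zrem_moment].
Qed.

(** Both quotients use the same direction and sample, so the main part is the mean-squared increment
    of the stochastic gradient. The two Taylor remainders contribute 4 + 4. *)
Lemma zcoef_diff_moment x y : smooth_pt x -> smooth_pt y ->
  (eavg Pxi (fun s xi => (zcoef x s xi - zcoef y s xi) ^+ 2)%R
     <= (2 * (Lf ^+ 2 * pnorm 2 (x - y) ^+ 2) + 8 * (Lf ^+ 2 * nu ^+ 2 * n%:R ^+ 2))%:E)%E.
Proof.
move=> xO yO; have Ox := smooth_pt_in xO; have Oy := smooth_pt_in yO.
have m1 : smeas (fun s xi => dotv (gF x xi - gF y xi) s ^+ 2).
  apply: smeasX => b; apply: measurable_dotv => //; apply: measurable_sub_rV; exact: gFm.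
have m2 := smeasX 2 (smeas_zrem Ox); have m3 := smeasX 2 (smeas_zrem Oy).
have n2 : 0 <= 4 * nu ^- 2 by rewrite mulr_ge0// invr_ge0 sqr_ge0.
apply: (@le_trans _ _ (eavg Pxi (fun s xi => 2 * dotv (gF x xi - gF y xi) s ^+ 2
    + (4 * nu ^- 2 * zrem x s xi ^+ 2 + 4 * nu ^- 2 * zrem y s xi ^+ 2))%R)).
  apply: eavg_le; first by apply: smeasX => b; apply: measurable_funB; exact: smeas_zcoef.
    by apply: smeasD; [|apply: smeasD]; apply: smeasZ.
  move=> b xi; rewrite sqr_ge0/= !zcoefE -exprVn dotvBl.
  move: (dotv (gF x xi) _) (dotv (gF y xi) _) (zrem x _ _) (zrem y _ _) nu^-1 => A A' B B' C.
  rewrite -subr_ge0 (_ : _ - _ = (A - A' - C * (B - B')) ^+ 2 + 2 * (C * (B + B')) ^+ 2).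
    by rewrite addr_ge0 ?sqr_ge0// mulr_ge0 ?sqr_ge0.
  by ring.
rewrite eavg_add//; first last.
- by move=> b xi; apply: addr_ge0; rewrite mulr_ge0 ?sqr_ge0.
- by move=> b xi; rewrite mulr_ge0 ?sqr_ge0.
- by apply: smeasD; apply: smeasZ.
- exact: smeasZ.
rewrite eavg_add//; first last.
- by move=> b xi; rewrite mulr_ge0 ?sqr_ge0.
- by move=> b xi; rewrite mulr_ge0 ?sqr_ge0.
- exact: smeasZ.
- exact: smeasZ.
rewrite !eavg_scale//; try by move=> b xi; exact: sqr_ge0.
rewrite [leRHS]EFinD; apply: leeD.
  rewrite eavgE//; last by move=> b xi; exact: sqr_ge0.
  under eq_integral do rewrite savg_dotv_sqr -pnorm2E.
  by rewrite EFinM; apply: lee_wpmul2l => //; exact: gFlip.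
rewrite [X in (_ <= X%:E)%E](_ : _ = (4 * nu ^- 2) * (Lf ^+ 2 * nu ^+ 4 * n%:R ^+ 2)
    + (4 * nu ^- 2) * (Lf ^+ 2 * nu ^+ 4 * n%:R ^+ 2)); last first.
  by move: n%:R => N; field; rewrite gt_eqF.
by rewrite [leRHS]EFinD 2!EFinM; apply: leeD; (apply: lee_wpmul2l; [rewrite lee_fin | exact: zrem_moment]).
Qed.

(** The mean of the two-point estimate over direction and sample. The error recursion is centred at
    this vector; its distance to [grad f] is accounted for separately by [gnu_bias]. *)
Definition gnu (x : 'rV[R]_n) : 'rV[R]_n := savg (fun s => ((f (x + nu *: s) - f x) / nu) *: s).

Lemma pnorm_savg p (g : 'rV[R]_n -> 'rV[R]_n) : 1 < p ->
  pnorm p (savg g) <= savg (fun s => pnorm p (g s) : R^o).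
Proof.
move=> p1; rewrite /savg pnormZ ?(lt_trans _ p1)// ger0_norm ?invr_ge0 ?exprn_ge0//.
by rewrite /GRing.scale/= ler_wpM2l ?invr_ge0 ?exprn_ge0// ler_pnorm_sum.
Qed.

(** With grad f written as the sign average of <grad f, s> s, each term is compared by the mean
    value theorem: the coefficients differ by at most Lf nu |s|_2^2 and multiply a vector of norm
    |s|_2, and |s|_2^3 = n^(3/2). *)
Lemma gnu_bias x : smooth_pt x ->
  pnorm 2 (gnu x - grad f x) ^+ 2 <= Lf ^+ 2 * nu ^+ 2 * n%:R ^+ 3.
Proof.
move=> xO; have Ox := smooth_pt_in xO.
have ps2 (b : {ffun 'I_n -> bool}) : pnorm 2 (signv R b) ^+ 2 = n%:R by rewrite pnorm2E dotv_signv.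
set sn := Num.sqrt (n%:R : R).
have ps (b : {ffun 'I_n -> bool}) : pnorm 2 (signv R b) = sn by rewrite /sn -(ps2 b) sqrtr_sqr ger0_norm ?pnorm_ge0.
have sn2 : sn ^+ 2 = n%:R by rewrite sqr_sqrtr.
have sn0 : 0 <= sn by exact: sqrtr_ge0.
have -> : gnu x - grad f x = savg (fun s => ((f (x + nu *: s) - f x) / nu - dotv (grad f x) s) *: s).
  rewrite -{1}[grad f x]savg_dotv /gnu -[- savg _]scaleN1r -savgZ -savgD /savg.
  by congr (_ *: _); apply: eq_bigr => b _; rewrite scaleN1r scalerBl.
suff H : pnorm 2 (savg (fun s => ((f (x + nu *: s) - f x) / nu - dotv (grad f x) s) *: s))
    <= Lf * nu * n%:R * sn.
  apply: le_trans (_ : (Lf * nu * n%:R * sn) ^+ 2 <= _).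
    by rewrite lerXn2r// nnegrE ?pnorm_ge0// !mulr_ge0// ltW.
  by rewrite !exprMn sn2 -mulrA -exprSr.
apply: le_trans (pnorm_savg _ _) _; first by rewrite ltr1n.
rewrite -[leRHS](savg_cst n (_ : R^o)); apply: savg_le => b.
rewrite pnormZ// ps ler_wpM2r//.
have [c /andP[c0 c1]] := MVT01 (fun t _ => is_derive_line (fdiff (x + t *: (nu *: signv R b)))).
rewrite scale1r scale0r addr0 => ->.
rewrite dotvZr mulrAC mulfV ?gt_eqF// mul1r -dotvBl.
apply: le_trans (ler_norm_dotv _ _ _ _ (half_conj R)) _ => //; rewrite ps.
have cO : O (x + c *: (nu *: signv R b)) by rewrite scalerA; apply: xO; rewrite !ltW.
have H := flip cO Ox.
apply: (@le_trans _ _ (Lf * (nu * sn) * sn)); last by rewrite -!mulrA -expr2 sn2 mulrA.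
apply: (ler_wpM2r sn0); apply: (le_trans H); apply: (ler_wpM2l Lf0).
rewrite addrAC subrr add0r !pnormZ// ps gtr0_norm// gtr0_norm//.
by rewrite ler_piMl ?(ltW c1)// mulr_ge0// ltW.
Qed.

Definition zbar (x s : 'rV[R]_n) : R := (f (x + nu *: s) - f x) / nu.

Lemma zcoef_integrable x s : Pxi.-integrable setT (EFin \o zcoef x s).
Proof.
have i : Pxi.-integrable setT (fun xi => (F (x + nu *: s) xi)%:E - (F x xi)%:E)%E.
  exact: (integrableB measurableT (Fint _) (Fint _)).
have := integrableZr measurableT nu^-1 i.
by apply: eq_integrable => // xi _; rewrite /= /zcoef EFinM EFinB.
Qed.

Lemma zcoef_mean x s : (\int[Pxi]_xi (zcoef x s xi)%:E = (zbar x s)%:E)%E.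
Proof.
have i : Pxi.-integrable setT (fun xi => (F (x + nu *: s) xi)%:E - (F x xi)%:E)%E.
  exact: (integrableB measurableT (Fint _) (Fint _)).
under eq_integral do rewrite EFinM EFinB.
rewrite (integralZr measurableT i) (integralB measurableT (Fint _) (Fint _)).
by rewrite !Fmean -EFinB -EFinM.
Qed.

Lemma gnuE x : gnu x = savg (fun s => zbar x s *: s). Proof. by []. Qed.

Opaque gnu.

Let Lf2 := Lf ^+ 2.
Let B2 := Lf2 * nu ^+ 2 * n%:R ^+ 3.

Lemma pnorm_sqrD r (a b : 'rV[R]_n) : 1 < r -> pnorm r (a + b) ^+ 2 <= 2 * pnorm r a ^+ 2 + 2 * pnorm r b ^+ 2.
Proof.
move=> r1; have h : pnorm r (a + b) <= pnorm r a + pnorm r b by exact: ler_pnormD.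
apply: (@le_trans _ _ ((pnorm r a + pnorm r b) ^+ 2)).
  by rewrite lerXn2r ?nnegrE ?addr_ge0 ?pnorm_ge0.
move: {h} (pnorm r a) (pnorm r b) => A B; have := sqr_ge0 (A - B); lra.
Qed.

Lemma sqr_mono (a b : R) : 0 <= a -> a <= b -> a ^+ 2 <= b ^+ 2.
Proof. by move=> a0 ab; rewrite !expr2; exact: ler_pM. Qed.

Lemma pnormZ_sqr r (t : R) (a : 'rV[R]_n) : 0 < r ->
  pnorm r (t *: a) ^+ 2 = t ^+ 2 * pnorm r a ^+ 2.
Proof. by move=> r0; rewrite (pnormZ t a r0) exprMn real_normK ?num_real. Qed.

Lemma pnorm_sqr_mix r (t t' U W : R) (a b : 'rV[R]_n) : 1 < r ->
  pnorm r a ^+ 2 <= U -> pnorm r b ^+ 2 <= W ->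
  pnorm r (t *: a + t' *: b) ^+ 2 <= 2 * t ^+ 2 * U + 2 * t' ^+ 2 * W.
Proof.
move=> r1 ha hb; have r0 : 0 < r by apply: lt_trans r1.
apply: (le_trans (pnorm_sqrD (t *: a) (t' *: b) r1)).
have l1 : pnorm r (t *: a) ^+ 2 <= t ^+ 2 * U.
  by rewrite pnormZ_sqr//; exact: (ler_wpM2l (sqr_ge0 t) ha).
have l2 : pnorm r (t' *: b) ^+ 2 <= t' ^+ 2 * W.
  by rewrite pnormZ_sqr//; exact: (ler_wpM2l (sqr_ge0 t') hb).
apply: (le_trans (lerD (ler_wpM2l (ler0n _ 2) l1) (ler_wpM2l (ler0n _ 2) l2))).
by rewrite !mulrA.
Qed.

Let two_gt1 : 1 < 2 :> R. Proof. by rewrite ltr1n. Qed.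

(** The two means are compared through [grad f], at the price of the bias at both points. *)
Lemma gnu_lip x y : smooth_pt x -> smooth_pt y ->
  pnorm 2 (gnu x - gnu y) ^+ 2 <= 2 * (Lf2 * pnorm 2 (x - y) ^+ 2) + 8 * B2.
Proof.
move=> xO yO; have Ox := smooth_pt_in xO; have Oy := smooth_pt_in yO.
have hx : pnorm 2 (gnu x - grad f x) ^+ 2 <= B2 := gnu_bias xO.
have hy : pnorm 2 (gnu y - grad f y) ^+ 2 <= B2 := gnu_bias yO.
have hl : pnorm 2 (grad f x - grad f y) ^+ 2 <= Lf2 * pnorm 2 (x - y) ^+ 2.
  rewrite /Lf2 -exprMn lerXn2r ?nnegrE ?pnorm_ge0//; last exact: flip.
  by rewrite mulr_ge0// pnorm_ge0.
have e : gnu x - gnu y = (grad f x - grad f y) + ((gnu x - grad f x) + (grad f y - gnu y)).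
  by apply/rowP => i; rewrite !mxE; ring.
have h1 := pnorm_sqrD (grad f x - grad f y) ((gnu x - grad f x) + (grad f y - gnu y)) two_gt1.
have h2 := pnorm_sqrD (gnu x - grad f x) (grad f y - gnu y) two_gt1.
rewrite -(opprB (gnu y) (grad f y)) pnormN (opprB (gnu y) (grad f y)) in h2; rewrite -e in h1.
apply: (le_trans h1); apply: lerD; first by apply: ler_wpM2l hl; rewrite ler0n.
have h3 := le_trans h2 (lerD (ler_wpM2l (ler0n _ 2) hx) (ler_wpM2l (ler0n _ 2) hy)).
apply: (le_trans (ler_wpM2l (ler0n _ 2) h3)).
by rewrite le_eqVlt; apply/orP; left; apply/eqP; move: B2 => B; ring.
Qed.

Lemma gnu_bound x : smooth_pt x -> pnorm 2 (gnu x) ^+ 2 <= 2 * Mf ^+ 2 + 2 * B2.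
Proof.
move=> xO; have Ox := smooth_pt_in xO.
have hx : pnorm 2 (gnu x - grad f x) ^+ 2 <= B2 := gnu_bias xO.
have hm : pnorm 2 (grad f x) ^+ 2 <= Mf ^+ 2 by rewrite lerXn2r ?nnegrE ?pnorm_ge0//; exact: fM.
have := pnorm_sqrD (gnu x - grad f x) (grad f x) two_gt1.
rewrite subrK => h; apply: (le_trans h).
apply: (le_trans (lerD (ler_wpM2l _ hx) (ler_wpM2l _ hm))); rewrite ?ler0n//.
by rewrite addrC.
Qed.

Section BatchStep.
Variables (r : R) (x y : 'rV[R]_n) (th : R).
Hypotheses (n_gt0 : (0 < n)%N) (r2 : 2 <= r) (xO : smooth_pt x) (yO : smooth_pt y) (th0 : 0 <= th <= 1).

Let r1 : 1 < r.
Proof. by apply: lt_le_trans r2; rewrite ltr1n. Qed.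
Let r0 : 0 < r.
Proof. exact: lt_trans r1. Qed.

(** The centred contribution of one draw. The error of the estimate at [x] is [th] times the error
    at the previous point [y] plus the batch average of [zstep], with [th] = 1 - alpha; [th] = 0
    describes the initial batch. *)
Definition zstep (s : 'rV[R]_n) (xi : Xi) : 'rV[R]_n :=
  (zcoef x s xi *: s - gnu x) - th *: (zcoef y s xi *: s - gnu y).

(* [|z s|_r^2 = sqS * z^2] for a sign vector [s]. *)
Definition sqS : R := (n%:R `^ r^-1) ^+ 2.

Definition var_diff : R :=
  2 * sqS * (2 * (Lf2 * pnorm 2 (x - y) ^+ 2) + 8 * (Lf2 * nu ^+ 2 * n%:R ^+ 2))
  + 2 * (2 * (Lf2 * pnorm 2 (x - y) ^+ 2) + 8 * B2).

Definition var_one : R :=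
  2 * sqS * (4 * (sigma ^+ 2 + Mf ^+ 2) + 2 * (Lf2 * nu ^+ 2 * n%:R ^+ 2))
  + 2 * (2 * Mf ^+ 2 + 2 * B2).

(** [zstep] is [th] times the difference of the centred estimates at [x] and [y], plus 1 - [th]
    times the centred estimate at [x]. The first part is controlled by |x - y|^2 and the smoothing
    terms, the second carries the small weight alpha^2. *)
Definition step_var : R := 2 * th ^+ 2 * var_diff + 2 * (1 - th) ^+ 2 * var_one.

Lemma zstepE s xi : zstep s xi =
  (zcoef x s xi - th * zcoef y s xi) *: s - (gnu x - th *: gnu y).
Proof. by rewrite /zstep; apply/rowP => i; rewrite !mxE; ring. Qed.

Lemma measurable_zstep b : measurable_fun [set: Xi] (zstep (signv R b) : Xi -> borelRV R n).
Proof.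
apply: measurable_sub_rV; [|apply: measurable_scale_rV; [exact: measurable_cst|]];
  apply: measurable_sub_rV; (try exact: measurable_cst);
  by apply: measurable_scale_rV; [exact: smeas_zcoef | exact: measurable_cst].
Qed.

Lemma zstep_mean g b : Pxi.-integrable setT (EFin \o (fun xi => dotv g (zstep (signv R b) xi))) /\
  (\int[Pxi]_xi (dotv g (zstep (signv R b) xi))%:E =
    (dotv g ((zbar x (signv R b) - th * zbar y (signv R b)) *: signv R b - (gnu x - th *: gnu y)))%:E)%E.
Proof.
set s := signv R b; move eD : (gnu x - th *: gnu y) => D.
have i1 : Pxi.-integrable setT (fun xi => th%:E * (zcoef y s xi)%:E)%E.
  exact: (integrableZl measurableT _ (zcoef_integrable y s)).
have i2 : Pxi.-integrable setT (fun xi => (zcoef x s xi)%:E - th%:E * (zcoef y s xi)%:E)%E.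
  exact: (integrableB measurableT (zcoef_integrable x s) i1).
have i3 : Pxi.-integrable setT (fun xi => (dotv g s)%:E * ((zcoef x s xi)%:E - th%:E * (zcoef y s xi)%:E))%E.
  exact: integrableZl.
have i4 : Pxi.-integrable setT (EFin \o (fun=> dotv g D) : Xi -> \bar R).
  exact: finite_measure_integrable_cst.
have eqE xi : ((dotv g (zstep s xi))%:E
    = (dotv g s)%:E * ((zcoef x s xi)%:E - th%:E * (zcoef y s xi)%:E) - (dotv g D)%:E)%E.
  by rewrite zstepE eD dotvBr dotvZr EFinB EFinM EFinB EFinM muleC.
split.
  apply: (eq_integrable measurableT _ _ (fun xi _ => esym (eqE xi))).
  exact: (integrableB measurableT i3 i4).
rewrite (eq_integral _ _ (fun xi _ => eqE xi)) (integralB measurableT i3 i4).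
rewrite (integralZl measurableT i2) (integralB measurableT (zcoef_integrable x s) i1).
rewrite (integralZl measurableT (zcoef_integrable y s)) !zcoef_mean.
have -> : (\int[Pxi]_xi (EFin \o (fun=> dotv g D)) xi = (dotv g D)%:E)%E.
  by have := expectation_cst Pxi (dotv g D); rewrite unlock.
by rewrite dotvBr dotvZr [_ * dotv g s]mulrC EFinB EFinM EFinB EFinM.
Qed.

(** The contribution is centred only jointly in direction and sample: for a fixed sign vector the
    mean is that of [zstep_mean], which vanishes after averaging over the signs. *)
Lemma zstep_centered g :
  (\sum_(b : {ffun 'I_n -> bool}) ((2 ^+ n)^-1)%:E
     * \int[Pxi]_xi (dotv g (zstep (signv R b) xi))%:E = 0)%E.
Proof.
under eq_bigr do rewrite (zstep_mean g _).2 -EFinM.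
rewrite sumEFin -mulr_sumr -dotv_sumr.
suff -> : \sum_(b : {ffun 'I_n -> bool})
   ((zbar x (signv R b) - th * zbar y (signv R b)) *: signv R b - (gnu x - th *: gnu y)) = 0.
  by rewrite dotv0r mulr0.
apply: (@scalerI _ _ ((2 ^+ n)^-1)); first by rewrite invr_eq0 expf_neq0// pnatr_eq0.
rewrite scaler0 -/(savg (fun s => (zbar x s - th * zbar y s) *: s - (gnu x - th *: gnu y))).
rewrite savgD savg_cst.
have -> : savg (fun s => (zbar x s - th * zbar y s) *: s) = gnu x - th *: gnu y.
  rewrite !gnuE -[th *: _]savgZ -[- savg _]scaleN1r -savgZ -savgD.
  by congr (_ *: _); apply: eq_bigr => b _; rewrite scaleN1r scalerBl scalerA.
by rewrite subrr.
Qed.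

(** Only the part along the sign vector pays the factor [sqS]; the deterministic part [D] passes
    from the 2-norm to the [r]-norm for free since [r >= 2]. *)
Lemma pnorm_dev (z : R) b (D : 'rV[R]_n) (V : R) : pnorm 2 D ^+ 2 <= V ->
  pnorm r (z *: signv R b - D) ^+ 2 <= 2 * sqS * z ^+ 2 + 2 * V.
Proof.
move=> h; apply: le_trans (pnorm_sqrD _ _ r1) _; rewrite pnormN//.
apply: lerD.
  rewrite pnormZ// pnorm_signv ?gt_eqF// exprMn real_normK ?num_real//.
  by rewrite /sqS le_eqVlt; apply/orP; left; apply/eqP; move: (_ `^ _) => A; ring.
apply: (ler_wpM2l (ler0n _ 2)); apply: le_trans h.
have h' : pnorm r D <= pnorm 2 D by exact: ler_pnorm.
exact: (sqr_mono (pnorm_ge0 _ _) h').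
Qed.

Lemma zstep_var : (eavg Pxi (fun s xi => pnorm r (zstep s xi) ^+ 2)%R <= step_var%:E)%E.
Proof.
have [t0 t1] := andP th0; have S0 : 0 <= 2 * sqS by rewrite mulr_ge0// sqr_ge0.
have c1 : 0 <= 2 * th ^+ 2 * (2 * sqS) by rewrite mulr_ge0// mulr_ge0// sqr_ge0.
have c2 : 0 <= 2 * (1 - th) ^+ 2 * (2 * sqS) by rewrite mulr_ge0// mulr_ge0// sqr_ge0.
set V1 := 2 * (2 * (Lf2 * pnorm 2 (x - y) ^+ 2) + 8 * B2).
set V2 := 2 * (2 * Mf ^+ 2 + 2 * B2).
have V10 : 0 <= V1 by rewrite mulr_ge0// (le_trans _ (gnu_lip xO yO)) ?sqr_ge0.
have V20 : 0 <= V2 by rewrite mulr_ge0// (le_trans _ (gnu_bound xO)) ?sqr_ge0.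
set V := 2 * th ^+ 2 * V1 + 2 * (1 - th) ^+ 2 * V2.
have V0 : 0 <= V by rewrite addr_ge0// mulr_ge0// mulr_ge0// sqr_ge0.
have md : smeas (fun s xi => (zcoef x s xi - zcoef y s xi) ^+ 2).
  by apply: smeasX => b; apply: measurable_funB; exact: smeas_zcoef.
have mx := smeasX 2 (smeas_zcoef x).
apply: (@le_trans _ _ (eavg Pxi (fun s xi => 2 * th ^+ 2 * (2 * sqS) * (zcoef x s xi - zcoef y s xi) ^+ 2
    + (2 * (1 - th) ^+ 2 * (2 * sqS) * zcoef x s xi ^+ 2 + V))%R)).
  apply: eavg_le.
  - by move=> b; apply: measurable_funX; apply: (measurable_pnorm r1); exact: measurable_zstep.
  - apply: smeasD; first exact: smeasZ.
    by apply: smeasD; [exact: smeasZ | move=> b; exact: measurable_cst].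
  move=> b xi; rewrite sqr_ge0/=.
  have -> : zstep (signv R b) xi = th *: ((zcoef x (signv R b) xi - zcoef y (signv R b) xi) *: signv R b - (gnu x - gnu y))
     + (1 - th) *: (zcoef x (signv R b) xi *: signv R b - gnu x).
    by rewrite /zstep; apply/rowP => i; rewrite !mxE; ring.
  have h1 := pnorm_dev (zcoef x (signv R b) xi - zcoef y (signv R b) xi) b (gnu_lip xO yO).
  have h2 := pnorm_dev (zcoef x (signv R b) xi) b (gnu_bound xO).
  apply: (le_trans (pnorm_sqr_mix th (1 - th) r1 h1 h2)); rewrite -/V1 -/V2 /V.
  rewrite le_eqVlt; apply/orP; left; apply/eqP.
  by clear; move: V1 V2 sqS (zcoef x _ _) (zcoef y _ _) => *; ring.
have p1 b xi : 0 <= 2 * th ^+ 2 * (2 * sqS) * (zcoef x (signv R b) xi - zcoef y (signv R b) xi) ^+ 2.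
  by rewrite mulr_ge0// sqr_ge0.
have p2 b xi : 0 <= 2 * (1 - th) ^+ 2 * (2 * sqS) * zcoef x (signv R b) xi ^+ 2.
  by rewrite mulr_ge0// sqr_ge0.
have m1 : smeas (fun s xi => 2 * th ^+ 2 * (2 * sqS) * (zcoef x s xi - zcoef y s xi) ^+ 2) by exact: smeasZ.
have m2 : smeas (fun s xi => 2 * (1 - th) ^+ 2 * (2 * sqS) * zcoef x s xi ^+ 2) by exact: smeasZ.
have m3 : smeas (fun (_ : 'rV[R]_n) (_ : Xi) => V) by move=> b; exact: measurable_cst.
rewrite eavg_add//; [|exact: smeasD|by move=> b xi; rewrite addr_ge0].
rewrite eavg_add// !eavg_scale//; try by move=> b xi; exact: sqr_ge0.
have e1 := zcoef_diff_moment xO yO; have e2 := zcoef_moment xO.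
have -> : eavg Pxi (fun (_ : 'rV[R]_n) (_ : Xi) => V) = V%:E.
  rewrite eavgE//; under eq_integral do rewrite savg_cst.
  by have := expectation_cst Pxi V; rewrite unlock.
apply: le_trans (leeD (lee_wpmul2l _ e1) (leeD (lee_wpmul2l _ e2) (lexx V%:E))) _; rewrite ?lee_fin//.
rewrite /step_var /var_diff /var_one -/V1 -/V2 /V /Lf2.
clear; move: V1 V2 sqS (pnorm _ _) n%:R => *.
by rewrite le_eqVlt; apply/orP; left; apply/eqP; ring.
Qed.

(** Stated for an arbitrary vector [a], in order to be applied with [a] the partial sum of the
    preceding draws of the batch. *)
Lemma batch_step a (c : R) :
  (eavg Pxi (fun s xi => pnorm r (a + c *: zstep s xi) ^+ 2)%R
     <= (pnorm r a ^+ 2 + c ^+ 2 * ((r - 1) * step_var))%:E)%E.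
Proof.
have := @pnorm_smooth_avg R n _ Xi Pxi r n_gt0 r2 (fun s xi => c *: zstep s xi) (c ^+ 2 * step_var).
rewrite mulrCA; apply.
- by move=> b; apply: measurable_scale_rV; [exact: measurable_cst | exact: measurable_zstep].
- move=> g b; under eq_fun do rewrite dotvZr -dotvZl.
  exact: (zstep_mean (c *: g) b).1.
- move=> g; rewrite -[RHS](zstep_centered (c *: g)).
  by apply: eq_bigr => b _; congr (_ * _)%E; apply: eq_integral => xi _; rewrite dotvZr dotvZl.
- under [X in eavg _ X]eq_fun do under eq_fun do rewrite (pnormZ_sqr _ _ r0).
  rewrite eavg_scale ?sqr_ge0//.
  + by rewrite [leRHS]EFinM; apply: lee_wpmul2l; [rewrite lee_fin sqr_ge0 | exact: zstep_var].
  + by move=> b; apply: measurable_funX; apply: (measurable_pnorm r1); exact: measurable_zstep.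
  + by move=> b xi; exact: sqr_ge0.
Qed.

End BatchStep.

End ZerothOrderMoments.

(** * Independence of the draws *)

Section Independence.
Variables (R : realType) (d d1 d2 : measure_display) (T : measurableType d)
  (T1 : measurableType d1) (T2 : measurableType d2) (P : probability T R)
  (Q : probability T2 R).

Definition rv_of d' (T' : measurableType d') (f : T -> T') (mf : measurable_fun setT f) :
  {RV P >-> T'} := mfun_Sub (mem_set mf).

Lemma preimage_measurable d0 d' (T0 : measurableType d0) (T' : measurableType d') (f : T0 -> T') B :
  measurable_fun setT f -> measurable B -> measurable (f @^-1` B).
Proof. by move=> mf mB; rewrite -[X in measurable X]setTI; exact: mf. Qed.

(** Two finite measures agreeing on rectangles coincide. The extra event [A] serves two purposes:
    with the full space it gives the joint law, with an event of the remaining draws it gives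
    independence of the pair from them. *)
Lemma joint_law (W : T -> T1) (Y : T -> T2) (A : set T) (mW : measurable_fun setT W) :
  measurable_fun setT Y -> measurable A ->
  (forall B B', measurable B -> measurable B' ->
     P (W @^-1` B `&` (Y @^-1` B' `&` A)) = (P (W @^-1` B) * (Q B' * P A))%E) ->
  forall C, measurable C ->
    P ((fun w => (W w, Y w)) @^-1` C `&` A) = ((distribution P (rv_of mW) \x Q)%E C * P A)%E.
Proof.
move=> mY mA H C mC.
have mZ : measurable_fun setT (fun w => (W w, Y w)) by exact: measurable_fun_pair.
have PA0 : 0 <= fine (P A) by exact: fine_ge0.
have PAf : P A \is a fin_num by exact: fin_num_measure.
pose m2 := mscale (NngNum PA0) (distribution P (rv_of mW) \x Q)%E.
pose G := [set B `*` B' | B in @measurable _ T1 & B' in @measurable _ T2].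
have mG : @measurable _ (T1 * T2)%type = <<s G >> by exact: measurable_prod_measurableType.
have GI : setI_closed G.
  move=> _ _ [B mB [B' mB' <-]] [D mD [D' mD' <-]].
  by exists (B `&` D); [exact: measurableI|exists (B' `&` D'); [exact: measurableI|rewrite setXI]].
pose m1_ : {measure set (T1 * T2) -> \bar R} := pushforward (mrestr P mA) (fun w => (W w, Y w)).
pose m1 := m1_ mZ.
have : m1 C = m2 C.
  apply: (measure_unique G (fun=> setT) mG GI) => //.
  - by move=> _; exists setT => //; exists setT => //; exact: setXTT.
  - exact: bigcup_const.
  - move=> _ [B mB [B' mB' <-]].
    rewrite /m1 /m1_ /m2 /= /pushforward /mrestr /mscale/= product_measure1E// fineK//.
    have -> : (fun w => (W w, Y w)) @^-1` (B `*` B') = W @^-1` B `&` Y @^-1` B' by [].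
    by rewrite -setIA H// muleA [RHS]muleC.
  - move=> _; rewrite /m1 /m1_ /= /pushforward /mrestr.
    by rewrite preimage_setT setTI; apply: (le_lt_trans (probability_le1 _ mA)); rewrite ltry.
rewrite /m1 /m1_ /m2 /= /pushforward /mrestr /mscale/= fineK// => ->.
by rewrite muleC.
Qed.

Section Indep.
Variables (I : eqType) (sig : I -> set (set T)).
Hypothesis sigm : forall i, sig i `<=` measurable.

(* [W] is independent of the events of the family [sig i], [J i], which are
   themselves taken to be mutually independent. *)
Definition indep d' (T' : measurableType d') (J : set I) (W : T -> T') : Prop :=
  forall B, measurable B -> forall (s : seq I) (A : I -> set T), uniq s ->
    (forall i, i \in s -> J i /\ sig i (A i)) ->
    P (W @^-1` B `&` \bigcap_(i in [set` s]) A i) = (P (W @^-1` B) * \prod_(i <- s) P (A i))%E.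

Lemma bigcap_cons i (s : seq I) (A : I -> set T) :
  \bigcap_(j in [set` i :: s]) A j = A i `&` \bigcap_(j in [set` s]) A j.
Proof.
apply/seteqP; split=> [w H|w [wi H] j /=].
  by split=> [|j js]; apply: H => /=; rewrite in_cons ?eqxx// js orbT.
by rewrite in_cons => /orP[/eqP ->|js]//; exact: H.
Qed.

Lemma bigcap_seq_measurable (s : seq I) (A : I -> set T) :
  (forall i, i \in s -> measurable (A i)) -> measurable (\bigcap_(i in [set` s]) A i).
Proof.
elim: s => [|i s IH] mA; first by rewrite classical_sets.set_nil bigcap_set0.
rewrite bigcap_cons; apply: measurableI; first by apply: mA; rewrite mem_head.
by apply: IH => j js; apply: mA; rewrite in_cons js orbT.
Qed.

Lemma indep_cst d' (T' : measurableType d') (J : set I) (c : T') :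
  mutually_independent P J sig -> indep J (fun=> c).
Proof.
move=> H B mB s A us sA; rewrite preimage_cst; case: ifPn => _.
  by rewrite setTI probability_setT mul1e; exact: H.
by rewrite set0I measure0 mul0e.
Qed.

Lemma indep_sub d' (T' : measurableType d') (J J' : set I) (W : T -> T') :
  J' `<=` J -> indep J W -> indep J' W.
Proof. by move=> JJ H B mB s A us sA; apply: H => // i /sA[/JJ]. Qed.

Lemma indep_comp d' (T' : measurableType d') d3 (T3 : measurableType d3) (J : set I)
  (W : T -> T') (g : T' -> T3) : measurable_fun setT g -> indep J W -> indep J (g \o W).
Proof.
by move=> mg H B mB s A us sA; rewrite comp_preimage; apply: H => //; exact: preimage_measurable.
Qed.

Section AddDraw.
Variables (J : set I) (W : T -> T1) (Y : T -> T2) (i : I).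
Hypotheses (mW : measurable_fun setT W) (mY : measurable_fun setT Y).
Hypotheses (Ji : J i) (sY : sigma_of Y `<=` sig i).
Hypothesis YQ : forall B, measurable B -> P (Y @^-1` B) = Q B.
Hypothesis WJ : indep J W.

Let mixed (B : set T1) (B' : set T2) s A : measurable B -> measurable B' -> uniq s ->
  (forall j, j \in s -> (J `\ i) j /\ sig j (A j)) ->
  P (W @^-1` B `&` (Y @^-1` B' `&` \bigcap_(j in [set` s]) A j)) =
    (P (W @^-1` B) * (Q B' * P (\bigcap_(j in [set` s]) A j)))%E.
Proof.
move=> mB mB' us sA.
have si : i \notin s by apply/negP => /sA[[_ /=]].
(* The event of draw [i] is adjoined to the list, so that one application of [WJ] factorizes all the
   events at once. *)
pose A' j := if j == i then Y @^-1` B' else A j.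
have eA j : j \in s -> A' j = A j.
  by move=> js; rewrite /A'; case: eqP => // ji; move: si; rewrite -ji js.
have -> : Y @^-1` B' `&` \bigcap_(j in [set` s]) A j = \bigcap_(j in [set` i :: s]) A' j.
  rewrite bigcap_cons {1}/A' eqxx; congr (_ `&` _).
  by apply: eq_bigcapr => j /= js; rewrite eA.
rewrite WJ//=; first last.
- move=> j; rewrite in_cons => /orP[/eqP ->|js]; last by rewrite eA//; have [[]] := sA _ js.
  by split=> //; rewrite /A' eqxx; apply: sY; exists B' => //; rewrite setTI.
- by rewrite si.
rewrite big_cons {1}/A' eqxx YQ//; congr (_ * (_ * _))%E.
have := WJ measurableT us (A := A); rewrite preimage_setT setTI probability_setT mul1e => ->.
  by apply: eq_big_seq => j js; rewrite eA.
by move=> j /sA[[]].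
Qed.

Let pair_law C : measurable C ->
  P ((fun w => (W w, Y w)) @^-1` C) = (distribution P (rv_of mW) \x Q)%E C.
Proof.
move=> mC; rewrite -[LHS]mule1 -(probability_setT P) -{1}[_ @^-1` _]setIT.
have -> : P ((fun w => (W w, Y w)) @^-1` C `&` setT) =
    ((distribution P (rv_of mW) \x Q)%E C * P setT)%E.
  apply: (joint_law mW mY measurableT _ mC) => B B' mB mB'.
  have := @mixed B B' [::] (fun=> setT) mB mB' isT (fun j => ltac:(by [])).
  by rewrite classical_sets.set_nil bigcap_set0.
by rewrite probability_setT !mule1.
Qed.

(** The draw [i] leaves the independent family and joins the variable. Applied after every draw,
    this keeps the growing state independent of all that is still to come. *)
Lemma indep_add : indep (J `\ i) (fun w => (W w, Y w)).
Proof.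
move=> C mC s A us sA.
have mA : measurable (\bigcap_(j in [set` s]) A j).
  by apply: bigcap_seq_measurable => j /sA[_]; exact: sigm.
have J1 := joint_law mW mY mA (fun B B' mB mB' => mixed mB mB' us sA) mC.
rewrite J1 pair_law//; congr (_ * _)%E.
have := WJ measurableT us (A := A); rewrite preimage_setT setTI probability_setT mul1e; apply.
by move=> j /sA[[]].
Qed.

Lemma expectation_indep (g : T1 * T2 -> \bar R) : measurable_fun setT g -> (forall z, 0 <= g z)%E ->
  (\int[P]_w g (W w, Y w) = \int[P]_w \int[Q]_y g (W w, y))%E.
Proof.
move=> mg g0.
have mZ : measurable_fun setT (fun w => (W w, Y w)) by exact: measurable_fun_pair.
transitivity (\int[distribution P (rv_of mZ)]_z g z)%E.
  by rewrite ge0_integral_distribution.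
transitivity (\int[(distribution P (rv_of mW) \x Q)%E]_z g z)%E.
  by apply: eq_measure_integral => C mC _; exact: pair_law.
rewrite fubini_tonelli1// ge0_integral_distribution//.
  exact: measurable_fun_fubini_tonelli_F.
by move=> y; apply: integral_ge0.
Qed.

End AddDraw.
End Indep.

End Independence.

(** * One draw, then one batch of draws *)

Section Draws.
Variables (R : realType) (n : nat) (dxi dom : measure_display)
  (Xi : measurableType dxi) (Om : measurableType dom) (Pr : probability Om R)
  (u : nat -> nat -> {RV Pr >-> borelRV R n}) (xi : nat -> nat -> {RV Pr >-> Xi})
  (ind : {RV Pr >-> nat}) (Pu : probability (borelRV R n) R) (Pxi : probability Xi R).
Hypothesis rad : rademacher Pu.
Local Notation sig := (draw_sigma u xi ind).
Local Notation ui k j := (inl (inl (k, j)) : (nat * nat + nat * nat) + unit).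
Local Notation xii k j := (inl (inr (k, j)) : (nat * nat + nat * nat) + unit).
Local Notation indep := (indep Pr sig).

Lemma sigma_of_measurable d' (T' : measurableType d') (Y : Om -> T') :
  measurable_fun setT Y -> sigma_of Y `<=` measurable.
Proof. by move=> mY _ [B mB <-]; exact: mY. Qed.

Lemma draw_sigma_measurable i : sig i `<=` measurable.
Proof.
by case: i => [[[k j]|[k j]]|[]] /=; apply: sigma_of_measurable; exact: measurable_funPT.
Qed.

Section OneDraw.
Variables (d1 d2 : measure_display) (T1 : measurableType d1) (T2 : measurableType d2).
Variables (k j : nat) (J : set ((nat * nat + nat * nat) + unit)) (Z : Om -> T1).
Variable Psi : T1 * borelRV R n * Xi -> T2.
Hypotheses (mZ : measurable_fun setT Z) (mPsi : measurable_fun setT Psi).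
Hypotheses (Ju : J (ui k j)) (Jxi : J (xii k j)).
Hypotheses (uQ : has_law (u k j) Pu) (xiQ : has_law (xi k j) Pxi).
Hypothesis ZJ : indep J Z.

Let mZu : measurable_fun setT (fun w => (Z w, u k j w)).
Proof. exact: measurable_fun_pair. Qed.

Lemma measurable_draw : measurable_fun setT (fun w => Psi ((Z w, u k j w), xi k j w)).
Proof. by apply: (measurableT_comp mPsi); exact: measurable_fun_pair. Qed.

Let indepu : indep (J `\ ui k j) (fun w => (Z w, u k j w)).
Proof. exact: (indep_add draw_sigma_measurable mZ _ Ju _ uQ ZJ). Qed.

Lemma indep_draw : indep (J `\ ui k j `\ xii k j) (fun w => Psi ((Z w, u k j w), xi k j w)).
Proof.
apply: (indep_comp mPsi).
by apply: (indep_add draw_sigma_measurable mZu _ _ _ xiQ indepu).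
Qed.

(** The sample is integrated out first, then the direction, each against its own law; the second
    integral is a finite sum by [integral_rademacher]. *)
Lemma expectation_draw (phi : T2 -> R) : measurable_fun setT phi -> (forall z, 0 <= phi z) ->
  (\int[Pr]_w (phi (Psi ((Z w, u k j w), xi k j w)))%:E =
   \int[Pr]_w eavg Pxi (fun s x => phi (Psi ((Z w, s), x)))%R)%E.
Proof.
move=> mphi phi0.
have mg : measurable_fun setT (fun z => (phi (Psi z))%:E).
  by apply/measurable_EFinP; exact: (measurableT_comp mphi mPsi).
have g0 z : (0 <= (phi (Psi z))%:E)%E by rewrite lee_fin.
have Jx : (J `\ ui k j) (xii k j) by split.
have mY := measurable_funPT (xi k j); have mU := measurable_funPT (u k j).
rewrite (expectation_indep mZu mY Jx (@subset_refl _ _) xiQ indepu mg g0).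
pose G z := (\int[Pxi]_y (phi (Psi (z, y)))%:E)%E.
have mG : measurable_fun setT G.
  exact: (@measurable_fun_fubini_tonelli_F _ _ _ _ R Pxi _ mg g0).
have G0 z : (0 <= G z)%E by apply: integral_ge0.
rewrite (@expectation_indep _ _ _ _ _ _ _ Pr Pu _ sig J Z (u k j) (ui k j) mZ mU Ju (@subset_refl _ _) uQ ZJ G mG G0).
apply: eq_integral => w _.
rewrite (integral_rademacher rad)//.
by apply: (measurableT_comp mG); exact: pair1_measurable.
Qed.

End OneDraw.

Section Batch.
Variables (d0 : measure_display) (T0 : measurableType d0) (W : Om -> T0) (N k : nat) (r : R).
Variable J : set ((nat * nat + nat * nat) + unit).
Variables (A : T0 -> 'rV[R]_n) (c : R) (zeta : T0 -> 'rV[R]_n -> Xi -> 'rV[R]_n) (V : T0 -> R).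
Hypotheses (r1 : 1 < r) (mW : measurable_fun setT W).
Hypothesis mA : measurable_fun setT (A : T0 -> borelRV R n).
Hypothesis mzeta : measurable_fun setT
  ((fun z => zeta z.1.1 z.1.2 z.2) : T0 * borelRV R n * Xi -> borelRV R n).
Hypotheses (mV : measurable_fun setT V) (V0 : forall w, 0 <= V (W w)).
Hypotheses (Ju : forall j, (j < N)%N -> J (ui k j)) (Jxi : forall j, (j < N)%N -> J (xii k j)).
Hypothesis uQ : forall j, (j < N)%N -> has_law (u k j) Pu /\ has_law (xi k j) Pxi.
Hypothesis WJ : indep J W.
Hypothesis step : forall w a,
  (eavg Pxi (fun s x => pnorm r (a + c *: zeta (W w) s x) ^+ 2)%R
     <= (pnorm r a ^+ 2 + V (W w))%:E)%E.

Definition drawn j : set ((nat * nat + nat * nat) + unit) :=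
  [set i | match i with
           | inl (inl (k', j')) | inl (inr (k', j')) => k' = k /\ (j' < j)%N
           | inr _ => False
           end].

Definition batch_sum j (w : Om) : 'rV[R]_n :=
  A (W w) + c *: \sum_(i < j) zeta (W w) (u k i w) (xi k i w).

(** Adds one draw to the partial sum. The state [W] is carried along because every draw of the batch
    is evaluated at it. *)
Let Psi (z : T0 * borelRV R n * borelRV R n * Xi) : T0 * borelRV R n :=
  (z.1.1.1, (z.1.1.2 : 'rV[R]_n) + c *: zeta z.1.1.1 z.1.2 z.2).

Let mPsi : measurable_fun setT Psi.
Proof.
apply: measurable_fun_pair; first exact: (measurableT_comp measurable_fst (measurableT_comp measurable_fst measurable_fst)).
apply: measurable_add_rV.
  exact: (measurableT_comp measurable_snd (measurableT_comp measurable_fst measurable_fst)).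
apply: measurable_scale_rV; first exact: measurable_cst.
apply: (measurableT_comp (f := fun z : T0 * borelRV R n * Xi => (zeta z.1.1 z.1.2 z.2 : borelRV R n)) mzeta
  (g := fun z : T0 * borelRV R n * borelRV R n * Xi => ((z.1.1.1, z.1.2), z.2))).
apply: measurable_fun_pair; last exact: measurable_snd.
apply: measurable_fun_pair; first exact: (measurableT_comp measurable_fst (measurableT_comp measurable_fst measurable_fst)).
exact: (measurableT_comp measurable_snd measurable_fst).
Qed.

Lemma batch_sumS j w : (W w, batch_sum j.+1 w : borelRV R n) =
  Psi ((W w, batch_sum j w : borelRV R n, u k j w), xi k j w).
Proof. by rewrite /batch_sum big_ord_recr/= scalerDr addrA. Qed.

Lemma measurable_batch j : measurable_fun setT (fun w => (W w, batch_sum j w : borelRV R n)).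
Proof.
elim: j => [|j IH].
  apply: measurable_fun_pair => //; rewrite /batch_sum.
  under eq_fun do rewrite big_ord0 scaler0 addr0.
  exact: (measurableT_comp mA mW).
under eq_fun do rewrite batch_sumS.
exact: (measurable_draw k j IH mPsi).
Qed.

Lemma indep_batch j : (j <= N)%N -> indep (J `\` drawn j) (fun w => (W w, batch_sum j w : borelRV R n)).
Proof.
elim: j => [_|j IH jN].
  rewrite (_ : (fun _ => _) = (fun t => (t, A t : borelRV R n)) \o W); last first.
    by apply/funext => w; rewrite /batch_sum big_ord0 scaler0 addr0.
  apply: (indep_sub (@subDsetl _ _ _)); apply: indep_comp WJ.
  exact: measurable_fun_pair.
rewrite (_ : (fun _ => _) = (fun w => Psi ((W w, batch_sum j w : borelRV R n, u k j w), xi k j w))); last first.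
  by apply/funext => w; exact: batch_sumS.
have [lu lxi] := uQ jN.
have h1 : (J `\` drawn j) (ui k j) by split; [exact: Ju | rewrite /drawn/= ltnn => -[]].
have h2 : (J `\` drawn j) (xii k j) by split; [exact: Jxi | rewrite /drawn/= ltnn => -[]].
have := indep_draw (measurable_batch j) mPsi h1 h2 lu lxi (IH (ltnW jN)).
apply: indep_sub => i [Ji di]; split; first split; first split=> //.
- by move: di; case: i {Ji} => [[[k' j']|[k' j']]|[]]//= di [kk jj]; apply: di; split=> //; exact: ltnW.
- by move=> /= e; apply: di; rewrite e /= ltnSn.
- by move=> /= e; apply: di; rewrite e /= ltnSn.
Qed.

(** [step] holds for every value [a] of the partial sum, so each draw adds at most one expectation
    of [V]. With [c] = 1/N and [V] proportional to c^2, a batch of N divides the variance bound of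
    one draw by N. *)
Lemma batch_moment j : (j <= N)%N ->
  (\int[Pr]_w (pnorm r (batch_sum j w) ^+ 2)%:E
     <= \int[Pr]_w (pnorm r (A (W w)) ^+ 2)%:E + j%:R%:E * \int[Pr]_w (V (W w))%:E)%E.
Proof.
elim: j => [_|j IH jN].
  rewrite mul0e adde0 le_eqVlt; apply/orP; left; apply/eqP.
  by apply: eq_integral => w _; rewrite /batch_sum big_ord0 scaler0 addr0.
pose phi (z : T0 * borelRV R n) := pnorm r (z.2 : 'rV[R]_n) ^+ 2.
have mphi : measurable_fun setT phi.
  by apply: measurable_funX; apply: (measurable_pnorm r1); exact: measurable_snd.
have phi0 z : 0 <= phi z by exact: sqr_ge0.
have [lu lxi] := uQ jN.
have h1 : (J `\` drawn j) (ui k j) by split; [exact: Ju | rewrite /drawn/= ltnn => -[]].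
have h2 : (J `\` drawn j) (xii k j) by split; [exact: Jxi | rewrite /drawn/= ltnn => -[]].
have E := expectation_draw (measurable_batch j) mPsi h1 h2 lu lxi (indep_batch (ltnW jN)) mphi phi0.
have e w : (pnorm r (batch_sum j.+1 w) ^+ 2)%:E
    = (phi (Psi ((W w, batch_sum j w : borelRV R n, u k j w), xi k j w)))%:E.
  by rewrite -batch_sumS.
have {}E := etrans (eq_integral _ _ (fun w _ => e w)) E.
apply: (le_trans (eq_ind_r (fun t => (t <= _)%E) (lexx _) E)).
have mb : measurable_fun setT (fun w => pnorm r (batch_sum j w) ^+ 2).
  apply: measurable_funX; apply: (measurable_pnorm r1).
  exact: (measurableT_comp measurable_snd (measurable_batch j)).
have mVW : measurable_fun setT (fun w => V (W w)) by exact: (measurableT_comp mV mW).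
apply: (@le_trans _ _ (\int[Pr]_w (pnorm r (batch_sum j w) ^+ 2 + V (W w))%:E)%E).
  apply: ge0_le_integral => //.
  - by move=> w _; apply: eavg_ge0 => b x; exact: phi0.
  - apply: emeasurable_sum => b; apply: measurable_funeM.
    have mm : measurable_fun setT (fun z => (phi (Psi (((z.1, signv R b : borelRV R n) : T0 * borelRV R n * borelRV R n), z.2)))%:E).
      apply/measurable_EFinP; apply: (measurableT_comp mphi); apply: (measurableT_comp mPsi).
      apply: measurable_fun_pair; last exact: measurable_snd.
      by apply: measurable_fun_pair; [exact: measurable_fst | exact: measurable_cst].
    have m1 := @measurable_fun_fubini_tonelli_F _ _ _ _ R Pxi _ mm (fun z => _).
    apply: (measurableT_comp (m1 _) (measurable_batch j)) => z; rewrite lee_fin; exact: phi0.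
  - by apply/measurable_EFinP; exact: measurable_funD.
  - by move=> w _; exact: step.
rewrite ge0_integralD_real//; last by move=> w; exact: sqr_ge0.
have V0' : (0 <= \int[Pr]_w (V (W w))%:E)%E by exact: ge0_integral_real.
have key (x a v : \bar R) : (0 <= v)%E -> (x <= a + j%:R%:E * v)%E -> (x + v <= a + j.+1%:R%:E * v)%E.
  by move=> v0 h; rewrite -natr1 EFinD ge0_muleDl ?lee_fin// mul1e addeA; exact: leeD.
exact: (key _ _ _ V0' (IH (ltnW jN))).
Qed.

End Batch.

Lemma integral_independent_index d' (T' : measurableType d') (J : set ((nat * nat + nat * nat) + unit))
  (W : Om -> T') (phi : T' -> R) (i : nat) : J (inr tt) ->
  measurable_fun setT W -> indep J W -> measurable_fun setT phi -> (forall z, 0 <= phi z) ->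
  (\int[Pr]_w (\1_(ind @^-1` [set i]) w * phi (W w))%:E
     = Pr (ind @^-1` [set i]) * \int[Pr]_w (phi (W w))%:E)%E.
Proof.
move=> Ji mW WJ mphi phi0.
have mI : measurable_fun setT (fun y : nat => \1_[set i] y : R) by exact: measurable_indic.
pose g (z : T' * nat) := (\1_[set i] z.2 * phi z.1)%:E.
have mg : measurable_fun setT g.
  apply/measurable_EFinP; apply: measurable_funM; last exact: (measurableT_comp mphi measurable_fst).
  exact: (measurableT_comp mI measurable_snd).
have g0 z : (0 <= g z)%E by rewrite lee_fin mulr_ge0.
have := @expectation_indep _ _ _ _ _ _ _ Pr (distribution Pr ind) _ sig J W ind (inr tt) mW
  (measurable_funPT ind) Ji (@subset_refl _ _) (fun B mB => erefl) WJ g mg g0.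
rewrite /g/= => H; rewrite [LHS]H.
under eq_integral => w _.
  under eq_integral do rewrite EFinM muleC.
  rewrite ge0_integralZl//; last by rewrite lee_fin.
  rewrite integral_indic// setIT muleC.
  over.
by rewrite ge0_integralZl//; [apply/measurable_EFinP; exact: (measurableT_comp mphi mW) | move=> w _; rewrite lee_fin].
Qed.

End Draws.

(** * Descent and feasibility of one step *)

Section Constraints.
Variables (R : realType) (n m : nat) (c : 'rV[R]_n -> 'rV[R]_m) (X : set 'rV[R]_n)
  (Mc Mcb Lc : R).
Hypotheses (Mc0 : 0 <= Mc) (Mcb0 : 0 <= Mcb) (Lc0 : 0 <= Lc).
Hypothesis cdiff : forall i x, differentiable (Defs.comp c i) x.
Hypothesis cb : forall i x, X x -> `|Defs.comp c i x| <= Mcb.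
Hypothesis cM : forall i x, X x -> pnorm 2 (grad (Defs.comp c i) x) <= Mc.
Hypothesis cL : forall i x y, X x -> X y ->
  pnorm 2 (grad (Defs.comp c i) x - grad (Defs.comp c i) y) <= Lc * pnorm 2 (x - y).
Hypothesis Xconv : forall x y (t : R), X x -> X y -> 0 <= t <= 1 -> X (x + t *: (y - x)).

Let two_gt1 : 1 < 2 :> R. Proof. by rewrite ltr1n. Qed.
Let two_gt0 : 0 < 2 :> R. Proof. exact: ltr0n. Qed.

Transparent dotv.
Lemma dotv_comp (lam : 'rV[R]_m) x : dotv lam (c x) = \sum_(i < m) lam ord0 i * Defs.comp c i x.
Proof. by []. Qed.

Lemma dotv_gradT (lam : 'rV[R]_m) x w :
  dotv (gradT c x lam) w = \sum_(i < m) lam ord0 i * dotv (grad (Defs.comp c i) x) w.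
Proof. by rewrite /gradT dotv_suml; apply: eq_bigr => i _; rewrite dotvZl. Qed.
Opaque dotv.

Lemma gradTD x (l l' : 'rV[R]_m) (mu : R) :
  gradT c x (l + mu *: l') = gradT c x l + mu *: gradT c x l'.
Proof.
rewrite /gradT scaler_sumr -big_split/=; apply: eq_bigr => i _.
by rewrite !mxE scalerDl scalerA.
Qed.

Lemma pnorm_lincomb k r (I : finType) (l : I -> R) (v : I -> 'rV[R]_k) (A B : R) : 1 < r -> 0 <= A ->
  (forall i, `|l i| <= A) -> (forall i, pnorm r (v i) <= B) ->
  pnorm r (\sum_i l i *: v i) <= #|I|%:R * (A * B).
Proof.
move=> r1 A0 lA vB; apply: (le_trans (ler_pnorm_sum _ _ r1)).
rewrite mulr_natl -sumr_const; apply: ler_sum => i _.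
rewrite (pnormZ (l i) (v i) (lt_trans ltr01 r1)).
exact: (ler_pM (normr_ge0 _) (pnorm_ge0 _ _) (lA i) (vB i)).
Qed.

Lemma comp_lip i x y : X x -> X y -> `|Defs.comp c i y - Defs.comp c i x| <= Mc * pnorm 2 (y - x).
Proof.
move=> Xx Xy.
have [t /andP[t0 t1]] := MVT01 (fun t _ => is_derive_line (cdiff i (x + t *: (y - x)))).
rewrite scale1r scale0r addr0 (addrC x (y - x)) subrK => ->.
apply: (le_trans (ler_norm_dotv _ _ two_gt0 two_gt0 (half_conj R))).
apply: (ler_wpM2r (pnorm_ge0 _ _)); apply: cM; apply: Xconv => //.
by rewrite !ltW.
Qed.

Lemma gradT_le x (lam : 'rV[R]_m) A : X x -> 0 <= A -> (forall i, `|lam ord0 i| <= A) ->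
  pnorm 2 (gradT c x lam) <= m%:R * (A * Mc).
Proof.
move=> Xx A0 lA; have := pnorm_lincomb two_gt1 A0 lA (fun i => cM i Xx).
by rewrite card_ord.
Qed.

Lemma gradT_lip x y (lam : 'rV[R]_m) A : X x -> X y -> 0 <= A -> (forall i, `|lam ord0 i| <= A) ->
  pnorm 2 (gradT c x lam - gradT c y lam) <= m%:R * (A * Lc) * pnorm 2 (x - y).
Proof.
move=> Xx Xy A0 lA; have := pnorm_lincomb two_gt1 A0 lA (fun i => cL i Xx Xy).
rewrite card_ord /gradT -sumrB.
under eq_bigr do rewrite scalerBr.
by rewrite !mulrA.
Qed.

(** Product rule splitting of c_i grad c_i: Mc^2 comes from the increment of c_i, Mcb Lc from that
    of its gradient. Multiplied by mu this is the part of L_mu proportional to mu. *)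
Lemma gradT_self_lip x y : X x -> X y ->
  pnorm 2 (gradT c x (c x) - gradT c y (c y)) <= m%:R * (Mc ^+ 2 + Mcb * Lc) * pnorm 2 (x - y).
Proof.
move=> Xx Xy; rewrite /gradT -sumrB.
apply: (le_trans (ler_pnorm_sum _ _ two_gt1)).
have -> : m%:R * (Mc ^+ 2 + Mcb * Lc) * pnorm 2 (x - y) =
    \sum_(i < m) (Mc ^+ 2 + Mcb * Lc) * pnorm 2 (x - y).
  by rewrite sumr_const card_ord -mulrA mulr_natl.
apply: ler_sum => i _.
have -> : c x ord0 i *: grad (Defs.comp c i) x - c y ord0 i *: grad (Defs.comp c i) y =
  (Defs.comp c i x - Defs.comp c i y) *: grad (Defs.comp c i) x + Defs.comp c i y *: (grad (Defs.comp c i) x - grad (Defs.comp c i) y).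
  by rewrite scalerBl scalerBr addrA subrK.
apply: (le_trans (ler_pnormD _ _ two_gt1)); rewrite mulrDl; apply: lerD.
  rewrite (pnormZ _ _ two_gt0).
  apply: (le_trans (ler_pM (normr_ge0 _) (pnorm_ge0 _ _) (comp_lip i Xy Xx) (cM i Xx))).
  by rewrite le_eqVlt; apply/orP; left; apply/eqP; move: (pnorm _ _) => P; ring.
rewrite (pnormZ _ _ two_gt0) -mulrA.
exact: (ler_pM (normr_ge0 _) (pnorm_ge0 _ _) (cb i Xy) (cL i Xx Xy)).
Qed.

Lemma dotv_con_le (lam : 'rV[R]_m) x A : X x -> 0 <= A -> (forall i, `|lam ord0 i| <= A) ->
  `|dotv lam (c x)| <= m%:R * (A * Mcb).
Proof.
move=> Xx A0 lA; rewrite dotv_comp; apply: (le_trans (ler_norm_sum _ _ _)).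
have -> : m%:R * (A * Mcb) = \sum_(i < m) A * Mcb by rewrite sumr_const card_ord mulr_natl.
apply: ler_sum => i _.
by rewrite normrM; apply: ler_pM => //; exact: cb.
Qed.

Section Lagrangian.
Variables (f : 'rV[R]_n -> R) (Lf mu rho : R).
Hypotheses (mu0 : 0 < mu) (rho0 : 0 <= rho) (Lf0 : 0 <= Lf).
Hypothesis fdiff : forall x, differentiable f x.
Hypothesis flip : forall x y, X x -> X y ->
  pnorm 2 (grad f x - grad f y) <= Lf * pnorm 2 (x - y).

Definition smooth_lag (lam : 'rV[R]_m) x : R := f x + dotv lam (c x) + mu / 2 * pnorm 2 (c x) ^+ 2.

Definition lag_grad (lam : 'rV[R]_m) x : 'rV[R]_n := grad f x + gradT c x (lam + mu *: c x).

Definition lag_lip : R := Lf + m%:R * (mu * Mc ^+ 2 + mu * Mcb * Lc + rho * Mcb * Lc).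

Lemma is_derive_lag (lam : 'rV[R]_m) x w (t : R) :
  is_derive t 1 (fun s : R => smooth_lag lam (x + s *: w)) (dotv (lag_grad lam (x + t *: w)) w).
Proof.
have hf := is_derive_line (fdiff (x + t *: w)).
have hc i := is_derive_line (cdiff i (x + t *: w)).
have dcst (a : R) : is_derive t 1 (cst a : R -> R) (0 : R) by exact: is_derive_cst.
have h1 := is_derive_bigsum (fun i => is_derive_mul (dcst (lam ord0 i)) (hc i)).
have h2 := is_derive_mul (dcst (mu / 2)) (is_derive_bigsum (fun i => is_derive_mul (hc i) (hc i))).
have H := is_derive_add (is_derive_add hf h1) h2.
have e : (fun s : R => smooth_lag lam (x + s *: w)) = (fun s : R => f (x + s *: w) +
     \sum_(i < m) cst (lam ord0 i) s * Defs.comp c i (x + s *: w) +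
     cst (mu / 2) s * \sum_(i < m) Defs.comp c i (x + s *: w) * Defs.comp c i (x + s *: w)).
  by apply/funext => s; rewrite /smooth_lag pnorm2E !dotv_comp.
rewrite e; apply: is_derive_eq H _.
rewrite /lag_grad gradTD !dotvDl dotvZl !dotv_gradT [RHS]addrA; congr (_ + _ + _).
  by apply: eq_bigr => i _; rewrite mul0r add0r.
rewrite mul0r add0r !mulr_sumr; apply: eq_bigr => i _.
rewrite -[c _ ord0 i]/(Defs.comp c i _); move: (dotv _ _) (Defs.comp c i _) => D C.
by rewrite /cst; field.
Qed.

Lemma lag_grad_lip (lam : 'rV[R]_m) x y : X x -> X y -> (forall i, `|lam ord0 i| <= rho * Mcb) ->
  pnorm 2 (lag_grad lam x - lag_grad lam y) <= lag_lip * pnorm 2 (x - y).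
Proof.
move=> Xx Xy lA; have A0 : 0 <= rho * Mcb by exact: mulr_ge0.
have -> : lag_grad lam x - lag_grad lam y =
    (grad f x - grad f y) + ((gradT c x lam - gradT c y lam) + mu *: (gradT c x (c x) - gradT c y (c y))).
  rewrite /lag_grad !gradTD scalerBr.
  by move: (grad f x) (grad f y) (gradT _ _ _) (mu *: _) (gradT _ _ _) (mu *: _) => a b d e g h; apply/rowP => i; rewrite !mxE; ring.
have h1 := flip Xx Xy; have h2 := gradT_lip Xx Xy A0 lA.
have h3 : pnorm 2 (mu *: (gradT c x (c x) - gradT c y (c y))) <= mu * (m%:R * (Mc ^+ 2 + Mcb * Lc) * pnorm 2 (x - y)).
  by rewrite (pnormZ _ _ two_gt0) (gtr0_norm mu0); exact: (ler_wpM2l (ltW mu0) (gradT_self_lip Xx Xy)).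
apply: (le_trans (ler_pnormD _ _ two_gt1)).
apply: (le_trans (lerD h1 (le_trans (ler_pnormD _ _ two_gt1) (lerD h2 h3)))).
rewrite /lag_lip le_eqVlt; apply/orP; left; apply/eqP.
by move: {h1 h2 h3} (pnorm _ _) => P; ring.
Qed.

Lemma lag_descent (lam : 'rV[R]_m) x y : X x -> X y -> (forall i, `|lam ord0 i| <= rho * Mcb) ->
  smooth_lag lam y <= smooth_lag lam x + dotv (lag_grad lam x) (y - x)
    + lag_lip / 2 * pnorm 2 (y - x) ^+ 2.
Proof.
move=> Xx Xy lA.
have H := taylor2_le (f := fun t : R => smooth_lag lam (x + t *: (y - x)))
  (df := fun t : R => dotv (lag_grad lam (x + t *: (y - x))) (y - x)) (C := lag_lip * pnorm 2 (y - x) ^+ 2)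
  (fun t _ => is_derive_lag lam x (y - x) t).
move: H; rewrite scale1r scale0r addr0 (addrC x (y - x)) subrK.
rewrite [lag_lip / 2 * _]mulrAC; apply=> t /andP[t0 t1].
rewrite -dotvBl; apply: (le_trans (ler_norm _)).
apply: (le_trans (ler_norm_dotv _ _ two_gt0 two_gt0 (half_conj R))).
have Xt : X (x + t *: (y - x)) by apply: Xconv => //; rewrite t0.
have h := ler_wpM2r (pnorm_ge0 2 (y - x)) (lag_grad_lip Xt Xx lA).
apply: (le_trans h).
rewrite (addrC x (t *: (y - x))) addrK (pnormZ _ _ two_gt0) (ger0_norm t0).
by rewrite le_eqVlt; apply/orP; left; apply/eqP; move: {h} (pnorm _ _) => P; ring.
Qed.

End Lagrangian.
End Constraints.

(** [D], [e], [N] stand for |y - x|_q, |s - grad f(x)|_p, |y - x|_2, and [g1], [g2], [g3] for the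
    pairings of y - x with the gradient of the Lagrangian, the error and the increment of grad v.
    Strong convexity supplies D^2 / eta. Smoothness takes at most D^2 / (4 eta) because 2 eta L <=
    1, Young's inequality for e D takes another D^2 / (4 eta), and D^2 / (2 eta) is left. *)
Lemma descent_arith (R : realType) (eta L D e N g1 g2 g3 Ly Lx hx hy : R) : 0 < eta ->
  2 * eta * L <= 1 -> 0 <= L -> 0 <= D -> 0 <= e ->
  0 <= - g1 - g2 - eta^-1 * g3 + hx - hy -> D ^+ 2 <= g3 -> - g2 <= e * D ->
  N ^+ 2 <= D ^+ 2 -> Ly <= Lx + g1 + L / 2 * N ^+ 2 ->
  Ly + hy + (2 * eta)^-1 * D ^+ 2 <= Lx + hx + eta * e ^+ 2.
Proof.
move=> eta0 es L0 D0 e0 V1 M1 H1 N3 D1.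
have ei : 0 < eta^-1 by rewrite invr_gt0.
have h1 := ler_wpM2l (ltW ei) M1.
have L2 : L / 2 <= eta^-1 / 4.
  by rewrite ler_pdivlMr// -(ler_pM2l eta0) mulrA mulfV ?gt_eqF//; lra.
have h2 : L / 2 * N ^+ 2 <= eta^-1 / 4 * D ^+ 2.
  by apply: le_trans (ler_wpM2l _ N3) (ler_wpM2r (sqr_ge0 _) L2); rewrite divr_ge0.
have h3 : e * D <= eta * e ^+ 2 + eta^-1 / 4 * D ^+ 2.
  rewrite -subr_ge0 (_ : _ - _ = eta * (e - eta^-1 / 2 * D) ^+ 2); last by field; rewrite gt_eqF.
  by rewrite mulr_ge0 ?sqr_ge0// ltW.
rewrite invfM; move: (eta^-1) (D ^+ 2) (e ^+ 2) (N ^+ 2) h1 h2 h3 D1 V1 {M1 N3} => E D2 e2 N2 h1 h2 h3 D1 V1.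
have -> : 2^-1 * E * D2 = E / 2 * D2 by ring.
have e1 : E / 4 * D2 = E * D2 / 4 by ring.
have e2' : E / 2 * D2 = E * D2 / 2 by ring.
rewrite e1 in h2 h3; rewrite e2'.
move: (E * D2) (E * g3) (L / 2 * N2) (e * D) (eta * e2) h1 h2 h3 D1 V1 H1 => a b b' b'' b3.
by clear; lra.
Qed.

Section Iteration.
Variables (R : realType) (n m : nat) (p q eta : R) (v : 'rV[R]_n -> R)
  (X : set 'rV[R]_n) (h : 'rV[R]_n -> \bar R) (hr : 'rV[R]_n -> R) (Mh : R).
Variables (c : 'rV[R]_n -> 'rV[R]_m) (f : 'rV[R]_n -> R) (Mc Mcb Lc Lf Mf Lv mu rho : R).
Hypotheses (p2 : 2 <= p) (q1 : 1 < q) (q2 : q <= 2) (pq : p^-1 + q^-1 = 1).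
Hypotheses (eta0 : 0 < eta) (mu0 : 0 < mu) (rho0 : 0 <= rho) (Lv0 : 0 <= Lv).
Hypotheses (Mc0 : 0 <= Mc) (Mcb0 : 0 <= Mcb) (Lc0 : 0 <= Lc) (Mh0 : 0 <= Mh) (Lf0 : 0 <= Lf).
Hypothesis v_line : forall x w (t : R),
  is_derive t 1 (fun s : R => v (x + s *: w)) (dotv (grad v (x + t *: w)) w).
Hypothesis v_mono : forall x y,
  pnorm q (y - x) ^+ 2 <= dotv (grad v y - grad v x) (y - x).
Hypothesis v_cont : continuous v.
Hypothesis v_lip : forall x y, X x -> X y ->
  pnorm p (grad v y - grad v x) <= Lv * pnorm q (y - x).
Hypotheses (X0 : X !=set0) (Xcomp : compact X).
Hypothesis Xconv : forall x y (t : R), X x -> X y -> 0 <= t <= 1 ->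
  X (x + t *: (y - x)).
Hypothesis h_fin : forall x, X x -> h x = (hr x)%:E.
Hypothesis h_conv : forall x y (t : R), X x -> X y -> 0 <= t <= 1 ->
  hr (x + t *: (y - x)) <= hr x + t * (hr y - hr x).
Hypothesis h_lip : forall x y, X x -> X y -> hr x - hr y <= Mh * pnorm 2 (x - y).
Hypothesis cdiff : forall i x, differentiable (Defs.comp c i) x.
Hypothesis cb : forall i x, X x -> `|Defs.comp c i x| <= Mcb.
Hypothesis cM : forall i x, X x -> pnorm 2 (grad (Defs.comp c i) x) <= Mc.
Hypothesis cL : forall i x y, X x -> X y ->
  pnorm 2 (grad (Defs.comp c i) x - grad (Defs.comp c i) y) <= Lc * pnorm 2 (x - y).
Hypothesis fdiff : forall x, differentiable f x.
Hypothesis flip : forall x y, X x -> X y ->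
  pnorm 2 (grad f x - grad f y) <= Lf * pnorm 2 (x - y).
Hypothesis fM : forall x, X x -> pnorm 2 (grad f x) <= Mf.
Local Notation Lmu := (lag_lip m Mc Mcb Lc Lf mu rho).
Hypothesis eta_small : 2 * eta * Lmu <= 1.

Let p1 : 1 < p. Proof. by apply: lt_le_trans p2; rewrite ltr1n. Qed.
Let p0 : 0 < p. Proof. exact: lt_trans p1. Qed.
Let q0 : 0 < q. Proof. exact: lt_trans q1. Qed.
Let two_gt1 : 1 < 2 :> R. Proof. by rewrite ltr1n. Qed.
Let two_gt0 : 0 < 2 :> R. Proof. exact: ltr0n. Qed.
Let ei0 : 0 < eta^-1. Proof. by rewrite invr_gt0. Qed.

Definition next_arg (x s : 'rV[R]_n) (lam : 'rV[R]_m) : 'rV[R]_n :=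
  s + gradT c x (lam + mu *: c x) - eta^-1 *: grad v x.

Definition next_pt x s lam : 'rV[R]_n := prox eta v X h (next_arg x s lam).

Lemma mirror_stepX x g : mirror_step X h v eta x g = prox eta v X h (g - eta^-1 *: grad v x).
Proof. exact: (mirror_stepE _ _ h_fin). Qed.

Lemma next_in x s lam : X (next_pt x s lam).
Proof. exact: (prox_in _ v_cont X0 Xcomp h_fin h_lip). Qed.

Lemma Lmu_ge0 : 0 <= Lmu.
Proof. by rewrite /lag_lip addr_ge0// mulr_ge0// !addr_ge0// !mulr_ge0// ?sqr_ge0// ltW. Qed.

Lemma descent_step x s (lam : 'rV[R]_m) : X x -> (forall i, `|lam ord0 i| <= rho * Mcb) ->
  smooth_lag c f mu lam (next_pt x s lam) + hr (next_pt x s lam)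
      + (2 * eta)^-1 * pnorm q (next_pt x s lam - x) ^+ 2
    <= smooth_lag c f mu lam x + hr x + eta * pnorm p (s - grad f x) ^+ 2.
Proof.
move=> Xx lA; have Xy := next_in x s lam; set y := next_pt x s lam in Xy *.
have D1 := lag_descent Mcb0 cdiff cb cM cL Xconv mu0 rho0 fdiff flip Xx Xy lA.
have V1 := prox_variational eta0 v_line v_cont X0 Xcomp Xconv h_fin h_conv h_lip (next_arg x s lam) Xx.
rewrite -/(next_pt x s lam) -/y in V1.
have e1 : dotv (next_arg x s lam + eta^-1 *: grad v y) (x - y)
   = - dotv (lag_grad c f mu lam x) (y - x) - dotv (s - grad f x) (y - x)
     - eta^-1 * dotv (grad v y - grad v x) (y - x).
  rewrite -(opprB y x) dotvNr /next_arg /lag_grad -dotvZl -!dotvNl -!dotvDl; congr dotv.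
  by move: (grad f x) (grad v x) (grad v y) (gradT _ _ _) => a b b' g; apply/rowP => i; rewrite !mxE; ring.
rewrite e1 in V1.
have M1 := v_mono x y.
have H1 : - dotv (s - grad f x) (y - x) <= pnorm p (s - grad f x) * pnorm q (y - x).
  by apply: (le_trans (ler_norm _)); rewrite normrN; exact: ler_norm_dotv.
have N2 : pnorm 2 (y - x) <= pnorm q (y - x) by exact: ler_pnorm.
have N3 := sqr_mono (pnorm_ge0 2 (y - x)) N2.
exact: (descent_arith eta0 eta_small Lmu_ge0 (pnorm_ge0 q (y - x)) (pnorm_ge0 p (s - grad f x)) V1 M1 H1 N3 D1).
Qed.

(** The gradient mapping uses the exact gradient, the iteration the estimate [s]. By Lipschitz
    continuity of the proximal map the two resulting points differ by at most eta times the
    error. *)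
Lemma stationarity_step x s (lam : 'rV[R]_m) : X x ->
  pnorm q (grad_mapping X h v eta x (grad f x + gradT c x (lam + mu *: c x))) ^+ 2
    <= 2 * (eta^-1 * pnorm q (next_pt x s lam - x)) ^+ 2 + 2 * pnorm p (s - grad f x) ^+ 2.
Proof.
move=> Xx; rewrite /grad_mapping mirror_stepX; set y := next_pt x s lam.
set z := prox _ _ _ _ _.
have e : x - z = (- (y - x)) + (y - z) by rewrite opprB addrA subrK.
rewrite e scalerDr.
have H : pnorm q (eta^-1 *: (y - z)) <= pnorm p (s - grad f x).
  rewrite (pnormZ _ _ q0) (gtr0_norm ei0) ler_pdivrMl//.
  have := prox_lipschitz p1 q1 pq eta0 v_line v_mono v_cont X0 Xcomp Xconv h_fin h_conv h_lip
     (next_arg x s lam) (grad f x + gradT c x (lam + mu *: c x) - eta^-1 *: grad v x).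
  rewrite (_ : next_arg x s lam - _ = s - grad f x)//.
  rewrite /next_arg; move: (grad f x) (gradT c x _) (eta^-1 *: _) => a b g.
  by apply/rowP => i; rewrite !mxE; ring.
apply: (le_trans (pnorm_sqrD _ _ q1)); apply: lerD.
  rewrite scalerN (pnormN q) (pnormZ _ _ q0) (gtr0_norm ei0); exact: lexx.
by apply: (ler_wpM2l (ler0n _ 2)); exact: (sqr_mono (pnorm_ge0 _ _) H).
Qed.

(** The optimality condition of the step puts a vector [a] into minus the normal cone at the new
    point y, and the distance in the regularity condition is tested at a / mu. Multiplied by mu, the
    difference has six bounded pieces: the change of the penalty gradient, the multiplier term, grad
    f, the error of [s], the increment of grad v over eta, and the contribution of [h]. *)
Lemma feasibility_step beta x s (lam : 'rV[R]_m) : X x -> (forall i, `|lam ord0 i| <= rho * Mcb) ->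
  beta * pnorm p (c (next_pt x s lam)) <=
    distp p (gradT c (next_pt x s lam) (c (next_pt x s lam)))
      [set - g | g in normal_cone X (next_pt x s lam)] ->
  beta * mu * pnorm p (c (next_pt x s lam)) <=
    (m%:R * rho * Mcb * Mc + Mf + Mh) + pnorm p (s - grad f x)
      + (Lv + 2^-1) * (eta^-1 * pnorm q (next_pt x s lam - x)).
Proof.
move=> Xx lA reg; have Xy := next_in x s lam; set y := next_pt x s lam in Xy reg *.
have A0 : 0 <= rho * Mcb by exact: mulr_ge0.
have [b bM bN] := prox_normal eta0 v_line v_cont X0 Xcomp Xconv h_fin h_conv h_lip (next_arg x s lam) Mh0.
rewrite -/(next_pt x s lam) -/y in bN.
set a := next_arg x s lam + eta^-1 *: grad v y + b in bN.
(* - [a] is normal at [y] and the normal cone is closed under positive scaling, so [mu^-1 *: a]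
   belongs to the set in [distp]. *)
have dle : distp p (gradT c y (c y)) [set - g | g in normal_cone X y]
    <= pnorm p (gradT c y (c y) - mu^-1 *: a).
  apply: ge_inf.
    by exists 0 => _ [w _ <-]; exact: pnorm_ge0.
  exists (mu^-1 *: a) => //; exists (mu^-1 *: - a); last by rewrite scalerN opprK.
  by move=> z Xz; rewrite dotvZl pmulr_rle0 ?invr_gt0//; exact: bN.
rewrite -mulrA mulrCA; apply: (le_trans (ler_wpM2l (ltW mu0) (le_trans reg dle))).
rewrite -{1}(gtr0_norm mu0) -(pnormZ _ _ p0) scalerBr scalerA mulfV ?gt_eqF// scale1r.
have -> : mu *: gradT c y (c y) - a = mu *: (gradT c y (c y) - gradT c x (c x)) +
   (- gradT c x lam + (- grad f x + (- (s - grad f x) + (- (eta^-1 *: (grad v y - grad v x)) + - b)))).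
  rewrite /a /next_arg gradTD !scalerBr.
  move: (grad f x) (gradT c x lam) (mu *: gradT _ _ _) (mu *: gradT _ _ _) (eta^-1 *: _) (eta^-1 *: _) => u1 u2 u3 u4 u5 u6.
  by apply/rowP => i; rewrite !mxE; ring.
have t1 : pnorm p (mu *: (gradT c y (c y) - gradT c x (c x))) <= 2^-1 * (eta^-1 * pnorm q (y - x)).
  rewrite (pnormZ _ _ p0) (gtr0_norm mu0).
  have g1 := gradT_self_lip cdiff cb cM cL Xconv Xy Xx.
  have g0 : pnorm p (gradT c y (c y) - gradT c x (c x)) <= pnorm 2 (gradT c y (c y) - gradT c x (c x)).
    exact: ler_pnorm.
  have N2 : pnorm 2 (y - x) <= pnorm q (y - x) by exact: ler_pnorm.
  have C0 : 0 <= m%:R * (Mc ^+ 2 + Mcb * Lc) by rewrite mulr_ge0// addr_ge0 ?sqr_ge0// mulr_ge0.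
  apply: (le_trans (ler_wpM2l (ltW mu0) (le_trans (le_trans g0 g1) (ler_wpM2l C0 N2)))).
  rewrite !mulrA; apply: (ler_wpM2r (pnorm_ge0 _ _)).
  (* L_mu dominates its part proportional to mu, and 2 eta L_mu <= 1 turns this Lipschitz constant
     into 1 / (2 eta). *)
  have : mu * m%:R * (Mc ^+ 2 + Mcb * Lc) <= Lmu.
    rewrite /lag_lip -subr_ge0 (_ : _ - _ = Lf + m%:R * rho * Mcb * Lc); last by ring.
    by rewrite addr_ge0// !mulr_ge0.
  move=> le; apply: (le_trans le); rewrite -invfM -[leRHS]mul1r ler_pdivlMr ?mulr_gt0//.
  by move: eta_small; rewrite [2 * eta * _]mulrC.
have t2 : pnorm p (- gradT c x lam) <= m%:R * rho * Mcb * Mc.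
  rewrite (pnormN p); apply: (le_trans (ler_pnorm _ two_gt0 p2)).
  by apply: (le_trans (gradT_le cM Xx A0 lA)); rewrite !mulrA.
have t3 : pnorm p (- grad f x) <= Mf.
  by rewrite (pnormN p); apply: (le_trans (ler_pnorm _ two_gt0 p2)); exact: fM.
have t4 : pnorm p (- (s - grad f x)) <= pnorm p (s - grad f x).
  by rewrite (pnormN p); exact: lexx.
have t5 : pnorm p (- (eta^-1 *: (grad v y - grad v x))) <= Lv * (eta^-1 * pnorm q (y - x)).
  rewrite (pnormN p) (pnormZ _ _ p0) (gtr0_norm ei0) mulrCA.
  by apply: (ler_wpM2l (ltW ei0)); exact: v_lip.
have t6 : pnorm p (- b) <= Mh.
  by rewrite (pnormN p); apply: (le_trans (ler_pnorm _ two_gt0 p2)).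
apply: (le_trans (ler_pnormD _ _ p1)).
have T := lerD t1 (le_trans (ler_pnormD _ _ p1) (lerD t2 (le_trans (ler_pnormD _ _ p1) (lerD t3
  (le_trans (ler_pnormD _ _ p1) (lerD t4 (le_trans (ler_pnormD _ _ p1) (lerD t5 t6)))))))).
apply: (le_trans T); rewrite le_eqVlt; apply/orP; left; apply/eqP.
by clear; move: (pnorm q _) (pnorm p _) => P Q; ring.
Qed.

End Iteration.

(** * Consequences of the assumptions on h, X, f and F *)

Section RegularizerFacts.
Variables (R : realType) (n : nat) (X : set 'rV[R]_n) (h : 'rV[R]_n -> \bar R) (Mh : R).
Hypothesis h_ny : forall x, h x != -oo%E.
Hypothesis h_prop : exists2 x, X x & (h x < +oo)%E.
Hypothesis h_sub : forall x, X x -> subdifferential h x !=set0.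
Hypothesis h_bd : forall x g, X x -> subdifferential h x g -> pnorm 2 g <= Mh.

(** If [h] were infinite at a point with a subgradient, the subgradient inequality would make it
    infinite everywhere, against properness. *)
Lemma reg_fin x : X x -> h x = (fine (h x))%:E.
Proof.
move=> Xx; have [g hg] := h_sub Xx; have [y Xy hy] := h_prop.
rewrite fineK// fin_numE h_ny/=; apply/eqP => hx.
have := hg y; rewrite hx addye ?(ltNye _)// leye_eq => /eqP e.
by rewrite e ltxx in hy.
Qed.

Lemma reg_lipschitz x y : X x -> X y -> fine (h x) - fine (h y) <= Mh * pnorm 2 (x - y).
Proof.
move=> Xx Xy; have [g hg] := h_sub Xx.
have H : fine (h x) + dotv g (y - x) <= fine (h y).
  by have := hg y; rewrite {1}(reg_fin Xx) {1}(reg_fin Xy) -EFinD lee_fin.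
have two0 : 0 < 2 :> R by [].
have D := ler_norm_dotv g (y - x) two0 two0 (half_conj R).
have B := ler_wpM2r (pnorm_ge0 2 (y - x)) (h_bd Xx hg).
rewrite -(opprB y x) (pnormN 2).
have := le_trans (ler_norm (- dotv g (y - x))) _; move/(_ (Mh * pnorm 2 (y - x))).
rewrite normrN => /(_ (le_trans D B)); move: H {D B}; move: (dotv _ _) (fine _) (fine _) (_ * _) => *; lra.
Qed.

Lemma reg_convex (hconv : convex_ereal h) x y (t : R) :
  (forall x y (t : R), X x -> X y -> 0 <= t <= 1 -> X (x + t *: (y - x))) ->
  X x -> X y -> 0 <= t <= 1 ->
  fine (h (x + t *: (y - x))) <= fine (h x) + t * (fine (h y) - fine (h x)).
Proof.
move=> Xconv Xx Xy t01; have := hconv y x t t01.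
have -> : t *: y + (1 - t) *: x = x + t *: (y - x) by apply/rowP => i; rewrite !mxE; ring.
rewrite (reg_fin Xx) (reg_fin Xy) (reg_fin (Xconv _ _ _ Xx Xy t01)) -!EFinM -EFinD lee_fin /=.
by move=> H; apply: (le_trans H); rewrite le_eqVlt; apply/orP; left; apply/eqP; ring.
Qed.

End RegularizerFacts.

Lemma convex_setP (R : realType) n (X : set 'rV[R]_n) :
  convex_set (X : set (convex_lmodType 'rV[R]_n)) ->
  forall x y (t : R), X x -> X y -> 0 <= t <= 1 -> X (x + t *: (y - x)).
Proof.
move=> cX x y t Xx Xy t01.
have [t0 t1] := andP t01.
have := cX y x (Itv01 t0 t1) (mem_set Xy) (mem_set Xx).
rewrite inE.
have -> // : conv (Itv01 t0 t1) (y : convex_lmodType 'rV[R]_n) (x : convex_lmodType 'rV[R]_n) = x + t *: (y - x) :> 'rV[R]_n.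
transitivity (t *: y + (1 - t) *: x); first by [].
by apply/rowP => i; rewrite !mxE; ring.
Qed.

(** The Lipschitz bound is used along the gradient itself, scaled so that the segment stays in the
    open set: the directional derivative gives |grad f|^2 <= M |grad f|. *)
Lemma grad_le_lipschitz (R : realType) n (f : 'rV[R]_n -> R) (O : set 'rV[R]_n) (M : R) x :
  open O -> O x -> (forall x, differentiable f x) -> 0 <= M ->
  (forall x y, O x -> O y -> `|f x - f y| <= M * pnorm 2 (x - y)) ->
  pnorm 2 (grad f x) <= M.
Proof.
move=> oO Ox fd M0 fM; set w := grad f x; have two0 : 0 < 2 :> R by [].
have [|N0] := eqVneq (pnorm 2 w) 0; first by move=> ->.
have Np : 0 < pnorm 2 w by rewrite lt_neqAle eq_sym N0 pnorm_ge0.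
have d := is_derive_line (fd (x + 0 *: w)).
have cl : (fun t : R => x + t *: w) @ (0 : R) --> x.
  rewrite -[X in _ --> X](addr0 x) -(scale0r w); apply: cvgD; first exact: cvg_cst.
  exact: cvgZr_tmp.
have [e /= e0 eO] : \forall t \near (0 : R), O (x + t *: w) by apply: cl; exact: open_nbhs_nbhs.
have d2 : is_derive (0 : R) 1 (fun s : R => - f (x + s *: ((e / 2) *: w))) (- (e / 2 * dotv w w)).
  have h := is_derive_line (f := f) (x := x) (w := (e / 2) *: w) (t := 0) (fd _).
  rewrite scale0r addr0 dotvZr -/w in h.
  exact: is_deriveN.
have := derive_right_ge d2 (K := - (M * (e / 2 * pnorm 2 w))) _.
rewrite -pnorm2E => /(_ _)/wrap[].
  move=> t /andP[t0 t1]; rewrite scale0r addr0.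
  have e2 : 0 < e / 2 by rewrite divr_gt0.
  have Ot : O (x + t *: ((e / 2) *: w)).
    rewrite scalerA; apply: eO; rewrite /ball/= sub0r normrN gtr0_norm ?mulr_gt0//.
    apply: le_lt_trans (_ : e / 2 < e); last by rewrite ltr_pdivrMr// ltr_pMr// ltr1n.
    by rewrite ler_piMl// ltW.
  have := le_trans (ler_norm _) (fM _ _ Ot Ox).
  have -> : x + t *: ((e / 2) *: w) - x = t *: ((e / 2) *: w) by rewrite addrC addKr.
  rewrite (pnormZ _ _ two0) (pnormZ _ _ two0) (gtr0_norm t0) (gtr0_norm e2).
  move: (f _) (f _) (pnorm _ _) => a b P.
  by rewrite (_ : M * (t * (e / 2 * P)) = M * (e / 2 * P) * t); [lra | ring].
move=> H; have e2 : 0 < e / 2 by exact: divr_gt0.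
rewrite -(ler_pM2r Np) -(ler_pM2l e2); move: H Np e2.
move: (pnorm 2 w) (e / 2) => P E; rewrite lerN2 expr2 => H _ _.
by rewrite [leRHS]mulrCA.
Qed.

Lemma smooth_pt_region (R : realType) (d m : nat) (dxi : measure_display) (Xi : measurableType dxi)
  (pb : problem R d m Xi) (nu : R) (Pu : probability (borelRV R d) R) (O : set 'rV[R]_d) x :
  rademacher Pu -> smoothing_region pb nu Pu `<=` O -> feas pb x -> smooth_pt O nu x.
Proof.
move=> rad sO Xx b t t01; apply: sO; exists x, t, (signv R b); split=> //.
exact: range_of_signv.
Qed.

Section GradientFacts.
Variables (R : realType) (d m : nat) (dxi : measure_display) (Xi : measurableType dxi)
  (pb : problem R d m Xi) (k : constants R) (O : set 'rV[R]_d).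
Local Notation gF x xi := (grad (sobj pb ^~ xi) x).
Hypotheses (A2 : assumption_A2 pb k O) (A3 : assumption_A3 pb k O).

Lemma sgrad_measurable x : O x ->
  measurable_fun [set: Xi] ((fun xi => gF x xi) : Xi -> borelRV R d).
Proof.
move=> Ox; apply: measurable_rV => i.
by have [/(_ i)[/integrableP[/measurable_EFinP ]]] := A2 Ox.
Qed.

Lemma sgrad_variance x : O x ->
  (\int[law pb]_xi (pnorm 2 (gF x xi - grad (obj pb) x) ^+ 2)%:E <= (csigma k ^+ 2)%:E)%E.
Proof. by move=> Ox; have [_] := A2 Ox; rewrite unlock. Qed.

Lemma sgrad_lipschitz x y : 0 < cLf k -> O x -> O y ->
  (\int[law pb]_xi (pnorm 2 (gF x xi - gF y xi) ^+ 2)%:E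
     <= (cLf k ^+ 2 * pnorm 2 (x - y) ^+ 2)%:E)%E.
Proof.
move=> L0 Ox Oy; have := A3 Ox Oy; rewrite unlock.
set I := (\int[_]_xi _)%E => H.
have I0 : (0 <= I)%E by apply: ge0_integral_real => xi; exact: sqr_ge0.
have L0' : 0 <= cLf k * pnorm 2 (x - y) by rewrite mulr_ge0 ?pnorm_ge0// ltW.
move: H I0; rewrite -exprMn; move: (cLf k * _) L0' => L L0'.
case: I => [r|H _|//]; last by move: H; rewrite poweRyr// leye_eq.
move=> H r0; rewrite lee_fin in r0; move: H; rewrite poweR_EFin !lee_fin powR12_sqrt// => H.
by rewrite -(sqr_sqrtr r0); apply: sqr_mono H; exact: sqrtr_ge0.
Qed.

End GradientFacts.

(** * The random iterates *)

Section Process.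
Variables (R : realType) (n m : nat) (dxi dom : measure_display)
  (Xi : measurableType dxi) (Om : measurableType dom) (Pr : probability Om R)
  (u : nat -> nat -> {RV Pr >-> borelRV R n}) (xi : nat -> nat -> {RV Pr >-> Xi})
  (ind : {RV Pr >-> nat}) (Pu : probability (borelRV R n) R)
  (pb : problem R n m Xi) (v : 'rV[R]_n -> R) (x0 : 'rV[R]_n)
  (mu eta nu alpha : R) (rho_ : nat -> R) (n0 N K : nat) (r : R).
Variables (Lf Mf sigma : R).
Local Notation RVn := (borelRV R n).
Local Notation RVm := (borelRV R m).
Local Notation X := (feas pb).
Local Notation F := (sobj pb).
Local Notation f := (obj pb).
Local Notation c := (con pb).
Local Notation sig := (draw_sigma u xi ind).
Local Notation ui k j := (inl (inl (k, j)) : (nat * nat + nat * nat) + unit).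
Local Notation xii k j := (inl (inr (k, j)) : (nat * nat + nat * nat) + unit).

Definition nxt (z : RVn * RVn * RVm) : RVn :=
  mirror_step X (reg pb) v eta z.1.1 (z.1.2 + gradT c z.1.1 (z.2 + mu *: c z.1.1)).

Hypotheses (rad : rademacher Pu) (samp : sampling u xi ind Pu (law pb) n0 N K).
Hypotheses (r2 : 2 <= r) (K0 : (0 < K)%N) (n00 : (0 < n0)%N) (N0 : (0 < N)%N).
Hypothesis alpha01 : 0 <= alpha <= 1.
Hypothesis mF : measurable_fun [set: RVn * Xi] (fun z : RVn * Xi => F z.1 z.2).
Hypothesis mf : measurable_fun [set: RVn] (f : RVn -> R).
Hypothesis mc : measurable_fun [set: RVn] (c : RVn -> RVm).
Hypothesis mnxt : measurable_fun setT nxt.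
Hypotheses (Xx0 : X x0) (Xnxt : forall z, X (nxt z)).
Hypothesis sv0 : forall x y th, X x -> X y -> 0 <= th <= 1 ->
  0 <= step_var Lf Mf sigma nu r x y th.
Hypothesis step : forall x y th a (c0 : R), X x -> X y -> 0 <= th <= 1 ->
  (eavg (law pb) (fun s t => pnorm r (a + c0 *: zstep F f nu x y th s t) ^+ 2)%R
     <= (pnorm r a ^+ 2 + c0 ^+ 2 * ((r - 1) * step_var Lf Mf sigma nu r x y th))%:E)%E.

Let r1 : 1 < r. Proof. by apply: lt_le_trans r2; rewrite ltr1n. Qed.
Let rm0 : 0 <= r - 1. Proof. by rewrite subr_ge0 ltW. Qed.

Definition run_state i (w : Om) : state R n m :=
  mdlal_state pb v x0 mu eta nu alpha rho_ n0 N (fun a j => u a j w) (fun a j => xi a j w) i.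

Definition run i (w : Om) : RVn * RVn * RVm :=
  (st_x (run_state i w), st_s (run_state i w), st_lam (run_state i w)).

Definition run_err i w : 'rV[R]_n := (run i w).1.2 - gnu f nu (run i w).1.1.

Lemma run_xS i w : (run i.+1 w).1.1 = nxt (run i w).
Proof. by rewrite /run /run_state /=; case: (mdlal_state _ _ _ _ _ _ _ _ _ _ _ _ _). Qed.

Lemma run_lamS i w : (run i.+1 w).2 = (run i w).2 + rho_ i *: c (run i w).1.1.
Proof. by rewrite /run /run_state /=; case: (mdlal_state _ _ _ _ _ _ _ _ _ _ _ _ _). Qed.

Lemma run_in i w : X (run i w).1.1.
Proof. by case: i => [|i]; [exact: Xx0 | rewrite run_xS; exact: Xnxt]. Qed.

Section Stage.
Variables (W : Om -> RVn * (RVn * RVn * RVm)) (k M : nat) (th c0 : R).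
Variable J : set ((nat * nat + nat * nat) + unit).
Hypotheses (mW : measurable_fun setT W) (th01 : 0 <= th <= 1).
Hypotheses (XW1 : forall w, X (W w).1) (XW2 : forall w, X (W w).2.1.1).
Hypotheses (Ju : forall j, (j < M)%N -> J (ui k j)) (Jxi : forall j, (j < M)%N -> J (xii k j)).
Hypothesis uQ : forall j, (j < M)%N -> has_law (u k j) Pu /\ has_law (xi k j) (law pb).
Hypothesis WJ : indep Pr sig J W.

(** A stage is the processing of one batch. [W] holds the new point followed by the old point,
    estimate and multiplier; the batch sum starts from the old error, damped by [th]. *)
Definition stage_init (z : RVn * (RVn * RVn * RVm)) : 'rV[R]_n :=
  th *: ((z.2.1.2 : 'rV[R]_n) - gnu f nu z.2.1.1).

Definition stage_zeta (z : RVn * (RVn * RVn * RVm)) (s : 'rV[R]_n) (t : Xi) : 'rV[R]_n :=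
  zstep F f nu z.1 z.2.1.1 th s t.

Lemma measurable_shift (s : 'rV[R]_n) :
  measurable_fun [set: RVn] ((fun x => x + nu *: s : 'rV[R]_n) : RVn -> RVn).
Proof. by apply: measurable_add_rV. Qed.

Lemma measurable_gnu : measurable_fun [set: RVn] ((gnu f nu) : RVn -> RVn).
Proof.
rewrite /gnu /savg; apply: measurable_scale_rV; first exact: measurable_cst.
apply: measurable_sum_rV => b; apply: measurable_scale_rV; last exact: measurable_cst.
apply: measurable_funM; last exact: measurable_cst.
apply: measurable_funB => //.
exact: (measurableT_comp mf (measurable_shift _)).
Qed.

Lemma measurable_zcoef : measurable_fun [set: RVn * RVn * Xi]
  (fun z : RVn * RVn * Xi => zcoef F nu z.1.1 z.1.2 z.2).
Proof.
apply: measurable_funM; last exact: measurable_cst.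
have m11 : measurable_fun [set: RVn * RVn * Xi] (fun z => z.1.1).
  exact: (measurableT_comp measurable_fst measurable_fst).
have m12 : measurable_fun [set: RVn * RVn * Xi] (fun z => z.1.2).
  exact: (measurableT_comp measurable_snd measurable_fst).
apply: measurable_funB.
  apply: (measurableT_comp mF (g := fun z : RVn * RVn * Xi => ((z.1.1 + nu *: (z.1.2 : 'rV[R]_n) : 'rV[R]_n) : RVn, z.2))).
  apply: measurable_fun_pair; last exact: measurable_snd.
  apply: (measurable_add_rV m11); apply: (measurable_scale_rV _ m12); exact: measurable_cst.
apply: (measurableT_comp mF (g := fun z : RVn * RVn * Xi => (z.1.1, z.2))).
by apply: measurable_fun_pair; last exact: measurable_snd.
Qed.

Lemma measurable_stage_init : measurable_fun setT (stage_init : _ -> RVn).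
Proof.
apply: measurable_scale_rV; first exact: measurable_cst.
apply: measurable_sub_rV.
  exact: (measurableT_comp measurable_snd (measurableT_comp measurable_fst measurable_snd)).
apply: (measurableT_comp measurable_gnu).
exact: (measurableT_comp measurable_fst (measurableT_comp measurable_fst measurable_snd)).
Qed.

Lemma measurable_stage_zeta : measurable_fun setT
  ((fun z => stage_zeta z.1.1 z.1.2 z.2) : (RVn * (RVn * RVn * RVm)) * RVn * Xi -> RVn).
Proof.
pose Z := ((RVn * (RVn * RVn * RVm)) * RVn * Xi)%type.
have mx : measurable_fun [set: Z] (fun z : Z => z.1.1.1).
  exact: (measurableT_comp measurable_fst (measurableT_comp measurable_fst measurable_fst)).
have my : measurable_fun [set: Z] (fun z : Z => z.1.1.2.1.1).
  apply: (measurableT_comp measurable_fst); apply: (measurableT_comp measurable_fst).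
  exact: (measurableT_comp measurable_snd (measurableT_comp measurable_fst measurable_fst)).
have ms : measurable_fun [set: Z] (fun z : Z => z.1.2).
  exact: (measurableT_comp measurable_snd measurable_fst).
have mt : measurable_fun [set: Z] (fun z : Z => z.2) by exact: measurable_snd.
have dev (g : Z -> RVn) : measurable_fun setT g ->
    measurable_fun setT ((fun z => zcoef F nu (g z) z.1.2 z.2 *: (z.1.2 : 'rV[R]_n) - gnu f nu (g z)) : Z -> RVn).
  move=> mg; apply: measurable_sub_rV; last exact: (measurableT_comp measurable_gnu mg).
  apply: (measurable_scale_rV _ ms).
  apply: (measurableT_comp measurable_zcoef (g := fun z : Z => (g z, z.1.2, z.2))).
  by apply: measurable_fun_pair => //; exact: measurable_fun_pair.
apply: measurable_sub_rV; first exact: dev.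
by apply: measurable_scale_rV; [exact: measurable_cst | exact: dev].
Qed.

Definition stage_var (z : RVn * (RVn * RVn * RVm)) : R :=
  c0 ^+ 2 * ((r - 1) * step_var Lf Mf sigma nu r (z.1 : 'rV[R]_n) z.2.1.1 th).

Lemma measurable_stage_var : measurable_fun setT stage_var.
Proof.
have mP : measurable_fun setT (fun z : RVn * (RVn * RVn * RVm) =>
    pnorm 2 ((z.1 : 'rV[R]_n) - z.2.1.1) ^+ 2).
  apply: measurable_funX; apply: measurable_pnorm; first by rewrite ltr1n.
  apply: measurable_sub_rV; first exact: measurable_fst.
  exact: (measurableT_comp measurable_fst (measurableT_comp measurable_fst measurable_snd)).
have cM (a : R) (g : _ -> R) : measurable_fun setT g -> measurable_fun setT (fun z : RVn * (RVn * RVn * RVm) => a * g z).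
  by move=> mg; apply: measurable_funM.
have aM (a : R) (g : _ -> R) : measurable_fun setT g -> measurable_fun setT (fun z : RVn * (RVn * RVn * RVm) => g z + a).
  by move=> mg; apply: measurable_funD.
apply: (cM); apply: (cM); rewrite /step_var /var_diff; apply: (aM); apply: (cM).
by apply: measurable_funD; apply: (cM); apply: (aM); apply: (cM); apply: (cM).
Qed.

Lemma stage_moment :
  (\int[Pr]_w (pnorm r (batch_sum u xi W k stage_init c0 stage_zeta M w) ^+ 2)%:E
     <= (th ^+ 2)%:E * \int[Pr]_w (pnorm r ((W w).2.1.2 - gnu f nu (W w).2.1.1) ^+ 2)%:E
        + M%:R%:E * \int[Pr]_w (stage_var (W w))%:E)%E.
Proof.
have V0 w : 0 <= stage_var (W w).
  by rewrite /stage_var mulr_ge0 ?sqr_ge0// mulr_ge0//; exact: sv0.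
have H := batch_moment rad r1 mW measurable_stage_init measurable_stage_zeta measurable_stage_var
  V0 Ju Jxi uQ WJ (fun w a => step a c0 (XW1 w) (XW2 w) th01) (leqnn M).
apply: (le_trans H); apply: leeD => //.
rewrite -ge0_integralZ_real ?sqr_ge0//; first last.
- by move=> w; exact: sqr_ge0.
- apply: measurable_funX; apply: (measurable_pnorm r1).
  apply: measurable_sub_rV.
    exact: (measurableT_comp measurable_snd (measurableT_comp measurable_fst (measurableT_comp measurable_snd mW))).
  apply: (measurableT_comp measurable_gnu).
  exact: (measurableT_comp measurable_fst (measurableT_comp measurable_fst (measurableT_comp measurable_snd mW))).
rewrite le_eqVlt; apply/orP; left; apply/eqP; apply: eq_integral => w _; congr EFin.
exact: (pnormZ_sqr _ _ (lt_trans ltr01 r1)).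
Qed.

Lemma stage_indep : indep Pr sig (J `\` drawn k M)
  (fun w => (W w, batch_sum u xi W k stage_init c0 stage_zeta M w : RVn)).
Proof. exact: (indep_batch c0 mW measurable_stage_init measurable_stage_zeta Ju Jxi uQ WJ (leqnn M)). Qed.

Lemma stage_measurable : measurable_fun setT
  (fun w => (W w, batch_sum u xi W k stage_init c0 stage_zeta M w : RVn)).
Proof. apply: measurable_batch => //; [exact: measurable_stage_init | exact: measurable_stage_zeta]. Qed.

End Stage.

Definition pre (z : RVn * RVn * RVm) : RVn * (RVn * RVn * RVm) := (nxt z, z).

(* With weight [1 - alpha] replaced by [0], the first batch is a stage started from
   this fictitious state. *)
Definition start : RVn * (RVn * RVn * RVm) := (x0, (x0, 0, 0)).

Lemma measurable_pre : measurable_fun setT pre.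
Proof. exact: measurable_fun_pair. Qed.

Lemma avg_add (V : lmodType R) M (g : nat -> V) (a : V) : (0 < M)%N ->
  M%:R^-1 *: (\sum_(j < M) g j) + a = M%:R^-1 *: (\sum_(j < M) (g j + a)).
Proof.
move=> M0; rewrite big_split/= sumr_const card_ord -(scaler_nat M a) scalerDr scalerA.
by rewrite mulVf ?scale1r// pnatr_eq0 -lt0n.
Qed.

Lemma run0_batch w : run_err 0 w =
  batch_sum u xi (fun=> start) 0 (stage_init 0) n0%:R^-1 (stage_zeta 0) n0 w.
Proof.
rewrite /run_err /run /run_state/= /batch_sum /stage_init scale0r add0r.
rewrite (avg_add (fun j => zo_grad pb nu x0 (u 0 j w) (xi 0 j w)) _ n00); congr (_ *: _).
apply: eq_bigr => j _.
by rewrite /stage_zeta /zstep scale0r subr0.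
Qed.

(** The recursion for s, centred by [gnu] at the new point and regrouped: the damped old error plus
    the average of the contributions [zstep]. *)
Lemma runS_batch i w : run_err i.+1 w =
  batch_sum u xi (pre \o run i) i.+1 (stage_init (1 - alpha)) N%:R^-1 (stage_zeta (1 - alpha)) N w.
Proof.
have -> : run_err i.+1 w = N%:R^-1 *: \sum_(j < N)
     (zo_grad pb nu (nxt (run i w)) (u i.+1 j w) (xi i.+1 j w)
      + (1 - alpha) *: ((run i w).1.2 - zo_grad pb nu (run i w).1.1 (u i.+1 j w) (xi i.+1 j w)))
     - gnu f nu (nxt (run i w)).
  by rewrite /run_err run_xS; congr (_ - _); rewrite /run /run_state /=; case: (mdlal_state _ _ _ _ _ _ _ _ _ _ _ _ _).
rewrite /batch_sum -[(pre \o run i) w]/(nxt (run i w), run i w).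
move: (run i w) (nxt (run i w)) => z x'; rewrite /stage_init /stage_zeta /=.
rewrite [RHS]addrC (avg_add (fun j => zstep F f nu x' z.1.1 (1 - alpha) (u i.+1 j w) (xi i.+1 j w)) _ N0).
rewrite (avg_add (fun j => zo_grad pb nu x' (u i.+1 j w) (xi i.+1 j w) +
  (1 - alpha) *: ((z.1.2 : 'rV[R]_n) - zo_grad pb nu z.1.1 (u i.+1 j w) (xi i.+1 j w))) _ N0).
congr (_ *: _); apply: eq_bigr => j _.
rewrite /zstep /zo_grad /zcoef.
by apply/rowP => l; rewrite !mxE; ring.
Qed.

(** A batch produces the centred error; adding [gnu] at the new point recovers the estimate, so
    measurability and independence pass to the full state. [ro] is the multiplier step just taken, 0
    at the start. *)
Definition rebuild (z : RVn * (RVn * RVn * RVm) * RVn) (ro : R) : RVn * RVn * RVm :=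
  (z.1.1, ((z.2 : 'rV[R]_n) + gnu f nu z.1.1 : 'rV[R]_n) : RVn,
   ((z.1.2.2 : 'rV[R]_m) + ro *: c z.1.2.1.1 : 'rV[R]_m) : RVm).

Lemma measurable_rebuild ro : measurable_fun setT (rebuild ^~ ro).
Proof.
have m1 : measurable_fun [set: RVn * (RVn * RVn * RVm) * RVn] (fun z => z.1.1).
  exact: (measurableT_comp measurable_fst measurable_fst).
have m2 : measurable_fun [set: RVn * (RVn * RVn * RVm) * RVn] (fun z => z.1.2).
  exact: (measurableT_comp measurable_snd measurable_fst).
apply: measurable_fun_pair; first apply: measurable_fun_pair => //.
  apply: measurable_add_rV; first exact: measurable_snd.
  exact: (measurableT_comp measurable_gnu m1).
apply: measurable_add_rV; first exact: (measurableT_comp measurable_snd m2).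
apply: measurable_scale_rV; first exact: measurable_cst.
exact: (measurableT_comp mc (measurableT_comp measurable_fst (measurableT_comp measurable_fst m2))).
Qed.

Lemma run0_rebuild : run 0 = (fun w => rebuild (start,
  batch_sum u xi (fun=> start) 0 (stage_init 0) n0%:R^-1 (stage_zeta 0) n0 w : RVn) 0).
Proof.
apply/funext => w; rewrite -run0_batch /rebuild /run_err /=.
by rewrite subrK scale0r addr0.
Qed.

Lemma runS_rebuild i : run i.+1 = (fun w => rebuild ((pre \o run i) w,
  batch_sum u xi (pre \o run i) i.+1 (stage_init (1 - alpha)) N%:R^-1 (stage_zeta (1 - alpha)) N w : RVn)
  (rho_ i)).
Proof.
apply/funext => w; rewrite -runS_batch /rebuild /run_err /pre/= -run_xS -run_lamS subrK.
by rewrite -!surjective_pairing.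
Qed.

Lemma measurable_run i : measurable_fun setT (run i).
Proof.
elim: i => [|i IH].
  rewrite run0_rebuild; apply: (measurableT_comp (measurable_rebuild 0)).
  by apply: stage_measurable; exact: measurable_cst.
rewrite runS_rebuild; apply: (measurableT_comp (measurable_rebuild (rho_ i))).
by apply: stage_measurable; exact: (measurableT_comp measurable_pre IH).
Qed.

Definition later i : set ((nat * nat + nat * nat) + unit) :=
  [set a | draw_index n0 N K a /\ match a with
     | inl (inl (k, _)) | inl (inr (k, _)) => (i < k)%N
     | inr _ => True end].

Let th01 : 0 <= 1 - alpha <= 1.
Proof. by case/andP: alpha01 => a0 a1; rewrite subr_ge0 a1 lerBlDr lerDl a0. Qed.

Let law0 j : (j < n0)%N -> has_law (u 0 j) Pu /\ has_law (xi 0 j) (law pb).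
Proof. by move=> jn; case: samp => + _ _; apply; rewrite /draw_used K0. Qed.

Let lawS i j : (i.+1 < K)%N -> (j < N)%N -> has_law (u i.+1 j) Pu /\ has_law (xi i.+1 j) (law pb).
Proof. by move=> iK jn; case: samp => + _ _; apply; rewrite /draw_used iK. Qed.

Let start_indep : indep Pr sig (draw_index n0 N K) (fun=> start).
Proof. by case: samp => _ _ H; exact: indep_cst. Qed.

Let use0 j : (j < n0)%N -> draw_index n0 N K (ui 0 j) /\ draw_index n0 N K (xii 0 j).
Proof. by move=> jn; rewrite /draw_index/= /draw_used K0. Qed.

Let useS i j : (i.+1 < K)%N -> (j < N)%N -> later i (ui i.+1 j) /\ later i (xii i.+1 j).
Proof. by move=> iK jn; rewrite /later/= /draw_index/= /draw_used iK ltnSn. Qed.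

(** Induction over the stages: stage [i] consumes only draws with first index [i], and the output
    index is kept in the family throughout. *)
Lemma run_indep i : (i < K)%N -> indep Pr sig (later i) (run i).
Proof.
elim: i => [_|i IH iK].
  rewrite run0_rebuild; apply: (indep_comp (measurable_rebuild 0)).
  have := stage_indep 0 n0%:R^-1 (@measurable_cst _ _ _ _ _ start)
    (fun j h => (use0 h).1) (fun j h => (use0 h).2) law0 start_indep.
  apply: indep_sub => -[[[k j]|[k j]]|[]] [Ja la]; split=> // -[]; by case: k la {Ja}.
rewrite runS_rebuild; apply: (indep_comp (measurable_rebuild (rho_ i))).
have := stage_indep (1 - alpha) N%:R^-1 (measurableT_comp measurable_pre (measurable_run i))
    (fun j h => (useS iK h).1) (fun j h => (useS iK h).2) (fun j => lawS iK)
    (indep_comp measurable_pre (IH (ltnW iK))).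
apply: indep_sub => -[[[k j]|[k j]]|[]] [Ja la]; split=> //.
- by split=> //; exact: ltnW.
- by move=> -[e _]; rewrite e ltnn in la.
- by split=> //; exact: ltnW.
- by move=> -[e _]; rewrite e ltnn in la.
Qed.

Lemma run_moment0 : (\int[Pr]_w (pnorm r (run_err 0 w) ^+ 2)%:E <=
  (n0%:R^-1 * ((r - 1) * step_var Lf Mf sigma nu r x0 x0 0))%:E)%E.
Proof.
under eq_integral do rewrite run0_batch.
have z01 : 0 <= (0 : R) <= 1 by rewrite lexx ler01.
have := stage_moment n0%:R^-1 (@measurable_cst _ _ _ _ _ start) z01 (fun=> Xx0) (fun=> Xx0)
    (fun j h => (use0 h).1) (fun j h => (use0 h).2) law0 start_indep.
move/le_trans; apply.
rewrite expr0n/= mul0e add0e.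
have -> : (\int[Pr]_w (stage_var 0 n0%:R^-1 start)%:E = (stage_var 0 n0%:R^-1 start)%:E)%E.
  by have := expectation_cst Pr (stage_var 0 n0%:R^-1 start); rewrite unlock.
rewrite -EFinM lee_fin /stage_var /=; move: (_ * step_var _ _ _ _ _ _ _ _) => V.
have n1 : n0%:R != 0 :> R by rewrite pnatr_eq0 -lt0n.
by rewrite le_eqVlt; apply/orP; left; apply/eqP; field.
Qed.

Lemma run_momentS i : (i.+1 < K)%N -> (\int[Pr]_w (pnorm r (run_err i.+1 w) ^+ 2)%:E <=
  ((1 - alpha) ^+ 2)%:E * \int[Pr]_w (pnorm r (run_err i w) ^+ 2)%:E
  + (N%:R^-1 * (r - 1))%:E *
     \int[Pr]_w (step_var Lf Mf sigma nu r ((run i.+1 w).1.1 : 'rV[R]_n) (run i w).1.1 (1 - alpha))%:E)%E.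
Proof.
move=> iK.
have E w : (pnorm r (run_err i.+1 w) ^+ 2)%:E = (pnorm r (batch_sum u xi (pre \o run i) i.+1
    (stage_init (1 - alpha)) N%:R^-1 (stage_zeta (1 - alpha)) N w) ^+ 2)%:E.
  by rewrite runS_batch.
apply: (le_trans (eq_ind_r (fun t => (t <= _)%E) (lexx _) (eq_integral _ _ (fun w _ => E w)))).
have H := stage_moment N%:R^-1 (measurableT_comp measurable_pre (measurable_run i)) th01
    (fun w => Xnxt (run i w)) (fun w => run_in i w)
    (fun j h => (useS iK h).1) (fun j h => (useS iK h).2) (fun j => lawS iK)
    (indep_comp measurable_pre (run_indep (ltnW iK))).
apply: (le_trans H); apply: leeD => //.
have Nr0 : 0 <= N%:R^-1 * (r - 1) by rewrite mulr_ge0// invr_ge0.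
have mv1 : measurable_fun setT (fun w => step_var Lf Mf sigma nu r (nxt (run i w) : 'rV[R]_n) (run i w).1.1 (1 - alpha)).
  have mv := measurableT_comp (measurable_stage_var (1 - alpha) 1) (measurableT_comp measurable_pre (measurable_run i)).
  have rp : 0 < r - 1 by rewrite subr_gt0.
  rewrite (_ : (fun w => _) = (fun w => (r - 1)^-1 * stage_var (1 - alpha) 1 (pre (run i w)))).
    by apply: measurable_funM => //; exact: measurable_cst.
  apply/funext => w; rewrite /stage_var expr1n mul1r mulrA mulVf ?gt_eqF// mul1r.
  by [].
have mv2 : measurable_fun setT (fun w => stage_var (1 - alpha) N%:R^-1 ((pre \o run i) w)).
  exact: (measurableT_comp (measurable_stage_var (1 - alpha) N%:R^-1) (measurableT_comp measurable_pre (measurable_run i))).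
under [X in (_ <= _ * X)%E]eq_integral do rewrite run_xS.
rewrite -!ge0_integralZ_real//; first last.
- by move=> w; rewrite /stage_var mulr_ge0 ?sqr_ge0// mulr_ge0//; exact: (sv0 (Xnxt _) (run_in _ _)).
- by move=> w; exact: (sv0 (Xnxt _) (run_in _ _)).
rewrite le_eqVlt; apply/orP; left; apply/eqP; apply: eq_integral => w _; congr EFin.
rewrite /stage_var /=; move: (step_var _ _ _ _ _ _ _ _) => V.
have n1 : N%:R != 0 :> R by rewrite pnatr_eq0 -lt0n.
by field.
Qed.

(** The K point masses of the output index already sum to 1, so it lies below K almost surely. On
    each event that the index equals i, independence from the i-th state factorizes the integral. *)
Lemma run_expectation (phi : nat -> RVn * RVn * RVm -> R) :
  (forall i, measurable_fun setT (phi i)) -> (forall i z, 0 <= phi i z) ->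
  (\int[Pr]_w (phi (ind w) (run (ind w) w))%:E =
   \sum_(i < K) (K%:R^-1)%:E * \int[Pr]_w (phi i (run i w))%:E)%E.
Proof.
move=> mphi phi0.
have [_ indK _] := samp.
pose g i w : R := \1_(ind @^-1` [set i]) w * phi i (run i w).
have mi i : measurable (ind @^-1` [set i]).
  by apply: preimage_measurable => //; exact: measurable_funPT.
have mpr i : measurable_fun setT (fun w => phi i (run i w)).
  exact: (measurableT_comp (mphi i) (measurable_run i)).
have mg i : measurable_fun setT (g i).
  by apply: measurable_funM => //; exact: measurable_indic.
have g0 i w : 0 <= g i w by rewrite /g mulr_ge0.
have E1 (i : 'I_K) : (\int[Pr]_w (g i w)%:E = (K%:R^-1)%:E * \int[Pr]_w (phi i (run i w))%:E)%E.
  rewrite -(indK i (ltn_ord i)).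
  have Ji : later i (inr tt) by [].
  have H := integral_independent_index i Ji (measurable_run i) (run_indep (ltn_ord i)) (mphi i) (phi0 i).
  exact: H.
transitivity (\int[Pr]_w (\sum_(i < K) g i w)%:E)%E; last first.
  under eq_integral do rewrite -sumEFin.
  rewrite ge0_integral_sum//; last 2 first.
  - by move=> i; apply/measurable_EFinP; exact: mg.
  - by move=> i w _; rewrite lee_fin.
  by apply: eq_bigr => i _; exact: E1.
have nullK : {ae Pr, forall w, (ind w < K)%N}.
  exists (~` \bigcup_(i < K) (ind @^-1` [set i])); split.
  - apply: measurableC; apply: bigcup_measurable => i _; exact: mi.
  - rewrite probability_setC; last by apply: bigcup_measurable => i _; exact: mi.
    have -> : Pr (\bigcup_(i < K) (ind @^-1` [set i])) = (\sum_(i < K) (K%:R^-1)%:E)%E.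
      rewrite bigcup_mkord; transitivity (\sum_(i < K) Pr (ind @^-1` [set (i : nat)]))%E; last first.
        by apply: eq_bigr => i _; exact: indK.
      apply: (@measure_semi_additive_ord_I _ _ _ Pr (fun i => ind @^-1` [set i]) K) => //.
      - apply/trivIsetP => i j _ _ ij; rewrite -preimage_setI; apply/seteqP; split=> // w /= [-> e].
        by move: ij; rewrite e eqxx.
      - by apply: bigsetU_measurable => i _; exact: mi.
    rewrite sumEFin sumr_const card_ord -(mulr_natl (K%:R^-1) K) mulfV ?subee//.
    by rewrite pnatr_eq0 -lt0n.
  - move=> w /= H; move=> [i /= iK e]; apply: H; by rewrite e.
apply: ae_eq_integral => //.
- apply/measurable_EFinP.
  have mcount : measurable_fun setT (fun w => phi (ind w) (run (ind w) w)).
    move=> _ B mB; rewrite setTI.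
    rewrite (_ : _ @^-1` B = \bigcup_i (ind @^-1` [set i] `&` (fun w => phi i (run i w)) @^-1` B)).
      apply: bigcup_measurable => i _; apply: measurableI; first exact: mi.
      exact: preimage_measurable.
    apply/seteqP; split=> [w Bw|w [i _ /= [e Bw]]]; first by exists (ind w).
    by rewrite /= e.
  exact: mcount.
- by apply/measurable_EFinP; apply: measurable_sum => i; exact: mg.
- apply: filterS nullK => w wK _; congr EFin.
  rewrite (bigD1 (Ordinal wK))//= big1 ?addr0.
    by rewrite /g indicE mem_set// mul1r.
  move=> i ij; rewrite /g indicE memNset ?mul0r//= => e.
  by move: ij; rewrite -val_eqE /= e eqxx.
Qed.

End Process.

(** * Averages over the iterations *)

Section AverageArithmetic.
Variable R : realType.

(** Since (1 - al)^2 <= 1 - al, each step gives up at least the fraction al of the error. The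
    induction retains (1 - al) times the last error, which is dropped only at the end. *)
Lemma recursion_sum (K : nat) (delta T : nat -> R) (al : R) : 0 <= al <= 1 ->
  (forall i, 0 <= delta i) -> (forall i, 0 <= T i) ->
  (forall i, (i.+1 < K)%N -> delta i.+1 <= (1 - al) ^+ 2 * delta i + T i) ->
  al * \sum_(i < K) delta i <= delta 0%N + \sum_(i < K) T i.
Proof.
move=> /andP[a0 a1] d0 T0 rec.
case: K rec => [|K] rec; first by rewrite !big_ord0 mulr0 addr0.
suff H : al * \sum_(i < K.+1) delta i + (1 - al) * delta K <= delta 0%N + \sum_(i < K) T i.
  rewrite [X in _ <= _ + X]big_ord_recr/=.
  have h1 : 0 <= (1 - al) * delta K by rewrite mulr_ge0// subr_ge0.
  by have := T0 K; lra.
elim: K rec => [|K IH] rec; first by rewrite big_ord_recr !big_ord0/=; lra.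
have {}IH := IH (fun i h => rec i (ltnW h)).
rewrite big_ord_recr [X in _ <= _ + X]big_ord_recr/= mulrDr.
have h := rec K (ltnSn _).
have h2 : (1 - al) ^+ 2 * delta K <= (1 - al) * delta K.
  by rewrite ler_wpM2r// expr2 ler_piMl ?subr_ge0// lerBlDr lerDl.
move: IH h h2; move: (al * \sum_(i < K.+1) _) (_ * delta K) (_ * delta K) (\sum_(i < K) T i) => x y z w.
by have := d0 K.+1; lra.
Qed.

(** [L] is L_f^2, [b] and [b'] are L_f^2 nu^2 d^3 and L_f^2 nu^2 d^2, [sd] and [sD] the sums of
    expected squared errors and steps, [VG] the variance bound of one estimate, [sb] is sigmabar^2.
    After division by [al] the initial error contributes 1/30, the smoothing terms 80/3456 and the
    fresh variance 1/60 of k e2, together below 733/10000; the steps keep the coefficient 12 L / al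
    = 1 / (8 eta^2). *)
Lemma variance_arith (e2 L eta S sb al k sd sD d0 sT VG b b' : R) :
  0 < L -> 0 < eta -> 2 <= S -> 0 < k -> 0 <= sD -> 0 <= b ->
  al = 96 * L * eta ^+ 2 -> al * sd <= d0 + sT -> d0 <= 16 / 5 * e2 ->
  sT <= S^-1 * (8 * (S + 1) * L * sD + k * (2 * (16 * S * b' + 16 * b) + 2 * al ^+ 2 * VG)) ->
  VG <= 2 * sb -> al * sb <= S * e2 / 240 -> b' <= b / 3 ->
  b <= L * eta ^+ 2 * e2 / 12 -> 1 <= L * eta ^+ 2 * k -> 0 <= e2 ->
  sd <= 733 / 10000 * k * e2 + (eta ^+ 2)^-1 * sD / 8.
Proof.
move=> L0 eta0 S2 k0 sD0 b0 alE Hsd Hd0 HsT HVG Hsb Hb' Hb Hk e20.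
have S0 : 0 < S by apply: lt_le_trans S2; rewrite ltr0n.
have E0 : 0 < eta ^+ 2 by rewrite exprn_gt0.
have al0 : 0 < al by rewrite alE !mulr_gt0.
rewrite -(ler_pM2l al0); apply: (le_trans Hsd).
have Si : S^-1 <= 1 / 2 by rewrite ler_pdivlMr// mulrC ler_pdivrMr// mul1r.
have Si0 : 0 < S^-1 by rewrite invr_gt0.
have t1 : S^-1 * (8 * (S + 1) * L * sD) <= 12 * L * sD.
  have -> : S^-1 * (8 * (S + 1) * L * sD) = (8 + 8 * S^-1) * (L * sD) by field; rewrite gt_eqF.
  rewrite -mulrA; apply: ler_wpM2r; [by rewrite mulr_ge0// ltW | lra].
have t2 : S^-1 * (k * (2 * (16 * S * b' + 16 * b))) <= k * (80 / 3 * b).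
  have -> : S^-1 * (k * (2 * (16 * S * b' + 16 * b))) = k * (32 * b' + 32 * (S^-1 * b)).
    by field; rewrite gt_eqF.
  apply: ler_wpM2l; first exact: ltW.
  by have := ler_wpM2r b0 Si; lra.
have t3 : S^-1 * (k * (2 * al ^+ 2 * VG)) <= k * (al * (e2 / 60)).
  have -> : S^-1 * (k * (2 * al ^+ 2 * VG)) = k * (al * (2 * (S^-1 * (al * VG)))).
    by rewrite expr2; ring.
  apply: ler_wpM2l; first exact: ltW.
  apply: ler_wpM2l; first exact: ltW.
  have : al * VG <= S * (e2 / 120).
    by have := ler_wpM2l (ltW al0) HVG; lra.
  move=> h; have : S^-1 * (al * VG) <= e2 / 120 by rewrite ler_pdivrMl.
  by clear; lra.
have t4 : d0 <= al * (k * e2 / 30).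
  apply: (le_trans Hd0); rewrite alE.
  have := ler_wpM2r e20 Hk; rewrite mul1r => h.
  have -> : 96 * L * eta ^+ 2 * (k * e2 / 30) = 16 / 5 * (L * eta ^+ 2 * k * e2) by field.
  by apply: ler_wpM2l h.
have t5 : k * (80 / 3 * b) <= al * (k * (80 / 3456 * e2)).
  have -> : al * (k * (80 / 3456 * e2)) = k * (80 / 3 * (L * eta ^+ 2 * e2 / 12)) by rewrite alE; field.
  by apply: ler_wpM2l; [exact: ltW | apply: ler_wpM2l].
have t6 : 12 * L * sD = al * ((eta ^+ 2)^-1 * sD / 8).
  by rewrite alE; field; rewrite gt_eqF.
rewrite mulrDr [k * (_ + _)]mulrDr [S^-1 * (_ + _)]mulrDr in HsT.
rewrite t6 in t1; rewrite mulrDr.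
have t7 : al * (k * e2 / 30) + al * (k * (80 / 3456 * e2)) + k * (al * (e2 / 60)) <= al * (733 / 10000 * k * e2).
  have -> : al * (k * e2 / 30) + al * (k * (80 / 3456 * e2)) + k * (al * (e2 / 60)) = (1 / 30 + 80 / 3456 + 1 / 60) * (al * k * e2) by field.
  have -> : al * (733 / 10000 * k * e2) = 733 / 10000 * (al * k * e2) by ring.
  by apply: ler_wpM2r; [rewrite !mulr_ge0// ltW | lra].
move: HsT t1 t2 t3 t4 t5 t7.
move: (S^-1 * _) (S^-1 * _) (S^-1 * _) (al * (k * _ / 30)) (al * (k * (80 / 3456 * e2))) (k * (al * _)) (k * (80 / 3 * b)) (al * (733 / 10000 * k * e2)) (al * _).
by clear; move=> *; lra.
Qed.

(** Inserting the error bound into the descent bound leaves 11/32 of Y = sD / eta^2 on the left, so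
    Y is at most about 0.306 k e2. The two totals are then about 0.90 and 0.95 times k e2. *)
Lemma kkt_arith (e2 eta k sd sD b Del c0 : R) : 0 < eta -> 0 < k -> 0 <= e2 ->
  sd <= 733 / 10000 * k * e2 + (eta ^+ 2)^-1 * sD / 8 -> b <= e2 / 1168 ->
  (2 * eta)^-1 * sD <= eta * (5 / 4 * sd + 5 * k * b) + Del -> Del <= k * eta * e2 / 108 ->
  c0 <= k * e2 / 5 -> 0 <= sd -> 0 <= sD -> 0 <= b ->
  2 * (eta ^+ 2)^-1 * sD + 2 * (5 / 4 * sd + 5 * k * b) <= k * e2 /\
  c0 + (3 / 10 * k * e2 + (eta ^+ 2)^-1 * sD + (5 / 4 * sd + 5 * k * b)) <= k * e2.
Proof.
move=> eta0 k0 e20 Hsd Hb HD HDel Hc0 sd0 sD0 b0.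
have E0 : 0 < eta ^+ 2 by rewrite exprn_gt0.
have Hkb : k * b <= k * e2 / 1168 by rewrite -mulrA; apply: ler_wpM2l => //; exact: ltW.
set Y := (eta ^+ 2)^-1 * sD in Hsd *.
have HY : Y / 2 <= (5 / 4 * sd + 5 * k * b) + k * e2 / 108.
  rewrite -(ler_pM2l eta0).
  have -> : eta * (Y / 2) = (2 * eta)^-1 * sD by rewrite /Y; field; rewrite gt_eqF.
  apply: (le_trans HD); rewrite [leRHS]mulrDr lerD2l; apply: (le_trans HDel).
  by rewrite le_eqVlt; apply/orP; left; apply/eqP; ring.
rewrite -(mulrA 2 _ sD) -/Y.
have ke0 : 0 <= k * e2 by rewrite mulr_ge0// ltW.
have e1 : 733 / 10000 * k * e2 = 733 / 10000 * (k * e2) by ring.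
have e3 : 3 / 10 * k * e2 = 3 / 10 * (k * e2) by ring.
have e4 : 5 * k * b = 5 * (k * b) by ring.
rewrite e1 in Hsd; rewrite e4 in HY; rewrite e3 e4.
have Y0 : 0 <= Y by rewrite mulr_ge0// invr_ge0 ltW.
move: Hsd Hkb HY Hc0 ke0 sd0 Y0; move: Y (k * e2) (k * b) => Y' ke kb; clear => *.
by split; lra.
Qed.

(** The square is split as 4 A^2 + 4/3 B^2, with B collecting error and step. By 40 M <= (beta mu)^2
    e2 the first part is at most 12/40 of (beta mu)^2 e2. The second has coefficients 8/3 for e^2
    and at most 16/3 Lv^2 + 4/3 for D^2, both below 8 (2 Lv^2 + 1) / 3. *)
Lemma feasibility_arith (e2 D e Lv A M beta mu P : R) : 0 <= e2 -> 0 <= D -> 0 <= e -> 0 <= Lv -> 0 <= A ->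
  0 < beta -> 0 < mu -> 0 <= P ->
  beta * mu * P <= A + e + (Lv + 2^-1) * D ->
  A ^+ 2 <= 3 * M -> 40 * M <= beta ^+ 2 * mu ^+ 2 * e2 ->
  8 * (2 * Lv ^+ 2 + 1) / 3 <= beta ^+ 2 * mu ^+ 2 ->
  P ^+ 2 <= 3 / 10 * e2 + D ^+ 2 + e ^+ 2.
Proof.
move=> e20 D0 e0 Lv0 A0 b0 m0 P0 H HA HM HL.
have q0 : 0 < beta * mu by rewrite mulr_gt0.
have Q0 : 0 < (beta * mu) ^+ 2 by rewrite exprn_gt0.
rewrite -exprMn in HM HL.
rewrite -(ler_pM2l Q0) -exprMn.
apply: (@le_trans _ _ ((A + (e + (Lv + 2^-1) * D)) ^+ 2)).
  by apply: sqr_mono; rewrite ?addrA// mulr_ge0// ltW.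
set B := e + (Lv + 2^-1) * D.
have h1 : (A + B) ^+ 2 <= 4 * A ^+ 2 + 4 / 3 * B ^+ 2.
  by rewrite -subr_ge0 (_ : _ - _ = 3 * (A - B / 3) ^+ 2); [rewrite mulr_ge0// sqr_ge0 | field].
have h2 : B ^+ 2 <= 2 * e ^+ 2 + 2 * ((Lv + 2^-1) ^+ 2 * D ^+ 2).
  by rewrite -subr_ge0 (_ : _ - _ = (e - (Lv + 2^-1) * D) ^+ 2); [rewrite sqr_ge0 | rewrite /B; ring].
have h3 : (Lv + 2^-1) ^+ 2 <= 2 * Lv ^+ 2 + 2^-1.
  by rewrite -subr_ge0 (_ : _ - _ = (Lv - 2^-1) ^+ 2); [rewrite sqr_ge0 | field].
have h4 := ler_wpM2r (sqr_ge0 D) h3.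
have h5 := ler_wpM2r (sqr_ge0 D) HL.
have h6 := ler_wpM2r (sqr_ge0 e) HL.
have h7 : 0 <= Lv ^+ 2 * e ^+ 2 by rewrite mulr_ge0 ?sqr_ge0.
have h8 := sqr_ge0 D; have h9 := sqr_ge0 e.
rewrite !mulrDr (mulrA _ (3 / 10) e2).
have x1 : 8 * (2 * Lv ^+ 2 + 1) / 3 * D ^+ 2 = 16 / 3 * (Lv ^+ 2 * D ^+ 2) + 8 / 3 * D ^+ 2 by field.
have x2 : 8 * (2 * Lv ^+ 2 + 1) / 3 * e ^+ 2 = 16 / 3 * (Lv ^+ 2 * e ^+ 2) + 8 / 3 * e ^+ 2 by field.
have x3 : (2 * Lv ^+ 2 + 2^-1) * D ^+ 2 = 2 * (Lv ^+ 2 * D ^+ 2) + D ^+ 2 / 2 by field.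
have x4 : (beta * mu) ^+ 2 * (3 / 10) * e2 = 3 / 10 * ((beta * mu) ^+ 2 * e2) by ring.
rewrite x1 in h5; rewrite x2 in h6; rewrite x3 in h4; rewrite x4.
move: h1 h2 h4 h5 h6 h7 h8 h9 HA HM.
move: (D ^+ 2) (e ^+ 2) ((A + B) ^+ 2) (B ^+ 2) (A ^+ 2) ((Lv + 2^-1) ^+ 2 * D ^+ 2) (Lv ^+ 2 * D ^+ 2) (Lv ^+ 2 * e ^+ 2) ((beta * mu) ^+ 2 * e2) ((beta * mu) ^+ 2 * D ^+ 2) ((beta * mu) ^+ 2 * e ^+ 2).
by clear => *; lra.
Qed.

End AverageArithmetic.

Lemma measurable_random_index (R : realType) dom d' (Om : measurableType dom) (T' : measurableType d')
  (Pr : probability Om R) (ind : {RV Pr >-> nat}) (g : nat -> Om -> T') :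
  (forall i, measurable_fun setT (g i)) -> measurable_fun setT (fun w => g (ind w) w).
Proof.
move=> mg _ B mB; rewrite setTI.
rewrite (_ : _ @^-1` B = \bigcup_i (ind @^-1` [set i] `&` g i @^-1` B)).
  apply: bigcup_measurable => i _; apply: measurableI; last exact: preimage_measurable.
  by apply: preimage_measurable => //; exact: measurable_funPT.
apply/seteqP; split=> [w Bw|w [i _ /= [e Bw]]]; first by exists (ind w).
by rewrite /= e.
Qed.

Section RealMoments.
Variables (R : realType) (d : measure_display) (T : measurableType d) (P : probability T R).

Lemma integral_sum_real (K : nat) (a : nat -> T -> R) (A : nat -> R) :
  (forall i, measurable_fun setT (a i)) -> (forall i x, 0 <= a i x) ->
  (forall i, (i < K)%N -> \int[P]_x (a i x)%:E = (A i)%:E)%E ->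
  (\int[P]_x (\sum_(i < K) a i x)%:E = (\sum_(i < K) A i)%:E)%E.
Proof.
move=> ma a0 aA; under eq_integral do rewrite -sumEFin.
rewrite ge0_integral_sum//; last 2 first.
- by move=> i; exact/measurable_EFinP.
- by move=> i x _; rewrite lee_fin.
by rewrite -sumEFin; apply: eq_bigr => i _; exact: aA.
Qed.

Lemma integral_affine_real (x y z A B : R) (a b : T -> R) : 0 <= x -> 0 <= y -> 0 <= z ->
  measurable_fun setT a -> measurable_fun setT b -> (forall t, 0 <= a t) -> (forall t, 0 <= b t) ->
  (\int[P]_t (a t)%:E = A%:E)%E -> (\int[P]_t (b t)%:E = B%:E)%E ->
  (\int[P]_t (x * a t + (y * b t + z))%:E = (x * A + (y * B + z))%:E)%E.
Proof.
move=> x0 y0 z0 ma mb a0 b0 aA bB.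
have mxa : measurable_fun setT (fun t => x * a t) by exact: measurable_funM.
have myb : measurable_fun setT (fun t => y * b t) by exact: measurable_funM.
rewrite ge0_integralD_real//; first last.
- by move=> t; rewrite addr_ge0// mulr_ge0.
- by move=> t; rewrite mulr_ge0.
- exact: measurable_funD.
rewrite ge0_integralD_real//; last by move=> t; rewrite mulr_ge0.
rewrite !ge0_integralZ_real// aA bB -!EFinM.
by have := expectation_cst P z; rewrite unlock => ->.
Qed.

Lemma measurable_affine (x y z : R) (a b : T -> R) : measurable_fun setT a -> measurable_fun setT b ->
  measurable_fun setT (fun t => x * a t + (y * b t + z)).
Proof.
move=> ma mb; apply: measurable_funD; first exact: measurable_funM.
by apply: measurable_funD => //; exact: measurable_funM.
Qed.

Lemma integral_le_affine (x y z A B : R) (g a b : T -> R) : 0 <= x -> 0 <= y -> 0 <= z ->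
  measurable_fun setT g ->
  measurable_fun setT a -> measurable_fun setT b -> (forall t, 0 <= a t) -> (forall t, 0 <= b t) ->
  (\int[P]_t (a t)%:E = A%:E)%E -> (\int[P]_t (b t)%:E = B%:E)%E -> (forall t, 0 <= g t) ->
  {ae P, forall t, g t <= x * a t + (y * b t + z)} ->
  (\int[P]_t (g t)%:E <= (x * A + (y * B + z))%:E)%E.
Proof.
move=> x0 y0 z0 mg ma mb a0 b0 aA bB g0 gle.
rewrite -(integral_affine_real x0 y0 z0 ma mb a0 b0 aA bB).
apply: ae_ge0_le_integral => //.
- by move=> t _; rewrite lee_fin.
- exact/measurable_EFinP.
- by move=> t _; rewrite lee_fin !addr_ge0// mulr_ge0.
- by apply/measurable_EFinP; exact: measurable_affine.
- by apply: filterS gle => t tle _; rewrite lee_fin.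
Qed.

Lemma expected_inequality (t y z A B : R) (a b : T -> R) : 0 <= t -> 0 <= y -> 0 <= z ->
  measurable_fun setT a -> measurable_fun setT b -> (forall t, 0 <= a t) -> (forall t, 0 <= b t) ->
  (\int[P]_t (a t)%:E = A%:E)%E -> (\int[P]_t (b t)%:E = B%:E)%E ->
  (forall w, t * a w <= y * b w + z) -> t * A <= y * B + z.
Proof.
move=> t0 y0 z0 ma mb a0 b0 aA bB le.
rewrite -lee_fin EFinM -aA -ge0_integralZ_real//.
have := @integral_le_affine 0 y z A B (fun w => t * a w) a b (lexx _) y0 z0 _ ma mb a0 b0 aA bB.
rewrite mul0r add0r; apply; first exact: measurable_funM.
- by move=> w; rewrite mulr_ge0.
- by apply: aeW => w; rewrite mul0r add0r.
Qed.

Lemma sum_affine (K : nat) (x z : R) (a : nat -> R) :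
  \sum_(i < K) (x * a i + z) = x * (\sum_(i < K) a i) + K%:R * z.
Proof. by rewrite big_split/= -mulr_sumr sumr_const card_ord -(mulr_natl z). Qed.

Lemma sum_affine2 (K : nat) (x y z : R) (a b : nat -> R) :
  \sum_(i < K) (x * a i + (y * b i + z)) = x * (\sum_(i < K) a i) + (y * (\sum_(i < K) b i) + K%:R * z).
Proof. by rewrite big_split/= -mulr_sumr sum_affine. Qed.

Lemma integral_fin_real (c : R) (a : T -> R) : (forall t, 0 <= a t) ->
  (\int[P]_t (a t)%:E <= c%:E)%E -> (\int[P]_t (a t)%:E = (fine (\int[P]_t (a t)%:E))%:E)%E.
Proof.
move=> a0 ac; rewrite fineK// ge0_fin_numE; first exact: le_lt_trans ac (ltry _).
exact: ge0_integral_real.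
Qed.

Lemma integral_le_cst (c : R) (a : T -> R) : measurable_fun setT a -> (forall t, 0 <= a t <= c) ->
  (\int[P]_t (a t)%:E <= c%:E)%E.
Proof.
move=> ma ac; apply: (@le_trans _ _ (\int[P]_t c%:E)%E).
  by apply: ge0_le_integral_real.
by have := expectation_cst P c; rewrite unlock => ->.
Qed.

End RealMoments.

Section StepVariance.
Variables (R : realType) (n : nat).

Lemma stationarity_total (x sd se K B e2 : R) : x * sd + 2 * (5 / 4 * se + 5 * K * B) <= K * e2 ->
  x * sd + (2 * (5 / 4) * se + K * (2 * (5 * B))) <= K * e2.
Proof. by move=> ?; lra. Qed.

Lemma feasibility_total (c0 x sd se K B e2 : R) :
  c0 + (3 / 10 * K * e2 + x * sd + (5 / 4 * se + 5 * K * B)) <= K * e2 ->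
  c0 + (x * sd + (5 / 4 * se + K * (3 / 10 * e2 + 5 * B))) <= K * e2.
Proof. by move=> ?; lra. Qed.

Lemma stationarity_split (x a b B : R) :
  x * a + 2 * (5 / 4 * b + 5 * B) = x * a + (2 * (5 / 4) * b + 2 * (5 * B)).
Proof. by ring. Qed.

Lemma feasibility_split (e x a b B : R) :
  e + x * a + (5 / 4 * b + 5 * B) = x * a + (5 / 4 * b + (e + 5 * B)).
Proof. by ring. Qed.

Lemma step_var_arith (L S b b' P Q al V : R) : 0 <= al -> al <= 1 -> 0 <= L -> 0 <= S -> 0 <= b -> 0 <= b' ->
  0 <= P -> P <= Q ->
  2 * (1 - al) ^+ 2 * (2 * S * (2 * (L * P) + 8 * b') + 2 * (2 * (L * P) + 8 * b)) + 2 * al ^+ 2 * V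
  <= 8 * (S + 1) * L * Q + (2 * (16 * S * b' + 16 * b) + 2 * al ^+ 2 * V).
Proof.
move=> a0 a1 L0 S0 B0 B'0 P0 PQ.
have t2 : (1 - al) ^+ 2 <= 1 by rewrite expr_le1// ?subr_ge0// lerBlDr lerDl.
have t0 : 0 <= (1 - al) ^+ 2 by exact: sqr_ge0.
rewrite addrA lerD2r.
have SP := ler_wpM2l S0 (ler_wpM2l L0 PQ); have LP := ler_wpM2l L0 PQ.
have W0 : 0 <= 4 * (S * (L * P)) + 16 * (S * b') + 4 * (L * P) + 16 * b.
  by rewrite !addr_ge0// !mulr_ge0.
have -> : 2 * (1 - al) ^+ 2 * (2 * S * (2 * (L * P) + 8 * b') + 2 * (2 * (L * P) + 8 * b)) =
   2 * ((1 - al) ^+ 2 * (4 * (S * (L * P)) + 16 * (S * b') + 4 * (L * P) + 16 * b)) by ring.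
have := ler_wpM2r W0 t2; rewrite mul1r.
have -> : 8 * (S + 1) * L * Q = 8 * (S * (L * Q)) + 8 * (L * Q) by ring.
have -> : 2 * (16 * S * b' + 16 * b) = 32 * (S * b') + 32 * b by ring.
move: SP LP; move: ((1 - al) ^+ 2 * _) => Z.
by move: (S * (L * P)) (L * P) (S * (L * Q)) (L * Q) (S * b') => *; lra.
Qed.

Lemma step_var_bound (Lf Mf sigma nu r q : R) (x y : 'rV[R]_n) (al : R) : 0 < q -> q <= 2 -> 0 <= al <= 1 ->
  step_var Lf Mf sigma nu r x y (1 - al) <=
  8 * (sqS n r + 1) * Lf ^+ 2 * pnorm q (x - y) ^+ 2
  + (2 * (16 * sqS n r * (Lf ^+ 2 * nu ^+ 2 * n%:R ^+ 2) + 16 * (Lf ^+ 2 * nu ^+ 2 * n%:R ^+ 3))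
     + 2 * al ^+ 2 * var_one n Lf Mf sigma nu r).
Proof.
move=> q0 q2 /andP[a0 a1].
have h : pnorm 2 (x - y) <= pnorm q (x - y) by exact: ler_pnorm.
have := sqr_mono (pnorm_ge0 _ _) h; have := sqr_ge0 (pnorm 2 (x - y)).
rewrite /step_var /var_diff; cbv zeta.
have e1 : 1 - (1 - al) = al by ring.
rewrite e1.
have L2 : 0 <= Lf ^+ 2 by exact: sqr_ge0.
have sS : 0 <= sqS n r by exact: sqr_ge0.
have b1 : 0 <= Lf ^+ 2 * nu ^+ 2 * n%:R ^+ 3 by rewrite mulr_ge0 ?exprn_ge0// mulr_ge0// sqr_ge0.
have b2 : 0 <= Lf ^+ 2 * nu ^+ 2 * n%:R ^+ 2 by rewrite mulr_ge0 ?exprn_ge0// mulr_ge0// sqr_ge0.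
by move=> P0 PQ; exact: (step_var_arith _ a0 a1 L2 sS b1 b2 P0 PQ).
Qed.

End StepVariance.

Section ProxContinuity.
Variables (R : realType) (n : nat).

Lemma pnorm_lipschitz_continuous p q (g : 'rV[R]_n -> 'rV[R]_n) (M : R) : 1 <= p -> 0 < q -> 0 <= M ->
  (forall x y, pnorm q (g x - g y) <= M * pnorm p (x - y)) -> continuous g.
Proof.
move=> p1 q0 M0 gl x; apply: (@cvg_rV _ _ _ (nbhs_filter x)) => i.
have C0 : 0 < M * n%:R + 1 by rewrite ltr_wpDl// mulr_ge0.
apply/(@cvgrPdist_le _ _ _ (nbhs x) (nbhs_filter x)) => e e0.
apply/nbhs_ballP; exists (e / (M * n%:R + 1)) => /=; first exact: divr_gt0.
move=> y; rewrite -ball_normE /ball_/= ltr_pdivlMr// => h.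
have -> : g x ord0 i - g y ord0 i = (g x - g y) ord0 i by rewrite !mxE.
apply: (le_trans (coord_le_pnorm (g x - g y) i q0)); apply: (le_trans (gl _ _)).
apply: (le_trans (ler_wpM2l M0 (pnorm_le_norm _ p1))); rewrite mulrA.
by apply: ltW; apply: le_lt_trans h; rewrite mulrC ler_wpM2l// lerDl.
Qed.

End ProxContinuity.

Section DescentArithmetic.
Variable R : realType.

Lemma telescope (K : nat) (Phi a b : nat -> R) (t e B z : R) :
  (forall i, (i < K)%N -> Phi i.+1 + t * b i <= Phi i + e * (5 / 4 * a i + 5 * B) + z) ->
  Phi K + t * \sum_(i < K) b i
    <= Phi 0%N + e * (5 / 4 * \sum_(i < K) a i + 5 * K%:R * B) + K%:R * z.
Proof.
elim: K => [_|K IH step]; first by rewrite !big_ord0; lra.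
have {}IH := IH (fun i h => step i (ltnW h)).
by have := step K (ltnSn K); rewrite !big_ord_recr/= -natr1 => ?; lra.
Qed.

Lemma descent_sumS (S1 H1 S2 H2 t a e b B P z z' : R) :
  S2 + H2 + t * a <= S1 + H1 + e * P -> e * P <= e * (5 / 4 * b + 5 * B) -> z <= z' ->
  S2 + z + H2 + t * a <= S1 + H1 + e * (5 / 4 * b + 5 * B) + z'.
Proof. by move=> *; lra. Qed.

Lemma lagrangian_lower (Phi f h dv w M : R) : Phi <= f + h -> - M <= dv -> 0 <= w ->
  Phi - M <= f + dv + w + h.
Proof. by move=> *; lra. Qed.

(** [M] is m rho Mcbar^2. The K multiplier updates together cost [M], and the final Lagrangian is
    bounded below by Phi_inf - [M]; hence the summand 2 m rho Mcbar^2 of Delta_0. *)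
Lemma descent_total (t sa SK HK S0 H0 e sb K B M Phi mm rho cb : R) :
  (SK + HK) + t * sa <= (S0 + H0) + e * (5 / 4 * sb + 5 * K * B) + K * (rho / K * (mm * (cb * cb))) ->
  K != 0 -> M = mm * (rho * cb * cb) ->
  Phi - M <= SK + HK ->
  t * sa <= e * (5 / 4) * sb + (e * (5 * K * B) + (S0 + H0 - Phi + 2 * mm * rho * cb ^+ 2)).
Proof.
move=> H K0 -> L.
have E : K * (rho / K * (mm * (cb * cb))) = mm * (rho * cb * cb) by field.
have E2 : 2 * mm * rho * cb ^+ 2 = 2 * (mm * (rho * cb * cb)) by rewrite expr2; ring.
by rewrite E in H; rewrite E2; move: H L; move: (mm * _) => M' *; lra.
Qed.

(** The uneven weights leave the stochastic error almost unamplified; the factor 5 falls on the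
    bias, which nu makes small. *)
Lemma sqr_split54 (A B : R) : (A + B) ^+ 2 <= 5 / 4 * A ^+ 2 + 5 * B ^+ 2.
Proof. by rewrite -subr_ge0 (_ : _ - _ = (A / 2 - 2 * B) ^+ 2); [exact: sqr_ge0 | field]. Qed.

Lemma sqr_sum3 (x y z : R) : (x + y + z) ^+ 2 <= 3 * (y ^+ 2 + z ^+ 2 + x ^+ 2).
Proof.
rewrite -subr_ge0 (_ : _ - _ = (x - y) ^+ 2 + (x - z) ^+ 2 + (y - z) ^+ 2); last by ring.
by rewrite !addr_ge0// sqr_ge0.
Qed.

End DescentArithmetic.

(** * Convergence to an approximate KKT point *)

Section Convergence.
Variables (R : realType) (m d : nat) (k : constants R) (p q : R)
  (dxi dom : measure_display) (Xi : measurableType dxi) (Om : measurableType dom)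
  (Pr : probability Om R) (pb : problem R d m Xi) (x0 : 'rV[R]_d) (Phi_inf : R)
  (O : set 'rV[R]_d) (Pu : probability (borelRV R d) R)
  (u : nat -> nat -> {RV Pr >-> borelRV R d}) (xi : nat -> nat -> {RV Pr >-> Xi})
  (ind : {RV Pr >-> nat}) (mu eta nu alpha e2 r : R) (n0 N K : nat).
Local Notation X := (feas pb).
Local Notation f := (obj pb).
Local Notation h := (reg pb).
Local Notation c := (con pb).
Local Notation F := (sobj pb).
Local Notation RVd := (borelRV R d).
Local Notation RVm := (borelRV R m).
Local Notation v := (vdelta q (cdelta k)).
Local Notation hr := (fun x : 'rV[R]_d => fine (h x)).
Local Notation Lv := (par_Lv k d q).
Local Notation Lmu := (lag_lip m (cMc k) (cMcbar k) (cLc k) (cLf k) mu (crho k)).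
Local Notation rho_ := (fun _ : nat => crho k / K%:R).
Hypotheses (hk : constants_pos k) (d3 : (3 <= d)%N) (p2 : 2 <= p) (pq : p^-1 + q^-1 = 1).
Hypotheses (setting : problem_setting pb) (rad : rademacher Pu) (oO : open O)
  (sO : smoothing_region pb nu Pu `<=` O) (A1 : assumption_A1 pb k q O Phi_inf)
  (A2 : assumption_A2 pb k O) (A3 : assumption_A3 pb k O) (Xx0 : X x0)
  (samp : sampling u xi ind Pu (law pb) n0 N K).
Hypotheses (mu0 : 0 < mu) (eta0 : 0 < eta) (nu0 : 0 < nu) (e20 : 0 <= e2).
Hypotheses (n00 : (0 < n0)%N) (N0 : (0 < N)%N) (K0 : (0 < K)%N).
Hypotheses (r2 : 2 <= r) (rp : r <= p) (eta_small : 2 * eta * Lmu <= 1).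

Let Lf0 : 0 < cLf k. Proof. by case: hk => -[]. Qed.
Let Mf0 : 0 < cMf k. Proof. by case: hk => -[]. Qed.
Let Mh0 : 0 < cMh k. Proof. by case: hk => -[]. Qed.
Let Mc0 : 0 < cMc k. Proof. by case: hk => -[]. Qed.
Let Mcb0 : 0 < cMcbar k. Proof. by case: hk => _ [[]]. Qed.
Let Lc0 : 0 < cLc k. Proof. by case: hk => _ [[]]. Qed.
Let beta0 : 0 < cbeta k. Proof. by case: hk => _ [[]]. Qed.
Let rho0 : 0 < crho k. Proof. by case: hk => _ [_ []]. Qed.
Let dl0 : 0 < cdelta k. Proof. by case: hk => _ [_ []]. Qed.
Let d0 : (0 < d)%N. Proof. exact: leq_trans d3. Qed.
Let q12 := conj_itv p2 pq.
Let q1 : 1 < q. Proof. by case/andP: q12. Qed.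
Let q2 : q <= 2. Proof. by case/andP: q12. Qed.
Let q0 : 0 < q. Proof. exact: lt_trans q1. Qed.
Let p1 : 1 < p. Proof. by apply: lt_le_trans p2; rewrite ltr1n. Qed.
Let r1 : 1 < r. Proof. by apply: lt_le_trans r2; rewrite ltr1n. Qed.
Let r0 : 0 < r. Proof. exact: lt_trans r1. Qed.

Let Xconv : forall x y (t : R), X x -> X y -> 0 <= t <= 1 -> X (x + t *: (y - x)).
Proof. by case: A1 => -[_ _ cX _] _; exact: convex_setP. Qed.
Let X0 : X !=set0. Proof. by case: A1 => -[]. Qed.
Let XD x : X x -> pnorm q x <= cDX k.
Proof. by case: A1 => -[_ _ _ H] _; exact: H. Qed.
Let Xcomp : compact X.
Proof. by case: A1 => -[_ cX _ H] _; exact: pnorm_bounded_compact q0 cX H. Qed.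
Let Xsm x : X x -> smooth_pt O nu x.
Proof. exact: smooth_pt_region rad sO. Qed.
Let XO x : X x -> O x. Proof. by move=> Xx; exact: smooth_pt_in (Xsm Xx). Qed.
Let h_fin x : X x -> h x = (fine (h x))%:E.
Proof.
case: setting => -[_ _ _ hny _] _; case: A1 => _ [_ [[hp _ hs _] _]] Xx.
exact: (reg_fin hny hp hs Xx).
Qed.
Let h_lip x y : X x -> X y -> hr x - hr y <= cMh k * pnorm 2 (x - y).
Proof.
case: setting => -[_ _ _ hny _] _; case: A1 => _ [_ [[hp _ hs hb] _]].
exact: (reg_lipschitz hny hp hs hb).
Qed.
Let h_conv x y (t : R) : X x -> X y -> 0 <= t <= 1 -> hr (x + t *: (y - x)) <= hr x + t * (hr y - hr x).
Proof.
case: setting => -[_ _ _ hny hc] _; case: A1 => _ [_ [[hp _ hs _] _]].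
exact: (reg_convex hny hp hs hc Xconv).
Qed.
Let fdiff x : differentiable f x.
Proof. by case: setting => -[_ [H _] _ _ _] _; exact: H. Qed.
Let fcont : continuous f. Proof. by move=> x; exact: differentiable_continuous. Qed.
Let gfcont : continuous (grad f).
Proof. by case: setting => -[_ [_ H] _ _ _] _. Qed.
Let cdiff i x : differentiable (Defs.comp c i) x.
Proof. by case: setting => -[_ _ H _ _] _; case: (H i) => H1 _; exact: H1. Qed.
Let gccont i : continuous (grad (Defs.comp c i)).
Proof. by case: setting => -[_ _ H _ _] _; case: (H i). Qed.
Let flipO x y : O x -> O y -> pnorm 2 (grad f x - grad f y) <= cLf k * pnorm 2 (x - y).
Proof. by case: A1 => _ [H _] Ox Oy; case: (H x y Ox Oy). Qed.
Let fMO x : O x -> pnorm 2 (grad f x) <= cMf k.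
Proof.
move=> Ox; apply: (grad_le_lipschitz oO Ox fdiff (ltW Mf0)) => y z Oy Oz.
by case: A1 => _ [H _]; case: (H y z Oy Oz).
Qed.
Let flip x y : X x -> X y -> pnorm 2 (grad f x - grad f y) <= cLf k * pnorm 2 (x - y).
Proof. by move=> Xx Xy; exact: flipO (XO Xx) (XO Xy). Qed.
Let fM x : X x -> pnorm 2 (grad f x) <= cMf k. Proof. by move=> Xx; exact: fMO (XO Xx). Qed.
Let cb i x : X x -> `|Defs.comp c i x| <= cMcbar k.
Proof. by case: A1 => _ [_ [_ [H _]]] Xx; case: (H i x x Xx Xx). Qed.
Let cM i x : X x -> pnorm 2 (grad (Defs.comp c i) x) <= cMc k.
Proof. by case: A1 => _ [_ [_ [H _]]] Xx; case: (H i x x Xx Xx). Qed.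
Let cL i x y : X x -> X y ->
  pnorm 2 (grad (Defs.comp c i) x - grad (Defs.comp c i) y) <= cLc k * pnorm 2 (x - y).
Proof. by case: A1 => _ [_ [_ [H _]]] Xx Xy; case: (H i x y Xx Xy). Qed.
Let inf_le x : X x -> Phi_inf <= f x + hr x.
Proof.
case: A1 => _ [_ [_ [_ H]]] Xx; have := H x Xx.
by rewrite (h_fin Xx) -EFinD lee_fin.
Qed.

Let v_line (x w : 'rV[R]_d) (t : R) :
  is_derive t 1 (fun s : R => v (x + s *: w)) (dotv (grad v (x + t *: w)) w).
Proof. exact: (is_derive_vdelta d0 dl0 p2 pq). Qed.
Let v_mono (x y : 'rV[R]_d) : pnorm q (y - x) ^+ 2 <= dotv (grad v y - grad v x) (y - x).
Proof. exact: (vdelta_mono d0 dl0 p2 pq). Qed.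
Let v_cont : continuous (v : 'rV[R]_d -> R).
Proof. by move=> x; apply: (cvg_vdelta d0 dl0 (F := nbhs x) (f := id)). Qed.
Let gv_cont : continuous (grad (v : 'rV[R]_d -> R)).
Proof. by move=> x; apply: (cvg_grad_vdelta d0 dl0 p2 pq (F := nbhs x) (f := id)). Qed.
Let v_lip x y : X x -> X y -> pnorm p (grad v y - grad v x) <= Lv * pnorm q (y - x).
Proof. by move=> Xx Xy; exact: (vdelta_lipschitz d0 dl0 p2 pq (XD Xx) (XD Xy)). Qed.

Let Lv0 : 0 <= Lv.
Proof.
have qm : 0 < q - 1 by rewrite subr_gt0.
rewrite /par_Lv addr_ge0//; first by rewrite divr_ge0 ?subr_ge0// ltW.
by rewrite mulr_ge0 ?powR_ge0// mulr_ge0 ?powR_ge0// invr_ge0 ltW.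
Qed.

Let mf : measurable_fun [set: RVd] (f : RVd -> R). Proof. exact: continuous_measurable_real. Qed.
Let mgf : measurable_fun [set: RVd] (grad f : RVd -> RVd). Proof. exact: continuous_measurable_rV. Qed.
Let mc : measurable_fun [set: RVd] (c : RVd -> RVm).
Proof.
apply: measurable_rV => i; apply: (@continuous_measurable_real _ _ (Defs.comp c i)) => x.
exact: differentiable_continuous.
Qed.

Let mgT d' (T : measurableType d') (x : T -> RVd) (l : T -> RVm) : measurable_fun setT x -> measurable_fun setT l ->
  measurable_fun setT ((fun w => gradT c (x w) ((l w : 'rV[R]_m) + mu *: c (x w))) : T -> RVd).
Proof.
move=> mx ml; apply: measurable_sum_rV => i; apply: measurable_scale_rV.
  apply: measurable_coord_comp; apply: measurable_add_rV => //.
  by apply: measurable_scale_rV; [exact: measurable_cst | exact: (measurableT_comp mc mx)].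
exact: (measurableT_comp (continuous_measurable_rV (gccont (i := i))) mx).
Qed.

Local Notation nxtX := (nxt pb v mu eta).

Let nxtE z : nxtX z = next_pt eta v X h c mu z.1.1 z.1.2 z.2.
Proof. by rewrite /nxt (mirror_stepX eta v h_fin). Qed.

Let mnxt : measurable_fun setT nxtX.
Proof.
have mg : measurable_fun setT
    ((fun z : RVd * RVd * RVm => next_arg eta v c mu z.1.1 z.1.2 z.2) : RVd * RVd * RVm -> RVd).
  have m11 : measurable_fun [set: RVd * RVd * RVm] (fun z => z.1.1).
    exact: (measurableT_comp measurable_fst measurable_fst).
  apply: measurable_sub_rV.
    apply: measurable_add_rV; first exact: (measurableT_comp measurable_snd measurable_fst).
    by apply: mgT => //; exact: measurable_snd.
  apply: measurable_scale_rV; first exact: measurable_cst.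
  exact: (measurableT_comp (continuous_measurable_rV gv_cont) m11).
have pc : continuous (prox eta v X h).
  apply: (pnorm_lipschitz_continuous (ltW p1) q0 (ltW eta0)) => y z.
  exact: (prox_lipschitz p1 q1 pq eta0 v_line v_mono v_cont X0 Xcomp Xconv h_fin h_conv h_lip).
have -> : nxtX = (prox eta v X h : RVd -> RVd) \o
    (fun z : RVd * RVd * RVm => next_arg eta v c mu z.1.1 z.1.2 z.2 : RVd).
  by apply/funext => z; rewrite nxtE.
exact: (measurableT_comp (continuous_measurable_rV pc) mg).
Qed.

Let Xnxt z : X (nxtX z).
Proof. by rewrite nxtE; exact: (next_in eta c mu v_cont X0 Xcomp h_fin h_lip). Qed.

Let sv0 x y th : X x -> X y -> 0 <= th <= 1 -> 0 <= step_var (cLf k) (cMf k) (csigma k) nu r x y th.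
Proof.
move=> _ _ _; have L2 : 0 <= cLf k ^+ 2 by exact: sqr_ge0.
have n2 : 0 <= nu ^+ 2 by exact: sqr_ge0.
have sS : 0 <= sqS d r by exact: sqr_ge0.
have pn : 0 <= pnorm 2 (x - y) ^+ 2 by exact: sqr_ge0.
have n3 : 0 <= d%:R ^+ 3 :> R by exact: exprn_ge0.
have n4 : 0 <= d%:R ^+ 2 :> R by exact: exprn_ge0.
have s2 : 0 <= csigma k ^+ 2 + cMf k ^+ 2 by rewrite addr_ge0 ?sqr_ge0.
have b1 : 0 <= cLf k ^+ 2 * nu ^+ 2 * d%:R ^+ 3 by exact: mulr_ge0 (mulr_ge0 L2 n2) n3.
have b2 : 0 <= cLf k ^+ 2 * nu ^+ 2 * d%:R ^+ 2 by exact: mulr_ge0 (mulr_ge0 L2 n2) n4.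
have b3 := mulr_ge0 L2 pn.
have vd : 0 <= var_diff (cLf k) nu r x y.
  apply: addr_ge0; apply: mulr_ge0; [exact: (mulr_ge0 (ler0n _ 2) sS)| |exact: (ler0n _ 2)|];
    apply: addr_ge0; apply: mulr_ge0 => //; exact: ler0n.
have vo : 0 <= var_one d (cLf k) (cMf k) (csigma k) nu r.
  apply: addr_ge0; apply: mulr_ge0; [exact: (mulr_ge0 (ler0n _ 2) sS)| |exact: (ler0n _ 2)|];
    apply: addr_ge0; apply: mulr_ge0 => //; first [exact: ler0n | exact: sqr_ge0].
by rewrite /step_var addr_ge0// mulr_ge0// mulr_ge0// sqr_ge0.
Qed.

Let step x y th a (c0 : R) : X x -> X y -> 0 <= th <= 1 ->
  (eavg (law pb) (fun s t => pnorm r (a + c0 *: zstep F f nu x y th s t) ^+ 2)%R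
     <= (pnorm r a ^+ 2 + c0 ^+ 2 * ((r - 1) * step_var (cLf k) (cMf k) (csigma k) nu r x y th))%:E)%E.
Proof.
move=> Xx Xy th01; have [_ [mF Fint Fm FC1]] := setting.
have Fmean y' : (\int[law pb]_t (F y' t)%:E = (f y')%:E)%E by have := Fm y'; rewrite unlock.
apply: (batch_step (ltW Lf0) (ltW Mf0) nu0 Fint Fmean fdiff flipO fMO FC1
  (fun _ => sgrad_measurable A2 (x := _)) (fun _ => sgrad_variance A2 (x := _))
  (fun _ _ => sgrad_lipschitz A3 Lf0) d0 r2 (Xsm Xx) (Xsm Xy) th01).
Qed.

Local Notation rn := (run u xi pb v x0 mu eta nu alpha rho_ n0 N).
Local Notation err := (run_err u xi pb v x0 mu eta nu alpha rho_ n0 N).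
Local Notation xx i w := ((rn i w).1.1 : 'rV[R]_d).
Local Notation ss i w := ((rn i w).1.2 : 'rV[R]_d).
Local Notation ll i w := ((rn i w).2 : 'rV[R]_m).
Local Notation B2 := (cLf k ^+ 2 * nu ^+ 2 * d%:R ^+ 3).
Local Notation sqe i w := (pnorm r (err i w) ^+ 2).
Local Notation sqd i w := (pnorm q (xx i.+1 w - xx i w) ^+ 2).
Local Notation Del := (smooth_lag c f mu 0 x0 + hr x0 - Phi_inf + 2 * m%:R * crho k * cMcbar k ^+ 2).

Let rx0 w : xx 0 w = x0. Proof. by []. Qed.
Let rl0 w : ll 0 w = 0. Proof. by []. Qed.
Let errE i w : err i w = ss i w - gnu f nu (xx i w). Proof. by []. Qed.

Opaque run run_err nxt.

Let xX i w : X (xx i w). Proof. exact: run_in Xx0 Xnxt i w. Qed.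

Let xS i w : xx i.+1 w = next_pt eta v X h c mu (xx i w) (ss i w) (ll i w).
Proof. by rewrite run_xS nxtE. Qed.

Let lam_bound i w j : (i <= K)%N -> `|ll i w ord0 j| <= crho k * cMcbar k.
Proof.
have H : `|ll i w ord0 j| <= i%:R * (crho k / K%:R * cMcbar k).
  elim: i => [|i IH]; first by rewrite rl0 mxE normr0 mul0r.
  rewrite run_lamS !mxE -natr1 mulrDl mul1r; apply: (le_trans (ler_normD _ _)); apply: lerD => //.
  rewrite normrM ger0_norm ?divr_ge0 ?(ltW rho0)//.
  by apply: ler_wpM2l; [rewrite divr_ge0// ltW | exact: cb].
move=> iK; apply: (le_trans H).
rewrite mulrA; apply: ler_wpM2r; first exact: ltW.
rewrite mulrCA ler_piMr ?(ltW rho0)// ler_pdivrMr ?ltr0n// mul1r ler_nat.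
exact: iK.
Qed.

(** The centred error is measured in the [r]-norm, which dominates the [p]-norm since [r <= p]; the
    bias is measured in the 2-norm, which dominates it since [p >= 2]. *)
Let err_bound i w : pnorm p (ss i w - grad f (xx i w)) ^+ 2 <= 5 / 4 * sqe i w + 5 * B2.
Proof.
have bias : pnorm 2 (gnu f nu (xx i w) - grad f (xx i w)) ^+ 2 <= B2.
  exact: (gnu_bias (ltW Lf0) nu0 fdiff flipO (Xsm (xX i w))).
have e : ss i w - grad f (xx i w) = err i w + (gnu f nu (xx i w) - grad f (xx i w)).
  by rewrite errE addrA subrK.
rewrite e.
have h1 : pnorm p (err i w) <= pnorm r (err i w) by exact: ler_pnorm.
have h2 : pnorm p (gnu f nu (xx i w) - grad f (xx i w)) <= pnorm 2 (gnu f nu (xx i w) - grad f (xx i w)).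
  exact: ler_pnorm.
have h3 := le_trans (ler_pnormD _ _ p1) (lerD h1 h2).
apply: (le_trans (sqr_mono (pnorm_ge0 _ _) h3)).
apply: (@le_trans _ _ (5 / 4 * sqe i w + 5 * pnorm 2 (gnu f nu (xx i w) - grad f (xx i w)) ^+ 2)).
  exact: sqr_split54.
by rewrite lerD2l; exact: (ler_wpM2l (ler0n _ 5) bias).
Qed.

Let B20 : 0 <= B2.
Proof. exact: mulr_ge0 (mulr_ge0 (sqr_ge0 _) (sqr_ge0 _)) (exprn_ge0 _ (ler0n _ _)). Qed.

(** The last summand pays for the multiplier update, which changes the Lagrangian at x^(n+1) by (rho
    / K) times the inner product of c(x^n) and c(x^(n+1)). *)
Let path_step w n : (n < K)%N ->
  smooth_lag c f mu (ll n.+1 w) (xx n.+1 w) + hr (xx n.+1 w) + (2 * eta)^-1 * sqd n w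
    <= smooth_lag c f mu (ll n w) (xx n w) + hr (xx n w) + eta * (5 / 4 * sqe n w + 5 * B2)
       + crho k / K%:R * (m%:R * (cMcbar k * cMcbar k)).
Proof.
move=> nK.
have lb j : `|ll n w ord0 j| <= crho k * cMcbar k by exact: (lam_bound w j (ltnW nK)).
have D := descent_step p2 q1 q2 pq eta0 mu0 (ltW rho0) (ltW Mc0) (ltW Mcb0) (ltW Lc0) (ltW Lf0)
  v_line v_mono v_cont X0 Xcomp Xconv h_fin h_conv h_lip cdiff cb cM cL fdiff flip eta_small (ss n w) (xX n w) lb.
rewrite -xS in D.
have E := ler_wpM2l (ltW eta0) (err_bound n w).
have lamE : smooth_lag c f mu (ll n.+1 w) (xx n.+1 w) = smooth_lag c f mu (ll n w) (xx n.+1 w)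
    + crho k / K%:R * dotv (c (xx n w)) (c (xx n.+1 w)).
  rewrite /smooth_lag run_lamS dotvDl dotvZl.
  by move: (dotv _ _) (dotv _ _) (f _) (_ * pnorm _ _ ^+ 2) => *; ring.
have cc : dotv (c (xx n w)) (c (xx n.+1 w)) <= m%:R * (cMcbar k * cMcbar k).
  apply: (le_trans (ler_norm _)); apply: (dotv_con_le cb (xX n.+1 w) (ltW Mcb0)) => j; exact: (cb j (xX n w)).
have rK : 0 <= crho k / K%:R by rewrite divr_ge0// ltW.
have C := ler_wpM2l rK cc.
by rewrite lamE; exact: (descent_sumS D E C).
Qed.

Lemma path_descent w : (2 * eta)^-1 * \sum_(i < K) sqd i w
    <= eta * (5 / 4) * \sum_(i < K) sqe i w + (eta * (5 * K%:R * B2) + Del).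
Proof.
have H := telescope (Phi := fun i => smooth_lag c f mu (ll i w) (xx i w) + hr (xx i w))
  (a := fun i => sqe i w) (b := fun i => sqd i w) (fun i => @path_step w i).
have L : Phi_inf - m%:R * (crho k * cMcbar k * cMcbar k) <= smooth_lag c f mu (ll K w) (xx K w) + hr (xx K w).
  have l1 := inf_le (xX K w).
  have A0 : 0 <= crho k * cMcbar k by rewrite mulr_ge0// ltW.
  have := dotv_con_le cb (xX K w) A0 (fun j => lam_bound w j (leqnn K)).
  rewrite ler_norml => /andP[l2 _].
  have l3 : 0 <= mu / 2 * pnorm 2 (c (xx K w)) ^+ 2 by rewrite mulr_ge0 ?sqr_ge0// divr_ge0// ltW.
  exact: (lagrangian_lower l1 l2 l3).
have Kn : K%:R != 0 :> R by rewrite pnatr_eq0 -lt0n.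
exact: (descent_total H Kn erefl L).
Qed.

Let stationarity i w :
  pnorm q (grad_mapping X h v eta (xx i w) (grad f (xx i w) + gradT c (xx i w) (ll i w + mu *: c (xx i w)))) ^+ 2
    <= 2 * (eta ^+ 2)^-1 * sqd i w + 2 * (5 / 4 * sqe i w + 5 * B2).
Proof.
have S := stationarity_step c f mu p2 q1 pq eta0 v_line v_mono v_cont X0 Xcomp Xconv h_fin h_conv h_lip
  (ss i w) (ll i w) (xX i w).
rewrite -xS in S; apply: (le_trans S); apply: lerD.
  by rewrite (exprMn _ eta^-1) exprVn mulrA.
exact: (ler_wpM2l (ler0n _ 2) (err_bound i w)).
Qed.

Hypothesis mu_lv : 8 * (2 * Lv ^+ 2 + 1) / 3 <= cbeta k ^+ 2 * mu ^+ 2.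
Hypothesis mu_eps : 40 * (cMf k ^+ 2 + cMh k ^+ 2 + m%:R ^+ 2 * crho k ^+ 2 * cMcbar k ^+ 2 * cMc k ^+ 2)
  <= cbeta k ^+ 2 * mu ^+ 2 * e2.

Let feasibility i w : (i <= K)%N -> regular_at pb k p (xx i.+1 w) ->
  pnorm p (c (xx i.+1 w)) ^+ 2 <= 3 / 10 * e2 + (eta ^+ 2)^-1 * sqd i w + (5 / 4 * sqe i w + 5 * B2).
Proof.
move=> iK; rewrite /regular_at xS => reg.
have lb j : `|ll i w ord0 j| <= crho k * cMcbar k by exact: (lam_bound w j iK).
have G := feasibility_step p2 q1 q2 eta0 mu0 (ltW rho0) (ltW Mcb0) (ltW Lc0) (ltW Mh0) (ltW Lf0)
  v_line v_cont v_lip X0 Xcomp Xconv h_fin h_conv h_lip cdiff cb cM cL fM eta_small (xX i w) lb reg.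
rewrite -xS in G *.
set A := m%:R * crho k * cMcbar k * cMc k + cMf k + cMh k in G.
have A0 : 0 <= A by rewrite /A addr_ge0 ?(ltW Mh0)// addr_ge0 ?(ltW Mf0)// !mulr_ge0// ltW.
have D0 : 0 <= eta^-1 * pnorm q (xx i.+1 w - xx i w) by rewrite mulr_ge0 ?pnorm_ge0// invr_ge0 ltW.
have A2' : A ^+ 2 <= 3 * (cMf k ^+ 2 + cMh k ^+ 2 + m%:R ^+ 2 * crho k ^+ 2 * cMcbar k ^+ 2 * cMc k ^+ 2).
  by rewrite /A -!exprMn; exact: sqr_sum3.
have H := feasibility_arith e20 D0 (pnorm_ge0 p _) Lv0 A0 beta0 mu0 (pnorm_ge0 p _) G A2' mu_eps mu_lv.
apply: (le_trans H); rewrite (exprMn _ eta^-1) exprVn.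
exact: (lerD (lexx _) (err_bound i w)).
Qed.

Hypotheses (alE : alpha = 96 * cLf k ^+ 2 * eta ^+ 2) (al1 : alpha <= 1).
Local Notation Sr := (sqS d r).
Local Notation VG := (var_one d (cLf k) (cMf k) (csigma k) nu r).
Variable sb : R.
Hypothesis S2 : 2 <= Sr.
Hypothesis hN : N%:R^-1 * (r - 1) <= Sr^-1.
Hypothesis hn0 : n0%:R^-1 * (r - 1) * sb <= 4 / 5 * e2.
Hypothesis hVG : VG <= 2 * sb.
Hypothesis hsb : alpha * sb <= Sr * e2 / 240.
Hypothesis hb' : cLf k ^+ 2 * nu ^+ 2 * d%:R ^+ 2 <= B2 / 3.
Hypothesis hb : B2 <= cLf k ^+ 2 * eta ^+ 2 * e2 / 12.
Hypothesis hb2 : B2 <= e2 / 1168.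
Hypothesis hK1 : 1 <= cLf k ^+ 2 * eta ^+ 2 * K%:R.
Hypothesis hDel : Del <= K%:R * eta * e2 / 108.
Hypothesis hc0 : pnorm 2 (c x0) ^+ 2 <= K%:R * e2 / 5.

Let al0 : 0 <= alpha.
Proof. by rewrite alE mulr_ge0 ?sqr_ge0// mulr_ge0 ?sqr_ge0. Qed.

Let al01 : 0 <= alpha <= 1. Proof. by rewrite al0 al1. Qed.

Let mF : measurable_fun [set: RVd * Xi] (fun z : RVd * Xi => F z.1 z.2).
Proof. by case: setting => _ []. Qed.

Let mrn i : measurable_fun setT (rn i).
Proof. apply: measurable_run; [exact: n00|exact: N0|exact: mF|exact: mf|exact: mc|exact: mnxt]. Qed.

Let mxx i : measurable_fun setT ((fun w => xx i w) : Om -> RVd).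
Proof. exact: (measurableT_comp measurable_fst (measurableT_comp measurable_fst (mrn i))). Qed.

Let msqe i : measurable_fun setT (fun w => sqe i w).
Proof.
apply: measurable_funX; apply: (measurable_pnorm r1); rewrite (funext (errE i)).
apply: measurable_sub_rV.
  exact: (measurableT_comp measurable_snd (measurableT_comp measurable_fst (mrn i))).
exact: (measurableT_comp (measurable_gnu nu mf) (mxx i)).
Qed.

Let msqd i : measurable_fun setT (fun w => sqd i w).
Proof. by apply: measurable_funX; apply: (measurable_pnorm q1); apply: measurable_sub_rV. Qed.

Let sqe0 i w : 0 <= sqe i w. Proof. exact: sqr_ge0. Qed.
Let sqd0 i w : 0 <= sqd i w. Proof. exact: sqr_ge0. Qed.

Let mD i : R := fine (\int[Pr]_w (sqd i w)%:E).
Let mE i : R := fine (\int[Pr]_w (sqe i w)%:E).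

Let mDE i : (\int[Pr]_w (sqd i w)%:E = (mD i)%:E)%E.
Proof.
apply: (integral_fin_real (c := (2 * cDX k) ^+ 2)); first by move=> w; exact: sqd0.
apply: integral_le_cst; first exact: msqd.
move=> w; rewrite sqd0/=; apply: (sqr_mono (pnorm_ge0 _ _)).
apply: (le_trans (ler_pnormB _ _ q1)).
by have := lerD (XD (xX i.+1 w)) (XD (xX i w)); rewrite mulrDl mul1r.
Qed.

Let mD0 i : 0 <= mD i. Proof. by apply: fine_ge0; exact: ge0_integral_real. Qed.
Let mE0 i : 0 <= mE i. Proof. by apply: fine_ge0; exact: ge0_integral_real. Qed.

Let V0 : 0 <= 2 * (16 * Sr * (cLf k ^+ 2 * nu ^+ 2 * d%:R ^+ 2) + 16 * B2) + 2 * alpha ^+ 2 * VG.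
Proof.
have z01 : 0 <= (1 - alpha) <= 1 by rewrite subr_ge0 al1 lerBlDr lerDl al0.
have := step_var_bound (cLf k) (cMf k) (csigma k) nu r x0 x0 q0 q2 al01.
rewrite subrr (pnorm0 _ q0) expr0n/= mulr0 add0r.
exact: (le_trans (sv0 Xx0 Xx0 z01)).
Qed.

Let T i : R := Sr^-1 * (8 * (Sr + 1) * cLf k ^+ 2 * mD i +
  (2 * (16 * Sr * (cLf k ^+ 2 * nu ^+ 2 * d%:R ^+ 2) + 16 * B2) + 2 * alpha ^+ 2 * VG)).

Let S0 : 0 < Sr. Proof. by apply: lt_le_trans S2; rewrite ltr0n. Qed.

Let T0 i : 0 <= T i.
Proof.
apply: mulr_ge0; first by rewrite invr_ge0 ltW.
apply: addr_ge0 V0; apply: mulr_ge0 (mD0 i); apply: mulr_ge0; last exact: sqr_ge0.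
by rewrite mulr_ge0// addr_ge0// ltW.
Qed.

Let step_int i : (i.+1 < K)%N ->
  ((N%:R^-1 * (r - 1))%:E * \int[Pr]_w (step_var (cLf k) (cMf k) (csigma k) nu r (xx i.+1 w) (xx i w) (1 - alpha))%:E
    <= (T i)%:E)%E.
Proof.
move=> iK.
have z01 : 0 <= (1 - alpha) <= 1 by rewrite subr_ge0 al1 lerBlDr lerDl al0.
have C0 : 0 <= 8 * (Sr + 1) * cLf k ^+ 2.
  by rewrite mulr_ge0 ?sqr_ge0// mulr_ge0// addr_ge0// ltW.
have I : (\int[Pr]_w (step_var (cLf k) (cMf k) (csigma k) nu r (xx i.+1 w) (xx i w) (1 - alpha))%:E
   <= (8 * (Sr + 1) * cLf k ^+ 2 * mD i + (0 * mD i +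
  (2 * (16 * Sr * (cLf k ^+ 2 * nu ^+ 2 * d%:R ^+ 2) + 16 * B2) + 2 * alpha ^+ 2 * VG)))%:E)%E.
  apply: (integral_le_affine C0 (lexx 0) V0 _ (msqd i) (msqd i) (sqd0 i) (sqd0 i) (mDE i) (mDE i)).
  - have mp : measurable_fun setT ((fun w => (xx i.+1 w, rn i w)) : Om -> RVd * (RVd * RVd * RVm)).
      by apply: measurable_fun_pair; [exact: mxx | exact: mrn].
    have mv := measurableT_comp (@measurable_stage_var R d m nu r (cLf k) (cMf k) (csigma k) (1 - alpha) 1) mp.
    have rp' : 0 < r - 1 by rewrite subr_gt0.
    rewrite (_ : (fun w => _) = (fun w => (r - 1)^-1 * stage_var nu r (cLf k) (cMf k) (csigma k) (1 - alpha) 1 (xx i.+1 w, rn i w))).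
      by apply: measurable_funM; [exact: measurable_cst | exact: mv].
    apply/funext => w; rewrite /stage_var expr1n mul1r mulrA mulVf ?gt_eqF// mul1r.
    by [].
  - by move=> w; exact: (sv0 (xX i.+1 w) (xX i w) z01).
  - apply: aeW => w; rewrite mul0r add0r.
    exact: (step_var_bound (cLf k) (cMf k) (csigma k) nu r (xx i.+1 w) (xx i w) q0 q2 al01).
have Nr0 : 0 <= N%:R^-1 * (r - 1).
  by apply: mulr_ge0; [rewrite invr_ge0 | rewrite subr_ge0 ltW].
apply: (le_trans (lee_wpmul2l _ I)); first by rewrite lee_fin.
rewrite -EFinM lee_fin mul0r add0r /T; apply: ler_wpM2r hN.
by apply: addr_ge0 V0; apply: mulr_ge0 (mD0 i).
Qed.

Let z01 : 0 <= (0 : R) <= 1. Proof. by rewrite lexx ler01. Qed.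

(** For [th] = 0 the step variance is 2 [var_one], at most 4 sigmabar^2, and n0 brings (r - 1)
    sigmabar^2 / n0 below 4/5 of e2. *)
Let mom0 : (\int[Pr]_w (sqe 0 w)%:E <= (16 / 5 * e2)%:E)%E.
Proof.
apply: (le_trans (run_moment0 v mu eta alpha rho_ rad samp r2 K0 n00 mF mf Xx0 sv0 step)).
rewrite lee_fin /step_var; cbv zeta; rewrite expr0n/= mulr0 mul0r add0r subr0 expr1n mulr1.
have Nr0 : 0 <= n0%:R^-1 * (r - 1).
  by apply: mulr_ge0; [rewrite invr_ge0 | rewrite subr_ge0 ltW].
rewrite mulrA; have := ler_wpM2l Nr0 (ler_wpM2l (ler0n _ 2) hVG).
move/le_trans; apply.
have -> : n0%:R^-1 * (r - 1) * (2 * (2 * sb)) = 4 * (n0%:R^-1 * (r - 1) * sb) by ring.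
apply: (le_trans (ler_wpM2l (ler0n _ 4) hn0)).
by rewrite le_eqVlt; apply/orP; left; apply/eqP; field.
Qed.

Let momS i : (i.+1 < K)%N -> (\int[Pr]_w (sqe i w)%:E = (mE i)%:E)%E ->
  (\int[Pr]_w (sqe i.+1 w)%:E <= ((1 - alpha) ^+ 2 * mE i + T i)%:E)%E.
Proof.
move=> iK mi.
have H := run_momentS rho_ rad samp r2 K0 n00 N0 al01 mF mf mc mnxt Xx0 Xnxt sv0 step iK.
apply: (le_trans H); apply: (le_trans (leeD (lexx _) (step_int iK))).
by rewrite mi -EFinM -EFinD; exact: lexx.
Qed.

(** Finiteness of the error moments propagates along the recursion from the initial batch; for the
    steps it comes from the boundedness of [X]. *)
Let mEE i : (i < K)%N -> (\int[Pr]_w (sqe i w)%:E = (mE i)%:E)%E.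
Proof.
elim: i => [_|i IH iK]; first exact: (integral_fin_real (sqe0 0) mom0).
exact: (integral_fin_real (sqe0 i.+1) (momS iK (IH (ltnW iK)))).
Qed.

Let recur : alpha * \sum_(i < K) mE i <= mE 0%N + \sum_(i < K) T i.
Proof.
apply: (recursion_sum al01 mE0 T0) => i iK.
by have := momS iK (mEE (ltnW iK)); rewrite (mEE iK) lee_fin.
Qed.

Let KR : 0 < K%:R :> R. Proof. by rewrite ltr0n. Qed.

Let sumE_bound : \sum_(i < K) mE i <= 733 / 10000 * K%:R * e2 + (eta ^+ 2)^-1 * (\sum_(i < K) mD i) / 8.
Proof.
have L0 : 0 < cLf k ^+ 2 by rewrite exprn_gt0.
have sD0 : 0 <= \sum_(i < K) mD i by apply: sumr_ge0 => i _; exact: mD0.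
have E0 : mE 0%N <= 16 / 5 * e2 by have := mom0; rewrite (mEE K0) lee_fin.
have sT : \sum_(i < K) T i <= Sr^-1 * (8 * (Sr + 1) * cLf k ^+ 2 * (\sum_(i < K) mD i) + K%:R *
  (2 * (16 * Sr * (cLf k ^+ 2 * nu ^+ 2 * d%:R ^+ 2) + 16 * B2) + 2 * alpha ^+ 2 * VG)).
  by rewrite /T -mulr_sumr sum_affine; exact: lexx.
exact: (variance_arith L0 eta0 S2 KR sD0 B20 alE recur E0 sT hVG hsb hb' hb hK1 e20).
Qed.

Let path_int : (2 * eta)^-1 * \sum_(i < K) mD i
   <= eta * (5 / 4 * \sum_(i < K) mE i + 5 * K%:R * B2) + Del.
Proof.
have t0 : 0 <= (2 * eta)^-1 by rewrite invr_ge0 mulr_ge0// ltW.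
have y0 : 0 <= eta * (5 / 4) by rewrite mulr_ge0// ltW.
have D0 : 0 <= Del.
  have l1 := inf_le Xx0.
  have l3 : 0 <= mu / 2 * pnorm 2 (c x0) ^+ 2 by rewrite mulr_ge0 ?sqr_ge0// divr_ge0// ltW.
  have l4 : 0 <= 2 * m%:R * crho k * cMcbar k ^+ 2.
    by apply: mulr_ge0 (sqr_ge0 _); apply: mulr_ge0 (ltW rho0); rewrite mulr_ge0.
  rewrite /smooth_lag dotv0l addr0; apply: addr_ge0 l4.
  by rewrite subr_ge0 addrAC; apply: (le_trans l1); rewrite lerDl.
have z0 : 0 <= eta * (5 * K%:R * B2) + Del.
  by apply: addr_ge0 D0; apply: mulr_ge0 (ltW eta0) _; apply: mulr_ge0 B20; rewrite mulr_ge0.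
have sd := integral_sum_real msqd sqd0 (fun i _ => mDE i) (K := K).
have se := integral_sum_real msqe sqe0 mEE.
have ms : measurable_fun setT (fun w => \sum_(i < K) sqd i w) by apply: measurable_sum => i; exact: msqd.
have mse : measurable_fun setT (fun w => \sum_(i < K) sqe i w) by apply: measurable_sum => i; exact: msqe.
have ps w : 0 <= \sum_(i < K) sqd i w by apply: sumr_ge0 => i _; exact: sqd0.
have pse w : 0 <= \sum_(i < K) sqe i w by apply: sumr_ge0 => i _; exact: sqe0.
have H := expected_inequality t0 y0 z0 ms mse ps pse sd se path_descent.
by apply: (le_trans H); rewrite mulrDr !mulrA addrA.
Qed.

Let sE0 : 0 <= \sum_(i < K) mE i. Proof. by apply: sumr_ge0 => i _; exact: mE0. Qed.
Let sD0 : 0 <= \sum_(i < K) mD i. Proof. by apply: sumr_ge0 => i _; exact: mD0. Qed.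

Let final_bounds := kkt_arith eta0 KR e20 sumE_bound hb2 path_int hDel hc0 sE0 sD0 B20.

Let stat_fun (z : RVd * RVd * RVm) : R :=
  pnorm q (grad_mapping X h v eta z.1.1 (grad f z.1.1 + gradT c z.1.1 ((z.2 : 'rV[R]_m) + mu *: c z.1.1))) ^+ 2.

Let feas_fun (z : RVd * RVd * RVm) : R := pnorm p (c z.1.1) ^+ 2.

Let m11 : measurable_fun [set: RVd * RVd * RVm] (fun z => z.1.1).
Proof. exact: (measurableT_comp measurable_fst measurable_fst). Qed.

Let mstat : measurable_fun setT stat_fun.
Proof.
apply: measurable_funX; apply: (measurable_pnorm q1).
apply: measurable_scale_rV; first exact: measurable_cst.
apply: (measurable_sub_rV m11).
apply: (measurableT_comp mnxt (g := fun z : RVd * RVd * RVm => (z.1.1, grad f z.1.1 : RVd, z.2))).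
apply: measurable_fun_pair; last exact: measurable_snd.
by apply: measurable_fun_pair => //; exact: (measurableT_comp mgf m11).
Qed.

Let mfeas : measurable_fun setT feas_fun.
Proof. by apply: measurable_funX; apply: (measurable_pnorm p1); exact: (measurableT_comp mc m11). Qed.

Let runE (phi : RVd * RVd * RVm -> R) : measurable_fun setT phi -> (forall z, 0 <= phi z) ->
  (\int[Pr]_w (phi (rn (ind w) w))%:E = \sum_(i < K) (K%:R^-1)%:E * \int[Pr]_w (phi (rn i w))%:E)%E.
Proof.
move=> mphi phi0.
exact: (@run_expectation _ _ _ _ _ _ _ Pr u xi ind Pu pb v x0 mu eta nu alpha rho_ n0 N K
  samp K0 n00 N0 mF mf mc mnxt (fun=> phi) (fun=> mphi) (fun=> phi0)).
Qed.

Lemma expected_stationarity : (\int[Pr]_w (stat_fun (rn (ind w) w))%:E <= e2%:E)%E.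
Proof.
rewrite (runE mstat (fun=> sqr_ge0 _)).
have t0 : 0 <= 2 * (eta ^+ 2)^-1 by rewrite mulr_ge0// invr_ge0 sqr_ge0.
have t1 : 0 <= 2 * (5 / 4) :> R by [].
have t2 : 0 <= 2 * (5 * B2) by rewrite mulr_ge0// mulr_ge0.
have I (i : 'I_K) : (\int[Pr]_w (stat_fun (rn i w))%:E
    <= (2 * (eta ^+ 2)^-1 * mD i + (2 * (5 / 4) * mE i + 2 * (5 * B2)))%:E)%E.
  apply: (integral_le_affine t0 t1 t2 _ (msqd i) (msqe i) (sqd0 i) (sqe0 i) (mDE i) (mEE (ltn_ord i))).
  - exact: (measurableT_comp mstat (mrn i)).
  - by move=> w; exact: sqr_ge0.
  - by apply: aeW => w; rewrite -stationarity_split; exact: stationarity.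
apply: (@le_trans _ _ (\sum_(i < K) (K%:R^-1 * (2 * (eta ^+ 2)^-1 * mD i + (2 * (5 / 4) * mE i + 2 * (5 * B2))))%:E)%E).
  apply: lee_sum => i _; rewrite EFinM; apply: lee_wpmul2l (I i).
  by rewrite lee_fin invr_ge0.
rewrite sumEFin lee_fin -mulr_sumr ler_pdivrMl// sum_affine2.
have [H _] := final_bounds; exact: stationarity_total H.
Qed.

Hypothesis reg : {ae Pr, forall w, forall i, (i <= K)%N -> regular_at pb k p (xx i w)}.

(** The violation at x^(i+1) is bounded by the step and the error at i, so the average is shifted by
    one index and x^0 enters with |c(x^0)|_2^2 itself. The pathwise bounds hold almost surely, as
    the regularity condition does. *)
Lemma expected_feasibility : (\int[Pr]_w (feas_fun (rn (ind w) w))%:E <= e2%:E)%E.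
Proof.
rewrite (runE mfeas (fun=> sqr_ge0 _)).
have t0 : 0 <= (eta ^+ 2)^-1 by rewrite invr_ge0 sqr_ge0.
have t1 : 0 <= (5 / 4) :> R by [].
have t2 : 0 <= 3 / 10 * e2 + 5 * B2.
  by apply: addr_ge0; [exact: (mulr_ge0 _ e20) | exact: (mulr_ge0 (ler0n _ 5) B20)].
have I i : (i.+1 < K)%N -> (\int[Pr]_w (feas_fun (rn i.+1 w))%:E
    <= ((eta ^+ 2)^-1 * mD i + (5 / 4 * mE i + (3 / 10 * e2 + 5 * B2)))%:E)%E.
  move=> iK.
  apply: (integral_le_affine t0 t1 t2 _ (msqd i) (msqe i) (sqd0 i) (sqe0 i) (mDE i) (mEE (ltnW iK))).
  - exact: (measurableT_comp mfeas (mrn i.+1)).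
  - by move=> w; exact: sqr_ge0.
  - apply: filterS reg => w regw; rewrite -feasibility_split.
    exact: (feasibility (ltnW (ltnW iK)) (regw i.+1 (ltnW iK))).
pose bd i : R := if i is j.+1 then (eta ^+ 2)^-1 * mD j + (5 / 4 * mE j + (3 / 10 * e2 + 5 * B2))
  else pnorm 2 (c x0) ^+ 2.
apply: (@le_trans _ _ (\sum_(i < K) (K%:R^-1 * bd i)%:E)%E).
  apply: lee_sum => -[[|i] iK] _ /=; rewrite EFinM; apply: lee_wpmul2l; rewrite ?lee_fin ?invr_ge0//; last exact: I.
  have -> : (\int[Pr]_w (feas_fun (rn 0 w))%:E = \int[Pr]_w (pnorm p (c x0) ^+ 2)%:E)%E.
    by apply: eq_integral => w _; rewrite /feas_fun rx0.
  have -> : (\int[Pr]_w (pnorm p (c x0) ^+ 2)%:E = (pnorm p (c x0) ^+ 2)%:E)%E.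
    by have := expectation_cst Pr (pnorm p (c x0) ^+ 2); rewrite unlock.
  rewrite lee_fin; apply: (sqr_mono (pnorm_ge0 _ _)); exact: ler_pnorm.
rewrite sumEFin lee_fin -mulr_sumr ler_pdivrMl//.
have [_ H] := final_bounds.
(* The nonnegative bound coming from step K - 1 is added, to complete the shifted sum to all i <
   K. *)
have bs : \sum_(i < K) bd i <= bd 0%N + \sum_(i < K) bd i.+1.
  rewrite -[in X in X <= _](prednK K0) big_ord_recl lerD2l.
  rewrite -[in X in _ <= X](prednK K0) big_ord_recr /= lerDl.
  apply: addr_ge0; first exact: (mulr_ge0 t0 (mD0 _)).
  by apply: addr_ge0 t2; exact: (mulr_ge0 t1 (mE0 _)).
apply: (le_trans bs); rewrite /bd sum_affine2; exact: feasibility_total.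
Qed.

(** The certifying multiplier is lambda^R + mu c(x^R): with it the gradient mapping is that of the
    augmented Lagrangian at the output. *)
Lemma convergence eps : e2 = eps ^+ 2 -> eps_kkt Pr pb v p q eta eps (fun w => xx (ind w) w).
Proof.
move=> e2E.
have mr := measurable_random_index ind mrn.
have mx : measurable_fun setT ((fun w => xx (ind w) w) : Om -> RVd).
  exact: (measurableT_comp measurable_fst (measurableT_comp measurable_fst mr)).
have ml : measurable_fun setT ((fun w => ll (ind w) w + mu *: c (xx (ind w) w)) : Om -> RVm).
  apply: measurable_add_rV; first exact: (measurableT_comp measurable_snd mr).
  by apply: measurable_scale_rV; [exact: measurable_cst | exact: (measurableT_comp mc mx)].
split; [exact: mx | by move=> w; exact: xX | ].
exists (rv_of Pr ml); split; rewrite unlock -e2E.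
  exact: expected_stationarity.
exact: expected_feasibility.
Qed.

End Convergence.

(** * The parameter values *)

Section NumericFacts.
Variable R : realType.

Lemma natceil_ge (x : R) : x <= (natceil x)%:R.
Proof. by rewrite /natceil natr_absz; apply: (le_trans (ceil_ge x)); rewrite ler_int ler_norm. Qed.

Lemma natceil_lt (x : R) : 0 <= x -> (natceil x)%:R < x + 1.
Proof.
move=> x0; rewrite /natceil natr_absz ger0_norm; last by rewrite ceil_ge0; exact: lt_le_trans x0.
by have := ceilB1_lt x; rewrite intrB ltrBlDr.
Qed.

Lemma natceil_gt0 (x : R) : 0 < x -> (0 < natceil x)%N.
Proof. by move=> x0; rewrite -(ltr0n R); exact: lt_le_trans (natceil_ge x). Qed.

(* exp(-1/6) >= 5/6, so exp 1 <= (6/5)^6 < 3. *)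
Lemma expR1_le3 : expR 1 <= 3 :> R.
Proof.
have h : 5 / 6 <= expR (- 6^-1) :> R.
  by apply: (le_trans _ (expR_ge1Dx _)); lra.
have h6 : (5 / 6) ^+ 6 <= expR (- 1) :> R.
  have -> : -1 = 6%:R * (- 6^-1) :> R by field.
  by rewrite expRM_natl; apply: lerXn2r h; rewrite nnegrE; [lra | exact: expR_ge0].
have h3 : 3^-1 <= expR (- 1) :> R by apply: le_trans h6; lra.
by move: h3; rewrite expRN lef_pV2 ?posrE ?expR_gt0.
Qed.

Lemma ln_ge1 (d : nat) : (3 <= d)%N -> 1 <= ln d%:R :> R.
Proof.
move=> d3; have d0 : 0 < d%:R :> R by rewrite ltr0n (leq_trans _ d3).
have h : expR 1 <= d%:R :> R by apply: (le_trans expR1_le3); rewrite ler_nat.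
by rewrite -[leLHS](expRK (R := R)) ler_ln ?posrE ?expR_gt0.
Qed.

Lemma le_sqr_inv (eta L : R) : 0 < eta -> 0 < L -> eta ^+ 2 <= (4 * L ^+ 2)^-1 -> 2 * eta * L <= 1.
Proof.
move=> e0 L0; rewrite -[leRHS]div1r ler_pdivlMr ?mulr_gt0 ?exprn_gt0// => h.
have p0 : 0 <= 2 * eta * L by exact: (mulr_ge0 (mulr_ge0 (ler0n _ 2) (ltW e0)) (ltW L0)).
rewrite -(@expr_le1 _ 2%N _ isT p0).
by apply: le_trans h; rewrite le_eqVlt; apply/orP; left; apply/eqP; ring.
Qed.

(** [D] is d^3. In the denominator 4 (4 L^2 + 3 eta^-2) of nu^2, keeping 12 eta^-2 alone gives the
    first bound; inserting eta^-2 >= 96 L^2 gives 4 (4 + 288) = 1168 for the second. *)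
Lemma smoothing_bounds (L eta nu2 e2 D : R) : 0 < L -> 0 < eta -> 0 < D -> 0 < e2 ->
  eta ^+ 2 <= (96 * L ^+ 2)^-1 ->
  nu2 <= e2 / (4 * (4 * L ^+ 2 + 3 * eta ^- 2) * D) ->
  L ^+ 2 * nu2 * D <= L ^+ 2 * eta ^+ 2 * e2 / 12 /\ L ^+ 2 * nu2 * D <= e2 / 1168.
Proof.
move=> L0 e0 D0 ee.
have L2 : 0 < L ^+ 2 by rewrite exprn_gt0.
have E2 : 0 < eta ^+ 2 by rewrite exprn_gt0.
move: L2 E2; move: (L ^+ 2) (eta ^+ 2) => A B A0 B0 h.
have Bi : 0 < B^-1 by rewrite invr_gt0.
have Bi96 : 96 * A <= B^-1.
  by rewrite -(invrK (96 * A)) lef_pV2// posrE invr_gt0 mulr_gt0.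
have den0 : 0 < 4 * A + 3 * B^-1 by rewrite addr_gt0// mulr_gt0.
rewrite ler_pdivlMr ?mulr_gt0// => hn.
have P0 : 4 * (A * nu2 * D) * (4 * A + 3 * B^-1) <= A * e2.
  apply: le_trans (ler_wpM2l (ltW A0) hn).
  by rewrite le_eqVlt; apply/orP; left; apply/eqP; ring.
case: (lerP (A * nu2 * D) 0) => [hP|hP].
  split; apply: (le_trans hP); apply: divr_ge0; [|exact: ler0n|exact: ltW|exact: ler0n].
  exact: (mulr_ge0 (mulr_ge0 (ltW A0) (ltW B0)) (ltW ee)).
move: hP P0; move: (A * nu2 * D) => P hP P0.
have BB : B^-1 * B = 1 by rewrite mulVf// gt_eqF.
split.
  rewrite ler_pdivlMr; last exact: ltr0Sn.
  have h1 : 12 * P * B^-1 <= A * e2.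
    by apply: le_trans P0; have : 0 <= P * A by [apply: mulr_ge0; exact: ltW]; lra.
  have := ler_wpM2r (ltW B0) h1.
  have -> : 12 * P * B^-1 * B = P * 12 by rewrite -mulrA BB mulr1 mulrC.
  by have -> : A * e2 * B = A * B * e2 by ring.
rewrite ler_pdivlMr; last exact: ltr0Sn.
rewrite -(ler_pM2l A0); apply: le_trans P0.
have -> : A * (P * 1168) = 4 * P * (4 * A + 3 * (96 * A)) by ring.
by apply: ler_wpM2l; [rewrite mulr_ge0// ltW | lra].
Qed.

(** As S <= d and C = d^3 B, the smoothing terms amount to at most 4 C + 4 C. By C <= e2 / 1168 they
    fit into twice the summand e2 / 16 of sigmabar^2. The factor 1/3 is d >= 3. *)
Lemma variance_budget (B C S d e2 sg M : R) : 0 <= B -> 3 <= d -> 0 <= S <= d -> C = d ^+ 3 * B ->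
  C <= e2 / 1168 ->
  B * d ^+ 2 <= C / 3 /\
  2 * S * (4 * (sg + M) + 2 * (B * d ^+ 2)) + 2 * (2 * M + 2 * C)
    <= 2 * (e2 / 16 + 4 * S * (sg + M) + 2 * M).
Proof.
move=> B0 d3 /andP[S0 Sd] -> hC.
have P0 : 0 <= B * d ^+ 2 by rewrite mulr_ge0// sqr_ge0.
have E : d ^+ 3 * B = d * (B * d ^+ 2) by ring.
rewrite E in hC *; move: P0 hC; move: (B * d ^+ 2) => P P0 hC.
have h1 : 3 * P <= d * P by apply: ler_wpM2r.
have h2 : S * P <= d * P by apply: ler_wpM2r.
split; [by rewrite ler_pdivlMr//; lra|].
have -> : 2 * S * (4 * (sg + M) + 2 * P) = 8 * (S * (sg + M)) + 4 * (S * P) by ring.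
have -> : 4 * S * (sg + M) = 4 * (S * (sg + M)) by ring.
by move: (S * (sg + M)) => Q; lra.
Qed.

Lemma step_budget (a b C L eta2 S e2 sb : R) : 0 < a -> 0 < b -> C = a * b -> 0 < L -> 0 < sb ->
  eta2 <= S * e2 / (C * L ^+ 2 * sb) -> a * L ^+ 2 * eta2 * sb <= S * e2 / b.
Proof.
move=> a0 b0 -> L0 sb0; have L2 : 0 < L ^+ 2 by rewrite exprn_gt0.
rewrite ler_pdivlMr; last exact: (mulr_gt0 (mulr_gt0 (mulr_gt0 a0 b0) L2) sb0).
move=> h; rewrite ler_pdivlMr//; apply: le_trans h.
by rewrite le_eqVlt; apply/orP; left; apply/eqP; ring.
Qed.

End NumericFacts.

Section ParameterValues.
Variables (R : realType) (k : constants R) (m d : nat) (p q eps : R).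
Hypotheses (hk : constants_pos k) (d3 : (3 <= d)%N) (p2 : 2 <= p) (pq : p^-1 + q^-1 = 1)
  (eps0 : 0 < eps).
Local Notation r := (phat d p).
Local Notation S := (Sdim d p).
Local Notation Lv := (par_Lv k d q).
Local Notation mu_ := (par_mu k m d q eps).
Local Notation eta := (par_eta k m d p q eps).
Local Notation sb := (par_sigmabar2 k d p eps).
Local Notation Lmu := (par_Lmu k m d q eps).

Let Lf0 : 0 < cLf k. Proof. by case: hk => -[]. Qed.
Let Mc0 : 0 < cMc k. Proof. by case: hk => -[]. Qed.
Let Mcb0 : 0 < cMcbar k. Proof. by case: hk => _ [[]]. Qed.
Let Lc0 : 0 < cLc k. Proof. by case: hk => _ [[]]. Qed.
Let beta0 : 0 < cbeta k. Proof. by case: hk => _ [[]]. Qed.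
Let rho0 : 0 < crho k. Proof. by case: hk => _ [_ []]. Qed.
Let dR0 : 0 < d%:R :> R. Proof. by rewrite ltr0n (leq_trans _ d3). Qed.
Let dR1 : 1 <= d%:R :> R. Proof. by rewrite ler1n (leq_trans _ d3). Qed.
Let ln1 : 1 <= ln d%:R :> R := ln_ge1 R d3.
Let q12 := conj_itv p2 pq.
Let q1 : 1 < q. Proof. by case/andP: q12. Qed.
Let q2 : q <= 2. Proof. by case/andP: q12. Qed.
Let e2 : 0 < eps ^+ 2. Proof. exact: exprn_gt0. Qed.

Lemma phat_ge2 : 2 <= r.
Proof. by rewrite /phat; case: ifP => // _; rewrite -[leLHS]mulr1 ler_wpM2l. Qed.

Lemma phat_le : r <= p.
Proof. by rewrite /phat; case: ifPn => // /negP h; apply: ltW; rewrite ltNge; apply/negP. Qed.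

Lemma phat_le_ln : r <= 2 * ln d%:R.
Proof. by rewrite /phat; case: ifP. Qed.

Let r0 : 0 < r. Proof. exact: (lt_le_trans (ltr0Sn _ 1) phat_ge2). Qed.

Lemma Sdim_sqS : S = sqS d r.
Proof.
rewrite /Sdim /sqS mulrC powRrM.
exact: (powR_mulrn 2 (powR_ge0 _ _)).
Qed.

Lemma Sdim_le : S <= d%:R.
Proof.
have h : 2 / r <= 1 by rewrite ler_pdivrMr// mul1r; exact: phat_ge2.
by have := ler_powR dR1 h; rewrite (powRr1 (ltW dR0)).
Qed.

(** Since phat <= 2 ln d, S is at least d^(1 / ln d) = e, and e >= 2. *)
Lemma Sdim_ge2 : 2 <= S.
Proof.
have l0 : 0 < ln d%:R :> R by apply: lt_le_trans ln1.
have h : (ln d%:R)^-1 <= 2 / r.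
  by rewrite ler_pdivlMr// mulrC ler_pdivrMr// phat_le_ln.
apply: le_trans (ler_powR dR1 h).
have -> : d%:R `^ (ln d%:R)^-1 = expR 1 :> R.
  rewrite -[LHS]lnK; last by rewrite posrE powR_gt0.
  by rewrite ln_powR mulVf// gt_eqF.
by have := expR_ge1Dx (1 : R).
Qed.

Lemma par_Lv_ge0 : 0 <= Lv.
Proof.
have q10 : 0 <= (q - 1)^-1 by rewrite invr_ge0 subr_ge0 ltW.
apply: addr_ge0; first by apply: mulr_ge0 q10; rewrite subr_ge0.
by apply: mulr_ge0 (powR_ge0 _ _); apply: mulr_ge0 q10 (powR_ge0 _ _).
Qed.

Let mu_sqr : exists M, [/\ mu_ = Num.sqrt M, 0 < M,
  8 * (2 * Lv ^+ 2 + 1) / (3 * cbeta k ^+ 2) <= M &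
  40 * (cMf k ^+ 2 + cMh k ^+ 2 + m%:R ^+ 2 * crho k ^+ 2 * cMcbar k ^+ 2 * cMc k ^+ 2)
      / (cbeta k ^+ 2 * eps ^+ 2) <= M].
Proof.
rewrite /par_mu; eexists; split; first by [].
- rewrite !lt_max; apply/orP; left; apply/orP; right.
  have h : 0 < 2 * Lv ^+ 2 + 1 by apply: ltr_wpDl => //; apply: mulr_ge0 (sqr_ge0 _).
  apply: divr_gt0; first exact: mulr_gt0.
  by apply: mulr_gt0 => //; exact: exprn_gt0.
- by rewrite !le_max lexx orbT.
- by rewrite !le_max lexx !orbT.
Qed.

Lemma par_mu_gt0 : 0 < mu_.
Proof. by have [M [-> M0 _ _]] := mu_sqr; rewrite sqrtr_gt0. Qed.

Lemma par_mu_Lv : 8 * (2 * Lv ^+ 2 + 1) / 3 <= cbeta k ^+ 2 * mu_ ^+ 2.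
Proof.
have [M [-> M0 + _]] := mu_sqr; rewrite sqr_sqrtr; last exact: ltW.
have b2 : 0 < cbeta k ^+ 2 by exact: exprn_gt0.
rewrite ler_pdivrMr; last exact: (mulr_gt0 (ltr0Sn _ 2) b2).
move: (cbeta k ^+ 2) (8 * _) => B A; rewrite mulrCA [M * _]mulrC mulrC => h.
by rewrite ler_pdivrMr; [rewrite [leRHS]mulrC; exact: h|exact: ltr0Sn].
Qed.

Lemma par_mu_eps :
  40 * (cMf k ^+ 2 + cMh k ^+ 2 + m%:R ^+ 2 * crho k ^+ 2 * cMcbar k ^+ 2 * cMc k ^+ 2)
  <= cbeta k ^+ 2 * mu_ ^+ 2 * eps ^+ 2.
Proof.
have [M [-> M0 _]] := mu_sqr; rewrite sqr_sqrtr; last exact: ltW.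
have b2 : 0 < cbeta k ^+ 2 by exact: exprn_gt0.
rewrite ler_pdivrMr; last exact: (mulr_gt0 b2 e2).
by move: (cbeta k ^+ 2) (eps ^+ 2) (40 * _) => B D A; rewrite mulrA [M * _]mulrC.
Qed.

Lemma par_Lmu_gt0 : 0 < Lmu.
Proof.
have h := par_mu_gt0; apply: ltr_wpDr Lf0; apply: mulr_ge0 => //.
by rewrite !addr_ge0// ltW// !mulr_gt0// exprn_gt0.
Qed.

Lemma par_sigmabar2_gt0 : 0 < sb.
Proof.
have S0 : 0 < S by exact: (lt_le_trans (ltr0Sn _ 1) Sdim_ge2).
have h2 : 0 <= csigma k ^+ 2 + cMf k ^+ 2 by rewrite addr_ge0// sqr_ge0.
apply: ltr_wpDr; first by rewrite mulr_ge0// sqr_ge0.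
apply: ltr_wpDr; first by apply: mulr_ge0 h2; rewrite mulr_ge0// ltW.
exact: divr_gt0.
Qed.

Let E1 := (4 * Lmu ^+ 2)^-1.
Let E2 := (96 * cLf k ^+ 2)^-1.
Let E3 := S * eps ^+ 2 / (23040 * cLf k ^+ 2 * sb).
Let E1_0 : 0 < E1. Proof. by rewrite invr_gt0 mulr_gt0// exprn_gt0// par_Lmu_gt0. Qed.
Let E2_0 : 0 < E2. Proof. by rewrite invr_gt0 mulr_gt0// exprn_gt0. Qed.
Let E3_0 : 0 < E3.
Proof.
have S0 : 0 < S by exact: (lt_le_trans (ltr0Sn _ 1) Sdim_ge2).
apply: divr_gt0; first exact: mulr_gt0.
by apply: mulr_gt0 par_sigmabar2_gt0; apply: mulr_gt0; [exact: ltr0Sn | exact: exprn_gt0].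
Qed.

Let E_0 : 0 < Num.min (Num.min E1 E2) E3.
Proof. by rewrite !lt_min E1_0 E2_0 E3_0. Qed.

Lemma par_eta_sqr : eta ^+ 2 = Num.min (Num.min E1 E2) E3.
Proof. exact: (sqr_sqrtr (ltW E_0)). Qed.

Lemma par_eta_gt0 : 0 < eta.
Proof. by rewrite /par_eta sqrtr_gt0; exact: E_0. Qed.

Lemma par_eta_Lmu : 2 * eta * Lmu <= 1.
Proof.
by apply: (le_sqr_inv par_eta_gt0 par_Lmu_gt0); rewrite par_eta_sqr !ge_min lexx.
Qed.

Lemma par_eta_Lf : eta ^+ 2 <= (96 * cLf k ^+ 2)^-1.
Proof. by rewrite par_eta_sqr ge_min ge_min lexx orbT. Qed.

Lemma par_eta_sb : eta ^+ 2 <= S * eps ^+ 2 / (23040 * cLf k ^+ 2 * sb).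
Proof. by rewrite par_eta_sqr; have := lexx E3; rewrite ge_min => ->; rewrite orbT. Qed.

Lemma par_alpha_le1 : par_alpha k m d p q eps <= 1.
Proof.
have L0 : 0 < 96 * cLf k ^+ 2 by rewrite mulr_gt0// exprn_gt0.
by have := ler_wpM2l (ltW L0) par_eta_Lf; rewrite mulfV// gt_eqF.
Qed.

(** The constant 23040 in eta is 96 times 240; the 96 is that of alpha. *)
Lemma par_alpha_sb : par_alpha k m d p q eps * sb <= S * eps ^+ 2 / 240.
Proof.
apply: (step_budget _ _ _ Lf0 par_sigmabar2_gt0 par_eta_sb); [exact: ltr0Sn|exact: ltr0Sn|ring].
Qed.

Lemma par_n_gt0 : (0 < par_n d p)%N.
Proof.
apply: natceil_gt0; apply: mulr_gt0 (lt_le_trans (ltr0Sn _ 1) Sdim_ge2).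
by rewrite subr_gt0; apply: lt_le_trans phat_ge2; rewrite ltr1n.
Qed.

Lemma par_n_inv : (par_n d p)%:R^-1 * (r - 1) <= S^-1.
Proof.
have S0 : 0 < S by exact: (lt_le_trans (ltr0Sn _ 1) Sdim_ge2).
have n0 : 0 < (par_n d p)%:R :> R by rewrite ltr0n par_n_gt0.
rewrite ler_pdivrMl// ler_pdivlMr//; exact: natceil_ge.
Qed.

Lemma par_n0_gt0 : (0 < par_n0 k d p eps)%N.
Proof.
apply: natceil_gt0; apply: divr_gt0; last exact: mulr_gt0.
apply: mulr_gt0 par_sigmabar2_gt0; apply: mulr_gt0 => //.
by rewrite subr_gt0; apply: lt_le_trans phat_ge2; rewrite ltr1n.
Qed.

Lemma par_n0_inv : (par_n0 k d p eps)%:R^-1 * (r - 1) * sb <= 4 / 5 * eps ^+ 2.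
Proof.
have n0 : 0 < (par_n0 k d p eps)%:R :> R by rewrite ltr0n par_n0_gt0.
rewrite -mulrA ler_pdivrMl//.
have := natceil_ge (5 * (r - 1) * sb / (4 * eps ^+ 2)).
rewrite -/(par_n0 k d p eps) ler_pdivrMr ?mulr_gt0//.
move: (par_n0 _ _ _ _)%:R sb (r - 1) (eps ^+ 2) => *; lra.
Qed.

Section Smoothing.
Variable E6 : R.
Hypothesis E6E : E6 = d%:R ^+ 3.
Local Notation nu := (par_nu k m d p q eps E6).
Let D0 : 0 < d%:R ^+ 3 :> R. Proof. exact: exprn_gt0. Qed.
Let eta2 : 0 < eta ^+ 2. Proof. by rewrite exprn_gt0// par_eta_gt0. Qed.
Let N1 := eps ^+ 2 / (4 * (4 * cLf k ^+ 2 + 3 * eta ^- 2) * d%:R ^+ 3).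
Let N2 := cbeta k ^+ 2 * mu_ ^+ 2 * eta ^+ 2 * eps ^+ 2 / (20 * (2 * Lv ^+ 2 + 1) * d%:R ^+ 3).
Let N1_0 : 0 < N1.
Proof.
apply: (divr_gt0 e2); apply: mulr_gt0 D0; apply: mulr_gt0; first exact: ltr0Sn.
by apply: addr_gt0; apply: mulr_gt0; rewrite ?ltr0Sn ?invr_gt0// exprn_gt0.
Qed.
Let N2_0 : 0 < N2.
Proof.
apply: divr_gt0.
  by apply: mulr_gt0 e2; apply: mulr_gt0 eta2; apply: mulr_gt0; apply: exprn_gt0 => //; exact: par_mu_gt0.
apply: mulr_gt0 D0; apply: mulr_gt0; first exact: ltr0Sn.
by apply: ltr_wpDl => //; apply: mulr_ge0 (sqr_ge0 _).
Qed.

Let N_0 : 0 < Num.min N1 N2. Proof. by rewrite lt_min N1_0 N2_0. Qed.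

Lemma par_nu_gt0 : 0 < nu.
Proof. by rewrite /par_nu E6E sqrtr_gt0; exact: N_0. Qed.

Lemma par_nu_sqr : nu ^+ 2 <= N1.
Proof.
rewrite /par_nu E6E (sqr_sqrtr (ltW N_0)).
by have := lexx N1; rewrite ge_min => ->.
Qed.

Lemma par_nu_bounds :
  cLf k ^+ 2 * nu ^+ 2 * d%:R ^+ 3 <= cLf k ^+ 2 * eta ^+ 2 * eps ^+ 2 / 12 /\
  cLf k ^+ 2 * nu ^+ 2 * d%:R ^+ 3 <= eps ^+ 2 / 1168.
Proof. exact: (smoothing_bounds Lf0 par_eta_gt0 D0 e2 par_eta_Lf par_nu_sqr). Qed.

Lemma par_nu_variance :
  cLf k ^+ 2 * nu ^+ 2 * d%:R ^+ 2 <= cLf k ^+ 2 * nu ^+ 2 * d%:R ^+ 3 / 3 /\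
  var_one d (cLf k) (cMf k) (csigma k) nu r <= 2 * sb.
Proof.
have h1 : 0 <= cLf k ^+ 2 * nu ^+ 2 by rewrite mulr_ge0// sqr_ge0.
have h2 : 3 <= d%:R :> R by rewrite ler_nat.
have h3 : 0 <= S <= d%:R by rewrite Sdim_le powR_ge0.
have [_ h4] := par_nu_bounds.
have := @variance_budget R _ _ S d%:R (eps ^+ 2) (csigma k ^+ 2) (cMf k ^+ 2) h1 h2 h3 (mulrC _ _) h4.
by rewrite /var_one /par_sigmabar2 -Sdim_sqS.
Qed.

End Smoothing.

Section IterationCount.
Variables (dxi : measure_display) (Xi : measurableType dxi) (pb : problem R d m Xi)
  (x0 : 'rV[R]_d) (Phi_inf : R).
Local Notation K := (par_K k p q eps pb x0 Phi_inf).

Let K_ge : [/\ 108 * par_Delta0 k q eps pb x0 Phi_inf / (eta * eps ^+ 2) <= K%:R,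
  5 * pnorm 2 (con pb x0) ^+ 2 / eps ^+ 2 <= K%:R &
  (cLf k ^+ 2 * eta ^+ 2)^-1 <= K%:R].
Proof.
by split; apply: le_trans (natceil_ge _); rewrite !le_max lexx ?orbT.
Qed.

Let Le0 : 0 < cLf k ^+ 2 * eta ^+ 2.
Proof. by rewrite mulr_gt0// exprn_gt0// par_eta_gt0. Qed.

Lemma par_K_gt0 : (0 < K)%N.
Proof.
by have [_ _ h] := K_ge; rewrite -(ltr0n R); apply: lt_le_trans h; rewrite invr_gt0.
Qed.

Lemma par_K_eta : 1 <= cLf k ^+ 2 * eta ^+ 2 * K%:R.
Proof.
by have [_ _ h] := K_ge; have := ler_wpM2l (ltW Le0) h; rewrite mulfV// gt_eqF.
Qed.

Lemma par_K_Delta0 : par_Delta0 k q eps pb x0 Phi_inf <= K%:R * eta * eps ^+ 2 / 108.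
Proof.
have [h _ _] := K_ge; move: h; rewrite ler_pdivrMr; last by rewrite mulr_gt0// par_eta_gt0.
rewrite ler_pdivlMr; last exact: ltr0Sn.
by rewrite mulrC mulrA.
Qed.

Lemma par_K_con : pnorm 2 (con pb x0) ^+ 2 <= K%:R * eps ^+ 2 / 5.
Proof.
have [_ h _] := K_ge; move: h; rewrite ler_pdivrMr// => h.
by rewrite ler_pdivlMr// mulrC.
Qed.

End IterationCount.

End ParameterValues.

Section ParameterChoice.
Variables (R : realType) (m d : nat) (k : constants R) (p q eps : R)
  (dxi dom : measure_display) (Xi : measurableType dxi) (Om : measurableType dom)
  (Pr : probability Om R) (pb : problem R d m Xi) (x0 : 'rV[R]_d) (Phi_inf : R)
  (O : set 'rV[R]_d) (Pu : probability (borelRV R d) R)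
  (u : nat -> nat -> {RV Pr >-> borelRV R d}) (xi : nat -> nat -> {RV Pr >-> Xi})
  (ind : {RV Pr >-> nat}).
Local Notation v := (vdelta q (cdelta k)).
Local Notation mu := (par_mu k m d q eps).
Local Notation eta := (par_eta k m d p q eps).
Local Notation alpha := (par_alpha k m d p q eps).
Local Notation nu := (par_nu k m d p q eps (Enorm6 Pu)).
Local Notation n0 := (par_n0 k d p eps).
Local Notation n := (par_n d p).
Local Notation K := (par_K k p q eps pb x0 Phi_inf).
Local Notation x := (fun (i : nat) (w : Om) =>
    iterate pb v x0 mu eta nu alpha (fun _ : nat => crho k / K%:R) n0 n
      (fun a j => u a j w) (fun a j => xi a j w) i).
Hypotheses (hk : constants_pos k) (d3 : (3 <= d)%N) (p2 : 2 <= p) (pq : p^-1 + q^-1 = 1)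
  (eps0 : 0 < eps).

Lemma parameters_eps_kkt :
  problem_setting pb -> rademacher Pu -> open O -> smoothing_region pb nu Pu `<=` O ->
  assumption_A1 pb k q O Phi_inf -> assumption_A2 pb k O -> assumption_A3 pb k O ->
  feas pb x0 -> sampling u xi ind Pu (law pb) n0 n K ->
  {ae Pr, forall w, forall i, (i <= K)%N -> regular_at pb k p (x i w)} ->
  eps_kkt Pr pb v p q eta eps (fun w => x (ind w) w).
Proof.
move=> setting rad oO sO A1 A2 A3 Xx0 samp reg.
have E6 := Enorm6_rademacher rad.
have [hb hb2] := par_nu_bounds m q hk d3 p2 eps0 E6.
have [hb' hVG] := par_nu_variance m q hk d3 p2 eps0 E6.
refine (convergence (sb := par_sigmabar2 k d p eps) hk d3 p2 pq setting rad oO sO A1 A2 A3 Xx0 samp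
  _ _ _ (ltW (exprn_gt0 2 eps0)) _ _ _ _ _ _ _ _ (erefl _) _ _ _ _ hVG _ hb' hb hb2 _ _ _ reg (erefl _)).
- exact: par_mu_gt0.
- exact: par_eta_gt0.
- exact: par_nu_gt0.
- exact: par_n0_gt0.
- exact: par_n_gt0.
- exact: par_K_gt0.
- exact: phat_ge2.
- exact: phat_le.
- exact: par_eta_Lmu.
- exact: par_mu_Lv.
- exact: par_mu_eps.
- exact: par_alpha_le1.
- by rewrite -Sdim_sqS; exact: Sdim_ge2.
- by rewrite -Sdim_sqS; exact: par_n_inv.
- exact: par_n0_inv.
- by rewrite -Sdim_sqS; exact: par_alpha_sb.
- exact: par_K_eta.
- apply: le_trans (par_K_Delta0 q hk d3 p2 eps0 pb x0 Phi_inf).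
  rewrite /par_Delta0 /aug_lagrangian /smooth_lag.
  by rewrite le_eqVlt; apply/orP; left; apply/eqP; ring.
- exact: par_K_con.
Qed.

End ParameterChoice.

(** * Oracle complexity *)

Section RateArithmetic.
Variable R : realType.

(** Since q = p / (p - 1), these turn L_v into an expression in p, where the factor p - 1 becomes
    visible. *)
Lemma conj_exponent_identities (p q : R) : 2 <= p -> p^-1 + q^-1 = 1 ->
  [/\ (2 - q) / (q - 1) = p - 2, (q - 1)^-1 = p - 1 & (2 - q) / q = 1 - 2 / p].
Proof.
move=> p2 pq.
have p0 : p != 0 by rewrite gt_eqF// (lt_le_trans _ p2).
have p1 : p - 1 != 0 by rewrite gt_eqF// subr_gt0 (lt_le_trans _ p2)// ltr1n.
have -> : q = p / (p - 1).
  rewrite -(invrK q) (_ : q^-1 = 1 - p^-1); last by rewrite -pq addrC addKr.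
  by rewrite (_ : 1 - p^-1 = (p - 1) / p) ?invf_div//; field.
have e : p / (p - 1) - 1 = (p - 1)^-1 by field.
by rewrite e invrK; split=> //; field; rewrite ?p0 ?p1.
Qed.

Lemma exponent_itv (p : R) : 2 <= p -> 0 <= 1 - 2 / p <= 1.
Proof.
move=> p2; have p0 : 0 < p by exact: lt_le_trans p2.
by rewrite subr_ge0 ler_pdivrMr// mul1r p2 gerBl divr_ge0// ltW.
Qed.

Lemma powR_le_max1 (a b t s : R) : 0 <= a -> a <= b -> 1 <= b -> 0 <= t -> t <= s -> a `^ t <= b `^ s.
Proof.
move=> a0 ab b1 t0 ts; apply: (le_trans (ler_powR_base t0 a0 ab)).
exact: (ler_powR b1 ts).
Qed.

Lemma Lv_scalar (p X Y x y T A1 : R) : 2 <= p -> p <= A1 -> 0 <= X -> 0 <= Y -> 0 <= T ->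
  A1 = p * T -> X <= T * x -> Y <= y -> 0 <= x ->
  (p - 2) + (p - 1) * X * Y <= (1 + x * y) * A1.
Proof.
move=> p2 pA X0 Y0 T0 AE Xx Yy x0.
have p1 : 0 <= p - 1 by lra.
have h : (p - 1) * X * Y <= (p * (T * x)) * y.
  apply: ler_pM Yy => //; first exact: mulr_ge0.
  by apply: ler_pM Xx => //; lra.
rewrite [(1 + _) * _]mulrDl mul1r; apply: lerD; first by lra.
by apply: (le_trans h); rewrite AE le_eqVlt; apply/orP; left; apply/eqP; ring.
Qed.

(** Since a <= c <= c^2, a single constant [c] serves for all entries of a maximum under a square
    root. *)
Lemma scale_sqr (a c w x : R) : 0 <= a -> a <= c -> 1 <= c -> x <= a * w ^+ 2 -> x <= (c * w) ^+ 2.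
Proof.
move=> a0 ac c1 h; apply: (le_trans h); rewrite exprMn; apply: ler_wpM2r; first exact: sqr_ge0.
by apply: (le_trans ac); rewrite expr2 -[leLHS]mulr1; apply: ler_wpM2l => //; exact: le_trans c1.
Qed.

Lemma sqrt_le_sqr (x y : R) : 0 <= y -> x <= y ^+ 2 -> Num.sqrt x <= y.
Proof. by move=> y0 /ler_wsqrtr; rewrite sqrtr_sqr ger0_norm. Qed.

Lemma sqrt_ge_inv (x y : R) : 0 < y -> y ^- 2 <= x -> y^-1 <= Num.sqrt x.
Proof.
move=> y0 /ler_wsqrtr; rewrite -exprVn sqrtr_sqr ger0_norm//.
by rewrite invr_ge0 ltW.
Qed.

Lemma quad_bound (L l w B N a b : R) : 0 <= L -> L <= l * w -> 1 <= w -> 0 < B -> 0 < N -> 0 <= a -> 0 <= b ->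
  N * (a * L ^+ 2 + b) / B <= N * (a * l ^+ 2 + b) / B * w ^+ 2.
Proof.
move=> L0 Ll w1 B0 N0 a0 b0.
have h : a * L ^+ 2 + b <= (a * l ^+ 2 + b) * w ^+ 2.
  have hL : L ^+ 2 <= l ^+ 2 * w ^+ 2 by rewrite -exprMn; apply: (sqr_mono L0).
  have hw : 1 <= w ^+ 2 by rewrite exprn_ege1.
  rewrite mulrDl; apply: lerD; first by rewrite -mulrA; exact: ler_wpM2l.
  by rewrite -[leLHS]mulr1; exact: ler_wpM2l.
rewrite -!mulrA; apply: (ler_wpM2l (ltW N0)).
rewrite [leRHS]mulrCA [leLHS]mulrC; apply: ler_wpM2l h; first by rewrite invr_ge0 ltW.
Qed.

Lemma inv_bound (B M w e N : R) : 0 < B -> 0 <= M -> 0 < N -> 0 < e -> e^-1 <= w ->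
  N * M / (B * e ^+ 2) <= N * M / B * w ^+ 2.
Proof.
move=> B0 M0 N0 e0 ew; rewrite invfM mulrA; apply: ler_wpM2l.
  by apply: divr_ge0 (ltW B0); exact: (mulr_ge0 (ltW N0)).
by rewrite -exprVn; apply: sqr_mono => //; rewrite invr_ge0 ltW.
Qed.

Lemma inv_ratio (S e w N L sb c : R) : 0 < S -> 0 < e -> e^-1 <= w -> 0 < N -> 0 < L -> 0 < sb ->
  sb <= c * S -> 0 < c -> forall C, N * L * c <= C -> 1 <= C -> (C * w) ^- 2 <= S * e ^+ 2 / (N * L * sb).
Proof.
move=> S0 e0 ew N0 L0 sb0 sc c0 C hC C1.
have i0 : 0 < e^-1 by rewrite invr_gt0.
have w0 : 0 < w by exact: lt_le_trans ew.
have NL : 0 < N * L by exact: mulr_gt0.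
have den : 0 < N * L * sb by exact: mulr_gt0.
have num : 0 < S * e ^+ 2 by rewrite mulr_gt0// exprn_gt0.
have C0 : 0 < C by exact: lt_le_trans C1.
rewrite -[leRHS]invrK lef_pV2 ?posrE ?invr_gt0 ?divr_gt0//; last by rewrite exprn_gt0// mulr_gt0.
rewrite invf_div; apply: (scale_sqr (a := N * L * c)) hC C1 _; first by rewrite mulr_ge0// ltW.
rewrite invfM mulrA.
have h1 : N * L * sb / S <= N * L * c.
  by rewrite ler_pdivrMr// -[leRHS]mulrA; apply: ler_wpM2l => //; exact: ltW.
apply: ler_pM h1 _; first by apply: divr_ge0; exact: ltW.
  by rewrite invr_ge0 sqr_ge0.
by rewrite -exprVn; apply: sqr_mono => //; exact: ltW.
Qed.

Lemma inv_scale (a c w : R) : 0 < a -> a <= c -> 1 <= c -> 1 <= w -> (c * w) ^- 2 <= a^-1.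
Proof.
move=> a0 ac c1 w1.
have c0 : 0 < c by exact: lt_le_trans c1.
have w0 : 0 < w by exact: lt_le_trans w1.
rewrite lef_pV2 ?posrE//; last by rewrite exprn_gt0// mulr_gt0.
apply: (scale_sqr (ltW a0) ac c1); rewrite -[leLHS]mulr1; apply: ler_wpM2l; first exact: ltW.
by rewrite exprn_ege1.
Qed.

Lemma le_sum4 (a b c : R) : 0 <= a -> 0 <= b -> 0 <= c ->
  [/\ 1 <= 1 + a + b + c, a <= 1 + a + b + c, b <= 1 + a + b + c & c <= 1 + a + b + c].
Proof. by move=> *; split; lra. Qed.

Lemma one_le_add (a b : R) : 2 <= a -> 0 < b -> 1 <= a + b.
Proof. by move=> *; lra. Qed.

Lemma sigmabar_scalar (e s M S : R) : e <= 1 -> 2 <= S -> 0 <= M ->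
  e / 16 + 4 * S * s + M <= (1 + 4 * s + M) * S.
Proof.
move=> e1 S2 M0; have h : M * 2 <= M * S by apply: ler_wpM2l.
have -> : (1 + 4 * s + M) * S = S + 4 * S * s + M * S by ring.
by move: (4 * S * s) => x; lra.
Qed.

(** Here E = 1/eps and T = A. Expanding T + E, the mixed terms are absorbed by Young's inequality,
    and E >= 1 puts E^2 and the rounding unit below E^3. *)
Lemma iteration_scalar (t1 t2 t3 a b g E T : R) : 0 <= a -> 0 <= b -> 0 <= g -> 1 <= E -> 0 <= T ->
  t1 <= a * ((T + E) * E ^+ 2) -> t2 <= b * E ^+ 2 -> t3 <= g * (T + E) ^+ 2 ->
  t1 + t2 + t3 + 1 <= (a + b + 2 * g + 1) * (E ^+ 3 + T * E ^+ 2 + T ^+ 2).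
Proof.
move=> a0 b0 g0 E1 T0 h1 h2 h3.
have E2 : 1 <= E ^+ 2 by rewrite exprn_ege1.
have E3 : E ^+ 2 <= E ^+ 3 by rewrite -[leLHS]mul1r [leRHS]exprS; apply: ler_wpM2r => //; exact: sqr_ge0.
have TE : 0 <= T * E ^+ 2 by apply: mulr_ge0 => //; exact: sqr_ge0.
have T2 := sqr_ge0 T.
have W2 : (T + E) ^+ 2 <= 2 * (T ^+ 2 + E ^+ 2).
  by rewrite -subr_ge0 (_ : _ - _ = (T - E) ^+ 2); [exact: sqr_ge0 | ring].
have eW : (T + E) * E ^+ 2 = T * E ^+ 2 + E ^+ 3 by ring.
have k1 := le_trans h3 (ler_wpM2l g0 W2).
rewrite eW in h1; move: h1 h2 k1 E2 E3 TE T2.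
move: (E ^+ 2) (E ^+ 3) (T * _) (T ^+ 2) => x y z s h1 h2 k1 x1 xy z0 s0.
have Q0 : y <= y + z + s by lra.
have q1 : a * (z + y) <= a * (y + z + s) by apply: ler_wpM2l => //; lra.
have q2 : b * x <= b * (y + z + s) by apply: ler_wpM2l => //; lra.
have q3 : g * (2 * (s + x)) <= g * (2 * (y + z + s)) by apply: ler_wpM2l => //; lra.
have -> : (a + b + 2 * g + 1) * (y + z + s) =
  a * (y + z + s) + b * (y + z + s) + g * (2 * (y + z + s)) + (y + z + s) by ring.
lra.
Qed.

Lemma max3_le (a b c : R) : 0 <= a -> 0 <= b -> 0 <= c -> Num.max (Num.max a b) c <= a + b + c.
Proof. by move=> a0 b0 c0; rewrite !ge_max; apply/andP; split; [apply/andP; split|]; lra. Qed.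

(** [F] is phat S, the order of the batch size, and [Q] the order of K. The initial batch, of order
    F eps^-2, is absorbed because eps^-2 <= Q. *)
Lemma oracle_scalar (n0 n K F Q s c E2 : R) : 0 <= F -> 1 <= E2 -> E2 <= Q -> 0 <= s -> 0 <= n -> 0 <= K ->
  n0 <= s * F * E2 + 1 -> 1 <= F -> n <= F -> K <= c * Q ->
  2 * n0 + 4 * n * K <= (2 * s + 2 + 4 * c) * (F * Q).
Proof.
move=> F0 E1 EQ s0 nn K0 hn0 F1 hn hK.
have Q1 : 1 <= Q by exact: le_trans EQ.
have h1 : n * K <= F * (c * Q) by apply: ler_pM.
have h2 : s * F * E2 <= s * F * Q by apply: ler_wpM2l => //; exact: mulr_ge0.
have h3 : 1 <= F * Q by rewrite -[leLHS]mulr1; apply: ler_pM.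
have -> : (2 * s + 2 + 4 * c) * (F * Q) = 2 * (s * F * Q) + 2 * (F * Q) + 4 * (F * (c * Q)) by ring.
have -> : 4 * n * K = 4 * (n * K) by ring.
lra.
Qed.

Lemma oracle_calls_le (n0 n K : nat) : (oracle_calls n0 n K)%:R <= 2 * n0%:R + 4 * n%:R * K%:R :> R.
Proof.
rewrite /oracle_calls -!natrM -natrD ler_nat.
case: K => [|K]; first by rewrite big_ord0.
rewrite big_ord_recl /= (eq_bigr (fun=> (n * 4)%N)) // sum_nat_const card_ord.
by rewrite leq_add2l [(4 * n)%N]mulnC mulnC leq_mul2l leqnSn orbT.
Qed.

Lemma horizon_scalar (N D G ce w eta e : R) : 0 <= N -> 0 <= G -> D <= G -> 0 < eta -> eta^-1 <= ce * w ->
  N * D / (eta * e ^+ 2) <= N * G * ce * (w * e^-1 ^+ 2).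
Proof.
move=> N0 G0 DG eta0 h.
have -> : N * D / (eta * e ^+ 2) = N * D * eta^-1 * e^-1 ^+ 2 by rewrite exprVn invfM [LHS]mulrA.
have -> : N * G * ce * (w * e^-1 ^+ 2) = N * G * (ce * w) * e^-1 ^+ 2 by ring.
apply: ler_wpM2r; first exact: sqr_ge0.
apply: (@le_trans _ _ (N * G * eta^-1)).
  apply: ler_wpM2r; first by rewrite invr_ge0 ltW.
  exact: ler_wpM2l.
by apply: ler_wpM2l h; exact: mulr_ge0.
Qed.

End RateArithmetic.

(** * Growth of the parameters in d, p and eps *)

Section Complexity.
Variables (R : realType) (k : constants R) (m : nat).
Hypothesis hk : constants_pos k.
Local Notation A d p := (p * d%:R `^ (1 - 2 / p)).
Local Notation W d p eps := (A d p + eps^-1).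

Let Lf0 : 0 < cLf k. Proof. by case: hk => -[]. Qed.
Let Mcb0 : 0 < cMcbar k. Proof. by case: hk => _ [[]]. Qed.
Let beta0 : 0 < cbeta k. Proof. by case: hk => _ [[]]. Qed.
Let rho0 : 0 < crho k. Proof. by case: hk => _ [_ []]. Qed.
Let DX0 : 0 < cDX k. Proof. by case: hk => _ [_ []]. Qed.
Let dl0 : 0 < cdelta k. Proof. by case: hk => _ [_ []]. Qed.

Lemma rate_base_ge (d : nat) (p : R) : (3 <= d)%N -> 2 <= p -> p <= A d p.
Proof.
move=> d3 p2; have [t0 _] := andP (exponent_itv p2).
have d1 : 1 <= d%:R :> R by rewrite ler1n (leq_trans _ d3).
have h := ler_powR d1 t0; rewrite (powRr0 _) in h.
by rewrite -[leLHS]mulr1; apply: ler_wpM2l h; exact: le_trans p2.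
Qed.

(** In terms of p, L_v is (p - 2) + (p - 1) (D_X^q + d delta^q)^(1 - 2/p) delta^(q - 2). As 1 < q <=
    2 and 0 <= 1 - 2/p <= 1, the powers of D_X and delta are bounded uniformly in p, and d^(1 - 2/p)
    comes out of the bracket. *)
Lemma par_Lv_rate : exists2 c, 0 < c & forall (d : nat) (p q : R), (3 <= d)%N -> 2 <= p ->
  p^-1 + q^-1 = 1 -> par_Lv k d q <= c * A d p.
Proof.
pose b1 := (1 + cDX k) ^+ 2 + (1 + cdelta k) ^+ 2.
pose b2 := 1 + (cdelta k)^-1.
have sq1 (x : R) : 0 < x -> 1 <= (1 + x) ^+ 2.
  by move=> x0; rewrite exprn_ege1// lerDl ltW.
have b11 : 1 <= b1.
  by rewrite -[leLHS]addr0; apply: lerD; [exact: sq1 | exact: sqr_ge0].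
have b20 : 1 <= b2 by rewrite lerDl invr_ge0 ltW.
exists (1 + b1 * b2); first by apply: ltr_pwDl => //; apply: mulr_ge0; exact: le_trans ler01 _.
move=> d p q d3 p2 pq; have [e1 e2 e3] := conj_exponent_identities p2 pq.
have /andP[t0 t1] := exponent_itv p2.
have /andP[q1 q2] := conj_itv p2 pq.
have q0 : 0 <= q by apply: ltW; exact: lt_trans q1.
have d0 : 0 <= d%:R :> R by [].
have d1 : 1 <= d%:R :> R by rewrite ler1n (leq_trans _ d3).
rewrite /par_Lv e1 e2 e3.
have pw (x : R) : 0 < x -> x `^ q <= (1 + x) ^+ 2.
  move=> x0; have x1 : 1 <= 1 + x by rewrite lerDl ltW.
  apply: (le_trans (powR_le_max1 (ltW x0) _ x1 q0 q2)); first by rewrite lerDr.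
  have x2 : 0 <= 1 + x by exact: le_trans x1.
  by have -> := powR_mulrn 2 x2; exact: lexx.
apply: (Lv_scalar p2 (rate_base_ge d3 p2) (powR_ge0 _ _) (powR_ge0 _ _) (powR_ge0 d%:R (1 - 2 / p)) (erefl _)).
- have b10 : 0 <= b1 by exact: le_trans b11.
  have h0 : 0 <= cDX k `^ q + d%:R * cdelta k `^ q.
    by apply: addr_ge0 (powR_ge0 _ _) _; apply: mulr_ge0 d0 (powR_ge0 _ _).
  have h : cDX k `^ q + d%:R * cdelta k `^ q <= d%:R * b1.
    rewrite mulrDr; apply: lerD.
      apply: (le_trans (pw _ DX0)); rewrite -[leLHS]mul1r.
      by apply: ler_wpM2r d1; exact: sqr_ge0.
    by apply: (ler_wpM2l d0); exact: pw.
  apply: (le_trans (ler_powR_base t0 h0 h)).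
  rewrite (powRM _ d0 b10); apply: (ler_wpM2l (powR_ge0 _ _)).
  apply: (le_trans (ler_powR b11 t1)); rewrite (powRr1 b10); exact: lexx.
- have i0 : 0 <= (cdelta k)^-1 by rewrite invr_ge0 ltW.
  have -> : cdelta k `^ (q - 2) = (cdelta k)^-1 `^ (2 - q).
    by rewrite -(powR_inv1 (ltW dl0)) -powRrM mulN1r opprB.
  have s0 : 0 <= 2 - q by rewrite subr_ge0.
  have s1 : 2 - q <= 1 by lra.
  have b2' : 0 <= b2 by exact: le_trans b20.
  apply: (le_trans (powR_le_max1 i0 _ b20 s0 s1)); first by rewrite lerDr.
  by rewrite (powRr1 b2'); exact: lexx.
- exact: le_trans b11.
Qed.

Lemma rate_base2 (d : nat) (p : R) : (3 <= d)%N -> 2 <= p -> 2 <= A d p.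
Proof. by move=> d3 p2; exact: le_trans (rate_base_ge d3 p2). Qed.

(** Two entries of the maximum defining mu^2 are quadratic in L_v = O(A), the third is O(eps^-2). *)
Lemma par_mu_rate : exists2 c, 0 < c & forall (d : nat) (p q eps : R), (3 <= d)%N -> 2 <= p ->
  p^-1 + q^-1 = 1 -> 0 < eps -> par_mu k m d q eps <= c * W d p eps.
Proof.
have [l l0 hl] := par_Lv_rate.
have B0 : 0 < cbeta k ^+ 2 by exact: exprn_gt0.
pose M := cMf k ^+ 2 + cMh k ^+ 2 + m%:R ^+ 2 * crho k ^+ 2 * cMcbar k ^+ 2 * cMc k ^+ 2.
have M0 : 0 <= M.
  by rewrite !addr_ge0 ?sqr_ge0//; do 3![apply: mulr_ge0; last exact: sqr_ge0]; exact: sqr_ge0.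
pose a1 := 10 * (8 * l ^+ 2 + 3) / (27 * cbeta k ^+ 2).
pose a2 := 8 * (2 * l ^+ 2 + 1) / (3 * cbeta k ^+ 2).
pose a3 := 40 * M / cbeta k ^+ 2.
have l2 := sqr_ge0 l.
have a10 : 0 <= a1.
  by apply: divr_ge0; apply: mulr_ge0 => //; [apply: addr_ge0 => //; exact: mulr_ge0 | exact: ltW].
have a20 : 0 <= a2.
  by apply: divr_ge0; apply: mulr_ge0 => //; [apply: addr_ge0 => //; exact: mulr_ge0 | exact: ltW].
have a30 : 0 <= a3 by apply: divr_ge0 (ltW B0); exact: mulr_ge0.
pose c := 1 + a1 + a2 + a3.
have [c1 ac1 ac2 ac3] := le_sum4 a10 a20 a30; rewrite -/c in c1 ac1 ac2 ac3.
exists c; first exact: lt_le_trans c1.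
move=> d p q eps d3 p2 pq e0.
have i0 : 0 < eps^-1 by rewrite invr_gt0.
have A2 := rate_base2 d3 p2; have Lvl := hl d p q d3 p2 pq.
have Lv0 : 0 <= par_Lv k d q by exact: par_Lv_ge0 p2 pq.
move: Lvl A2; rewrite /par_mu; move: (A d p) (par_Lv k d q) Lv0 => T L L0 LT T2.
have w1 := one_le_add T2 i0.
have Lw : L <= l * (T + eps^-1).
  by apply: (le_trans LT); apply: (ler_wpM2l (ltW l0)); rewrite lerDl ltW.
have ew : eps^-1 <= T + eps^-1 by rewrite lerDr (le_trans _ T2).
apply: sqrt_le_sqr; first by apply: mulr_ge0; exact: le_trans ler01 _.
rewrite !ge_max -/M; apply/andP; split; first (apply/andP; split).
- apply: (scale_sqr a10 ac1 c1); apply: (quad_bound L0 Lw w1) => //; exact: mulr_gt0.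
- apply: (scale_sqr a20 ac2 c1); apply: (quad_bound L0 Lw w1) => //; exact: mulr_gt0.
- by apply: (scale_sqr a30 ac3 c1); exact: inv_bound.
Qed.

Lemma par_sigmabar2_rate : exists2 c, 0 < c & forall (d : nat) (p eps : R), (3 <= d)%N -> 2 <= p ->
  0 < eps -> eps <= 1 -> par_sigmabar2 k d p eps <= c * Sdim d p.
Proof.
have s0 : 0 <= csigma k ^+ 2 + cMf k ^+ 2 by rewrite addr_ge0// sqr_ge0.
have M0 : 0 <= 2 * cMf k ^+ 2 by rewrite mulr_ge0// sqr_ge0.
exists (1 + 4 * (csigma k ^+ 2 + cMf k ^+ 2) + 2 * cMf k ^+ 2).
  by rewrite -addrA ltr_pwDl// addr_ge0// mulr_ge0.
move=> d p eps d3 p2 e0 e1; have S2 := Sdim_ge2 d3 p2.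
rewrite /par_sigmabar2; move: (Sdim d p) S2 => S S2.
have e2 : eps ^+ 2 <= 1 by rewrite expr_le1// ltW.
exact: sigmabar_scalar.
Qed.

Lemma par_Lmu_rate : exists2 c, 0 < c & forall (d : nat) (p q eps : R), (3 <= d)%N -> 2 <= p ->
  p^-1 + q^-1 = 1 -> 0 < eps -> par_Lmu k m d q eps <= c * W d p eps.
Proof.
have [c c0 hc] := par_mu_rate.
have Lc0 : 0 < cLc k by case: hk => _ [[]].
pose a := cMc k ^+ 2 + cMcbar k * cLc k.
pose b := crho k * cMcbar k * cLc k.
have a0 : 0 <= a by rewrite addr_ge0 ?sqr_ge0// mulr_ge0// ltW.
have b0 : 0 <= b by rewrite !mulr_ge0// ltW.
exists (cLf k + m%:R * (c * a + b)).
  by apply: ltr_pwDl => //; apply: mulr_ge0 => //; apply: addr_ge0 => //; apply: mulr_ge0 => //; exact: ltW.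
move=> d p q eps d3 p2 pq e0; have h := hc d p q eps d3 p2 pq e0.
have A2 := rate_base2 d3 p2; have i0 : 0 < eps^-1 by rewrite invr_gt0.
have w1 := one_le_add A2 i0.
rewrite /par_Lmu; move: (W d p eps) (par_mu k m d q eps) w1 h => w mu w1 h.
rewrite mulrDl; apply: lerD; first by rewrite -[leLHS]mulr1 ler_wpM2l// ltW.
rewrite -[leRHS]mulrA; apply: ler_wpM2l => //; rewrite mulrDl; apply: lerD.
  have -> : mu * cMc k ^+ 2 + mu * cMcbar k * cLc k = mu * a by rewrite /a; ring.
  by have := ler_wpM2r a0 h; rewrite mulrAC.
by rewrite -[leLHS]mulr1; exact: ler_wpM2l.
Qed.

(** eta^-2 is the maximum of 4 L_mu^2, a constant, and a multiple of sigmabar^2 / (S eps^2), where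
    the dimension cancels because sigmabar^2 = O(S). *)
Lemma par_eta_rate : exists2 c, 0 < c & forall (d : nat) (p q eps : R), (3 <= d)%N -> 2 <= p ->
  p^-1 + q^-1 = 1 -> 0 < eps -> eps <= 1 -> (par_eta k m d p q eps)^-1 <= c * W d p eps.
Proof.
have [c c0 hc] := par_Lmu_rate; have [s s0 hs] := par_sigmabar2_rate.
have L2 : 0 < cLf k ^+ 2 by exact: exprn_gt0.
have N0 : 0 < 23040 :> R by exact: ltr0Sn.
rewrite /par_eta; move: 23040%:R N0 => N N0.
pose C := 1 + 2 * c + 96 * cLf k ^+ 2 + N * cLf k ^+ 2 * s.
have x1 : 0 < 96 * cLf k ^+ 2 by rewrite mulr_gt0.
have x2 : 0 < N * cLf k ^+ 2 * s by rewrite !mulr_gt0.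
have x0 : 0 < 2 * c by rewrite mulr_gt0.
have [C1 Cc CL CN] := le_sum4 (ltW x0) (ltW x1) (ltW x2); rewrite -/C in C1 Cc CL CN.
have C0 : 0 < C by exact: lt_le_trans C1.
exists C => // d p q eps d3 p2 pq e0 e1.
have h := hc d p q eps d3 p2 pq e0; have hs' := hs d p eps d3 p2 e0 e1.
have Lmu0 := par_Lmu_gt0 m d q eps hk.
have sb0 := par_sigmabar2_gt0 k d3 p2 e0.
have S0 : 0 < Sdim d p by exact: (lt_le_trans (ltr0Sn _ 1) (Sdim_ge2 d3 p2)).
have A2 := rate_base2 d3 p2; have i0 : 0 < eps^-1 by rewrite invr_gt0.
have w1 := one_le_add A2 i0.
have ew : eps^-1 <= W d p eps by rewrite lerDr (le_trans _ A2).
move: (W d p eps) w1 ew h => w w1 ew h.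
have w0 : 0 < w by exact: lt_le_trans w1.
rewrite -[leRHS]invrK; rewrite lef_pV2 ?posrE ?invr_gt0.
- apply: sqrt_ge_inv; first exact: mulr_gt0.
  rewrite !le_min; apply/andP; split; first (apply/andP; split).
  + have Lm2 : 0 < par_Lmu k m d q eps ^+ 2 by exact: exprn_gt0.
    rewrite lef_pV2 ?posrE; [|by rewrite exprn_gt0// mulr_gt0|by rewrite mulr_gt0].
    rewrite (_ : 4 * _ ^+ 2 = (2 * par_Lmu k m d q eps) ^+ 2); last by ring.
    apply: sqr_mono; first by rewrite mulr_ge0// ltW.
    have := ler_wpM2l (ler0n R 2) h; move/le_trans; apply.
    by rewrite mulrA; apply: ler_wpM2r Cc; exact: ltW.
  + exact: inv_scale.
  + exact: (inv_ratio S0 e0 ew N0 L2 sb0 hs' s0).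
- rewrite sqrtr_gt0 !lt_min; apply/andP; split; first (apply/andP; split).
  + by rewrite invr_gt0 mulr_gt0// exprn_gt0.
  + by rewrite invr_gt0.
  + by rewrite divr_gt0// mulr_gt0// ?exprn_gt0// mulr_gt0.
- exact: mulr_gt0.
Qed.

(** The assumption on x^0 keeps the penalty mu / 2 |c(x^0)|_2^2 below 1, although mu grows as eps
    tends to 0. *)
Lemma par_Delta0_le (d : nat) (q eps gap : R) (dxi : measure_display) (Xi : measurableType dxi)
    (pb : problem R d m Xi) (x0 : 'rV[R]_d) (Phi_inf : R) : 0 < par_mu k m d q eps ->
  ((obj pb x0)%:E + reg pb x0 - Phi_inf%:E = gap%:E)%E ->
  pnorm 2 (con pb x0) ^+ 2 <= (par_mu k m d q eps)^-1 ->
  par_Delta0 k q eps pb x0 Phi_inf <= `|gap| + 1 + 2 * m%:R * crho k * cMcbar k ^+ 2.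
Proof.
move=> mu0 hg hc; rewrite /par_Delta0 /aug_lagrangian dotv0l addr0; apply: lerD => //.
have -> : gap = obj pb x0 + fine (reg pb x0) - Phi_inf.
  by move: hg; case: (reg pb x0) => [t| |] //= -[].
have h : par_mu k m d q eps / 2 * pnorm 2 (con pb x0) ^+ 2 <= 1.
  have := ler_wpM2l (ltW mu0) hc; rewrite mulfV ?gt_eqF//.
  have : 0 <= par_mu k m d q eps * pnorm 2 (con pb x0) ^+ 2 by rewrite mulr_ge0 ?sqr_ge0 // ltW.
  rewrite mulrAC; move: (par_mu _ _ _ _ _ * _) => y y0 y1.
  by rewrite ler_pdivrMr//; apply: (le_trans y1); rewrite mul1r ler1n.
rewrite addrAC; apply: lerD h; exact: ler_norm.
Qed.

(** (beta mu)^2 >= 8 (2 L_v^2 + 1) / 3 >= 1. Together with |c(x^0)|_2^2 <= 1 / mu this bounds the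
    second entry of K by a multiple of eps^-2. *)
Lemma par_mu_inv_le (d : nat) (q eps : R) : (par_mu k m d q eps)^-1 <= cbeta k.
Proof.
have mu0 := par_mu_gt0 m d q eps hk.
have := par_mu_Lv m d q eps hk; rewrite -exprMn => h.
have L0 := sqr_ge0 (par_Lv k d q).
have h1 : 1 <= (cbeta k * par_mu k m d q eps) ^+ 2.
  by apply: le_trans h; rewrite ler_pdivlMr//; move: L0; move: (par_Lv _ _ _ ^+ 2) => y y0; lra.
have y0 : 0 <= cbeta k * par_mu k m d q eps by rewrite mulr_ge0// ltW.
by rewrite invf_ple ?posrE//; rewrite -[_^-1]mul1r ler_pdivrMr// mulrC;
  move: h1; rewrite expr_ge1.
Qed.

(** With W = A + 1/eps the three entries of the maximum defining K are O(W eps^-2), O(eps^-2) and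
    O(W^2). *)
Lemma par_K_rate (gap : R) : exists2 c, 0 < c &
  forall (d : nat) (p q eps : R), (3 <= d)%N -> 2 <= p -> p^-1 + q^-1 = 1 -> 0 < eps -> eps <= 1 ->
  forall (dxi : measure_display) (Xi : measurableType dxi) (pb : problem R d m Xi)
    (x0 : 'rV[R]_d) (Phi_inf : R),
  ((obj pb x0)%:E + reg pb x0 - Phi_inf%:E = gap%:E)%E ->
  pnorm 2 (con pb x0) ^+ 2 <= (par_mu k m d q eps)^-1 ->
  (par_K k p q eps pb x0 Phi_inf)%:R
    <= c * (eps^-1 ^+ 3 + A d p * eps^-1 ^+ 2 + A d p ^+ 2).
Proof.
have [ce ce0 he] := par_eta_rate.
have L2 : 0 < cLf k ^+ 2 by exact: exprn_gt0.
pose G := `|gap| + 1 + 2 * m%:R * crho k * cMcbar k ^+ 2.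
have G0 : 0 < G.
  apply: ltr_wpDr; last by rewrite ltr_wpDl.
  by apply: mulr_ge0 (sqr_ge0 _); apply: mulr_ge0 (ltW rho0); rewrite mulr_ge0.
pose a := 108 * G * ce; pose b := 5 * cbeta k; pose g := (cLf k ^+ 2)^-1 * ce ^+ 2.
have a0 : 0 <= a by rewrite !mulr_ge0// ltW.
have b0 : 0 <= b by rewrite mulr_ge0// ltW.
have g0 : 0 <= g by rewrite mulr_ge0 ?sqr_ge0// invr_ge0 ltW.
exists (a + b + 2 * g + 1); first by rewrite ltr_wpDl// !addr_ge0// mulr_ge0.
move=> d p q eps d3 p2 pq e0 e1 dxi Xi pb x0 Phi_inf hg hc.
have mu0 := par_mu_gt0 m d q eps hk.
have eta0 : 0 < par_eta k m d p q eps by exact: par_eta_gt0.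
have hD := par_Delta0_le mu0 hg hc; rewrite -/G in hD.
have hE := he d p q eps d3 p2 pq e0 e1.
have T0 : 0 <= A d p by apply: le_trans (rate_base2 d3 p2).
have E1 : 1 <= eps^-1 by rewrite invf_ge1.
have i0 : 0 <= eps^-1 by exact: le_trans E1.
have h0 : 0 <= (par_eta k m d p q eps)^-1 by rewrite invr_ge0 ltW.
pose t1 := 108 * par_Delta0 k q eps pb x0 Phi_inf / (par_eta k m d p q eps * eps ^+ 2).
pose t2 := 5 * pnorm 2 (con pb x0) ^+ 2 / eps ^+ 2.
pose t3 := (cLf k ^+ 2 * par_eta k m d p q eps ^+ 2)^-1.
have b1 : t1 <= a * (W d p eps * eps^-1 ^+ 2).
  exact: (horizon_scalar _ (ler0n _ 108) (ltW G0) hD eta0 hE).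
have b2 : t2 <= b * eps^-1 ^+ 2.
  rewrite /t2 -exprVn; apply: ler_wpM2r; first exact: sqr_ge0.
  by apply: ler_wpM2l => //; exact: le_trans hc (par_mu_inv_le _ _ _).
have b3 : t3 <= g * W d p eps ^+ 2.
  have i2 : 0 <= (cLf k ^+ 2)^-1 by rewrite invr_ge0 ltW.
  have -> : t3 = (cLf k ^+ 2)^-1 * (par_eta k m d p q eps)^-1 ^+ 2 by rewrite /t3 invfM exprVn.
  have -> : g * W d p eps ^+ 2 = (cLf k ^+ 2)^-1 * (ce * W d p eps) ^+ 2.
    by rewrite /g exprMn [RHS]mulrA.
  by apply: (ler_wpM2l i2); exact: sqr_mono.
have t30 : 0 <= t3 by rewrite invr_ge0 mulr_ge0// sqr_ge0.
have t20 : 0 <= t2 by rewrite divr_ge0 ?sqr_ge0// mulr_ge0// sqr_ge0.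
apply: (le_trans (ltW (natceil_lt _))); first by rewrite le_max t30 orbT.
(* With the positive part of [t1] all three entries are nonnegative, so their maximum is at most
   their sum. *)
have m1 : t1 <= Num.max t1 0 by rewrite le_max lexx.
have b1' : Num.max t1 0 <= a * (W d p eps * eps^-1 ^+ 2).
  rewrite ge_max b1 mulr_ge0// mulr_ge0 ?sqr_ge0//; exact: addr_ge0.
have := iteration_scalar a0 b0 g0 E1 T0 b1' b2 b3; apply: le_trans; rewrite lerD2r.
apply: le_trans (max3_le _ t20 t30); last by rewrite le_max lexx orbT.
rewrite -/t1 -/t2 -/t3 !ge_max !le_max !lexx ?orbT /=; by rewrite ?orbT.
Qed.

(** Rounding up costs at most 1 <= S, so (phat - 1) S grows to at most phat S. *)
Lemma par_n_le (d : nat) (p : R) : (3 <= d)%N -> 2 <= p -> (par_n d p)%:R <= phat d p * Sdim d p.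
Proof.
move=> d3 p2; have r2 := phat_ge2 d3 p2; have S2 := Sdim_ge2 d3 p2.
apply: (le_trans (ltW (natceil_lt _))).
  by apply: mulr_ge0; [rewrite subr_ge0 (le_trans _ r2)// ler1n | exact: le_trans S2].
by rewrite mulrBl mul1r -addrA gerDl addrC subr_le0 (le_trans _ S2)// ler1n.
Qed.

Lemma par_n0_rate : exists2 c, 0 < c & forall (d : nat) (p eps : R), (3 <= d)%N -> 2 <= p ->
  0 < eps -> eps <= 1 ->
  (par_n0 k d p eps)%:R <= c * (phat d p * Sdim d p) * eps^-1 ^+ 2 + 1.
Proof.
have [s s0 hs] := par_sigmabar2_rate.
exists (5 / 4 * s); first by rewrite mulr_gt0.
move=> d p eps d3 p2 e0 e1; have r2 := phat_ge2 d3 p2; have S2 := Sdim_ge2 d3 p2.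
have sb0 := par_sigmabar2_gt0 k d3 p2 e0.
have r1 : 0 <= phat d p - 1 by rewrite subr_ge0 (le_trans _ r2)// ler1n.
apply: (le_trans (ltW (natceil_lt _))).
  apply: divr_ge0; last by rewrite mulr_ge0// sqr_ge0.
  by apply: mulr_ge0 (ltW sb0); apply: mulr_ge0.
rewrite lerD2r invfM mulrA -exprVn; apply: ler_wpM2r; first exact: sqr_ge0.
rewrite mulrAC; have -> : 5 * (phat d p - 1) / 4 * par_sigmabar2 k d p eps
  = 5 / 4 * ((phat d p - 1) * par_sigmabar2 k d p eps) by ring.
rewrite -[leRHS]mulrA; apply: ler_wpM2l => //; rewrite [leRHS]mulrCA.
have h := hs d p eps d3 p2 e0 e1.
apply: ler_pM => //; first exact: ltW.
by rewrite gerDl lerN10.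
Qed.

(** For p <= 2 ln d the left-hand side expands exactly to the rate, the powers of d combining.
    Beyond that phat = 2 ln d and S = e <= 3, and 2 times 3 is the factor 6. *)
Lemma complexity_rate_ge (d : nat) (p eps : R) : (3 <= d)%N -> 2 <= p -> 0 < eps ->
  phat d p * Sdim d p * (eps^-1 ^+ 3 + A d p * eps^-1 ^+ 2 + A d p ^+ 2)
    <= 6 * complexity_rate d p eps.
Proof.
move=> d3 p2 e0.
have p0 : 0 < p by exact: lt_le_trans p2.
have i0 : 0 <= eps^-1 by rewrite invr_ge0 ltW.
have dR0 : 0 < d%:R :> R by rewrite ltr0n (leq_trans _ d3).
have dn0 : d%:R != 0 :> R by rewrite gt_eqF.
have pD (x y : R) : d%:R `^ x * d%:R `^ y = d%:R `^ (x + y).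
  by rewrite powRD//; apply/implyP.
have l1 : 1 <= ln d%:R :> R := ln_ge1 R d3.
have l0 : 0 < ln d%:R :> R by exact: lt_le_trans l1.
rewrite /complexity_rate /Sdim /phat; case: ifPn => hp.
  have -> : p ^+ 2 * d%:R = p * (d%:R `^ (2 / p) * (p * d%:R `^ (1 - 2 / p))).
    have -> : d%:R `^ (2 / p) * (p * d%:R `^ (1 - 2 / p)) = p * d%:R :> R.
      by rewrite mulrCA pD addrC subrK (powRr1 (ltW dR0)).
    by ring.
  have -> : p ^+ 3 * d%:R `^ (2 - 2 / p) = p * (d%:R `^ (2 / p) * (p * d%:R `^ (1 - 2 / p)) ^+ 2).
    have -> : 2 - 2 / p = 2 / p + (1 - 2 / p) + (1 - 2 / p) :> R by field; rewrite gt_eqF.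
    by rewrite -(pD (2 / p + (1 - 2 / p))) -(pD (2 / p)); move: (_ `^ (2 / p)) (_ `^ (1 - 2 / p)) => a b; ring.
  have a0 := powR_ge0 (d%:R : R) (2 / p); have b0 := powR_ge0 (d%:R : R) (1 - 2 / p).
  move: (_ `^ (2 / p)) (_ `^ (1 - 2 / p)) a0 b0 => a b a0 b0; rewrite -!exprVn.
  have h : 0 <= p * a * (eps^-1 ^+ 3 + p * b * eps^-1 ^+ 2 + (p * b) ^+ 2).
    apply: mulr_ge0; first by rewrite mulr_ge0// ltW.
    rewrite !addr_ge0 ?exprn_ge0 ?mulr_ge0 ?exprn_ge0//; exact: ltW.
  have -> : p * a * eps^-1 ^+ 3 + p * (a * (p * b)) * eps^-1 ^+ 2 + p * (a * (p * b) ^+ 2)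
    = p * a * (eps^-1 ^+ 3 + p * b * eps^-1 ^+ 2 + (p * b) ^+ 2) by ring.
  by move: (p * a * _) h => y; lra.
have -> : d%:R `^ (2 / (2 * ln d%:R)) = expR 1 :> R.
  rewrite -[LHS]lnK; last by rewrite posrE powR_gt0.
  by rewrite ln_powR (_ : _ * _ = 1) //; field; rewrite gt_eqF.
have -> : d%:R `^ (2 - 4 / p) = d%:R `^ (1 - 2 / p) * d%:R `^ (1 - 2 / p) :> R.
  by rewrite pD; congr (_ `^ _); field; rewrite gt_eqF.
have b0 := powR_ge0 (d%:R : R) (1 - 2 / p).
move: (_ `^ (1 - 2 / p)) b0 => b b0; rewrite -!exprVn.
have -> : 6 * (ln d%:R * eps^-1 ^+ 3 + p * b * ln d%:R * eps^-1 ^+ 2 + p ^+ 2 * (b * b) * ln d%:R)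
  = 2 * ln d%:R * 3 * (eps^-1 ^+ 3 + p * b * eps^-1 ^+ 2 + (p * b) ^+ 2) by ring.
apply: ler_wpM2r.
  rewrite !addr_ge0 ?exprn_ge0 ?mulr_ge0 ?exprn_ge0//; exact: ltW.
by apply: ler_wpM2l (expR1_le3 R); rewrite mulr_ge0// ltW.
Qed.

Lemma oracle_calls_rate (gap : R) : exists2 C, 0 < C &
  forall (d : nat) (p q eps : R), (3 <= d)%N -> 2 <= p -> p^-1 + q^-1 = 1 -> 0 < eps -> eps <= 1 ->
  forall (dxi : measure_display) (Xi : measurableType dxi) (pb : problem R d m Xi)
    (x0 : 'rV[R]_d) (Phi_inf : R),
  ((obj pb x0)%:E + reg pb x0 - Phi_inf%:E = gap%:E)%E ->
  pnorm 2 (con pb x0) ^+ 2 <= (par_mu k m d q eps)^-1 ->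
  (oracle_calls (par_n0 k d p eps) (par_n d p) (par_K k p q eps pb x0 Phi_inf))%:R
    <= C * complexity_rate d p eps.
Proof.
have [c c0 hc] := par_K_rate gap; have [s s0 hs] := par_n0_rate.
pose C := 2 * s + 2 + 4 * c.
have C0 : 0 < C by rewrite /C; apply: addr_gt0; [apply: addr_gt0 => //|]; exact: mulr_gt0.
exists (C * 6); first exact: mulr_gt0.
move=> d p q eps d3 p2 pq e0 e1 dxi Xi pb x0 Phi_inf hg hx0.
apply: (le_trans (oracle_calls_le _ _ _ _)).
have hK := hc d p q eps d3 p2 pq e0 e1 dxi Xi pb x0 Phi_inf hg hx0.
have hn0 := hs d p eps d3 p2 e0 e1; have hn := par_n_le d3 p2.
rewrite -[leRHS]mulrA; apply: le_trans (ler_wpM2l (ltW C0) (complexity_rate_ge d3 p2 e0)).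
have T0 : 0 <= A d p by apply: le_trans (rate_base2 d3 p2).
have E1 : 1 <= eps^-1 by rewrite invf_ge1.
have i0 : 0 <= eps^-1 by exact: le_trans E1.
have F1 : 1 <= phat d p * Sdim d p.
  rewrite -[leLHS]mulr1; apply: ler_pM => //.
    by apply: le_trans (phat_ge2 d3 p2); rewrite ler1n.
  by apply: le_trans (Sdim_ge2 d3 p2); rewrite ler1n.
apply: (oracle_scalar _ _ _ (ltW s0) _ _ hn0 F1 hn hK) => //.
- exact: le_trans F1.
- by rewrite exprn_ege1.
- have h : eps^-1 ^+ 2 <= eps^-1 ^+ 3.
    by rewrite -[leLHS]mul1r [leRHS]exprS; apply: ler_wpM2r => //; exact: sqr_ge0.
  apply: (le_trans h); rewrite -addrA lerDl; apply: addr_ge0; last exact: sqr_ge0.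
  by apply: mulr_ge0 => //; exact: sqr_ge0.
Qed.

End Complexity.

Theorem theorem6p1 (R : realType) (m : nat) (hm : (1 <= m)%N)
  (k : constants R) (hk : constants_pos k) (gap : R) :
  exists C : R, 0 < C /\
  forall (d : nat) (p q eps : R),
  (3 <= d)%N -> 2 <= p -> p^-1 + q^-1 = 1 -> 0 < eps ->
  forall (dxi dom : measure_display) (Xi : measurableType dxi)
    (Om : measurableType dom) (Pr : probability Om R)
    (pb : problem R d m Xi) (x0 : 'rV[R]_d) (Phi_inf : R)
    (O : set 'rV[R]_d) (Pu : probability (borelRV R d) R)
    (u : nat -> nat -> {RV Pr >-> borelRV R d})
    (xi : nat -> nat -> {RV Pr >-> Xi})
    (ind : {RV Pr >-> nat}),
  let v := vdelta q (cdelta k) in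
  let mu := par_mu k m d q eps in
  let eta := par_eta k m d p q eps in
  let alpha := par_alpha k m d p q eps in
  let nu := par_nu k m d p q eps (Enorm6 Pu) in
  let n0 := par_n0 k d p eps in
  let n := par_n d p in
  let K := par_K k p q eps pb x0 Phi_inf in
  let rho_ := fun _ : nat => crho k / K%:R in
  let x := fun (i : nat) (w : Om) =>
    iterate pb v x0 mu eta nu alpha rho_ n0 n
      (fun a j => u a j w) (fun a j => xi a j w) i in
  problem_setting pb ->
  rademacher Pu ->
  open O -> smoothing_region pb nu Pu `<=` O ->
  assumption_A1 pb k q O Phi_inf ->
  assumption_A2 pb k O ->
  assumption_A3 pb k O ->
  feas pb x0 ->
  (forall i, (i < K)%N -> 0 < rho_ i < mu) ->
  sampling u xi ind Pu (law pb) n0 n K ->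
  {ae Pr, forall w, forall i, (i <= K)%N -> regular_at pb k p (x i w)} ->
  ((obj pb x0)%:E + reg pb x0 - Phi_inf%:E = gap%:E)%E ->
  pnorm 2 (con pb x0) ^+ 2 <= mu^-1 ->
  eps_kkt Pr pb v p q eta eps (fun w => x (ind w) w) /\
  (eps <= 1 ->
   (oracle_calls n0 n K)%:R <= C * complexity_rate d p eps).
Proof.
have [C C0 hC] := oracle_calls_rate m hk gap.
exists C; split=> // d p q eps d3 p2 pq eps0 dxi dom Xi Om Pr pb x0 Phi_inf O Pu u xi ind.
move=> v mu eta alpha nu n0 n K rho_ x setting rad oO sO A1 A2 A3 Xx0 _ samp reg hg hc.
split; first exact: (parameters_eps_kkt hk d3 p2 pq eps0 setting rad oO sO A1 A2 A3 Xx0 samp reg).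
by move=> eps1; exact: hC.
Qed.
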